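(* Let $n\ge 3$, let $B_1\subset\mathbb{R}^n$ be the open unit ball, and let $(\lambda^*,u^* )$ be the pair described in the context (the radial singular solution of $-\Delta u=\lambda^*\exp(e^u)$ in $B_1\setminus\{0\}$, $u=0$ on $\partial B_1$, with the prescribed asymptotic behaviour at the origin). Let $\{(\lambda(\rho),u(\rho))\}$ be the curve of classical solutions, described in the context, of the problem $$ -\Delta u=\lambda \exp(e^u)\ \text{ in } B_1,\qquad u>0\ \text{ in }B_1,\qquad u=0\ \text{ on }\partial B_1. \qquad (P_\lambda) $$ Then: (i) If $n\geq 11$, then the Morse index of $u^*$ is finite. (ii) If $3\leq n\leq 9$, then the Morse index of $u^*$ is infinite. Furthermore: (ii1) The curve $(\lambda(\rho), u(\rho))$ has infinitely many turning points around $\lambda^*$. In particular, problem $(P_{\lambda})$ with $\lambda=\lambda^*$ has infinitely many solutions. (ii2) The number of intersection points between $u(\rho)$ and the singular solution $u^*$ tends to infinity as $\rho\to \infty$.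
   Context: Notation: $\exp(e^u)=e^{e^u}$. The pair $(\lambda^*,u^* )$: $\lambda^*>0$ is the unique number for which the problem $-\Delta u=\lambda^* \exp(e^u)$ in $B_1\setminus\{0\}$, $u=0$ on $\partial B_1$, has a singular (unbounded near the origin) solution $u^*$ satisfying, as $|x|\to0$, $$ u^*\Big(\frac{x}{\sqrt{\lambda^*}} \Big)=\ln\left[2\ln \frac{1}{|x|}+\ln\frac{n-2}{\ln\frac{1}{|x|}}+\ln\left(1+\frac{\ln \ln\frac{1}{|x|}}{2\ln\frac{1}{|x|}}\right) \right]+O\Big(\ln^{-2}\frac{1}{|x|}\Big) $$ and $$ \frac{1}{\sqrt{\lambda^*}}\big|\nabla u^*\big|\Big(\frac{x}{\sqrt{\lambda^*}}\Big)= \frac{1}{|x|\ln\frac{1}{|x|}}+\frac{\ln (\ln\frac{1}{|x|})}{2|x| \ln^2 \frac{1}{|x|}}+O\Big( \frac{1}{|x|\ln^2\frac{1}{|x|}}\Big), $$ and $u^*$ is this solution, which is radial and positive. The solution curve: all solutions of $(P_\lambda)$ are radially symmetric (Gidas–Ni–Nirenberg), and the set of all solutions $(\lambda,u)$ can be described as a curve $\{(\lambda(\rho),u(\rho))\}$ parametrized by $\rho=\|u(\rho)\|_{L^\infty(B_1)}$, with $\lambda(0)=0$, emanating from $(\lambda,u)=(0,0)$. Morse index of $u^*$: the supremum of the dimensions of linear subspaces $X\subset H^1_0(B_1)$ such that $\int_{B_1}\big(|\nabla \phi|^2-\lambda^* e^{u^*}\exp(e^{u^*})\phi^2\big)\,dx<0$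 for all $\phi\in X\setminus\{0\}$. Turning points: a turning point of the curve is a value of $\rho>0$ at which $\rho\mapsto\lambda(\rho)$ has a strict local extremum; ''infinitely many turning points around $\lambda^*$'' means that every neighbourhood of $\lambda^*$ contains $\lambda(\rho)$ for infinitely many turning points $\rho$. Intersection points between $u(\rho)$ and $u^*$: the radii $r\in(0,1)$ at which $u(\rho)$ and $u^*$, viewed as functions of $r=|x|$, take the same value. *)

(* Defs.v *)
From HB Require Import structures.
From mathcomp Require Import all_boot all_order all_algebra.
From mathcomp Require Import all_classical all_reals all_analysis.
Set Implicit Arguments.
Unset Strict Implicit.
Unset Printing Implicit Defensive.
Import Order.TTheory GRing.Theory Num.Theory.
Import numFieldNormedType.Exports.
Local Open Scope classical_set_scope.
Local Open Scope ring_scope.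

Definition lebesgue_sfm (R : realType) :
    {sigma_finite_measure set (measurableTypeR R) -> \bar R} :=
  @lebesgue_measure R.

(* Lebesgue measure on R^n, built on n-tuples as the n-fold product of the
   one-dimensional Lebesgue measure, then transported to row vectors, on which
   the differential calculus of the library is available. *)
Section cons_measure.
Context {R : realType} (n : nat).
Local Notation T := (measurableTypeR R).
Variable m : {sigma_finite_measure set (n.-tuple T) -> \bar R}.

Definition tcons (p : T * n.-tuple T) : n.+1.-tuple T := [tuple of p.1 :: p.2].

Lemma measurable_tcons : measurable_fun [set: T * n.-tuple T] tcons.
Proof. exact: measurable_cons. Qed.

Lemma tcons_preimage_measurable (A : set (n.+1.-tuple T)) :
  measurable A -> measurable (tcons @^-1` A).
Proof. by move=> mA; rewrite -[X in measurable X]setTI; exact: measurable_tcons. Qed.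

Definition cons_measure (A : set (n.+1.-tuple T)) : \bar R :=
  (lebesgue_sfm R \x m)%E (tcons @^-1` A).

Let cons_measure0 : cons_measure set0 = 0%E.
Proof. by rewrite /cons_measure preimage_set0 measure0. Qed.

Let cons_measure_ge0 A : (0 <= cons_measure A)%E.
Proof. exact: measure_ge0. Qed.

Let cons_measure_sigma_additive : semi_sigma_additive cons_measure.
Proof.
move=> F mF tF mUF; rewrite /cons_measure preimage_bigcup.
apply: measure_semi_sigma_additive.
- by move=> k; exact: tcons_preimage_measurable.
- apply/trivIsetP => /= i j _ _ ij; rewrite -preimage_setI.
  by move/trivIsetP : tF => /(_ _ _ _ _ ij) ->//; rewrite preimage_set0.
- by rewrite -preimage_bigcup; exact: tcons_preimage_measurable.
Qed.

HB.instance Definition _ := isMeasure.Build _ _ _ cons_measure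
  cons_measure0 cons_measure_ge0 cons_measure_sigma_additive.

Let cons_measure_sigma_finite : sigma_finite setT cons_measure.
Proof.
have /sigma_finiteP[F [TF ndF Foo]] := sigma_finiteT (lebesgue_sfm R).
have /sigma_finiteP[G [TG ndG Goo]] := sigma_finiteT m.
pose g (t : n.+1.-tuple T) : T * n.-tuple T := (thead t, [tuple of behead t]).
have tg : cancel tcons g.
  by case=> a t; rewrite /g /tcons/=; congr pair; apply/val_inj.
have mg : measurable_fun setT g.
  apply/measurable_fun_pair => /=; first exact: (measurable_tnth ord0).
  exact: measurable_behead.
exists (fun k => g @^-1` (F k `*` G k)).
  rewrite -preimage_bigcup (_ : \bigcup_k _ = setT) ?preimage_setT//.
  apply/seteqP; split => // -[x y] _.
  have [i _ Fx] : (\bigcup_k F k) x by rewrite -TF.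
  have [j _ Gy] : (\bigcup_k G k) y by rewrite -TG.
  exists (maxn i j) => //; split => /=.
    by move: x Fx; exact/subsetPset/ndF/leq_maxl.
  by move: y Gy; exact/subsetPset/ndG/leq_maxr.
move=> k; have [mF Fk] := Foo k; have [mG Gk] := Goo k; split.
  by rewrite -[X in measurable X]setTI; apply: mg => //; exact: measurableX.
rewrite /cons_measure -comp_preimage (_ : g \o tcons = id); last first.
  by apply/funext => x /=; rewrite tg.
by rewrite preimage_id product_measure1E// lte_mul_pinfty// ge0_fin_numE.
Qed.

HB.instance Definition _ := @Measure_isSigmaFinite.Build _ _ _ cons_measure
  cons_measure_sigma_finite.

End cons_measure.

Fixpoint lebesgue_tuple (R : realType) (n : nat) :
    {sigma_finite_measure set (n.-tuple (measurableTypeR R)) -> \bar R} :=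
  match n with
  | 0 => \d_([tuple] : 0.-tuple (measurableTypeR R))
  | k.+1 => cons_measure (lebesgue_tuple R k)
  end.

Definition row_of_tuple (R : realType) (n : nat)
    (t : n.-tuple (measurableTypeR R)) : 'rV[R]_n := \row_i tnth t i.

Definition rV_display : measure_display.
Proof. exact: default_measure_display. Qed.

(* As row_of_tuple is a bijection, this is the sigma-algebra generated by the
   coordinates, that is, the Borel sigma-algebra of R^n. *)
Section measurable_rV.
Context {R : realType} {n : nat}.

Definition measurable_rV : set (set 'rV[R]_n) :=
  [set A | measurable (@row_of_tuple R n @^-1` A)].

Let measurable_rV0 : measurable_rV set0.
Proof. by rewrite /measurable_rV/= preimage_set0. Qed.

Let measurable_rVC A : measurable_rV A -> measurable_rV (~` A).
Proof. by rewrite /measurable_rV/= preimage_setC; exact: measurableC. Qed.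

Let measurable_rV_bigcup (F : (set 'rV[R]_n)^nat) :
  (forall i, measurable_rV (F i)) -> measurable_rV (\bigcup_i F i).
Proof.
move=> mF; rewrite /measurable_rV/= preimage_bigcup.
by apply: bigcup_measurable => i _; exact: mF.
Qed.

HB.instance Definition _ := @isMeasurable.Build rV_display 'rV[R]_n
  measurable_rV measurable_rV0 measurable_rVC measurable_rV_bigcup.

End measurable_rV.

Section lebesgue_rV.
Context {R : realType} {n : nat}.

Definition lebesgue_rV (A : set 'rV[R]_n) : \bar R :=
  lebesgue_tuple R n (@row_of_tuple R n @^-1` A).

Let lebesgue_rV0 : lebesgue_rV set0 = 0%E.
Proof. by rewrite /lebesgue_rV preimage_set0 measure0. Qed.

Let lebesgue_rV_ge0 A : (0 <= lebesgue_rV A)%E.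
Proof. exact: measure_ge0. Qed.

Let lebesgue_rV_sigma_additive : semi_sigma_additive lebesgue_rV.
Proof.
move=> F mF tF mUF; rewrite /lebesgue_rV preimage_bigcup.
apply: measure_semi_sigma_additive => //.
apply/trivIsetP => /= i j _ _ ij; rewrite -preimage_setI.
by move/trivIsetP : tF => /(_ _ _ _ _ ij) ->//; rewrite preimage_set0.
Qed.

HB.instance Definition _ := isMeasure.Build _ _ _ lebesgue_rV
  lebesgue_rV0 lebesgue_rV_ge0 lebesgue_rV_sigma_additive.

Let lebesgue_rV_sigma_finite : sigma_finite setT lebesgue_rV.
Proof.
have [F TF F_fin] := sigma_finiteT (lebesgue_tuple R n).
pose g (v : 'rV[R]_n) : n.-tuple (measurableTypeR R) := [tuple v 0 i | i < n].
have rg : cancel (@row_of_tuple R n) g.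
  by move=> t; apply/eq_from_tnth => i; rewrite tnth_mktuple mxE.
have gK A : @row_of_tuple R n @^-1` (g @^-1` A) = A.
  by apply/seteqP; split => t; rewrite /preimage/= rg.
exists (fun k => g @^-1` F k).
  by rewrite -preimage_bigcup -TF preimage_setT.
by move=> k; have [mF Fk] := F_fin k; split; [|];
  rewrite /measurable/= /measurable_rV/= /lebesgue_rV gK.
Qed.

HB.instance Definition _ := @Measure_isSigmaFinite.Build _ _ _ lebesgue_rV
  lebesgue_rV_sigma_finite.

End lebesgue_rV.

Section calculus.
Context {R : realType} {n : nat}.
Implicit Types (f u : 'rV[R]_n -> R) (x : 'rV[R]_n) (D : set 'rV[R]_n).

(* The norm `|x| of 'rV[R]_n in the library is the maximum norm; it has the
   same topology, but the balls of the problem are Euclidean. *)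
Definition enorm x : R := Num.sqrt (\sum_(i < n) x 0 i ^+ 2).

Definition uball : set 'rV[R]_n := [set x | enorm x < 1].
Definition cball : set 'rV[R]_n := [set x | enorm x <= 1].
Definition usphere : set 'rV[R]_n := [set x | enorm x = 1].

Definition pderiv (i : 'I_n) f : 'rV[R]_n -> R :=
  fun x => 'D_(delta_mx 0 i) f x.

Definition iter_pderiv (s : seq 'I_n) f : 'rV[R]_n -> R := foldr pderiv f s.

(* For D open; s lists the directions of an iterated partial derivative, so that
   all mixed derivatives of order at most k are covered. *)
Definition class_C (k : nat) D f :=
  forall (s : seq 'I_n) x, (size s <= k)%N -> D x ->
    {for x, continuous (iter_pderiv s f)} /\
    ((size s < k)%N ->
     forall i, derivable (iter_pderiv s f) x (delta_mx 0 i)).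

Definition laplacian u : 'rV[R]_n -> R :=
  fun x => \sum_(i < n) pderiv i (pderiv i u) x.

Definition grad_norm u : 'rV[R]_n -> R :=
  fun x => Num.sqrt (\sum_(i < n) pderiv i u x ^+ 2).

Definition radial D u := forall x y, D x -> D y -> enorm x = enorm y -> u x = u y.

(* C_c^oo(D), for D open, its elements being extended by 0 to R^n *)
Definition test_function D f :=
  (forall k, class_C k setT f) /\
  exists K, [/\ compact K, K `<=` D & forall x, ~ K x -> f x = 0].

End calculus.

Section sobolev.
Context {R : realType} {n : nat}.
Implicit Types (f psi V : 'rV[R]_n -> R) (g : 'I_n -> 'rV[R]_n -> R).
Implicit Types (D : set 'rV[R]_n) (X : set ('rV[R]_n -> R)).

Definition L2 D f := measurable_fun D f /\
  (\int[lebesgue_rV]_(x in D) ((f x) ^+ 2)%:E < +oo)%E.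

Definition ae_zero D f := {ae lebesgue_rV, forall x, D x -> f x = 0}.

Definition weak_gradient D f g := forall i, L2 D (g i) /\
  forall psi, test_function D psi ->
    (\int[lebesgue_rV]_(x in D) (f x * pderiv i psi x)%:E =
     - \int[lebesgue_rV]_(x in D) (g i x * psi x)%:E)%E.

(* H^1_0(D): the closure of C_c^oo(D) in H^1(D); elements are represented by
   functions, to be identified when they agree almost everywhere on D. *)
Definition H10 D : set ('rV[R]_n -> R) := [set f | L2 D f /\
  exists2 g, weak_gradient D f g &
  exists2 psi : nat -> 'rV[R]_n -> R, forall k, test_function D (psi k) &
    (\int[lebesgue_rV]_(x in D) ((psi k x - f x) ^+ 2 +
        \sum_(i < n) (pderiv i (psi k) x - g i x) ^+ 2)%:E)%E
      @[k --> \oo] --> 0%E].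

Definition linear_space X := X (fun=> 0) /\
  forall (a : R) f1 f2, X f1 -> X f2 -> X (fun x => a * f1 x + f2 x).

(* dimension, in N or +oo, of the image of the linear space X in the quotient
   by almost everywhere equality on D *)
Definition ae_dim D X : \bar R := ereal_sup [set k%:R%:E | k in
  [set k : nat | exists2 b : 'I_k -> 'rV[R]_n -> R, forall j, X (b j) &
     forall c : 'I_k -> R, ae_zero D (fun x => \sum_(j < k) c j * b j x) ->
       forall j, c j = 0]].

Definition quad_form D V f g : \bar R :=
  (\int[lebesgue_rV]_(x in D) (\sum_(i < n) g i x ^+ 2 - V x * f x ^+ 2)%:E)%E.

(* The weak gradient of f is unique up to almost everywhere equality, so that
   quad_form D V f g depends on f only. *)
Definition negative_space D V X := [/\ X `<=` H10 D, linear_space X &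
  forall f, X f -> ~ ae_zero D f ->
    exists2 g, weak_gradient D f g & (quad_form D V f g < 0)%E].

Definition morse_index D V : \bar R :=
  ereal_sup [set ae_dim D X | X in negative_space D V].

End sobolev.

Section problem.
Context {R : realType} {n : nat}.
Implicit Types (u v : 'rV[R]_n -> R) (l : R).

Definition expexp (t : R) : R := expR (expR t).

Definition classical_solution l : set ('rV[R]_n -> R) := [set u |
  [/\ class_C 2 uball u, {within cball, continuous u},
      forall x, uball x -> - laplacian u x = l * expexp (u x),
      forall x, uball x -> 0 < u x &
      forall x, usphere x -> u x = 0]].

(* the L^oo norm on the ball, for continuous functions *)
Definition sup_norm u : R := sup [set `|u x| | x in uball].

(* ln (1 / |x|) *)
Definition logi (x : 'rV[R]_n) : R := ln (enorm x)^-1.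

Definition singular_profile (x : 'rV[R]_n) : R :=
  ln (2 * logi x + ln ((n%:R - 2) / logi x)
      + ln (1 + ln (logi x) / (2 * logi x))).

Definition singular_slope (x : 'rV[R]_n) : R :=
  (enorm x * logi x)^-1 + ln (logi x) / (2 * enorm x * logi x ^+ 2).

Definition singular_solution l u :=
  [/\ [/\ 0 < l, class_C 2 (uball `\ 0) u &
          {within cball `\ 0, continuous u}],
      [/\ forall x, (uball `\ 0) x -> - laplacian u x = l * expexp (u x),
          forall x, usphere x -> u x = 0,
          forall x, (uball `\ 0) x -> 0 < u x,
          radial (cball `\ 0) u &
          ~ exists M : R, forall x, (uball `\ 0) x -> `|u x| <= M],
      (fun x : 'rV[R]_n => u ((Num.sqrt l)^-1 *: x) - singular_profile x)
        =O_ ((0 : 'rV[R]_n)^') (fun x => (logi x ^+ 2)^-1) &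
      (fun x : 'rV[R]_n => (Num.sqrt l)^-1 * grad_norm u ((Num.sqrt l)^-1 *: x)
                - singular_slope x)
        =O_ ((0 : 'rV[R]_n)^') (fun x => (enorm x * logi x ^+ 2)^-1)].

Definition singular_pair (lamS : R) (uS : 'rV[R]_n -> R) :=
  singular_solution lamS uS /\
  forall l v, singular_solution l v -> l = lamS.

(* The potential is the derivative of t |-> l * expexp t at u x. *)
Definition solution_morse_index l u : \bar R :=
  morse_index uball (fun x => l * expR (u x) * expexp (u x)).

Definition solution_curve (lam : R -> R) (u : R -> 'rV[R]_n -> R) :=
  [/\ lam 0 = 0 /\ forall x, cball x -> u 0 x = 0,
      {within `[0, +oo[, continuous lam} /\
      (forall r0 : R, 0 <= r0 -> forall e : R, 0 < e ->
         \forall r \near r0, 0 <= r ->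
           forall x, cball x -> `|u r x - u r0 x| <= e),
      forall rho, 0 < rho -> [/\ classical_solution (lam rho) (u rho),
        sup_norm (u rho) = rho & radial cball (u rho)] &
      forall l v, classical_solution l v ->
        l = lam (sup_norm v) /\ forall x, cball x -> v x = u (sup_norm v) x].

Definition turning_point (lam : R -> R) (rho : R) := 0 < rho /\
  ((\forall r \near rho^', lam r < lam rho) \/
   (\forall r \near rho^', lam rho < lam r)).

Definition infinitely_many_turning_points (lam : R -> R) (l : R) :=
  forall U : set R, nbhs l U ->
    infinite_set [set rho | turning_point lam rho /\ U (lam rho)].

Definition intersection_radii u v : set R :=
  [set r | 0 < r < 1 /\ forall x, enorm x = r -> u x = v x].

End problem.

(* Main.v *)
(** In the variable [t = ln (sqrt lambda |x|)], write a radial solution as [y(t)] and put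
    [Z = e^y + y + 2 t - ln (2 m)] with [m = n - 2]. Then [Z'' + m Z' + 2 m (e^Z - 1)] is
    small wherever [e^(-y)] is, and [|x|^2] times the potential of the linearized problem
    is [2 m e^Z]. The singular solution has [Z -> 0] as [t -> -oo].

    Multiplicity ([n <= 9]). A Lyapunov function shows that the regular solution with
    maximum [rho] enters a fixed neighbourhood of [Z = 0] shortly after
    [t = - (e^rho + rho) / 2], and that it converges to the singular one as [rho] tends to
    infinity. The difference of the two solves a perturbation of [D'' + m D' + 2 m D = 0],
    whose characteristic roots are not real as [m < 8], so that the number of sign changes
    of the difference tends to infinity, and its size beats the shift caused by
    [lambda(rho) <> lambda*]: this gives the intersection points. If
    [lambda(rho) - lambda*] eventually had a constant sign, the number of alternations
    would be locally constant in [rho]; hence this difference takes both signs for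
    arbitrarily large [rho], which gives the solutions at [lambda*] and local extrema. A
    local extremum is made strict as follows: if a level of [lambda] accumulated at a point
    where it is not locally constant, the solutions of the initial value problem taken at
    [N] nearby values of [rho] would satisfy, by submultiplicativity of a norm on divided
    differences, bounds uniform in [N], as if they were analytic in [rho].

    Morse index. For [n >= 11], [2 m < m^2 / 4] and Hardy's inequality makes the quadratic
    form nonnegative on the functions whose averages over the cells of a fine grid vanish,
    a space of finite codimension. For [n <= 9], [2 m > m^2 / 4] and the functions
    [|x|^(-m/2) h(ln |x|)] with [h] a smooth bump on a long interval make the form
    negative; infinitely many of them have disjoint supports. *)

(* [Z] replaces the double exponential by a single one: up to the remainder, its equation is that of
   the Gelfand problem [-Delta w = e^w] in Emden variables. Both halves of the theorem thus turn on
   the sign of [m - 8]. At [m = 8] the characteristic root is double and [2 m] equals the Hardy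
   constant [m^2/4], so that the remainder would decide; this is why [n = 10] does not occur. In [t]
   the equation does not contain [lambda], which survives only as the right end [b = ln lambda / 2]
   of the interval. Comparing [lambda(rho)] with [lamS] means comparing the ends [b] and [bS], and
   the solution that ends first is the smaller one there, so the sign of the difference at the end
   is known. Alternations of sign are counted instead of zeros: they persist under small changes of
   [rho] and can be gained or lost through the right end only. The price is quantitative uniqueness:
   a lower bound on [|D| + |D'|], uniform in the parameter, which comes from Gronwall inequalities
   applied to the opposite of an energy. *)
From HB Require Import structures.
Require Import Defs.
From mathcomp Require Import all_boot all_order all_algebra finmap.
From mathcomp Require Import all_classical all_reals all_analysis.
From mathcomp Require Import measurable_realfun ring lra.
Set Implicit Arguments.
Unset Strict Implicit.
Unset Printing Implicit Defensive.
Import Order.TTheory GRing.Theory Num.Theory.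
Import numFieldNormedType.Exports.
Local Open Scope classical_set_scope.
Local Open Scope ring_scope.

(** * One-variable calculus *)


Section derivative_rules.
Context {R : realType}.
Implicit Types (f g : R -> R) (x a b : R).

Lemma d_eq f x a b : is_derive x 1 f a -> a = b -> is_derive x 1 f b.
Proof. by move=> h <-. Qed.

Lemma dD f g x a b : is_derive x 1 f a -> is_derive x 1 g b ->
  is_derive x 1 (fun y => f y + g y) (a + b).
Proof. by move=> hf hg; exact: is_deriveD. Qed.

Lemma dN f x a : is_derive x 1 f a -> is_derive x 1 (fun y => - f y) (- a).
Proof. by move=> hf; exact: is_deriveN. Qed.

Lemma dM f g x a b : is_derive x 1 f a -> is_derive x 1 g b ->
  is_derive x 1 (fun y => f y * g y) (f x * b + g x * a).
Proof. by move=> hf hg; exact: is_deriveM. Qed.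

Lemma dC c x : is_derive x 1 (fun=> c : R) (0 : R).
Proof. exact: is_derive_cst. Qed.

Lemma dI x : is_derive x 1 (fun y : R => y) (1 : R).
Proof. exact: is_derive_id. Qed.

Lemma dcomp1 f g x a b : is_derive (g x) 1 f a -> is_derive x 1 g b ->
  is_derive x 1 (fun y => f (g y)) (a * b).
Proof. by move=> hf hg; exact: is_derive1_comp. Qed.

Lemma dexp f x a : is_derive x 1 f a ->
  is_derive x 1 (fun y => expR (f y)) (expR (f x) * a).
Proof. by move=> hf; apply: (@dcomp1 expR) => //; exact: is_derive_expR. Qed.

Lemma dV f x a : f x != 0 -> is_derive x 1 f a ->
  is_derive x 1 (fun y => (f y)^-1) (- (f x) ^- 2 * a).
Proof. by move=> fx hf; exact: is_deriveV. Qed.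

Lemma dX f n x a : is_derive x 1 f a ->
  is_derive x 1 (fun y => f y ^+ n.+1) ((n.+1)%:R * f x ^+ n * a).
Proof. 
move=> hf; have -> : (fun y => f y ^+ n.+1) = f ^+ n.+1 by rewrite exprfctE.
by have := @is_deriveX R R f n.+1 x 1 a hf; rewrite /GRing.scale/=. Qed.

Lemma dln f x a : 0 < f x -> is_derive x 1 f a ->
  is_derive x 1 (fun y => ln (f y)) ((f x)^-1 * a).
Proof. by move=> fx hf; apply: (@dcomp1 (@ln R)) => //; exact: is_derive1_ln. Qed.

Lemma d_cont f x a : is_derive x 1 f a -> {for x, continuous f}.
Proof. by move=> h; apply: differentiable_continuous; apply/derivable1_diffP. Qed.

Lemma d_ext f g x a : (\near x, f x = g x) -> is_derive x 1 f a -> is_derive x 1 g a.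
Proof. by move=> fg h; exact: near_eq_is_derive fg h. Qed.
End derivative_rules.

Ltac dtac := eapply d_eq;
  [repeat (first [apply dC | eassumption | solve [auto] | eapply dexp | eapply dX | eapply dD | eapply dN | eapply dM
     | apply dI | eapply dln | eapply dV ]) | rewrite /=].

Ltac qlra := first [solve [repeat match goal with H : forall _, _ |- _ => clear H | x := _ |- _ => clearbody x end; lra] | lra].
Ltac sp := apply/andP; split; qlra.

Section real_tools.
Context {R : realType}.
Implicit Types (f g : R -> R) (x a b : R).

Lemma le_of_deriv_le0 f (df : R -> R) a b : a <= b ->
  (forall x : R, a <= x <= b -> is_derive x 1 f (df x)) ->
  (forall x : R, a <= x <= b -> df x <= 0) -> f b <= f a.
Proof.
move=> ab hd h0.
have [||] := @MVT_segment R f df a b ab.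
- by move=> x /[!in_itv]/= /andP[ax xb]; apply: hd; rewrite !ltW.
- apply: derivable_within_continuous => x /[!in_itv]/= xab.
  by have := hd _ xab => -[].
move=> c; rewrite in_itv/= => cab e.
by rewrite -subr_le0 e mulr_le0_ge0 ?h0 // subr_ge0.
Qed.

Lemma ge_of_deriv_ge0 f (df : R -> R) a b : a <= b ->
  (forall x : R, a <= x <= b -> is_derive x 1 f (df x)) ->
  (forall x : R, a <= x <= b -> 0 <= df x) -> f a <= f b.
Proof.
move=> ab hd h0; rewrite -lerN2.
apply: (@le_of_deriv_le0 (fun x => - f x) (fun x => - df x)) => // x xab.
  by apply: dN; exact: hd.
by rewrite oppr_le0 h0.
Qed.

(* The integrating factor makes [(E + r/k) e^{-kx}] nonincreasing. *)
Lemma gronwall f (df : R -> R) (k r : R) a b : a <= b -> k != 0 ->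
  (forall x : R, a <= x <= b -> is_derive x 1 f (df x)) ->
  (forall x : R, a <= x <= b -> df x <= k * f x + r) ->
  f b + r / k <= (f a + r / k) * expR (k * (b - a)).
Proof.
move=> ab k0 hd h0.
have -> : expR (k * (b - a)) = expR (k * b) * expR (- (k * a)) by rewrite -expRD; congr expR; ring.
rewrite mulrA mulrAC -ler_pdivrMr ?expR_gt0// -expRN.
apply: (@le_of_deriv_le0 (fun x => (f x + r / k) * expR (- (k * x)))
  (fun x => (df x - k * f x - r) * expR (- (k * x)))) => // x xab.
  have hx := hd x xab.
  by dtac; field.
by rewrite mulr_le0_ge0 ?expR_ge0 //; have := h0 x xab; qlra.
Qed.

Lemma lip_of_deriv f (df : R -> R) (K : R) a b : a <= b ->
  (forall x : R, a <= x <= b -> is_derive x 1 f (df x)) ->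
  (forall x : R, a <= x <= b -> `|df x| <= K) -> `|f b - f a| <= K * (b - a).
Proof.
move=> ab hd h0; have K0 : 0 <= K by apply: le_trans (h0 a _); rewrite ?normr_ge0 ?lexx.
have h1 : f b - K * b <= f a - K * a.
  apply: (@le_of_deriv_le0 (fun x => f x - K * x) (fun x => df x - K)) => // x xab.
    by have hx := hd x xab; dtac; ring.
  by have := h0 x xab; rewrite ler_norml => /andP[]; qlra.
have h2 : f a + K * a <= f b + K * b.
  apply: (@ge_of_deriv_ge0 (fun x => f x + K * x) (fun x => df x + K)) => // x xab.
    by have hx := hd x xab; dtac; ring.
  by have := h0 x xab; rewrite ler_norml => /andP[]; qlra.
by rewrite ler_norml; sp.
Qed.

(** The estimates on radial profiles are proved for [r > 0], where the radial equation makes sense;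
    this carries them to [r = 0]. *)
Lemma cont_right_ge f a d c : {for a, continuous f} -> 0 < d ->
  (forall x : R, a < x < a + d -> c <= f x) -> c <= f a.
Proof.
move=> ca d0 H; apply: (cvgr_to_ge (cvg_at_right_filter ca)).
exists d => // x /= xd ax; apply: H; rewrite ax/=.
by move: xd; rewrite ltr0_norm ?subr_lt0//; lra.
Qed.

(** [z] is the infimum of the points where [f <= 0]; continuity from both sides gives the value 0
    there. *)
Lemma first_zero f a b : a < b -> (forall x : R, a <= x <= b -> {for x, continuous f}) ->
  0 < f a -> f b <= 0 ->
  exists z : R, [/\ a < z <= b, f z = 0 & forall x : R, a <= x < z -> 0 < f x].
Proof.
move=> ab fc fa fb.
pose S := [set x | a <= x <= b /\ f x <= 0].
have S0 : S !=set0 by exists b; rewrite /S/= lexx ltW.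
have lS : lbound S a by move=> x [/andP[]].
have hS : has_inf S by split => //; exists a.
pose z := inf S.
have az : a <= z by apply: lb_le_inf.
have zb : z <= b by apply: ge_inf; [exists a | rewrite /S/= lexx ltW].
have zab : a <= z <= b by rewrite az zb.
have pos (x : R) : a <= x < z -> 0 < f x.
  move=> /andP[ax xz]; rewrite ltNge; apply/negP => fx.
  suff : z <= x by rewrite leNgt xz.
  by apply: ge_inf; [exists a|split => //; rewrite ax (le_trans (ltW xz))].
have fz : f z <= 0.
  rewrite leNgt; apply/negP => fz.
  have := cvgr_gt _ (fc z zab) _ fz => -[e /= e0 he].
  have [x [/andP[ax xb] fx] xz] := inf_adherent e0 hS.
  have zx : z <= x by apply: ge_inf; [exists a|split => //; rewrite ax].
  have : 0 < f x by apply: he; rewrite /ball_/= ltr_norml; apply/andP; split; rewrite -/z in xz; qlra.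
  by rewrite ltNge fx.
have az' : a < z by rewrite lt_neqAle az andbT; apply/negP => /eqP e; move: fz; rewrite -e leNgt fa.
exists z; split => //; first by rewrite az' zb.
apply/eqP; rewrite eq_le fz leNgt; apply/negP => fz0.
have := cvgr_lt _ (fc z zab) _ fz0 => -[e /= e0 he].
pose x := Num.max a (z - e / 2).
have xz : x < z by rewrite gt_max az'/=; qlra.
have ax : a <= x by rewrite le_max lexx.
have : f x < 0.
  apply: he; rewrite /ball_/= ger0_norm ?subr_ge0 ?(ltW xz)//.
  have : z - e / 2 <= x by rewrite le_max lexx orbT.
  qlra.
by rewrite ltNge ltW // pos // ax xz.
Qed.

(** Bootstrap principle: at a first point where [f = K], the non-strict bound holds up to that
    point, and the last hypothesis makes it strict there. *)
Lemma first_exit f a b (K : R) : a <= b -> (forall x : R, a <= x <= b -> {for x, continuous f}) ->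
  f a < K ->
  (forall c : R, a <= c <= b -> (forall x : R, a <= x <= c -> f x <= K) -> f c < K) ->
  forall x : R, a <= x <= b -> f x < K.
Proof.
move=> ab fc fa H x /andP[ax xb]; rewrite ltNge; apply/negP => fx.
have ax' : a < x by rewrite lt_neqAle ax andbT; apply/negP => /eqP e; move: fx; rewrite -e leNgt fa.
have [|||z [/andP[az zx] fz pos]] := @first_zero (fun x => K - f x) a x ax'.
- move=> t /andP[at_ tx]; apply: cvgB; first exact: cvg_cst.
  by apply: fc; rewrite at_ (le_trans tx).
- by rewrite subr_gt0.
- by rewrite subr_le0.
suff : f z < K by move: fz; qlra.
apply: H => [|t /andP[at_ tz]]; first by rewrite ltW//= (le_trans zx).
have [->|tz'] := eqVneq t z; first by move: fz; qlra.
have := pos t; rewrite at_ lt_neqAle tz' tz => /(_ isT); qlra.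
Qed.


Lemma no_zero_neg f a b : a <= b -> (forall x : R, a <= x <= b -> {for x, continuous f}) ->
  (forall x : R, a <= x <= b -> f x != 0) -> f a < 0 -> f b < 0.
Proof.
move=> ab fc f0 fa; rewrite ltNge; apply/negP => fb.
have ab' : a < b by rewrite lt_neqAle ab andbT; apply/negP => /eqP e; move: fb; rewrite -e leNgt fa.
have [|||z [/andP[az zb] fz _]] := @first_zero (fun x => - f x) a b ab'.
- by move=> x xab; apply: cvgN; exact: fc.
- by rewrite oppr_gt0.
- by rewrite oppr_le0.
by have := f0 z; rewrite zb (ltW az) => /(_ isT)/negP; apply; rewrite -oppr_eq0 fz.
Qed.

(* Where [D] is small its derivative is large, so a zero of [D] cannot be
   tangential and [D] grows linearly away from it. *)
Lemma amplify (D S : R -> R) (a c K z h : R) : 0 < c -> 0 < K ->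
  h = c / (4 * K) -> a < z - h ->
  (forall x : R, a < x < z -> is_derive x 1 D (S x)) ->
  (forall x : R, a < x < z -> {for x, continuous S}) ->
  (forall x : R, a < x < z -> `|S x| <= K /\ c <= `|D x| + `|S x|) ->
  D x @[x --> z^'-] --> (0 : R) ->
  (forall e : R, 0 < e -> exists2 x : R, z - e < x < z & 0 < D x) ->
  forall x : R, z - h <= x < z -> c / 2 * (z - x) <= D x.
Proof.
move=> c0 K0 hE ah dD_ cS bd cz near.
have h0 : 0 < h by rewrite hE divr_gt0// mulr_gt0.
have close (t e : R) : t < z -> 0 < e -> exists y : R, [/\ t <= y < z, z - e <= y & `|D y| < e].
  move=> tz e0.
  have : \forall y \near z^'-, `|0 - D y| < e by move/cvgrPdist_lt: cz; exact.
  move=> -[/= d d0 hd].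
  pose y := Num.max t (Num.max (z - d / 2) (z - e)).
  have yz : y < z by rewrite !gt_max tz/=; sp.
  have ty : t <= y by rewrite le_max lexx.
  have zy : z - d / 2 <= y by rewrite !le_max lexx orbT.
  have zy' : z - e <= y by rewrite !le_max lexx !orbT.
  exists y; split => //; first by rewrite ty yz.
  by have := hd y; rewrite sub0r normrN; apply => //=; rewrite ger0_norm; qlra.
(* [D] tends to 0 at [z] with slope at most [K]. On a length [h] with [K h = c / 4] it stays below
   [c / 4], so [|S|] keeps more than [c / 2]. *)
have small (t : R) : z - h <= t < z -> `|D t| <= K * (z - t).
  move=> /andP[ht tz].
  apply/ler_addgt0Pr => e e0.
  have [y [/andP[ty yz] _ Dy]] := close t e tz e0.
  have : `|D y - D t| <= K * (y - t).
    apply: (@lip_of_deriv D S) => // s /andP[ts sy].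
      by apply: dD_; sp.
    by apply: (bd _ _).1; sp.
  have : `|D t| <= `|D y| + `|D y - D t|.
    by rewrite -[X in `|X| <= _](subrK (D y)) addrC (le_trans (ler_normD _ _))// lerD2l distrC.
  have : K * (y - t) <= K * (z - t) by rewrite ler_pM2l //; qlra.
  qlra.
have Sbig (t : R) : z - h <= t < z -> c / 2 < `|S t|.
  move=> /[dup] htz /andP[ht tz].
  have := small t htz.
  have : K * (z - t) <= c / 4.
    have -> : c / 4 = K * h by rewrite hE; field; rewrite lt0r_neq0.
    by rewrite ler_pM2l//; qlra.
  have [|_] := bd t.
    by sp.
  qlra.
(* A nonnegative [S] at one point would stay positive up to [z], its absolute value being bounded
   below; [D], positive at points close to [z], would then increase and could not tend to 0. *)
have Sneg (t : R) : z - h <= t < z -> S t < 0.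
  move=> /[dup] htz /andP[ht tz]; rewrite ltNge; apply/negP => St.
  have Spos (s : R) : t <= s < z -> 0 < S s.
    move=> /andP[ts sz]; rewrite -oppr_lt0.
    apply: (@no_zero_neg (fun x => - S x) t s ts).
    - by move=> x /andP[tx xs]; apply: cvgN; apply: cS; sp.
    - move=> x /andP[tx xs]; rewrite oppr_eq0 -normr_gt0 (lt_trans _ (Sbig x _)) ?divr_gt0//.
      by sp.
    rewrite oppr_lt0 lt_neqAle St andbT eq_sym -normr_gt0 (lt_trans _ (Sbig t _)) ?divr_gt0//.
  have [|x /andP[x1 x2] Dx] := near (z - t); first qlra.
  have [y [/andP[xy yz] _ Dy]] := close x (D x) x2 Dx.
  suff : D x <= D y by move: Dy; rewrite ltr_norml => /andP[]; qlra.
  apply: (@ge_of_deriv_ge0 D S) => // s /andP[xs sy].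
    by apply: dD_; sp.
  by rewrite ltW// Spos//; sp.
move=> t /[dup] htz /andP[ht tz].
apply/ler_addgt0Pr => e e0.
have e'0 : 0 < e / (1 + c) by rewrite divr_gt0//; qlra.
have [y [/andP[ty yz] yz' Dy]] := close t _ tz e'0.
have : D y + c / 2 * y <= D t + c / 2 * t.
  apply: (@le_of_deriv_le0 (fun x => D x + c / 2 * x) (fun x => S x + c / 2)) => // s /andP[ts sy].
    have hx := dD_ s; have hx' := hx (_ : a < s < z).
    by have {hx'}hx : is_derive s 1 D (S s) by [apply: hx'; sp]; dtac; ring.
  have h1 : z - h <= s < z by sp.
  by have := Sbig s h1; rewrite ltr0_norm ?Sneg//; qlra.
have eE : e = e / (1 + c) + c * (e / (1 + c)) by field; rewrite lt0r_neq0//; qlra.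
have h1 : c / 2 * (z - y) <= c * (e / (1 + c)).
  have -> : c / 2 * (z - y) = c * ((z - y) / 2) by ring.
  by rewrite ler_pM2l//; qlra.
move: Dy; rewrite ltr_norml => /andP[]; qlra.
Qed.

(** Connectedness of a segment, stated for a predicate that is open and closed; it serves to move
    the existence of an alternation along the solution curve. *)
Lemma locally_constant_seg (P : R -> Prop) a b : a <= b ->
  (forall x : R, a <= x <= b -> exists2 e : R, 0 < e &
     forall y : R, a <= y <= b -> `|y - x| < e -> (P x <-> P y)) ->
  P b -> P a.
Proof.
move=> ab H Pb.
pose S := [set x | a <= x <= b /\ P x].
have Sb : S b by split => //; rewrite ab lexx.
have lS : lbound S a by move=> x [/andP[]].
have hS : has_inf S by split; [exists b|exists a].
pose z := inf S.
have az : a <= z by apply: lb_le_inf => //; exists b.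
have zb : z <= b by apply: ge_inf; [exists a|].
have zab : a <= z <= b by rewrite az zb.
have [e e0 he] := H z zab.
have [x [/andP[ax xb] Px] xz] := inf_adherent e0 hS.
have zx : z <= x by apply: ge_inf; [exists a|split => //; rewrite ax].
have Pz : P z.
  apply/(he x); rewrite ?ax//; rewrite -/z in xz; rewrite ger0_norm; qlra.
have [->//|az'] := eqVneq a z.
have azl : a < z by rewrite lt_neqAle az' az.
pose y := Num.max a (z - e / 2).
have yz : y < z by rewrite gt_max azl/=; qlra.
have ay : a <= y by rewrite le_max lexx.
have zy : z - e / 2 <= y by rewrite le_max lexx orbT.
have yab : a <= y <= b by sp.
have Py : P y by apply/(he y) => //; rewrite ltr0_norm; qlra.
suff : z <= y by rewrite leNgt yz.
by apply: ge_inf; [exists a|].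
Qed.
End real_tools.

(** * Radial profiles in logarithmic coordinates *)


Ltac sl := apply/andP; split; lra.

Section line.
Context {R : realType} {n : nat}.
Implicit Types (f u : 'rV[R]_n -> R) (x v : 'rV[R]_n).

Lemma line_quotient f x v (t : R) :
  (fun h : R => h^-1 *: ((f \o shift (t *: v + x)) (h *: v) - f (t *: v + x))) =
  (fun h : R => h^-1 *: (((fun s : R => f (s *: v + x)) \o shift t) (h *: (1 : R)) - f (t *: v + x))).
Proof.
apply/funext => h /=; congr (_ *: (f _ - _)).
by rewrite [h *: 1]mulr1 scalerDl addrA.
Qed.

Lemma is_derive_lineP f x v (t df : R) :
  is_derive (t *: v + x) v f df <-> is_derive t 1 (fun s : R => f (s *: v + x)) df.
Proof.
split=> -[h1 h2]; apply: DeriveDef.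
- by move: h1; rewrite /derivable line_quotient.
- by move: h2; rewrite /derive line_quotient.
- by rewrite /derivable line_quotient.
- by rewrite /derive line_quotient.
Qed.

Lemma is_derive_line f x v (df : R) :
  is_derive x v f df <-> is_derive (0 : R) 1 (fun s : R => f (s *: v + x)) df.
Proof. by rewrite -is_derive_lineP scale0r add0r. Qed.

Lemma continuous_line x v : continuous (fun s : R => s *: v + x).
Proof. by move=> s; apply: cvgD; [apply: cvgZr_tmp; exact: cvg_id|exact: cvg_cst]. Qed.
End line.

Section radial.
Context {R : realType} {n : nat}.
Implicit Types (r s t : R).
Implicit Types (f u : 'rV[R]_n -> R) (x v : 'rV[R]_n).
Local Notation e i := (delta_mx 0 i : 'rV[R]_n).

Lemma enorm2 (a b : R) (i j : 'I_n) : j != i ->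
  enorm (b *: e j + a *: e i) = Num.sqrt (a ^+ 2 + b ^+ 2).
Proof.
move=> ji; rewrite /enorm (bigD1 i)//= (bigD1 j)//= big1 ?addr0.
  by rewrite !mxE !eqxx/= (negbTE ji) eq_sym (negbTE ji) !mulr0 !mulr1 add0r addr0.
move=> k /andP[ki kj]; rewrite !mxE eqxx/= (negbTE ki) (negbTE kj).
by rewrite !mulr0 addr0 expr0n.
Qed.

Lemma enorm1 (a : R) (i : 'I_n) : enorm (a *: e i) = `|a|.
Proof.
rewrite /enorm (bigD1 i)//= big1 ?addr0; first by rewrite !mxE !eqxx mulr1 sqrtr_sqr.
by move=> k ki; rewrite !mxE (negbTE ki) mulr0 expr0n.
Qed.

Lemma scaler_e_eq0 (a : R) i : (a *: e i == 0) = (a == 0).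
Proof.
apply/eqP/eqP => [|->]; last by rewrite scale0r.
by move=> /(congr1 enorm); rewrite enorm1 -(scale0r (e i)) enorm1 normr0 => /normr0_eq0.
Qed.

Lemma uball0_line (r : R) i : 0 < r < 1 -> (uball `\ 0) (r *: e i).
Proof.
move=> /andP[r0 r1]; split; first by rewrite /uball/= enorm1 gtr0_norm.
by move/eqP; rewrite scaler_e_eq0 gt_eqF.
Qed.

Context (u : 'rV[R]_n -> R) (l : R) (i0 : 'I_n).
Hypothesis C2 : class_C 2 (uball `\ 0) u.
Hypothesis radu : radial (uball `\ 0) u.
Hypothesis equ : forall x, (uball `\ 0) x -> - laplacian u x = l * expexp (u x).
Let U (r : R) := u (r *: e i0).
Let dU (r : R) := pderiv i0 u (r *: e i0).

Lemma der1 i x : (uball `\ 0) x -> is_derive x (e i) u (pderiv i u x).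
Proof. by move=> Dx; apply: derivableP; have [_] := C2 (s := [::]) (isT : (0 <= 2)%N) Dx; exact. Qed.

Lemma der2 i j x : (uball `\ 0) x -> is_derive x (e j) (pderiv i u) (pderiv j (pderiv i u) x).
Proof. by move=> Dx; apply: derivableP; have [_] := C2 (s := [:: i]) (isT : (1 <= 2)%N) Dx; exact. Qed.

Lemma profile_der1 r : 0 < r < 1 -> is_derive r 1 U (dU r).
Proof.
move=> r01; have := (is_derive_lineP u 0 (e i0) r (dU r)).1.
rewrite addr0 => /(_ (der1 i0 (uball0_line i0 r01))).
by congr is_derive; apply/funext => s; rewrite addr0.
Qed.

Lemma profile_der2 r : 0 < r < 1 -> is_derive r 1 dU (pderiv i0 (pderiv i0 u) (r *: e i0)).
Proof.
move=> r01; have := (is_derive_lineP (pderiv i0 u) 0 (e i0) r _).1.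
rewrite addr0 => /(_ _ (der2 i0 i0 (uball0_line i0 r01))).
by congr is_derive; apply/funext => s; rewrite addr0.
Qed.

(** On the line [r e_i0 + s e_i] one has [u = U (w s)] with [w s = sqrt (r^2 + s^2)]. The first
    derivative is [s U'(w) / w], and its derivative at [s = 0] is [U'(r) / r]; the [n - 1]
    transverse directions produce the first-order term of the radial Laplacian. *)
Lemma radial_transverse r (i : 'I_n) : 0 < r < 1 -> i != i0 ->
  pderiv i (pderiv i u) (r *: e i0) = dU r / r.
Proof.
move=> /[dup] r01 /andP[r0 r1] ii0.
pose w (s : R) := Num.sqrt (r ^+ 2 + s ^+ 2).
have w0 : w 0 = r by rewrite /w expr0n addr0 sqrtr_sqr gtr0_norm.
have wpos (s : R) : 0 < w s.
  by rewrite sqrtr_gt0; have := sqr_ge0 s; have := exprn_gt0 2 r0; lra.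
have dw (s : R) : is_derive s 1 w (s / w s).
  have p : 0 < r ^+ 2 + s ^+ 2 by rewrite -sqrtr_gt0; exact: wpos.
  have dp : is_derive s 1 (fun t => r ^+ 2 + t ^+ 2) (2 * s) by dtac; ring.
  have h := dcomp1 (g := fun t => r ^+ 2 + t ^+ 2) (is_derive1_sqrt p) dp.
  by apply: (d_eq h); rewrite -/(w s); field; rewrite gt_eqF.
have near1 : \forall s \near (0 : R), w s < 1.
  have c : {for (0 : R), continuous w} by apply: d_cont (dw 0).
  by apply: (cvgr_lt _ c); rewrite w0.
have Dw (s : R) : w s < 1 -> (uball `\ 0) (s *: e i + r *: e i0).
  move=> ws; split; first by rewrite /uball/= enorm2.
  move=> h; have := enorm2 r s ii0; rewrite h -(scale0r (e i)) enorm1 normr0.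
  by move=> /esym/eqP; rewrite -/(w s) gt_eqF.
have line_eq (s : R) : w s < 1 -> u (s *: e i + r *: e i0) = U (w s).
  move=> ws; apply: radu.
  - exact: Dw.
  - by apply: uball0_line; rewrite wpos.
  - by rewrite enorm2// enorm1 gtr0_norm.
have open1 (s : R) : w s < 1 -> \forall t \near s, w t < 1.
  have c : {for s, continuous w} by apply: d_cont (dw s).
  by move=> ws; apply: (cvgr_lt _ c).
have pd (s : R) : w s < 1 -> pderiv i u (s *: e i + r *: e i0) = s * (dU (w s) / w s).
  move=> ws.
  have h1 := (is_derive_lineP u (r *: e i0) (e i) s _).1 (der1 i (Dw s ws)).
  have h2 : is_derive s 1 (fun t => u (t *: e i + r *: e i0)) (s * (dU (w s) / w s)).
    apply: (@d_ext _ (fun t => U (w t))).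
      by have := open1 s ws; apply: filterS => t wt; rewrite line_eq.
    have h2 := profile_der1 (r := w s); rewrite wpos ws in h2.
    by eapply d_eq; [exact: (dcomp1 (h2 isT) (dw s))|ring].
  by case: h1 => _ <-; case: h2.
have Dr := uball0_line i0 r01.
have h1 := (is_derive_line _ _ _ _).1 (der2 i i Dr).
suff h2 : is_derive (0 : R) 1 (fun s : R => pderiv i u (s *: e i + r *: e i0)) (dU r / r).
  by case: h1 => _ <-; case: h2.
apply: (@d_ext _ (fun s => s * (dU (w s) / w s))).
  by apply: filterS near1 => s ws; rewrite pd.
have d2 := profile_der2 r01; rewrite -[in is_derive r]w0 in d2.
have wn0 : w 0 != 0 by rewrite gt_eqF.
eapply d_eq; first exact: (dM (dI 0) (dM (dcomp1 d2 (dw 0)) (dV wn0 (dw 0)))).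
by rewrite /= w0 mul0r add0r mulr1.
Qed.

Lemma radial_ode r : 0 < r < 1 ->
  is_derive r 1 dU (- (n%:R - 1) / r * dU r - l * expexp (U r)).
Proof.
move=> /[dup] r01 /andP[r0 r1]; apply: (d_eq (profile_der2 r01)).
have := equ (uball0_line i0 r01); rewrite -/(U r) => <-.
rewrite /laplacian (bigD1 i0)//= (eq_bigr (fun=> dU r / r)); last first.
  by move=> i ii0; rewrite radial_transverse.
rewrite sumr_const (_ : #|_| = n.-1); last first.
  by rewrite -[n in n.-1]card_ord -(cardC1 i0); apply: eq_card => i; rewrite !inE.
have n0 : (0 < n)%N by apply: leq_ltn_trans (ltn_ord i0).
rewrite -[_ *+ n.-1]mulr_natr -subn1 natrB//; field.
by rewrite gt_eqF.
Qed.
End radial.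

(** The radial equation in [t = ln (sqrt lambda |x|)]. The sphere [|x| = 1] is [t = b] with
    [b = ln lambda / 2], and the Dirichlet condition becomes a limit from the left. *)
Definition log_sol {R : realType} (m b : R) (y dy : R -> R) :=
  [/\ forall t : R, t < b -> is_derive t 1 y (dy t),
      forall t : R, t < b -> is_derive t 1 dy (- m * dy t - expR (2 * t) * expexp (y t)),
      forall t : R, t < b -> 0 < y t /\ dy t < 0 &
      y t @[t --> b^'-] --> (0 : R)].

Section profiles.
Context {R : realType} {n : nat}.
Implicit Types (r s t : R) (u : 'rV[R]_n -> R).
Local Notation e i := (delta_mx 0 i : 'rV[R]_n).

Lemma expexp_ge1 t : 1 <= expexp t.
Proof. by rewrite /expexp -expR0 ler_expR expR_ge0. Qed.

Lemma expexp_gt0 t : 0 < expexp t.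
Proof. exact: expR_gt0. Qed.

Lemma expexp_le s t : s <= t -> expexp s <= expexp t.
Proof. by move=> st; rewrite /expexp !ler_expR. Qed.

Definition logprof (u : 'rV[R]_n -> R) (b : R) (i : 'I_n) t : R := u (expR (t - b) *: e i).
Definition dlogprof (u : 'rV[R]_n -> R) (b : R) (i : 'I_n) t : R :=
  expR (t - b) * pderiv i u (expR (t - b) *: e i).

Lemma boundary_limit u (D : set 'rV[R]_n) (i : 'I_n) :
  {within D, continuous u} -> (forall r, 0 < r <= 1 -> D (r *: e i)) ->
  (forall x, usphere x -> u x = 0) ->
  u (r *: e i) @[r --> (1 : R)^'-] --> (0 : R).
Proof.
move=> /subspace_continuousP cu De u0.
have <- : u (1 *: e i) = 0 by rewrite u0// /usphere/= enorm1 normr1.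
have h := cu (1 *: e i) (De 1 _); rewrite ltr01 lexx in h.
apply: (@cvg_comp _ _ _ (fun r : R => r *: e i) u _ _ _ _ (h isT)).
move=> A wA.
have c : (fun r : R => r *: e i) @ (1 : R) --> (1 : R) *: e i.
  by apply: cvgZr_tmp; exact: cvg_id.
have /nbhs_ballP[/= d d0 hd] := c _ wA.
exists (Num.min d 1); first by rewrite /= lt_min d0 ltr01.
move=> r /= rd r1; apply: hd; first by rewrite /ball/= (lt_le_trans rd)// ge_min lexx.
apply: De; rewrite (ltW r1) andbT.
have : `|1 - r| < 1 by rewrite (lt_le_trans rd)// ge_min lexx orbT.
by rewrite ltr_norml => /andP[_]; qlra.
Qed.

Lemma shift_exp_lim (b : R) : expR (t - b) @[t --> b^'-] --> (1 : R)^'-.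
Proof.
move=> A /nbhs_ballP[/= d d0 dA].
have c : {for b, continuous (fun t => expR (t - b))}.
  by apply: (@d_cont _ _ _ (expR (b - b))); dtac; ring.
have /nbhs_ballP[/= d1 d10 hd] : \forall t \near b, ball (1 : R) d (expR (t - b)).
  by move: (c (ball (1 : R) d)); rewrite /= subrr expR0; apply; exact: nbhsx_ballx.
exists d1 => // t td tb; apply: dA; first exact: hd.
by rewrite -expR0 ltr_expR subr_lt0.
Qed.

Section one_solution.
Context (u : 'rV[R]_n -> R) (l : R) (i : 'I_n).
Hypothesis C2 : class_C 2 (uball `\ 0) u.
Hypothesis radu : radial (uball `\ 0) u.
Hypothesis equ : forall x, (uball `\ 0) x -> - laplacian u x = l * expexp (u x).
Hypothesis l0 : 0 < l.
Let b : R := ln l / 2.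

Lemma exp_2b : expR (2 * b) = l.
Proof. by rewrite /b mulrC divfK// lnK. Qed.

Lemma logprof_in t : t < b -> 0 < expR (t - b) < 1.
Proof. by move=> tb; rewrite expR_gt0 -expR0 ltr_expR subr_lt0. Qed.

Lemma logprof_der1 t : t < b -> is_derive t 1 (logprof u b i) (dlogprof u b i t).
Proof.
move=> tb; have dE : is_derive t 1 (fun s => expR (s - b)) (expR (t - b)) by dtac; ring.
have h := dcomp1 (g := fun s => expR (s - b)) (profile_der1 i C2 (logprof_in tb)) dE.
apply: (d_eq h).
by rewrite mulrC.
Qed.

Lemma logprof_der2 t : t < b -> is_derive t 1 (dlogprof u b i)
  (- (n%:R - 2) * dlogprof u b i t - expR (2 * t) * expexp (logprof u b i t)).
Proof.
move=> tb; have dE : is_derive t 1 (fun s => expR (s - b)) (expR (t - b)) by dtac; ring.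
have h := dM dE (dcomp1 (g := fun s => expR (s - b)) (radial_ode i C2 radu equ (logprof_in tb)) dE).
apply: (d_eq h).
rewrite /logprof /dlogprof.
have -> : expR (2 * t) = l * expR (t - b) ^+ 2.
  by rewrite -exp_2b expr2 -!expRD; congr expR; ring.
by field; rewrite expR_eq0.
Qed.
End one_solution.

Section regular.
Context (u : 'rV[R]_n -> R) (l : R) (i : 'I_n).
Hypothesis n3 : (3 <= n)%N.
Hypothesis solu : classical_solution l u.
Hypothesis radu : radial cball u.
Let U r := u (r *: e i).
Let dU r := pderiv i u (r *: e i).
Let W r := r ^+ n.-1 * dU r.

Lemma uball_line r : 0 <= r < 1 -> uball (r *: e i).
Proof. by move=> /andP[r0 r1]; rewrite /uball/= enorm1 ger0_norm. Qed.

Lemma regular_C2 : class_C 2 (uball `\ 0) u.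
Proof. by case: solu => h _ _ _ _ s x sk [Dx _]; exact: h. Qed.

Lemma regular_rad : radial (uball `\ 0) u.
Proof. by move=> x y [Dx _] [Dy _]; apply: radu; apply: ltW. Qed.

Lemma regular_eq x : (uball `\ 0) x -> - laplacian u x = l * expexp (u x).
Proof. by case: solu => _ _ h _ _ [Dx _]; exact: h. Qed.

Lemma regular_der1 r : 0 <= r < 1 -> is_derive r 1 U (dU r).
Proof.
move=> r01; have := (is_derive_lineP u 0 (e i) r (dU r)).1.
have -> : (fun s => u (s *: e i + 0)) = U by apply/funext => s; rewrite addr0.
apply; rewrite addr0; apply: derivableP; case: solu => C2 _ _ _ _.
by have [_] := C2 [::] _ isT (uball_line r01); exact.
Qed.

Lemma regular_der2 r : 0 <= r < 1 -> is_derive r 1 dU (pderiv i (pderiv i u) (r *: e i)).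
Proof.
move=> r01; have := (is_derive_lineP (pderiv i u) 0 (e i) r (pderiv i (pderiv i u) (r *: e i))).1.
have -> : (fun s => pderiv i u (s *: e i + 0)) = dU by apply/funext => s; rewrite addr0.
apply; rewrite addr0; apply: derivableP; case: solu => C2 _ _ _ _.
by have [_] := C2 [:: i] _ isT (uball_line r01); exact.
Qed.

(** The divergence form of the radial equation still makes sense at [r = 0], unlike the quotient in
    [radial_ode]; with [W 0 = 0] it can be integrated from the origin. *)
Lemma regular_derW r : 0 <= r < 1 -> is_derive r 1 W (- l * r ^+ n.-1 * expexp (U r)).
Proof.
move=> /[dup] r01 /andP[r0 r1].
have d2 := regular_der2 r01.
have [k kE] : exists k, n.-1 = k.+2 by exists (n - 3)%N; move: n3; case: (n) => [|[|[|p]]]//; rewrite !subSS subn0.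
have nE : n%:R = k%:R + 3 :> R by rewrite -(prednK (ltnW (ltnW n3))) kE -!natr1; ring.
rewrite /W kE.
have dp : is_derive r 1 (fun r => r ^+ k.+2) (k.+2%:R * r ^+ k.+1) by dtac; ring.
move: r0; rewrite le_eqVlt => /predU1P[r0|r0].
  eapply d_eq; first exact: dM dp d2.
  by rewrite -r0 !exprS; ring.
have r01' : 0 < r < 1 by rewrite r0.
have h := radial_ode i regular_C2 regular_rad regular_eq r01'.
eapply d_eq; first exact: dM dp h.
rewrite /= -/(dU r) -/(U r) nE -!natr1 !exprS; field.
by rewrite gt_eqF.
Qed.

Lemma regular_W0 : W 0 = 0.
Proof. by rewrite /W; move: n3; case: (n.-1) (ltn_predK n3) => [<-//|p _ _]; rewrite exprS !mul0r. Qed.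

Lemma regular_lim1 : U r @[r --> (1 : R)^'-] --> (0 : R).
Proof.
case: solu => _ cu _ _ u0; apply: boundary_limit cu _ u0 => r /andP[r0 r1].
by rewrite /cball/= enorm1 gtr0_norm.
Qed.

(** If [l <= 0], the flux [W] is nondecreasing from 0, so [U] is nondecreasing and [U (1/2)] is at
    most the boundary value 0, against positivity. *)
Lemma regular_l0 : 0 < l.
Proof.
rewrite ltNge; apply/negP => l0.
have dU0 r : 0 < r < 1 -> 0 <= dU r.
  move=> /andP[r0 r1].
  have : W 0 <= W r.
    apply: (@ge_of_deriv_ge0 _ W (fun r => - l * r ^+ n.-1 * expexp (U r))); first exact: ltW.
      by move=> x /andP[x0 xr]; apply: regular_derW; rewrite x0 (le_lt_trans xr).
    move=> x /andP[x0 xr]; rewrite mulr_ge0 ?(ltW (expexp_gt0 _))// mulr_ge0 ?exprn_ge0//.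
    by rewrite oppr_ge0.
  by rewrite regular_W0 /W pmulr_rge0// exprn_gt0.
have h2 : 0 < U (1 / 2) by case: solu => _ _ _ u0 _; apply: u0; apply: uball_line; sl.
suff : U (1 / 2) <= 0 by rewrite leNgt h2.
apply: (cvgr_to_ge regular_lim1); exists (1 / 2); first by rewrite /= divr_gt0.
move=> r /= r2 r1.
have {r2}r2 : 1 / 2 <= r by move: r2; rewrite ltr_norml => /andP[]; lra.
apply: (@ge_of_deriv_ge0 _ U dU _ _ r2) => x /andP[x0 xr].
  by apply: regular_der1; sl.
by apply: dU0; sl.
Qed.

(** The flux is bounded in two rounds. First [expexp >= 1] makes [W] negative, so that [U] decreases
    from [U 0]; then [expexp (U r) <= expexp (U 0)] bounds [W] from below. A last integration gives
    the parabola below which [U 0 - U r] stays. *)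
Lemma regular_dU : forall r, 0 < r < 1 ->
  - (l * expexp (U 0) * r / n%:R) <= dU r < 0 /\ U 0 - U r <= l * expexp (U 0) * r ^+ 2 / (2 * n%:R).
Proof.
have n0 : 0 < n%:R :> R by rewrite ltr0n (leq_trans _ n3).
have W_le r : 0 <= r < 1 -> W r <= - (l * r ^+ n / n%:R).
  move=> /andP[r0 r1].
  have nE : n = n.-1.+1 by rewrite prednK// (leq_trans _ n3).
  have : W r + l * r ^+ n / n%:R <= W 0 + l * 0 ^+ n / n%:R.
    apply: (@le_of_deriv_le0 _ (fun r => W r + l * r ^+ n / n%:R)
      (fun r => - l * r ^+ n.-1 * expexp (U r) + l * r ^+ n.-1)) => // x /andP[x0 xr].
      have hW : is_derive x 1 W (- l * x ^+ n.-1 * expexp (U x)).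
        by apply: regular_derW; rewrite x0 (le_lt_trans xr).
      have dp : is_derive x 1 (fun r => r ^+ n) (n%:R * x ^+ n.-1).
        by rewrite nE; dtac; rewrite -nE; ring.
      by dtac; field; rewrite gt_eqF.
    have := ler_wpM2l (mulr_ge0 (ltW regular_l0) (exprn_ge0 n.-1 x0)) (expexp_ge1 (U x)).
    by rewrite mulr1; lra.
  have z : 0 ^+ n = 0 :> R by rewrite nE expr0n.
  by rewrite regular_W0 z mulr0 mul0r addr0; lra.
have dU_lt0 r : 0 < r < 1 -> dU r < 0.
  move=> /andP[r0 r1]; have := W_le r; rewrite (ltW r0) r1 => /(_ isT).
  rewrite leNgt; apply: contraNT; rewrite -leNgt => h.
  rewrite (lt_le_trans (y := 0))//; last by rewrite mulr_ge0// exprn_ge0// ltW.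
  by rewrite oppr_lt0 divr_gt0// mulr_gt0 ?exprn_gt0// regular_l0.
have U_le r : 0 <= r < 1 -> U r <= U 0.
  move=> /andP[]; rewrite le_eqVlt => /predU1P[<-//|r0 r1].
  have c0 : {for (0 : R), continuous U} by apply: d_cont (@regular_der1 0 _); rewrite lexx ltr01.
  apply: (cont_right_ge c0 r0) => x /andP[x0 xr]; rewrite add0r in xr.
  apply: (@le_of_deriv_le0 _ U dU _ _ (ltW xr)) => y /andP[y0 yr].
    by apply: regular_der1; sl.
  by rewrite ltW// dU_lt0//; sl.
have W_ge r : 0 <= r < 1 -> - (l * expexp (U 0) * r ^+ n / n%:R) <= W r.
  move=> /andP[r0 r1].
  have nE : n = n.-1.+1 by rewrite prednK// (leq_trans _ n3).
  have : W 0 + l * expexp (U 0) * 0 ^+ n / n%:R <= W r + l * expexp (U 0) * r ^+ n / n%:R.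
    apply: (@ge_of_deriv_ge0 _ (fun r => W r + l * expexp (U 0) * r ^+ n / n%:R)
      (fun r => - l * r ^+ n.-1 * expexp (U r) + l * expexp (U 0) * r ^+ n.-1)) => // x /andP[x0 xr].
      have hW : is_derive x 1 W (- l * x ^+ n.-1 * expexp (U x)).
        by apply: regular_derW; rewrite x0 (le_lt_trans xr).
      have dp : is_derive x 1 (fun r => r ^+ n) (n%:R * x ^+ n.-1).
        by rewrite nE; dtac; rewrite -nE; ring.
      by dtac; field; rewrite gt_eqF.
    have h : expexp (U x) <= expexp (U 0) by rewrite expexp_le// U_le// x0 (le_lt_trans xr).
    by have := ler_wpM2l (mulr_ge0 (ltW regular_l0) (exprn_ge0 n.-1 x0)) h; lra.
  have z : 0 ^+ n = 0 :> R by rewrite nE expr0n.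
  by rewrite regular_W0 z mulr0 mul0r addr0; lra.
have dU_ge r : 0 < r < 1 -> - (l * expexp (U 0) * r / n%:R) <= dU r.
  move=> /andP[r0 r1]; have := W_ge r; rewrite (ltW r0) r1 => /(_ isT).
  have nE : n = n.-1.+1 by rewrite prednK// (leq_trans _ n3).
  rewrite {1}nE exprS /W => h; rewrite -(ler_pM2l (exprn_gt0 n.-1 r0)).
  apply: le_trans h; rewrite le_eqVlt; apply/orP; left; apply/eqP; ring.
move=> r r01; split; first by rewrite dU_lt0// dU_ge.
case/andP: r01 => r0 r1.
have : U 0 + l * expexp (U 0) * 0 ^+ 2 / (2 * n%:R) <= U r + l * expexp (U 0) * r ^+ 2 / (2 * n%:R).
  apply: (@ge_of_deriv_ge0 _ (fun r => U r + l * expexp (U 0) * r ^+ 2 / (2 * n%:R))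
     (fun r => dU r + l * expexp (U 0) * r / n%:R) _ _ (ltW r0)) => x /andP[x0 xr].
    have hU : is_derive x 1 U (dU x) by apply: regular_der1; rewrite x0 (le_lt_trans xr).
    by dtac; field; rewrite gt_eqF.
  move: x0; rewrite le_eqVlt => /predU1P[<-|x0]; last first.
    by have := dU_ge x; rewrite x0 (le_lt_trans xr)// => /(_ isT); lra.
  have cc : {for (0 : R), continuous (fun x => dU x + l * expexp (U 0) * x / n%:R)}.
    have hd : is_derive (0 : R) 1 dU (pderiv i (pderiv i u) (0 *: e i)).
      by apply: regular_der2; rewrite lexx ltr01.
    by apply: d_cont; dtac.
  apply: (cont_right_ge cc r0) => y /andP[y0 yr]; rewrite add0r in yr.
  by have := dU_ge y; rewrite y0 (lt_trans yr r1) => /(_ isT); lra.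
by rewrite expr0n mulr0 mul0r addr0; lra.
Qed.

Lemma regular_sup rho : sup_norm u = rho -> U 0 = rho.
Proof.
move=> <-; have [_ _ _ u0 _] := solu.
have z01 : 0 <= (0 : R) < 1 by rewrite lexx ltr01.
have U0 : 0 < U 0 by apply: u0; exact: uball_line.
have ub x : uball x -> `|u x| <= U 0.
  move=> Dx; rewrite gtr0_norm ?u0//.
  have -> : u x = U (enorm x).
    apply: radu; rewrite /cball/= ?enorm1 ?ger0_norm ?sqrtr_ge0//; exact: ltW.
  have := sqrtr_ge0 (\sum_(k < n) x 0 k ^+ 2); rewrite -/(enorm x) le_eqVlt => /predU1P[<-//|x0].
  have x01 : 0 < enorm x < 1 by rewrite x0.
  have c0 : {for (0 : R), continuous U} by apply: d_cont (@regular_der1 0 _); rewrite lexx ltr01.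
  apply: (cont_right_ge c0 x0) => y /andP[y0 yr]; rewrite add0r in yr.
  apply: (@le_of_deriv_le0 _ U dU _ _ (ltW yr)) => z /andP[yz zx].
    by apply: regular_der1; rewrite (le_trans _ yz) ?(ltW y0)//= (le_lt_trans zx).
  have z1 : 0 < z < 1 by rewrite (lt_le_trans y0 yz)/= (le_lt_trans zx).
  by have [/andP[_ /ltW]] := regular_dU z1.
apply/esym/eqP; rewrite eq_le; apply/andP; split.
  apply: sup_le_ub; first by exists `|u (0 *: e i)|; exists (0 *: e i) => //; exact: uball_line.
  by move=> _ [x Dx <-]; exact: ub.
apply: ub_le_sup; first by exists (U 0) => _ [x Dx <-]; exact: ub.
by exists (0 *: e i); [exact: uball_line|rewrite gtr0_norm].
Qed.

End regular.

Lemma regular_log u l rho (i : 'I_n) : (3 <= n)%N -> classical_solution l u ->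
  radial cball u -> sup_norm u = rho ->
  [/\ 0 < l, log_sol (n%:R - 2) (ln l / 2) (logprof u (ln l / 2) i) (dlogprof u (ln l / 2) i) &
   forall t, t < ln l / 2 ->
     - (expR (2 * t) * expexp rho / n%:R) <= dlogprof u (ln l / 2) i t
     /\ rho - expR (2 * t) * expexp rho / (2 * n%:R) <= logprof u (ln l / 2) i t <= rho].
Proof.
move=> n3 solu radu supu.
have l0 := regular_l0 i n3 solu radu.
have C2 := regular_C2 solu; have rd := regular_rad radu; have eqs := regular_eq solu.
have U0 := regular_sup i n3 solu radu supu.
have tl t : expR (2 * t) = l * expR (t - ln l / 2) ^+ 2.
  by rewrite -{1}(exp_2b l0) expr2 -!expRD; congr expR; ring.
have n0 : 0 < n%:R :> R by rewrite ltr0n (leq_trans _ n3).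
split; first exact: l0.
  split.
  - by move=> t; exact: logprof_der1.
  - by move=> t; exact: logprof_der2.
  - move=> t tb; have r01 := logprof_in tb.
    have [/andP[_ d0] _] := regular_dU i n3 solu radu r01.
    split; last by rewrite /dlogprof pmulr_rlt0 ?expR_gt0.
    by have [_ _ _ u0 _] := solu; apply: u0; apply: uball_line; case/andP: r01 => /ltW ->.
  - exact: (cvg_comp _ _ (shift_exp_lim _) (regular_lim1 i solu)).
move=> t tb; have r01 := logprof_in tb.
have [/andP[d1 d0] d2] := regular_dU i n3 solu radu r01.
rewrite U0 in d1 d2; set r := expR (t - _) in r01 d1 d0 d2.
have /andP[r0 r1] := r01.
rewrite tl -/r; split.
  rewrite /dlogprof -/r -(ler_pM2l r0) in d1 *.
  by apply: le_trans d1; rewrite le_eqVlt; apply/orP; left; apply/eqP; ring.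
apply/andP; split; first by move: d2; rewrite /logprof -/r; lra.
have c0 : {for (0 : R), continuous (fun r => u (r *: e i))}.
  by apply: d_cont (regular_der1 i solu _); rewrite lexx ltr01.
rewrite -U0; apply: (cont_right_ge c0 r0) => x /andP[x0 xr]; rewrite add0r in xr.
apply: (@le_of_deriv_le0 _ (fun r => u (r *: e i)) _ _ _ (ltW xr)) => y /andP[xy yr].
  by apply: (regular_der1 i solu); rewrite (le_trans (ltW x0) xy)/= (le_lt_trans yr).
have y01 : 0 < y < 1 by rewrite (lt_le_trans x0 xy)/= (le_lt_trans yr).
by have [/andP[_ /ltW]] := regular_dU i n3 solu radu y01.
Qed.
End profiles.

(** * Emden variables *)


(** The linearization [D'' + m D' + 2 m D = E] at the equilibrium, as a first-order system. The
    factor [1/8] is small enough for the energy to decay when [m >= 1] and for the solution to keep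
    rotating when [1 <= m <= 7]. *)
Definition perturbed {R : realType} (m a b : R) (D S E : R -> R) :=
  forall t : R, a <= t <= b ->
    [/\ is_derive t 1 D (S t), is_derive t 1 S (- m * S t - 2 * m * D t + E t) &
        `|E t| <= (`|D t| + `|S t|) / 8].

(** The quadratic part of [lyap]. Thanks to the cross term its derivative along the unperturbed
    equation is [- m S^2 / 2 - m^2 D^2], definite in both variables; the plain energy would lose
    only the term in [S]. *)
Definition energy {R : realType} (m : R) (D S : R -> R) (t : R) : R :=
  (S t + m * D t / 2) ^+ 2 / 2 + m ^+ 2 * D t ^+ 2 / 8 + m * D t ^+ 2.

Section perturbed_system.
Context {R : realType}.
Implicit Types (m a b d s e t : R) (D S E : R -> R).

Lemma perturbation_bound m d s e : 1 <= m -> `|e| <= (`|d| + `|s|) / 8 ->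
  `|e * (s + m * d / 2)| <= m / 4 * (d ^+ 2 + s ^+ 2).
Proof.
move=> m1 he; rewrite normrM.
have h1 : `|s + m * d / 2| <= m * (`|d| + `|s|).
  apply: (le_trans (ler_normD _ _)); rewrite !normrM (ger0_norm (_ : 0 <= m)) ?(le_trans _ m1)//.
  rewrite (ger0_norm (_ : 0 <= 2^-1)) ?invr_ge0//.
  have : `|s| <= m * `|s| by rewrite ler_peMl.
  have : 0 <= m * `|d| by rewrite mulr_ge0// (le_trans _ m1).
  lra.
apply: (le_trans (ler_pM _ _ he h1)) => //.
rewrite -(real_normK (num_real d)) -(real_normK (num_real s)).
have h : 0 <= m * (`|d| - `|s|) ^+ 2 by rewrite mulr_ge0 ?sqr_ge0// (le_trans _ m1).
lra.
Qed.

Lemma energy_bounds m d s : 1 <= m ->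
  let h := (s + m * d / 2) ^+ 2 / 2 + m ^+ 2 * d ^+ 2 / 8 + m * d ^+ 2 in
  [/\ s ^+ 2 <= 8 * h, m ^+ 2 * d ^+ 2 <= 8 * h, d ^+ 2 <= h &
      h <= 3 / 4 * s ^+ 2 + 3 / 2 * (m ^+ 2 * d ^+ 2)].
Proof.
move=> m1 h; rewrite /h.
have a1 := sqr_ge0 (s + m * d / 2); have a2 := sqr_ge0 (m * d); have a3 := sqr_ge0 d.
have a4 := sqr_ge0 (s - m * d); have a5 := sqr_ge0 (s + m * d).
have m_2 : d ^+ 2 <= m * d ^+ 2 by rewrite ler_peMl.
have m_3 : m * d ^+ 2 <= m ^+ 2 * d ^+ 2.
  by rewrite expr2 -mulrA ler_peMl// (le_trans a3).
split; lra.
Qed.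

Lemma energy_deriv m a b D S E t : perturbed m a b D S E -> a <= t <= b ->
  is_derive t 1 (energy m D S)
    (- (m / 2) * S t ^+ 2 - m ^+ 2 * D t ^+ 2 + E t * (S t + m * D t / 2)).
Proof.
move=> H tab; have [h1 h2 _] := H t tab; rewrite /energy.
by dtac; field.
Qed.

Lemma energy_decay m a b D S E : 1 <= m -> a <= b -> perturbed m a b D S E ->
  energy m D S b <= energy m D S a * expR (- (b - a) / 4).
Proof.
move=> m1 ab H.
have := @gronwall _ (energy m D S) _ (- (1 / 4)) 0 a b ab _ (fun t tab => energy_deriv H tab).
rewrite mul0r !addr0 (_ : - (1 / 4) * (b - a) = - (b - a) / 4); last by ring.
apply; first by rewrite oppr_eq0 lt0r_neq0.
move=> t tab; have [_ _ hE] := H t tab.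
have := perturbation_bound m1 hE; rewrite ler_norml => /andP[_ h1].
have [_ _ _ h2] := energy_bounds (D t) (S t) m1.
have h3 : S t ^+ 2 <= m * S t ^+ 2 by rewrite ler_peMl// sqr_ge0.
have h4 : m * D t ^+ 2 <= m ^+ 2 * D t ^+ 2.
  by rewrite expr2 -mulrA ler_peMl// mulr_ge0 ?sqr_ge0// (le_trans _ m1).
rewrite -/(energy m D S t) in h2.
have h5 := sqr_ge0 (S t); have h6 := mulr_ge0 (sqr_ge0 m) (sqr_ge0 (D t)).
move: h1 h2 h3 h4; move: (energy m D S t) => h; lra.
Qed.

(** Quantitative uniqueness: a nonzero difference of two solutions cannot collapse faster than
    exponentially. *)
Lemma energy_lower m a b D S E : 1 <= m -> a <= b -> perturbed m a b D S E ->
  energy m D S a * expR (- (16 * m) * (b - a)) <= energy m D S b.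
Proof.
move=> m1 ab H.
have m0 : 0 < m by rewrite (lt_le_trans _ m1).
have := @gronwall _ (fun t => - energy m D S t) _ (- (16 * m)) 0 a b ab _
   (fun t tab => dN (energy_deriv H tab)).
rewrite mul0r !addr0 mulNr lerN2; apply; first by rewrite oppr_eq0 lt0r_neq0// mulr_gt0.
move=> t tab; have [_ _ hE] := H t tab.
have := perturbation_bound m1 hE; rewrite ler_norml => /andP[h1 _].
have [h2 h3 _ _] := energy_bounds (D t) (S t) m1.
have h4 : m * D t ^+ 2 <= m ^+ 2 * D t ^+ 2.
  by rewrite expr2 -mulrA ler_peMl// mulr_ge0 ?sqr_ge0// ltW.
rewrite -/(energy m D S t) in h2 h3.
have h5 : 0 <= m * (8 * energy m D S t - S t ^+ 2) by rewrite mulr_ge0 ?subr_ge0// ltW.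
have h0 : 0 <= energy m D S t by have := sqr_ge0 (S t); lra.
have h6 : energy m D S t <= m * energy m D S t by rewrite ler_peMl.
move: h1 h3 h4 h5 h6; move: (energy m D S t) => h; clear; lra.
Qed.

(* The Riccati variable [S/D + m/2] decreases at least like a tangent, the
   discriminant [m^2/4 - 2m] being negative for [m <= 7]. *)
Lemma nonvanishing_short m a b D S E : 1 <= m <= 7 -> a <= b -> perturbed m a b D S E ->
  (forall t : R, a <= t <= b -> D t != 0) -> b - a < 2 * pi.
Proof.
move=> /andP[m1 m7] ab H D0.
pose X t := S t / D t + m / 2.
pose dX t := (- m * S t - 2 * m * D t + E t) / D t - (S t / D t) ^+ 2.
have hX t : a <= t <= b -> is_derive t 1 (fun t => atan (X t)) ((1 + X t ^+ 2)^-1 * dX t).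
  move=> tab; have [h1 h2 _] := H t tab; have Dt := D0 t tab.
  have h3 : is_derive t 1 X (dX t) by rewrite /X /dX; dtac; field.
  by apply: dcomp1 h3; exact: is_derive1_atan.
(* [atan X] decreases at rate at least [1/2] and takes values in an interval of length [pi], hence
   the bound [2 pi] on the length. *)
have : atan (X b) + 1 / 2 * b <= atan (X a) + 1 / 2 * a.
  apply: (@le_of_deriv_le0 _ (fun t => atan (X t) + 1 / 2 * t)
    (fun t => (1 + X t ^+ 2)^-1 * dX t + 1 / 2)) => // t tab.
    by have h := hX t tab; dtac; ring.
  have [_ _ hE] := H t tab; have Dt := D0 t tab.
  have p : 0 < 1 + X t ^+ 2 by rewrite ltr_pwDl// sqr_ge0.
  rewrite -lerBrDr sub0r ler_pdivrMl//.
  have Dt0 : 0 < `|D t| by rewrite normr_gt0.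
  have e1 : `|E t / D t| <= (1 + `|S t / D t|) / 8.
    rewrite !normrM !normfV ler_pdivrMr//.
    apply: (le_trans hE); rewrite le_eqVlt; apply/orP; left; apply/eqP; field.
    by rewrite lt0r_neq0.
  have e2 : dX t = - (X t ^+ 2 + (2 * m - m ^+ 2 / 4)) + E t / D t.
    by rewrite /dX /X; field.
  have e3 : `|S t / D t| <= `|X t| + m / 2.
    have -> : S t / D t = X t - m / 2 by rewrite /X; ring.
    by rewrite (le_trans (ler_normB _ _))// lerD2l ger0_norm//; lra.
  have e4 : 2 * `|X t| <= 1 + X t ^+ 2.
    by rewrite -(real_normK (num_real (X t))); have := sqr_ge0 (`|X t| - 1); lra.
  (* The minimum of this concave function on [[1, 7]], attained at both ends. *)
  have e5 : 7 / 4 <= 2 * m - m ^+ 2 / 4.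
    have : 0 <= (m - 1) * (7 - m) by rewrite mulr_ge0 ?subr_ge0.
    lra.
  have e6 := sqr_ge0 (X t).
  move: e1; rewrite ler_norml => /andP[_]; rewrite e2.
  lra.
have := atan_gtNpi2 (X b); have := atan_ltpi2 (X a).
lra.
Qed.

(** [D] has a zero at distance at least 1 from both ends. If [D] were never positive, this zero
    would be an interior maximum, so that [D = S = 0] and the energy would vanish there. *)
Lemma takes_positive m a b D S E : 1 <= m <= 7 -> 2 * pi + 2 <= b - a -> perturbed m a b D S E ->
  (forall t : R, a <= t <= b -> 0 < energy m D S t) -> exists2 t : R, a < t < b & 0 < D t.
Proof.
move=> m17 ab H En.
have pi0 : 0 < pi :> R by exact: pi_gt0.
apply: contrapT => noD.
have Dle t : a < t < b -> D t <= 0.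
  by move=> tab; rewrite leNgt; apply/negP => Dt; apply: noD; exists t.
have [t tab /eqP Dt] : exists2 t : R, a + 1 <= t <= b - 1 & D t == 0.
  apply: contrapT => no0.
  have H' : perturbed m (a + 1) (b - 1) D S E by move=> t /andP[t1 t2]; apply: H; sp.
  have ab' : a + 1 <= b - 1 by qlra.
  suff : b - 1 - (a + 1) < 2 * pi by qlra.
  apply: (nonvanishing_short m17 ab' H') => t tab.
  by apply/negP => Dt; apply: no0; exists t.
have tab' : a <= t <= b by move: tab => /andP[? ?]; sp.
have [h1 _ _] := H t tab'.
have [_ S0] : is_derive t 1 D 0.
  apply: (@derive1_at_max _ D a b t).
  - by qlra.
  - move=> x /[!in_itv]/= /andP[x1 x2]; have [|[]//] := H x; sp.
  - by rewrite in_itv/=; move: tab => /andP[? ?]; sp.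
  - by move=> x /[!in_itv]/= xab; rewrite Dt; exact: Dle.
have St : S t = 0 by rewrite -S0; case: h1.
have := En t tab'; have -> : energy m D S t = 0 by rewrite /energy Dt St; ring.
by rewrite ltxx.
Qed.
End perturbed_system.

Section emden.
Context {R : realType}.
Implicit Types (m b t : R) (y dy : R -> R).

(* In the variable [t = ln (sqrt lambda |x|)] the scaled potential of the linearized
   problem is [2 m e^Z]; [Z] satisfies [Z'' + m Z' + 2 m (e^Z - 1) = 0] up to the
   remainder [emR], and [emP] is [Z']. *)
Definition emZ m y t : R := expR (y t) + y t + 2 * t - ln (2 * m).
Definition emP y dy t : R := (expR (y t) + 1) * dy t + 2.
(* the non-autonomous part of the equation, small where [a = expR (- y)] is *)
Definition emR m (a Z P : R) : R :=
  - 2 * m * a * expR Z + a / (1 + a) ^+ 2 * (P - 2) ^+ 2.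

(** The mechanical energy [P^2/2 + 2 m (e^Z - 1 - Z)] of the damped oscillator, augmented by
    [m P Z / 2 + m^2 Z^2 / 4] so that the dissipation also controls [Z]. *)
Definition lyap (m Z P : R) : R :=
  (P + m * Z / 2) ^+ 2 / 2 + m ^+ 2 * Z ^+ 2 / 8 + 2 * m * (expR Z - 1 - Z).

Context (m b : R) (y dy : R -> R).
Hypothesis m1 : 1 <= m.
Hypothesis sol : log_sol m b y dy.
Let Z := emZ m y.
Let P := emP y dy.
Let r t := emR m (expR (- y t)) (Z t) (P t).

Lemma emZ_deriv t : t < b -> is_derive t 1 Z (P t).
Proof.
case: sol => h1 _ _ _ tb; have hy := h1 t tb.
by rewrite /Z /P /emZ /emP; dtac; ring.
Qed.

Lemma emZ_exp t : 2 * m * expR (Z t) = expR (y t) * (expR (2 * t) * expexp (y t)).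
Proof.
have m0 : 0 < 2 * m by rewrite mulr_gt0// (lt_le_trans _ m1).
rewrite -{1}(lnK m0) /expexp -!expRD; congr expR; rewrite /Z /emZ; ring.
Qed.

Lemma emP_deriv t : t < b -> is_derive t 1 P (- m * P t - 2 * m * (expR (Z t) - 1) + r t).
Proof.
case: sol => h1 h2 _ _ tb; have hy := h1 t tb; have hd := h2 t tb.
rewrite /r /emR /P /emP; dtac.
have a0 : expR (y t) != 0 by rewrite expR_eq0.
have a1 : 1 + expR (y t) != 0 by rewrite lt0r_neq0// ltr_pwDr// ?expR_gt0// ltW.
have : expR (2 * t) * expexp (y t) = 2 * m * expR (Z t) / expR (y t).
  by rewrite emZ_exp; field.
by move=> ->; rewrite expRN; field; rewrite a0 addrC a1.
Qed.

Lemma lyap_deriv t : t < b -> is_derive t 1 (fun t => lyap m (Z t) (P t))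
  (- (m / 2) * P t ^+ 2 - m ^+ 2 * (Z t * (expR (Z t) - 1)) + r t * (P t + m * Z t / 2)).
Proof.
move=> tb; have hZ := emZ_deriv tb; have hP := emP_deriv tb; rewrite /lyap.
by dtac; field.
Qed.

Lemma norm_le_of_sqr (x c : R) : 0 <= c -> x ^+ 2 <= c ^+ 2 -> `|x| <= c.
Proof. by move=> c0 h; rewrite -ler_sqr ?nnegrE// real_normK// num_real. Qed.

Lemma lyap_bounds (K B z p : R) : 0 <= B -> 8 * K <= B ^+ 2 -> lyap m z p <= K ->
  [/\ `|z| <= B, `|p| <= B & `|p + m * z / 2| <= B].
Proof.
move=> B0 BK; rewrite /lyap => h.
have e1 : 0 <= 2 * m * (expR z - 1 - z).
  by rewrite mulr_ge0 ?mulr_ge0 ?(le_trans _ m1)//; have := expR_ge1Dx z; lra.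
have a1 := sqr_ge0 (p + m * z / 2); have a2 := sqr_ge0 (m * z); have a3 := sqr_ge0 z.
have a4 : z ^+ 2 <= m ^+ 2 * z ^+ 2.
  by rewrite ler_peMl// -[1](expr1n _ 2) lerXn2r ?nnegrE// (le_trans _ m1).
have a5 := sqr_ge0 (p + m * z).
by split; apply: norm_le_of_sqr => //; lra.
Qed.

(** Both [e^z - 1 - z] and [e^(-B) z^2] are at most [z (e^z - 1)] when [|z| <= B]. The rate has to
    degenerate with [B], because the restoring force stays bounded as [z] tends to [-oo]. *)
Lemma lyap_dissipation (B z p : R) : `|z| <= B ->
  - (m / 2) * p ^+ 2 - m ^+ 2 * (z * (expR z - 1)) <= - (expR (- B) / 4) * lyap m z p.
Proof.
move=> zB; have B0 : 0 <= B := le_trans (normr_ge0 _) zB.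
have c0 : 0 < expR (- B) := expR_gt0 _.
have c1 : expR (- B) <= 1 by rewrite -expR0 ler_expR oppr_le0.
have h1 : expR z - 1 - z <= z * (expR z - 1).
  have : expR z * (1 - z) <= 1.
    by rewrite -ler_pdivlMl ?expR_gt0// mulr1 -expRN; have := expR_ge1Dx (- z); lra.
  lra.
have h2 : expR (- B) * z ^+ 2 <= z * (expR z - 1).
  have z2 := sqr_ge0 z; have [z0|z0] := leP 0 z.
    have : z * z <= z * (expR z - 1) by rewrite ler_wpM2l//; have := expR_ge1Dx z; lra.
    have : expR (- B) * z ^+ 2 <= z ^+ 2 by rewrite ler_piMl.
    rewrite expr2; lra.
  have h : expR (- B) * (- z) <= 1 - expR z.
    have zb : - B <= z by move: zB; rewrite ltr0_norm//; lra.
    have : expR (- B) * (- z) <= expR z * (- z) by rewrite ler_wpM2r ?ler_expR//; lra.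
    have : expR z * (1 - z) <= 1.
      by rewrite -ler_pdivlMl ?expR_gt0// mulr1 -expRN; have := expR_ge1Dx (- z); lra.
    lra.
  have : 0 <= (- z) * (1 - expR z - expR (- B) * (- z)) by rewrite mulr_ge0; lra.
  rewrite expr2; lra.
set c := expR (- B) in c0 c1 h2 *.
rewrite /lyap; set E := expR z in h1 h2 *; set q := z * (E - 1) in h1 h2 *.
have q0 : 0 <= q by apply: le_trans h2; rewrite mulr_ge0 ?sqr_ge0// ltW.
have m0 : 0 <= m by rewrite (le_trans _ m1).
have p2 := sqr_ge0 p.
have b1 : c * p ^+ 2 <= m * p ^+ 2 by rewrite ler_wpM2r// (le_trans c1).
have b2 : m ^+ 2 * (c * z ^+ 2) <= m ^+ 2 * q by rewrite ler_wpM2l// sqr_ge0.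
have b3 : c * (2 * m * (E - 1 - z)) <= 2 * m ^+ 2 * q.
  have : 2 * m * (E - 1 - z) <= 2 * m * q by rewrite ler_wpM2l// mulr_ge0.
  move=> /(ler_wpM2l (ltW c0)) /le_trans; apply.
  have : c * (2 * m * q) <= 1 * (2 * m * q).
    by rewrite ler_wpM2r//; apply: mulr_ge0 => //; exact: mulr_ge0.
  have : m * (m * q) >= m * q by rewrite ler_peMl// mulr_ge0.
  lra.
have b4 : 0 <= c * (p - m * z) ^+ 2 by rewrite mulr_ge0 ?sqr_ge0// ltW.
have b5 : 0 <= m ^+ 2 * q by rewrite mulr_ge0 ?sqr_ge0.
have b6 : 0 <= m * p ^+ 2 by rewrite mulr_ge0.
lra.
Qed.

Lemma emR_bound (B eta a z p : R) : `|z| <= B -> `|p| <= B -> 0 < a <= eta ->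
  `|emR m a z p| <= eta * (2 * m * expR B + (B + 2) ^+ 2).
Proof.
move=> zB pB /andP[a0 ae]; have B0 : 0 <= B := le_trans (normr_ge0 _) zB.
have m0 : 0 <= m by rewrite (le_trans _ m1).
have eta0 : 0 < eta := lt_le_trans a0 ae.
rewrite /emR mulrDr (le_trans (ler_normD _ _))// lerD//.
  rewrite mulrAC !mulNr normrN mulrC ger0_norm; last by rewrite !mulr_ge0 ?expR_ge0// ltW.
  rewrite ler_pM ?mulr_ge0 ?expR_ge0//; first exact: ltW.
  rewrite ler_wpM2l ?mulr_ge0// ler_expR; move: zB; rewrite ler_norml => /andP[]//.
have a1 : 0 < (1 + a) ^+ 2 by rewrite exprn_gt0// addr_gt0.
rewrite ger0_norm; last by rewrite mulr_ge0 ?sqr_ge0// divr_ge0 ?sqr_ge0// ltW.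
rewrite ler_pM ?sqr_ge0//; first by rewrite divr_ge0 ?sqr_ge0// ltW.
  rewrite ler_pdivrMr//; have := sqr_ge0 a; have := mulr_ge0 (ltW eta0) (sqr_ge0 a).
  have := mulr_gt0 eta0 a0; lra.
rewrite -(real_normK (num_real (p - 2))) ler_sqr ?nnegrE//; last by rewrite addr_ge0.
by rewrite (le_trans (ler_normB _ _))// lerD// ger0_norm.
Qed.

(** Per unit of [eta], a bound for the product of [emR] and [P + m Z / 2], the term by which the
    remainder feeds [lyap]. *)
Definition trapC (B : R) : R := B * (2 * m * expR B + (B + 2) ^+ 2).

(** As long as [lyap <= F0 + 1], both variables are bounded by [B] and the remainder contributes at
    most half of [expR (- B) / 4], the rate of dissipation. Gronwall then gives [lyap <= F0 + 1/2],
    which closes the bootstrap. *)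
Lemma trap (F0 B eta s T : R) : 0 <= F0 -> 0 <= B -> 8 * (F0 + 1) <= B ^+ 2 ->
  eta * trapC B <= expR (- B) / 8 -> s <= T < b ->
  lyap m (Z s) (P s) <= F0 -> (forall t, s <= t <= T -> expR (- y t) <= eta) ->
  forall t, s <= t <= T ->
    lyap m (Z t) (P t) <= F0 * expR (- (expR (- B) / 4) * (t - s)) + eta * trapC B / (expR (- B) / 4)
    /\ [/\ `|Z t| <= B, `|P t| <= B & lyap m (Z t) (P t) <= F0 + 1].
Proof.
move=> F00 B0 BF etaC /andP[sT Tb] Fs ay.
have c0 : 0 < expR (- B) / 4 by rewrite divr_gt0 ?expR_gt0.
have eta0 : 0 <= eta by rewrite (le_trans (expR_ge0 _) (ay s _))// lexx.
have C0 : 0 <= trapC B.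
  have m0 : 0 <= m by rewrite (le_trans _ m1).
  by rewrite mulr_ge0// addr_ge0 ?sqr_ge0// !mulr_ge0// expR_ge0.
pose F t := lyap m (Z t) (P t).
have q : eta * trapC B / (expR (- B) / 4) <= 1 / 2.
  by rewrite ler_pdivrMr//; lra.
have q0 : 0 <= eta * trapC B / (expR (- B) / 4) by apply: divr_ge0; [exact: mulr_ge0|exact: ltW].
have step c : s <= c <= T -> (forall x : R, s <= x <= c -> F x <= F0 + 1) ->
    F c <= F0 * expR (- (expR (- B) / 4) * (c - s)) + eta * trapC B / (expR (- B) / 4).
  move=> /andP[sc cT] Fle.
  have cn0 : - (expR (- B) / 4) != 0 by rewrite oppr_eq0 gt_eqF.
  have tb t : s <= t <= c -> t < b by move=> /andP[_ tc]; rewrite (le_lt_trans tc)// (le_lt_trans cT).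
  have := @gronwall _ F _ (- (expR (- B) / 4)) (eta * trapC B) s c sc cn0 (fun t h => lyap_deriv (tb t h)).
  rewrite invrN mulrN => h.
  have {h} : F c - eta * trapC B / (expR (- B) / 4) <=
     (F s - eta * trapC B / (expR (- B) / 4)) * expR (- (expR (- B) / 4) * (c - s)).
    apply: h => t stc; have [zB pB wB] := lyap_bounds B0 BF (Fle t stc).
    have := lyap_dissipation (P t) zB; rewrite -/(F t).
    have /andP[st tc] := stc.
    have ha : 0 < expR (- y t) <= eta by rewrite expR_gt0 ay// st (le_trans tc).
    have hR := emR_bound zB pB ha.
    have : `|r t * (P t + m * Z t / 2)| <= eta * trapC B.
      rewrite normrM /trapC mulrCA mulrC.
      by rewrite ler_pM// -/(r t).
    rewrite ler_norml => /andP[_]; lra.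
  have e1 := expR_ge0 (- (expR (- B) / 4) * (c - s)).
  have : F s * expR (- (expR (- B) / 4) * (c - s)) <= F0 * expR (- (expR (- B) / 4) * (c - s)).
    by rewrite ler_wpM2r.
  have := mulr_ge0 q0 e1; lra.
have all_lt x : s <= x <= T -> F x < F0 + 1.
  apply: (@first_exit _ F s T (F0 + 1) sT).
  - move=> t /andP[_ tT]; apply: d_cont (lyap_deriv _); exact: le_lt_trans tT Tb.
  - by rewrite (le_lt_trans Fs)// ltrDl.
  move=> c sc /(step c sc)/le_lt_trans; apply.
  have : F0 * expR (- (expR (- B) / 4) * (c - s)) <= F0.
    rewrite ler_piMr// -expR0 ler_expR mulNr oppr_le0 mulr_ge0 ?(ltW c0)// subr_ge0.
    by case/andP: sc.
  lra.
move=> t /[dup] stT /andP[st tT]; split.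
  by apply: step => // x /andP[sx xt]; rewrite ltW// all_lt// sx (le_trans xt).
by have [zB pB _] := lyap_bounds B0 BF (ltW (all_lt t stT)); split=> //; rewrite ltW// all_lt.
Qed.
End emden.

(** * Differences of two solutions in Emden variables *)

Section pair.
Context {R : realType}.
Implicit Types (x y z d e : R).

Lemma wlog_le2 (Q : R -> R -> Prop) : (forall x y, Q x y -> Q y x) ->
  (forall x y, x <= y -> Q x y) -> forall x y, Q x y.
Proof.
move=> sym H x y; have [xy|yx] := leP x y; first exact: H.
by apply: sym; apply: H; exact: ltW.
Qed.

Lemma expN_lip e x y : expR (- x) <= e -> expR (- y) <= e ->
  `|expR (- x) - expR (- y)| <= e * `|x - y|.
Proof.
move: x y; apply: wlog_le2 => [x y H hy hx|x y xy hx hy].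
  by rewrite distrC (distrC y) H.
rewrite ger0_norm ?subr_ge0 ?ler_expR ?lerN2// distrC ger0_norm ?subr_ge0//.
have -> : expR (- y) = expR (- x) * expR (- (y - x)) by rewrite -expRD; congr expR; ring.
have h1 := expR_ge1Dx (- (y - x)).
have h2 := expR_gt0 (- x).
have : expR (- x) * (1 - expR (- (y - x))) <= expR (- x) * (y - x) by rewrite ler_pM2l//; lra.
have : expR (- x) * (y - x) <= e * (y - x) by rewrite ler_wpM2r// subr_ge0.
lra.
Qed.

(** [e^y + y] has slope at least 1, so closeness of the variables [Z] gives back closeness of the
    [y], and with it of the coefficients [e^(-y)] in the remainder. *)
Lemma expDid_lip x y : `|x - y| <= `|expR x + x - (expR y + y)|.
Proof.
move: x y; apply: wlog_le2 => [x y H|x y xy]; first by rewrite distrC (distrC (expR y + y)).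
have h : expR x <= expR y by rewrite ler_expR.
by rewrite distrC ger0_norm ?subr_ge0// distrC ger0_norm; lra.
Qed.

Lemma expR_small d z : 0 <= d <= 1 / 2 -> `|z| <= d -> `|expR z - 1| <= 2 * d.
Proof.
move=> /andP[d0 d1] /[!ler_norml] /andP[z1 z2].
have h1 := expR_ge1Dx z; apply/andP; split; first lra.
have [z0|z0] := leP z 0.
  have : expR z <= 1 by rewrite -expR0 ler_expR.
  lra.
have : expR z * (1 - z) <= 1.
  by rewrite -ler_pdivlMl ?expR_gt0// mulr1 -expRN; have := expR_ge1Dx (- z); lra.
have : 0 <= (1 + 2 * z) * (1 - z) - 1.
  have : 0 <= z * (1 - 2 * z) by rewrite mulr_ge0; lra.
  lra.
move=> h2 h3.
have : expR z * (1 - z) <= (1 + 2 * z) * (1 - z) by lra.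
rewrite ler_pM2r; lra.
Qed.

Lemma exp_lin d x y : 0 <= d <= 1 / 2 -> `|x| <= d -> `|y| <= d ->
  `|expR x - expR y - (x - y)| <= 2 * d * `|x - y|.
Proof.
move=> dd; move: x y; apply: wlog_le2 => [x y H hy hx|x y xy hx hy].
  by rewrite (distrC y x) (_ : expR y - _ - _ = - (expR x - expR y - (x - y))) ?normrN ?H//; ring.
rewrite (distrC x) (ger0_norm (_ : 0 <= y - x)) ?subr_ge0// -normrN.
have -> : - (expR x - expR y - (x - y)) = (expR y - y) - (expR x - x) by ring.
apply: (@lip_of_deriv _ (fun z => expR z - z) (fun z => expR z - 1)) => // z /andP[xz zy].
apply: expR_small => //; rewrite ler_norml; move: hx hy; rewrite !ler_norml => /andP[? ?] /andP[? ?].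
by apply/andP; split; lra.
Qed.

Lemma expR_lip G x y : expR x <= G -> expR y <= G -> `|expR x - expR y| <= G * `|x - y|.
Proof.
move: x y; apply: wlog_le2 => [x y H hy hx|x y xy hx hy].
  by rewrite distrC (distrC y) H.
rewrite (distrC x) (ger0_norm (_ : 0 <= y - x)) ?subr_ge0// distrC.
apply: (@lip_of_deriv _ expR expR) => // z /andP[xz zy].
by rewrite ger0_norm ?expR_ge0// (le_trans _ hy)// ler_expR.
Qed.

Lemma emR_lip (m e G q a1 a2 z1 z2 p1 p2 : R) : 0 < m ->
  expR z1 <= G -> expR z2 <= G -> `|p1| <= q -> `|p2| <= q ->
  0 < a1 <= e -> 0 < a2 <= e -> `|a1 - a2| <= e * `|z1 - z2| ->
  `|emR m a1 z1 p1 - emR m a2 z2 p2| <=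
    e * ((4 * m * G + (q + 2) ^+ 2) * `|z1 - z2| + (2 * q + 4) * `|p1 - p2|).
Proof.
move=> m0 hz1 hz2 hp1 hp2 /andP[a10 a1e] /andP[a20 a2e] ha.
have e0 : 0 < e := lt_le_trans a10 a1e.
have q0 : 0 <= q := le_trans (normr_ge0 _) hp1.
have E1 : `|a1 * expR z1 - a2 * expR z2| <= 2 * G * e * `|z1 - z2|.
  have -> : a1 * expR z1 - a2 * expR z2 = (a1 - a2) * expR z1 + a2 * (expR z1 - expR z2) by ring.
  have b2 := expR_lip hz1 hz2.
  have c1 : `|(a1 - a2) * expR z1| <= (e * `|z1 - z2|) * G.
    by rewrite normrM ler_pM// ger0_norm ?expR_ge0.
  have c2 : `|a2 * (expR z1 - expR z2)| <= e * (G * `|z1 - z2|).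
    by rewrite normrM ler_pM// gtr0_norm.
  by rewrite (le_trans (ler_normD _ _))//; lra.
pose A a : R := a / (1 + a) ^+ 2.
have A_le (a : R) : 0 < a -> 0 <= A a <= a.
  move=> a0; have p : 0 < (1 + a) ^+ 2 by rewrite exprn_gt0// addr_gt0.
  rewrite /A divr_ge0 ?sqr_ge0 ?(ltW a0)//= ler_pdivrMr// ler_peMr// ?(ltW a0)//.
  have := sqr_ge0 a; lra.
have E2 : `|A a1 - A a2| <= `|a1 - a2|.
  have p1' : 0 < 1 + a1 by rewrite addr_gt0.
  have p2' : 0 < 1 + a2 by rewrite addr_gt0.
  have -> : A a1 - A a2 = (a1 - a2) * ((1 - a1 * a2) / ((1 + a1) ^+ 2 * (1 + a2) ^+ 2)).
    by rewrite /A; field; rewrite !gt_eqF.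
  rewrite normrM ler_piMr// normrM normfV (gtr0_norm (mulr_gt0 (exprn_gt0 2 p1') (exprn_gt0 2 p2'))).
  have aa := mulr_gt0 a10 a20.
  rewrite ler_pdivrMr ?mul1r; last by rewrite mulr_gt0// exprn_gt0.
  have -> : (1 + a1) ^+ 2 * (1 + a2) ^+ 2 = (1 + a1 + a2 + a1 * a2) ^+ 2 by ring.
  have h1 : 1 + a1 * a2 <= 1 + a1 + a2 + a1 * a2 by lra.
  have h2 : `|1 - a1 * a2| <= 1 + a1 * a2 by rewrite ler_norml; apply/andP; split; lra.
  by rewrite (le_trans h2)// (le_trans h1)// expr2 ler_peMl; lra.
have E3 : `|A a1 * (p1 - 2) ^+ 2 - A a2 * (p2 - 2) ^+ 2| <=
    (q + 2) ^+ 2 * e * `|z1 - z2| + (2 * q + 4) * e * `|p1 - p2|.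
  have -> : A a1 * (p1 - 2) ^+ 2 - A a2 * (p2 - 2) ^+ 2 =
     (A a1 - A a2) * (p1 - 2) ^+ 2 + A a2 * ((p1 - p2) * (p1 + p2 - 4)) by ring.
  have c1 : `|(A a1 - A a2) * (p1 - 2) ^+ 2| <= (e * `|z1 - z2|) * (q + 2) ^+ 2.
    rewrite normrM ler_pM//; first exact: le_trans E2 ha.
    have h : `|p1 - 2| <= q + 2 by move: hp1; rewrite !ler_norml => /andP[? ?]; sp.
    by rewrite normrX lerXn2r ?nnegrE// addr_ge0.
  have c2 : `|A a2 * ((p1 - p2) * (p1 + p2 - 4))| <= e * (`|p1 - p2| * (2 * q + 4)).
    have /andP[A0 A1] := A_le a2 a20.
    rewrite normrM ler_pM//; first by rewrite ger0_norm// (le_trans A1).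
    rewrite normrM ler_wpM2l//.
    by move: hp1 hp2; rewrite !ler_norml => /andP[? ?] /andP[? ?]; sp.
  by rewrite (le_trans (ler_normD _ _))//; lra.
have -> : emR m a1 z1 p1 - emR m a2 z2 p2 = - (2 * m) * (a1 * expR z1 - a2 * expR z2) +
    (A a1 * (p1 - 2) ^+ 2 - A a2 * (p2 - 2) ^+ 2) by rewrite /emR /A; ring.
rewrite (le_trans (ler_normD _ _))// normrM normrN (gtr0_norm (mulr_gt0 _ m0))//.
have E1' : 2 * m * `|a1 * expR z1 - a2 * expR z2| <= 2 * m * (2 * G * e * `|z1 - z2|).
  by rewrite ler_wpM2l// mulr_ge0// ltW.
move: E1' E3; clear; lra.
Qed.

(** [E] has two sources: the quadratic part of [e^Z], of relative size [4 m d], and the difference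
    of the remainders, of relative size [17 m e]. *)
Lemma pair_perturbed (m b1 b2 : R) (y1 dy1 y2 dy2 : R -> R) (a b d e : R) :
  1 <= m -> log_sol m b1 y1 dy1 -> log_sol m b2 y2 dy2 -> b < b1 -> b < b2 ->
  0 <= d <= 1 / 2 -> 4 * m * d + 17 * m * e <= 1 / 8 ->
  (forall t, a <= t <= b -> [/\ `|emZ m y1 t| <= d, `|emP y1 dy1 t| <= 1 & expR (- y1 t) <= e]) ->
  (forall t, a <= t <= b -> [/\ `|emZ m y2 t| <= d, `|emP y2 dy2 t| <= 1 & expR (- y2 t) <= e]) ->
  exists E, perturbed m a b (fun t => emZ m y1 t - emZ m y2 t) (fun t => emP y1 dy1 t - emP y2 dy2 t) E.
Proof.
move=> m1 s1 s2 bb1 bb2 dd de H1 H2.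
have m0 : 0 < m by rewrite (lt_le_trans _ m1).
pose Z1 := emZ m y1; pose Z2 := emZ m y2; pose P1 := emP y1 dy1; pose P2 := emP y2 dy2.
pose r1 t := emR m (expR (- y1 t)) (Z1 t) (P1 t); pose r2 t := emR m (expR (- y2 t)) (Z2 t) (P2 t).
exists (fun t => - 2 * m * (expR (Z1 t) - expR (Z2 t) - (Z1 t - Z2 t)) + (r1 t - r2 t)) => t /[dup] tab /andP[_ tb].
have t1 := le_lt_trans tb bb1; have t2 := le_lt_trans tb bb2.
have [z1 p1 e1] := H1 t tab; have [z2 p2 e2] := H2 t tab.
rewrite -/(Z1 t) -/(Z2 t) -/(P1 t) -/(P2 t) in z1 p1 z2 p2 *.
have hZ1 : is_derive t 1 Z1 (P1 t) := emZ_deriv s1 t1.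
have hZ2 : is_derive t 1 Z2 (P2 t) := emZ_deriv s2 t2.
have hP1 := emP_deriv m1 s1 t1; have hP2 := emP_deriv m1 s2 t2.
rewrite -/(Z1 t) -/(Z2 t) -/(P1 t) -/(P2 t) -/(r1 t) -/(r2 t) -/P1 -/P2 in hP1 hP2.
have d1 : d <= 1 / 2 by case/andP: dd.
have hh : 0 <= (1 / 2 : R) <= 1 / 2 by rewrite lexx divr_ge0.
split.
- by rewrite -/Z1 -/Z2; dtac.
- by rewrite -/P1 -/P2; dtac; ring.
rewrite -/(Z1 t) -/(Z2 t) -/(P1 t) -/(P2 t).
have L1 := exp_lin dd z1 z2.
have ha : `|expR (- y1 t) - expR (- y2 t)| <= e * `|Z1 t - Z2 t|.
  apply: (le_trans (expN_lip e1 e2)); rewrite ler_wpM2l//; first exact: le_trans (expR_ge0 _) e1.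
  by apply: (le_trans (expDid_lip _ _)); rewrite /Z1 /Z2 /emZ le_eqVlt; apply/orP; left; apply/eqP; congr `|_|; ring.
(* With [G = 2] and [q = 1], the constants of [emR_lip] are [8 m + 9] and [6], both at most
   [17 m]. *)
have L2 : `|r1 t - r2 t| <= 17 * m * e * (`|Z1 t - Z2 t| + `|P1 t - P2 t|).
  have E2 z : `|z| <= d -> expR z <= 2.
    by move=> /(le_trans)/(_ d1)/(expR_small hh); rewrite ler_norml => /andP[_]; lra.
  have h := @emR_lip m e 2 1 _ _ _ _ _ _ m0 (E2 _ z1) (E2 _ z2) p1 p2 (_ : 0 < _ <= e) (_ : 0 < _ <= e) ha.
  rewrite !expR_gt0 in h; apply: (le_trans (h e1 e2)).
  have e0 : 0 <= e := le_trans (expR_ge0 _) e1.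
  have f1 : e * `|Z1 t - Z2 t| <= m * (e * `|Z1 t - Z2 t|) by rewrite ler_peMl// mulr_ge0.
  have f2 : e * `|P1 t - P2 t| <= m * (e * `|P1 t - P2 t|) by rewrite ler_peMl// mulr_ge0.
  have f3 : 0 <= e * `|P1 t - P2 t| by rewrite mulr_ge0.
  lra.
rewrite (le_trans (ler_normD _ _))// normrM mulNr normrN (gtr0_norm (mulr_gt0 _ m0))//.
have L1' : 2 * m * `|expR (Z1 t) - expR (Z2 t) - (Z1 t - Z2 t)| <= 2 * m * (2 * d * `|Z1 t - Z2 t|).
  by rewrite ler_wpM2l// mulr_ge0// ltW.
have : (4 * m * d + 17 * m * e) * (`|Z1 t - Z2 t| + `|P1 t - P2 t|) <=
       1 / 8 * (`|Z1 t - Z2 t| + `|P1 t - P2 t|) by rewrite ler_wpM2r// addr_ge0.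
have : 0 <= m * d * `|P1 t - P2 t| by rewrite !mulr_ge0 ?(ltW m0)//; case/andP: dd.
lra.
Qed.
End pair.


(** The bounds are those of [regular_dU] in the variable [t]; as [t] tends to [-oo] they encode
    [u(0) = rho] and regularity at the origin. *)
Definition reg_sol {R : realType} (n : nat) (rho b : R) (y dy : R -> R) :=
  log_sol (n%:R - 2) b y dy /\ forall t : R, t < b ->
    - (expR (2 * t) * expexp rho / n%:R) <= dy t /\
    rho - expR (2 * t) * expexp rho / (2 * n%:R) <= y t <= rho.

(** All that is kept of the prescribed expansions: convergence to the equilibrium [(Z, P) = (0, 0)]
    and [y -> +oo] as [t -> -oo]. *)
Definition sing_sol {R : realType} (m b : R) (y dy : R -> R) :=
  log_sol m b y dy /\ forall d : R, 0 < d -> exists2 T, T < b &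
    forall t : R, t <= T -> [/\ `|emZ m y t| <= d, `|emP y dy t| <= d & expR (- y t) <= d].

(* the scale at which the regular solution with maximum [rho] starts to bend:
   [expR (2 * inner rho) * expR rho * expexp rho = 1] *)
Definition inner {R : realType} (rho : R) : R := - (expR rho + rho) / 2.

(** * Entry of the regular solutions into a neighbourhood of the equilibrium *)

Section settle.
Context {R : realType} (n : nat).
Hypothesis n3 : (3 <= n)%N.
Let m : R := n%:R - 2.

Lemma m_ge1 : 1 <= m.
Proof.
have : 3 <= n%:R :> R by rewrite ler_nat.
by rewrite /m; qlra.
Qed.

Lemma inner_exp (rho : R) : expR (2 * inner rho) * expexp rho = expR (- rho).
Proof. by rewrite /expexp -expRD /inner; congr expR; field. Qed.

Lemma lim_at_end (b : R) (y dy : R -> R) (c s : R) : log_sol m b y dy -> s < b -> 0 < c ->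
  exists2 t, s < t < b & y t < c.
Proof.
move=> [_ _ _ yb] sb c0.
have [/= d d0 hd] := cvgr_lt _ yb _ c0.
pose t := Num.max ((s + b) / 2) (b - d / 2).
have tb : t < b by rewrite gt_max; apply/andP; split; qlra.
exists t; first by rewrite tb andbT lt_max; apply/orP; left; qlra.
apply: hd => //=; rewrite ger0_norm ?subr_ge0 ?ltW//.
have : b - d / 2 <= t by rewrite le_max lexx orbT.
by qlra.
Qed.

(** At this time [y] is within [e^(-rho) / (2 n)] of [rho], an error that [e^y] magnifies by
    [e^rho], hence to order one. So [(Z, P)] lies in a compact set independent of [rho], with [Z]
    below the equilibrium by at least [ln (2 m)]. *)
Lemma reg_start (rho b : R) (y dy : R -> R) : 1 <= rho -> reg_sol n rho b y dy ->
  [/\ inner rho < b, - 1 - ln (2 * m) <= emZ m y (inner rho) <= - ln (2 * m),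
      1 <= emP y dy (inner rho) <= 2 & rho - 1 / 2 <= y (inner rho)].
Proof.
move=> rho1 [sol H].
have n0 : 3 <= n%:R :> R by rewrite ler_nat.
have er0 := expR_gt0 (- rho).
have er1 : expR (- rho) <= 1 by rewrite -expR0 ler_expR; qlra.
have kn : expR (- rho) / (2 * n%:R) <= expR (- rho) / 6.
  by rewrite ler_pM2l// lef_pV2 ?posrE; qlra.
have sb : inner rho < b.
  rewrite ltNge; apply/negP => bs.
  have [||t /andP[_ tb] yt] := @lim_at_end b y dy (1 / 2) (b - 1) sol; [qlra|qlra|].
  have [_ /andP[h _]] := H t tb.
  have : expR (2 * t) * expexp rho / (2 * n%:R) <= expR (- rho) / (2 * n%:R).
    rewrite ler_wpM2r ?invr_ge0//.
    by rewrite -inner_exp ler_wpM2r ?(ltW (expexp_gt0 _))// ler_expR; qlra.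
  by qlra.
have [h1 /andP[h2 h3]] := H _ sb.
rewrite inner_exp in h1 h2; set s := inner rho in sb h1 h2 h3 *.
have ee : expR rho * expR (- rho) = 1 by rewrite -expRD subrr expR0.
have ey : expR (y s) <= expR rho by rewrite ler_expR.
have ey2 : expR rho - 1 / 6 <= expR (y s).
  have : expR rho * (1 + (y s - rho)) <= expR (y s).
    have -> : expR (y s) = expR rho * expR (y s - rho) by rewrite -expRD; congr expR; ring.
    by rewrite ler_wpM2l ?expR_ge0// expR_ge1Dx.
  have : expR rho * (rho - y s) <= expR rho * (expR (- rho) / 6).
    by rewrite ler_wpM2l ?expR_ge0//; qlra.
  by rewrite mulrA ee; qlra.
split => //.
- by rewrite /emZ (_ : 2 * s = - (expR rho + rho)); [apply/andP; split; qlra|rewrite /s /inner; field].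
- have [_ dy0] : 0 < y s /\ dy s < 0 by case: sol => _ _ h _; exact: h.
  have e0 : 0 < expR (y s) + 1 by rewrite addr_gt0// expR_gt0.
  rewrite /emP; apply/andP; split; last by have := mulr_gt0 e0 (_ : 0 < - dy s); rewrite oppr_gt0 => /(_ dy0); qlra.
  have kn3 : expR (- rho) / n%:R <= expR (- rho) / 3.
    by rewrite ler_pM2l// lef_pV2 ?posrE; qlra.
  have h4 : - dy s <= expR (- rho) / 3 by qlra.
  have : (expR (y s) + 1) * (- dy s) <= (expR rho + 1) * (expR (- rho) / 3).
    rewrite ler_pM ?lerD2r ?oppr_ge0 ?(ltW e0) ?(ltW dy0)//.
  have -> : (expR rho + 1) * (expR (- rho) / 3) = (1 + expR (- rho)) / 3.
    by rewrite mulrA mulrDl ee mul1r.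
  by qlra.
- by qlra.
Qed.

(** [F0] bounds [lyap] on the range given by [reg_start], and [B] is large enough for the condition
    [8 (F0 + 1) <= B^2] of [trap]. *)
Let k : R := 1 + ln (2 * m).
Let F0 : R := (2 + m * k) ^+ 2 + m ^+ 2 * k ^+ 2 + 2 * m * k.
Let B : R := 8 * (F0 + 1).

Lemma ln2m_ge : 1 / 2 <= ln (2 * m).
Proof.
have m1 := m_ge1.
rewrite -[1/2]expRK ler_ln ?posrE ?expR_gt0//; last by qlra.
have : expR (1 / 2 : R) * (1 - 1 / 2) <= 1.
  rewrite -ler_pdivlMl ?expR_gt0// mulr1 -expRN.
  by have := expR_ge1Dx (- (1 / 2) : R); qlra.
by qlra.
Qed.

Lemma start_lyap (rho b : R) (y dy : R -> R) : 1 <= rho -> reg_sol n rho b y dy ->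
  lyap m (emZ m y (inner rho)) (emP y dy (inner rho)) <= F0.
Proof.
move=> rho1 H; have [_ z p _] := reg_start rho1 H; move: z p.
move: (emZ _ _ _) (emP _ _ _) => z p /andP[z1 z2] /andP[p1 p2].
have m1 := m_ge1; have l2 := ln2m_ge.
have k0 : 0 <= k by rewrite /k; qlra.
have zk : `|z| <= k by rewrite ler_norml /k; apply/andP; split; qlra.
have mk : 0 <= m * k by rewrite mulr_ge0//; qlra.
have s1 : (p + m * z / 2) ^+ 2 <= (2 + m * k) ^+ 2.
  rewrite -(real_normK (num_real (p + _))) ler_sqr ?nnegrE ?addr_ge0//.
  rewrite (le_trans (ler_normD _ _))// lerD//; first by rewrite ger0_norm; qlra.
  rewrite !normrM (ger0_norm (_ : 0 <= m)) ?(ger0_norm (_ : 0 <= 2^-1)) ?invr_ge0//; last by qlra.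
  have : m * `|z| <= m * k by rewrite ler_wpM2l//; qlra.
  have : 0 <= m * `|z| by rewrite mulr_ge0//; qlra.
  by qlra.
have s2 : m ^+ 2 * z ^+ 2 <= m ^+ 2 * k ^+ 2.
  by rewrite ler_wpM2l ?sqr_ge0// -(real_normK (num_real z)) ler_sqr ?nnegrE.
have s3 : 2 * m * (expR z - 1 - z) <= 2 * m * k.
  have ez : expR z <= 1 by rewrite -expR0 ler_expR; qlra.
  by rewrite ler_wpM2l//; [qlra|rewrite /k; qlra].
have := sqr_ge0 (m * k); have := sqr_ge0 (2 + m * k).
by rewrite /lyap /F0; qlra.
Qed.

Lemma F0_ge0 : 0 <= F0.
Proof.
have m1 := m_ge1; have l2 := ln2m_ge.
have k0 : 0 <= k by rewrite /k; qlra.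
have mk : 0 <= m * k by rewrite mulr_ge0//; qlra.
by rewrite /F0; have := sqr_ge0 (2 + m * k); have := sqr_ge0 (m * k); qlra.
Qed.

(* The Lyapunov function of the autonomous equation dissipates from the scale
   [inner rho] on, as long as [expR (- y)] stays small. *)
Lemma settle : exists B : R, 0 <= B /\ forall d : R, 0 < d <= 1 / 2 -> exists X T0 : R, 0 <= X /\
  forall T, T <= T0 -> exists2 rho1, 1 <= rho1 & forall rho b y dy, rho1 <= rho ->
    reg_sol n rho b y dy ->
    [/\ T < b, inner rho + X <= T,
       forall t, inner rho <= t <= T -> [/\ `|emZ m y t| <= B, `|emP y dy t| <= B & expR (- y t) <= d] &
       forall t, inner rho + X <= t <= T -> `|emZ m y t| <= d /\ `|emP y dy t| <= d].
Proof.
have m1 := m_ge1; have F00 := F0_ge0.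
have B0 : 0 <= B by rewrite /B mulr_ge0// addr_ge0.
have BF : 8 * (F0 + 1) <= B ^+ 2.
  by rewrite -/B expr2 ler_peMr// /B; qlra.
exists B; split => // d /andP[d0 d12].
pose c : R := expR (- B) / 4.
have c0 : 0 < c by rewrite divr_gt0 ?expR_gt0.
(* The level of [lyap] below which [lyap_bounds] gives [|Z|, |P| <= d]. Half of it is left to the
   remainder, by the choice of [eta], and half to the decaying initial value, by the choice of
   [X]. *)
pose K : R := d ^+ 2 / 8.
have K0 : 0 < K by rewrite divr_gt0 ?exprn_gt0.
have K1 : K <= 1.
  rewrite /K; have : d ^+ 2 <= 1 by rewrite expr_le1//; qlra.
  by qlra.
have C0 : 0 <= trapC m B by rewrite /trapC mulr_ge0// addr_ge0 ?sqr_ge0// !mulr_ge0 ?expR_ge0//; qlra.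
pose eta := Num.min d (c * K / (2 * (trapC m B + 1))).
have C1 : 0 < 2 * (trapC m B + 1) by qlra.
have eta0 : 0 < eta by rewrite lt_min d0/= divr_gt0// mulr_gt0.
have etad : eta <= d by rewrite ge_min lexx.
have etaC : eta * trapC m B / c <= K / 2.
  have : eta <= c * K / (2 * (trapC m B + 1)) by rewrite ge_min lexx orbT.
  rewrite ler_pdivlMr// => h; rewrite ler_pdivrMr//.
  have := mulr_ge0 (ltW eta0) C0; qlra.
have etaB : eta * trapC m B <= expR (- B) / 8.
  move: etaC; rewrite ler_pdivrMr//; have : K * c <= c by rewrite ler_piMl// ltW.
  by rewrite /c; qlra.
pose Y0 := - ln eta.
have eY : expR (- Y0) = eta by rewrite opprK lnK.
have Y00 : 0 < Y0.
  by rewrite /Y0 oppr_gt0 -ln1 ltr_ln ?posrE//; qlra.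
(* From [e^(- c X) <= 1 / (1 + c X)] one gets [F0 e^(- c X) <= K / 2]. *)
pose X := 2 * F0 / (c * K).
have X0 : 0 <= X by rewrite divr_ge0 ?mulr_ge0// ?ltW.
exists X, ((ln (2 * m) - B - expR Y0 - Y0) / 2 - 1); split => // T TT0.
exists (1 + Y0 + 2 * `|T| + 2 * X); first by have := normr_ge0 T; qlra.
move=> rho b y dy hrho H.
have rho1 : 1 <= rho by have := normr_ge0 T; qlra.
have [sb _ _ ys] := reg_start rho1 H.
have Fs := start_lyap rho1 H.
have sol : log_sol m b y dy by case: H.
have sX : inner rho + X <= T.
  rewrite /inner; have := expR_ge0 rho; have := ler_norm (- T); rewrite normrN; qlra.
have sT : inner rho <= T by qlra.
(* If [y] came down to [Y0] at time [z], the bound [Z >= - B] would read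
   [2 z >= ln (2 m) - B - e^Y0 - Y0], that is [z >= T0 + 1]. So [e^(-y)] stays below [eta] up to
   [T], and [trap] applies on the whole interval. *)
have T_bound z : inner rho <= z <= T -> z < b -> (forall t, inner rho <= t <= z -> Y0 <= y t) -> y z != Y0.
  move=> /andP[sz zT] zb hy; apply/negP => /eqP yz.
  have ha t : inner rho <= t <= z -> expR (- y t) <= eta by move=> /hy ?; rewrite -eY ler_expR lerN2.
  have szb : inner rho <= z < b by rewrite sz.
  have szz : inner rho <= z <= z by rewrite sz lexx.
  have [_ [+ _ _]] := trap m1 sol F00 B0 BF etaB szb Fs ha szz.
  rewrite ler_norml => /andP[+ _]; rewrite /emZ yz; qlra.
have yY t : inner rho <= t <= T -> t < b -> Y0 < y t.
  move=> /andP[st tT] tb; rewrite ltNge; apply/negP => yt.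
  have st' : inner rho < t.
    rewrite lt_neqAle st andbT; apply/negP => /eqP e; move: yt; rewrite -e; have := normr_ge0 T; qlra.
  have [|||z [/andP[sz zt] yz pos]] := @first_zero _ (fun t => y t - Y0) _ _ st'.
  - move=> x /andP[_ xt]; apply: (@d_cont _ _ _ (dy x)); case: sol => h _ _ _.
    by have hx := h x (le_lt_trans xt tb); dtac; ring.
  - by rewrite subr_gt0; have := normr_ge0 T; qlra.
  - by rewrite subr_le0.
  have := T_bound z; rewrite (ltW sz) (le_trans zt tT) (le_lt_trans zt tb) => /(_ isT isT).
  move: yz => /eqP; rewrite subr_eq0 => yz; rewrite yz => /(_ _)/negP; apply => // x /andP[sx xz].
  have [->|xz'] := eqVneq x z; first by rewrite (eqP yz).
  by have := pos x; rewrite sx lt_neqAle xz' xz subr_gt0 => /(_ isT)/ltW.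
have Tb : T < b.
  rewrite ltNge; apply/negP => bT.
  have [t /andP[st tb] yt] := lim_at_end sol sb Y00.
  by have := yY t; rewrite (ltW st) (le_trans (ltW tb) bT) tb => /(_ isT isT); rewrite ltNge (ltW yt).
have ha t : inner rho <= t <= T -> expR (- y t) <= eta.
  move=> /[dup] stT /andP[_ tT]; rewrite -eY ler_expR lerN2 ltW// yY//; exact: le_lt_trans tT Tb.
have sTb : inner rho <= T < b by rewrite sT.
have TR := trap m1 sol F00 B0 BF etaB sTb Fs ha.
split => //.
  move=> t stT; have [_ [? ? _]] := TR t stT; split => //.
  exact: le_trans (ha t stT) etad.
move=> t /andP[sXt tT].
have stT : inner rho <= t <= T by rewrite tT andbT; qlra.
have [h _] := TR t stT; rewrite -/c in h.
have e1 : F0 * expR (- c * (t - inner rho)) <= K / 2.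
  have h1 : X <= t - inner rho by qlra.
  have h2 : c * X <= c * (t - inner rho) by rewrite ler_pM2l.
  have h3 : expR (- c * (t - inner rho)) * (1 + c * X) <= 1.
    rewrite -ler_pdivlMl ?expR_gt0// mulr1 -expRN mulNr opprK.
    by have := expR_ge1Dx (c * (t - inner rho)); qlra.
  have h4 : c * X * K = 2 * F0 by rewrite /X; field; rewrite !gt_eqF.
  set E := expR _ in h3 *.
  have E0 : 0 <= E := expR_ge0 _.
  have h5 : E * (c * X) <= 1 by qlra.
  have : E * (c * X) * K <= 1 * K by rewrite ler_pM2r.
  by rewrite -(mulrA E) h4; qlra.
have hK : lyap m (emZ m y t) (emP y dy t) <= K by qlra.
by have [] := @lyap_bounds _ m m1 K d _ _ (ltW d0) (_ : 8 * K <= d ^+ 2) hK; rewrite /K; [qlra|].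
Qed.
End settle.

(** * Continuous dependence and quantitative uniqueness in the original variables *)

Section two_solutions.
Context {R : realType}.
Implicit Types (m b s t Y L : R) (y dy : R -> R).

Lemma log_sol_decr m b y dy s t : log_sol m b y dy -> s <= t -> t < b -> y t <= y s.
Proof.
move=> [h1 _ h3 _] st tb; apply: (@le_of_deriv_le0 _ y dy _ _ st) => x /andP[sx xt].
  by apply: h1; exact: le_lt_trans tb.
by have [_ /ltW] := h3 x (le_lt_trans xt tb).
Qed.

Lemma log_sol_pos m b y dy t : log_sol m b y dy -> t < b -> 0 < y t.
Proof. by move=> [_ _ h3 _] tb; have [] := h3 t tb. Qed.

Lemma expexp_lip Y x z : x <= Y -> z <= Y ->
  `|expexp x - expexp z| <= expR Y * expexp Y * `|x - z|.
Proof.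
move: x z; apply: wlog_le2 => [x z H hz hx|x z xz hx hz].
  by rewrite distrC (distrC z) H.
rewrite (distrC x) (ger0_norm (_ : 0 <= z - x)) ?subr_ge0// distrC.
apply: (@lip_of_deriv _ expexp (fun x => expR x * expexp x) _ _ _ xz) => w /andP[xw wz].
  by rewrite /expexp; dtac; ring.
by rewrite ger0_norm ?mulr_ge0 ?expR_ge0// ler_pM ?expR_ge0 ?expexp_le ?ler_expR// (le_trans wz).
Qed.

Definition dist2 (y1 dy1 y2 dy2 : R -> R) t : R := (y1 t - y2 t) ^+ 2 + (dy1 t - dy2 t) ^+ 2.

(** For the range up to the right end, where [e^(-y)] is not small and the Emden variables give
    nothing. The upper bound is continuous dependence, the lower one quantitative uniqueness; both
    follow from the logarithmic derivative of the distance being bounded. *)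
Lemma dist2_growth m b1 b2 y1 dy1 y2 dy2 s t Y La K : 0 <= m ->
  log_sol m b1 y1 dy1 -> log_sol m b2 y2 dy2 -> s <= t -> t < b1 -> t < b2 ->
  y1 s <= Y -> y2 s <= Y -> expR (2 * t) <= La -> K = 1 + 2 * m + La * (expR Y * expexp Y) ->
  dist2 y1 dy1 y2 dy2 s * expR (- K * (t - s)) <= dist2 y1 dy1 y2 dy2 t /\
  dist2 y1 dy1 y2 dy2 t <= dist2 y1 dy1 y2 dy2 s * expR (K * (t - s)).
Proof.
move=> m0 s1 s2 st tb1 tb2 Y1 Y2 hLa KE.
have [h11 h12 _ _] := s1; have [h21 h22 _ _] := s2.
pose L := expR Y * expexp Y.
have L0 : 0 <= L by rewrite mulr_ge0 ?expR_ge0.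
have La0 : 0 <= La := le_trans (expR_ge0 _) hLa.
have K0 : 0 < K by rewrite KE -/L; have := mulr_ge0 La0 L0; qlra.
pose nu x := 2 * (y1 x - y2 x) * (dy1 x - dy2 x) + 2 * (dy1 x - dy2 x) *
  (- m * (dy1 x - dy2 x) - expR (2 * x) * (expexp (y1 x) - expexp (y2 x))).
have hd x : s <= x <= t -> is_derive x 1 (dist2 y1 dy1 y2 dy2) (nu x).
  move=> /andP[sx xt]; have x1 := le_lt_trans xt tb1; have x2 := le_lt_trans xt tb2.
  have d11 := h11 x x1; have d12 := h12 x x1; have d21 := h21 x x2; have d22 := h22 x x2.
  by rewrite /dist2 /nu; dtac; ring.
have hN x : s <= x <= t -> `|nu x| <= K * dist2 y1 dy1 y2 dy2 x.
  move=> /andP[sx xt]; have x1 := le_lt_trans xt tb1; have x2 := le_lt_trans xt tb2.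
  have yY1 : y1 x <= Y := le_trans (log_sol_decr s1 sx x1) Y1.
  have yY2 : y2 x <= Y := le_trans (log_sol_decr s2 sx x2) Y2.
  have hL := expexp_lip yY1 yY2; rewrite -/L in hL.
  rewrite /nu /dist2; set a := y1 x - y2 x in hL *; set d := dy1 x - dy2 x.
  have e1 : `|expR (2 * x) * (expexp (y1 x) - expexp (y2 x))| <= La * L * `|a|.
    rewrite normrM ger0_norm ?expR_ge0// -mulrA ler_pM ?expR_ge0//.
    by apply: le_trans hLa; rewrite ler_expR; qlra.
  have e2 : 2 * `|a| * `|d| <= a ^+ 2 + d ^+ 2.
    rewrite -(real_normK (num_real a)) -(real_normK (num_real d)).
    by have := sqr_ge0 (`|a| - `|d|); qlra.
  apply: (le_trans (ler_normD _ _)).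
  have -> : `|2 * a * d| = 2 * `|a| * `|d| by rewrite !normrM ger0_norm.
  rewrite normrM (_ : `|2 * d| = 2 * `|d|) ?normrM ?(ger0_norm (_ : 0 <= 2))//.
  have e3 : `|- m * d - expR (2 * x) * (expexp (y1 x) - expexp (y2 x))| <= m * `|d| + La * L * `|a|.
    rewrite (le_trans (ler_normB _ _))// lerD//.
    by rewrite normrM normrN (ger0_norm m0).
  have e4 := ler_wpM2l (_ : 0 <= 2 * `|d|) e3.
  have {}e4 := e4 (mulr_ge0 _ _); rewrite ler0n normr_ge0 in e4; have {}e4 := e4 isT isT.
  have e5 : La * L * (2 * `|a| * `|d|) <= La * L * (a ^+ 2 + d ^+ 2) by rewrite ler_wpM2l// mulr_ge0.
  have e6 : 0 <= m * a ^+ 2 by rewrite mulr_ge0 ?sqr_ge0.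
  have e7 : `|d| * `|d| = d ^+ 2 by rewrite -expr2 real_normK// num_real.
  have e8 : 2 * `|d| * (m * `|d| + La * L * `|a|) = 2 * m * d ^+ 2 + La * L * (2 * `|a| * `|d|).
    by rewrite -e7; ring.
  by rewrite e8 in e4; rewrite KE -/L; qlra.
split.
  have := @gronwall _ (fun x => - dist2 y1 dy1 y2 dy2 x) _ (- K) 0 s t st _ (fun x h => dN (hd x h)).
  rewrite mul0r !addr0 mulNr lerN2; apply; first by rewrite oppr_eq0 gt_eqF.
  by move=> x /hN; rewrite ler_norml => /andP[+ _]; qlra.
have := @gronwall _ (fun x => dist2 y1 dy1 y2 dy2 x) _ K 0 s t st _ hd.
rewrite mul0r !addr0; apply; first by rewrite gt_eqF.
by move=> x /hN; rewrite ler_norml => /andP[_]; qlra.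
Qed.
End two_solutions.

Lemma norm_diff_le {R : realType} (a b d : R) : `|a| <= d -> `|b| <= d -> `|a - b| <= 2 * d.
Proof. by move=> ha hb; rewrite (le_trans (ler_normB _ _))//; lra. Qed.

Lemma sqr_ge_sixteenth {R : realType} (x : R) : x <= - (1 / 4) -> 1 / 16 <= x ^+ 2.
Proof.
move=> h; have : 0 <= (- x - 1 / 4) * (- x + 1 / 4) by apply: mulr_ge0; lra.
lra.
Qed.

Lemma lipschitz_dist2 {R : realType} (m G q e a s E r : R) : 0 < m -> 0 < G -> 0 <= q -> 0 < e ->
  e <= 1 -> `|E| <= G * `|a| ->
  `|r| <= e * ((4 * m * G + (q + 2) ^+ 2) * `|a| + (2 * q + 4) * `|s|) ->
  `|2 * a * s + 2 * s * (- m * s - 2 * m * E + r)| <=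
    (2 + 2 * m + 6 * m * G + (q + 2) ^+ 2 + 4 * q + 8) * (a ^+ 2 + s ^+ 2).
Proof.
move=> m0 G0 q0 e0 e1 E1 E2.
pose W := (q + 2) ^+ 2; have W0 : 0 <= W by exact: sqr_ge0.
rewrite -/W in E2 *.
have mG : 0 < m * G by exact: mulr_gt0.
have q1 : 0 <= (4 * m * G + W) * `|a| + (2 * q + 4) * `|s|.
  by rewrite addr_ge0// mulr_ge0//; move: mG W0 q0; clear; lra.
have {}E2 : `|r| <= (4 * m * G + W) * `|a| + (2 * q + 4) * `|s|.
  by apply: (le_trans E2); rewrite ler_piMl.
have E3 : `|- m * s - 2 * m * E + r| <= (m + 2 * q + 4) * `|s| + (6 * m * G + W) * `|a|.
  apply: (le_trans (ler_normD _ _)); have := ler_normB (- m * s) (2 * m * E).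
  rewrite !normrM normrN (gtr0_norm m0) (ger0_norm (_ : 0 <= 2))//.
  have := ler_wpM2l (ltW m0) E1; move: E2; clear; lra.
have e2 : 2 * `|a| * `|s| <= a ^+ 2 + s ^+ 2.
  rewrite -(real_normK (num_real a)) -(real_normK (num_real s)).
  by have := sqr_ge0 (`|a| - `|s|); clear; lra.
have E4 : `|2 * a * s + 2 * s * (- m * s - 2 * m * E + r)| <=
    2 * `|a| * `|s| + 2 * `|s| * ((m + 2 * q + 4) * `|s| + (6 * m * G + W) * `|a|).
  rewrite (le_trans (ler_normD _ _))// lerD//; first by rewrite !normrM (ger0_norm (_ : 0 <= 2)).
  by rewrite normrM normrM (ger0_norm (_ : 0 <= 2))// ler_wpM2l// mulr_ge0.
apply: (le_trans E4).
have e7 : `|s| * `|s| = s ^+ 2 by rewrite -expr2 real_normK// num_real.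
have -> : 2 * `|s| * ((m + 2 * q + 4) * `|s| + (6 * m * G + W) * `|a|) =
   2 * (m + 2 * q + 4) * s ^+ 2 + (6 * m * G + W) * (2 * `|a| * `|s|).
  by rewrite -e7; ring.
have e5 : (6 * m * G + W) * (2 * `|a| * `|s|) <= (6 * m * G + W) * (a ^+ 2 + s ^+ 2).
  by rewrite ler_wpM2l//; move: mG W0; clear; lra.
have e6 : 0 <= (2 * (m + 2 * q + 4)) * a ^+ 2.
  by rewrite mulr_ge0 ?sqr_ge0//; move: m0 q0; clear; lra.
have := sqr_ge0 a; have := sqr_ge0 s; move: e2 e5 e6; clear; lra.
Qed.

Section link.
Context {R : realType} (n : nat) (bS : R) (yS dyS : R -> R).
Hypothesis n3 : (3 <= n)%N.
Let m : R := n%:R - 2.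
Hypothesis singS : sing_sol m bS yS dyS.

Let D (y : R -> R) t := emZ m y t - emZ m yS t.
Let S (y dy : R -> R) t := emP y dy t - emP yS dyS t.

Lemma D_sgn (y : R -> R) t : (0 < D y t -> yS t < y t) /\ (D y t < 0 -> y t < yS t).
Proof.
have -> : D y t = expR (y t) + y t - (expR (yS t) + yS t) by rewrite /D /emZ; ring.
split=> h; rewrite ltNge; apply/negP => h'.
  have : expR (y t) <= expR (yS t) by rewrite ler_expR.
  by qlra.
have : expR (yS t) <= expR (y t) by rewrite ler_expR.
by qlra.
Qed.

(** At [inner rho] the regular [Z] is at most [-1/2], while the singular one is nearly 0. During the
    bounded time [X] this gap shrinks by a factor independent of [rho], so the linear regime begins
    with an energy of at least [e0], whatever the value of [rho]. *)
Lemma link : exists X T0 e0 : R, [/\ 0 <= X, T0 < bS, 0 < e0 & forall T, T <= T0 ->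
  exists2 rho1, 1 <= rho1 & forall rho b y dy, rho1 <= rho -> reg_sol n rho b y dy ->
    [/\ T < b, inner rho + X <= T, exists E, perturbed m (inner rho + X) T (D y) (S y dy) E,
       forall t, inner rho + X <= t <= T -> energy m (D y) (S y dy) t <= 1 &
       e0 <= energy m (D y) (S y dy) (inner rho + X)]].
Proof.
have m1 : 1 <= m := m_ge1 n3.
have m0 : 0 < m by qlra.
(* With [e = d] in [pair_perturbed], the condition is [21 m d <= 1/8], an equality here. *)
pose d : R := (168 * m)^-1.
have d0 : 0 < d by rewrite invr_gt0 mulr_gt0.
have md : m * d = 1 / 168 by rewrite /d; field; rewrite gt_eqF.
have d1 : d <= 1 / 168 by rewrite -md ler_peMl// ltW.
have d2 : 2 * d <= 1 / 84 by lra.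
have [B [B0 /(_ d)[|X [T1 [X0 HT]]]]] := settle (R := R) n3; first by apply/andP; split; qlra.
have [solS /(_ d d0)[T2 T2b HS]] := singS.
pose B' := B + 1.
pose G := expR B'.
have G0 : 0 < G := expR_gt0 _.
pose K := 2 + 2 * m + 6 * m * G + (B' + 2) ^+ 2 + 4 * B' + 8.
have B'0 : 0 <= B' by rewrite /B'; lra.
have d11 : d <= 1 by lra.
have BB' : B <= B' by rewrite lerDl.
have dB' : d <= B' by rewrite /B'; lra.
have K0 : 0 < K.
  rewrite /K; have := sqr_ge0 (B' + 2); have := mulr_gt0 m0 G0; rewrite /B'; qlra.
(* The squared gap is at least [1/16] at [inner rho], and [D^2 + S^2] is at most 9 times the
   energy. *)
exists X, (Num.min T1 T2), (expR (- K * X) / 144).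
have T0b : Num.min T1 T2 < bS by rewrite gt_min T2b orbT.
have e00 : 0 < expR (- K * X) / 144 by rewrite divr_gt0 ?expR_gt0.
split=> // T; rewrite le_min => /andP[TT1 TT2].
have [rho1 rho11 H] := HT T TT1.
exists rho1 => // rho b y dy hrho reg.
have [Tb sX h1 h2] := H rho b y dy hrho reg.
have TbS : T < bS := le_lt_trans TT2 T2b.
have sol : log_sol m b y dy by case: reg.
have sT : inner rho <= T by qlra.
have dd : 0 <= d <= 1 / 2 by apply/andP; split; qlra.
have small t : inner rho + X <= t <= T -> `|D y t| <= 2 * d /\ `|S y dy t| <= 2 * d.
  move=> /[dup] tt /andP[_ tT]; have [z p] := h2 t tt; have [z' p' _] := HS t (le_trans tT TT2).
  by rewrite /D /S; split; exact: norm_diff_le.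
split => //.
- apply: (@pair_perturbed _ m b bS y dy yS dyS _ _ d d) => //; first by qlra.
    move=> t /[dup] tt /andP[t1 t2]; have [z p] := h2 t tt.
    have stT : inner rho <= t <= T by rewrite t2 andbT (le_trans _ t1)// lerDl.
    by have [_ _ e] := h1 t stT; split => //; qlra.
  by move=> t /andP[_ t2]; have [z p e] := HS t (le_trans t2 TT2); split => //; qlra.
- move=> t tt; have [hD hS] := small t tt.
  have [_ _ _] := energy_bounds (D y t) (S y dy t) m1; rewrite -/(energy m (D y) (S y dy) t) => h.
  have q1 : m ^+ 2 * D y t ^+ 2 <= (1 / 84) ^+ 2.
    rewrite -exprMn -(real_normK (num_real (m * _))) ler_sqr ?nnegrE// normrM gtr0_norm//.
    have : m * `|D y t| <= m * (2 * d) by rewrite ler_pM2l.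
    by qlra.
  have q2 : S y dy t ^+ 2 <= (1 / 84) ^+ 2.
    by rewrite -(real_normK (num_real (S y dy t))) ler_sqr ?nnegrE// (le_trans hS).
  by qlra.
pose N t := D y t ^+ 2 + S y dy t ^+ 2.
have rho1' : 1 <= rho by qlra.
have [sb /andP[_ z1] _ _] := reg_start n3 rho1' reg; rewrite -/m in z1.
have l2 : 1 / 2 <= ln (2 * m) := ln2m_ge n3.
have Ns : 1 / 16 <= N (inner rho).
  have [+ _ _] := HS (inner rho) (le_trans sT TT2); rewrite ler_norml => /andP[z2 _].
  have hD : D y (inner rho) <= - (1 / 4) by rewrite /D; qlra.
  by rewrite /N (le_trans (sqr_ge_sixteenth hD))// lerDl sqr_ge0.
pose r1 t := emR m (expR (- y t)) (emZ m y t) (emP y dy t).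
pose r2 t := emR m (expR (- yS t)) (emZ m yS t) (emP yS dyS t).
pose nu t := 2 * D y t * S y dy t + 2 * S y dy t *
  (- m * S y dy t - 2 * m * (expR (emZ m y t) - expR (emZ m yS t)) + (r1 t - r2 t)).
have hd t : inner rho <= t <= inner rho + X -> is_derive t 1 N (nu t).
  move=> /andP[_ tX]; have tT := le_trans tX sX; have t1 : t < b := le_lt_trans tT Tb.
  have t2 : t < bS := le_lt_trans tT TbS.
  have dZ1 := emZ_deriv sol t1; have dZ2 := emZ_deriv solS t2.
  have dP1 := emP_deriv m1 sol t1; have dP2 := emP_deriv m1 solS t2.
  by rewrite /N /D /S; dtac; rewrite /nu /D /S /r1 /r2; ring.
have hN t : inner rho <= t <= inner rho + X -> - K * N t <= nu t.
  move=> /andP[st tX]; have tT := le_trans tX sX.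
  have stT : inner rho <= t <= T by rewrite st.
  have tT2 : t <= T2 := le_trans tT TT2.
  have [z p e] := h1 t stT; have [z' p' e'] := HS t tT2.
  have zG : expR (emZ m y t) <= G by rewrite ler_expR (le_trans (ler_norm _))// (le_trans z).
  have zG' : expR (emZ m yS t) <= G by rewrite ler_expR (le_trans (ler_norm _))// (le_trans z').
  have pB : `|emP y dy t| <= B' := le_trans p BB'.
  have pB' : `|emP yS dyS t| <= B' := le_trans p' dB'.
  have E1 := expR_lip zG zG'; rewrite -/(D y t) in E1.
  have ea : `|expR (- y t) - expR (- yS t)| <= d * `|D y t|.
    apply: (le_trans (expN_lip e e')); rewrite ler_pM2l//.
    by apply: (le_trans (expDid_lip _ _)); rewrite /D /emZ le_eqVlt; apply/orP; left; apply/eqP; congr `|_|; ring.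
  have a1 : 0 < expR (- y t) <= d by rewrite expR_gt0.
  have a2 : 0 < expR (- yS t) <= d by rewrite expR_gt0.
  have E2 := emR_lip m0 zG zG' pB pB' a1 a2 ea; rewrite -/(r1 t) -/(r2 t) -/(D y t) -/(S y dy t) in E2.
  have : `|nu t| <= K * N t := lipschitz_dist2 m0 G0 B'0 d0 d11 E1 E2.
  by rewrite ler_norml mulNr => /andP[].
have sX' : inner rho <= inner rho + X by rewrite lerDl.
have := @gronwall _ (fun t => - N t) _ (- K) 0 _ _ sX' _ (fun t h => dN (hd t h)).
rewrite mul0r !addr0 mulNr lerN2 (_ : inner rho + X - inner rho = X); last by ring.
move=> NX.
have {}NX : N (inner rho) * expR (- K * X) <= N (inner rho + X).
  apply: NX; first by rewrite oppr_eq0 gt_eqF.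
  by move=> t /hN; qlra.
have [q1 _ q2 _] := energy_bounds (D y (inner rho + X)) (S y dy (inner rho + X)) m1.
rewrite -/(energy m (D y) (S y dy) (inner rho + X)) in q1 q2.
have : 1 / 16 * expR (- K * X) <= N (inner rho) * expR (- K * X) by rewrite ler_wpM2r ?expR_ge0.
by move: NX; rewrite /N; qlra.
Qed.
End link.

(** * Convergence of the regular solutions to the singular one *)


Section convergence.
Context {R : realType}.
Implicit Types (m b t e : R) (y dy : R -> R).

(** [P - 2] is [(e^y + 1) y'] with a factor at least 1, so [y'] is recovered from [P] once the
    difference of the factors is charged to [Z]. *)
Lemma slope_diff (y1 y2 d1 d2 : R) :
  `|d1 - d2| <= `|((expR y1 + 1) * d1 + 2) - ((expR y2 + 1) * d2 + 2)| +
     `|d2| * `|(expR y1 + y1) - (expR y2 + y2)|.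
Proof.
have h : `|expR y1 - expR y2| <= `|(expR y1 + y1) - (expR y2 + y2)|.
  move: y1 y2; apply: wlog_le2 => [y1 y2 H|y1 y2 y12].
    by rewrite distrC (distrC (expR y2 + _)).
  have h : expR y1 <= expR y2 by rewrite ler_expR.
  by rewrite distrC ger0_norm ?subr_ge0// distrC ger0_norm; lra.
have p : 1 <= expR y1 + 1 by rewrite lerDr expR_ge0.
have : `|(expR y1 + 1) * (d1 - d2)| <= `|((expR y1 + 1) * d1 + 2) - ((expR y2 + 1) * d2 + 2)| + `|d2 * (expR y1 - expR y2)|.
  have -> : (expR y1 + 1) * (d1 - d2) = (((expR y1 + 1) * d1 + 2) - ((expR y2 + 1) * d2 + 2)) - d2 * (expR y1 - expR y2) by ring.
  exact: ler_normB.
rewrite normrM (ger0_norm (_ : 0 <= expR y1 + 1)); last by rewrite (le_trans _ p).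
have h1 : `|d1 - d2| <= (expR y1 + 1) * `|d1 - d2| by rewrite ler_peMl.
have h2 : `|d2 * (expR y1 - expR y2)| <= `|d2| * `|(expR y1 + y1) - (expR y2 + y2)|.
  by rewrite normrM ler_wpM2l.
lra.
Qed.

Lemma inv_exp_small (e q : R) : 0 < e -> 0 < q -> exists A : R, forall x, A <= x -> q * expR (- x) <= e.
Proof.
move=> e0 q0; exists (q / e) => x hx.
have x0 : 0 < x by rewrite (lt_le_trans _ hx)// divr_gt0.
have : expR (- x) * (1 + x) <= 1.
  by rewrite -ler_pdivlMl ?expR_gt0// mulr1 -expRN opprK expR_ge1Dx.
move=> h1; have h2 : q <= e * x by rewrite mulrC -ler_pdivrMr.
have h3 : expR (- x) * q <= expR (- x) * (e * x) by rewrite ler_wpM2l ?expR_ge0.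
have h4 : 0 < expR (- x) := expR_gt0 _.
have : e * (expR (- x) * (1 + x)) <= e * 1 by rewrite ler_wpM2l// ltW.
have := mulr_gt0 e0 h4.
lra.
Qed.

Lemma inner_le (rho : R) : 0 <= rho -> inner rho <= - rho / 2.
Proof. by move=> r0; rewrite /inner; have := expR_ge0 rho; lra. Qed.

Variables (n : nat) (bS : R) (yS dyS : R -> R).
Hypothesis n3 : (3 <= n)%N.
Let m : R := n%:R - 2.
Hypothesis singS : sing_sol m bS yS dyS.

(** From [inner rho + X] to the fixed time [T] the energy of the difference, at most 1 initially,
    decays at rate [1/4]; the length of this interval tends to infinity with [rho]. *)
Lemma converge_at : exists2 T, T < bS & forall e, 0 < e -> exists2 rho1, 1 <= rho1 &
  forall rho b y dy, rho1 <= rho -> reg_sol n rho b y dy -> T < b /\ dist2 y dy yS dyS T <= e.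
Proof.
have [X [T [e0 [X0 TbS _ HT]]]] := link n3 singS.
have [rho1 rho11 H] := HT T (lexx T).
exists T => // e eps0.
(* With energy [En]: [d^2 <= En] and [s^2 <= 8 En], while [slope_diff] bounds the squared difference
   of slopes by [2 s^2 + 2 dyS^2 d^2]. *)
pose C := 17 + 2 * dyS T ^+ 2.
have C0 : 0 < C by rewrite /C; have := sqr_ge0 (dyS T); lra.
have [A hA] := inv_exp_small eps0 C0.
exists (rho1 + 2 * `|4 * A + X - T|); first by have := normr_ge0 (4 * A + X - T); lra.
move=> rho b y dy hrho reg.
have r1 : rho1 <= rho by have := normr_ge0 (4 * A + X - T); lra.
have [Tb sX [E pert] en1 _] := H rho b y dy r1 reg.
split=> //.
have m1 : 1 <= m := m_ge1 n3.
have := energy_decay m1 sX pert.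
have ss : inner rho + X <= inner rho + X <= T by rewrite lexx.
have e1 := en1 _ ss.
set En := energy m _ _ in e1 *.
move=> h.
have h2 : En T <= expR (- A).
  apply: (le_trans h); rewrite -[leRHS]mul1r ler_pM ?expR_ge0//; last first.
    rewrite ler_expR.
    have := inner_le (_ : 0 <= rho); have := ler_norm (4 * A + X - T).
    move=> h1 h3; have {}h3 := h3 (le_trans (ltW ltr01) (le_trans rho11 r1)).
    lra.
  have [] := energy_bounds (emZ m y (inner rho + X) - emZ m yS (inner rho + X))
               (emP y dy (inner rho + X) - emP yS dyS (inner rho + X)) m1.
  by move=> _ _ + _; apply: le_trans; exact: sqr_ge0.
apply: le_trans (hA A (lexx A)).
have [q1 _ q2 _] := energy_bounds (emZ m y T - emZ m yS T) (emP y dy T - emP yS dyS T) m1.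
set d := emZ m y T - _ in q1 q2; set s := emP y dy T - _ in q1.
have {}q1 : s ^+ 2 <= 8 * En T := q1.
have {}q2 : d ^+ 2 <= En T := q2.
have f1 : `|y T - yS T| <= `|d|.
  by apply: (le_trans (expDid_lip _ _)); rewrite /d /emZ le_eqVlt; apply/orP; left; apply/eqP; congr `|_|; ring.
have f2 : `|dy T - dyS T| <= `|s| + `|dyS T| * `|d|.
  have := slope_diff (y T) (yS T) (dy T) (dyS T); rewrite -/(emP y dy T) -/(emP yS dyS T) -/s.
  by have -> : expR (y T) + y T - (expR (yS T) + yS T) = d by rewrite /d /emZ; ring.
have g1 : (y T - yS T) ^+ 2 <= d ^+ 2.
  by rewrite -(real_normK (num_real (y T - yS T))) -(real_normK (num_real d)) ler_sqr ?nnegrE.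
have g2 : (dy T - dyS T) ^+ 2 <= 2 * s ^+ 2 + 2 * (dyS T ^+ 2 * d ^+ 2).
  rewrite -(real_normK (num_real (dy T - dyS T))).
  apply: (@le_trans _ _ ((`|s| + `|dyS T| * `|d|) ^+ 2)).
    by rewrite ler_sqr ?nnegrE ?addr_ge0 ?mulr_ge0.
  rewrite -(real_normK (num_real s)) -(real_normK (num_real d)) -(real_normK (num_real (dyS T))).
  by have := sqr_ge0 (`|s| - `|dyS T| * `|d|); lra.
have g3 : dyS T ^+ 2 * d ^+ 2 <= dyS T ^+ 2 * expR (- A).
  by rewrite ler_wpM2l ?sqr_ge0// (le_trans q2).
by rewrite /dist2 /C; lra.
Qed.

Lemma log_sol_slope b y dy s t : log_sol m b y dy -> s <= t -> t < b ->
  expR (m * t) * dy t <= expR (m * s) * dy s.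
Proof.
move=> [_ h2 _ _] st tb.
apply: (@le_of_deriv_le0 _ (fun t => expR (m * t) * dy t)
   (fun t => - (expR (m * t) * (expR (2 * t) * expexp (y t)))) _ _ st) => x /andP[sx xt].
  by have hd := h2 x (le_lt_trans xt tb); dtac; ring.
by rewrite oppr_le0 !mulr_ge0 ?expR_ge0.
Qed.

(** From [T] on the two solutions stay within [z]. An end earlier than [bS - e] would need [y] small
    where [yS >= c]. An end later than [bS + e] would need [y], already at most [2 z] near [bS], to
    stay positive while it goes down by [w >= 4 z]. *)
Lemma converge_b e : 0 < e -> exists2 rho1, 1 <= rho1 &
  forall rho b y dy, rho1 <= rho -> reg_sol n rho b y dy -> `|b - bS| <= e.
Proof.
move=> e0; have [T TbS H] := converge_at.
have solS : log_sol m bS yS dyS by case: singS.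
have [hS1 hS2 hS3 hS4] := solS.
have m0 : 0 <= m by have := m_ge1 n3 : 1 <= m; lra.
pose t1 := Num.max T (bS - e).
have t1b : t1 < bS by rewrite gt_max TbS/= ltrBlDr ltrDl.
pose c := yS t1; have c0 : 0 < c := log_sol_pos solS t1b.
have dT0 : dyS T < 0 by have [] := hS3 T TbS.
(* A lower bound on the flux [- e^(m t) y'], which only grows with [t]; the factor 2 allows for the
   distance between the two slopes at [T]. *)
pose q : R := - (expR (m * T) * dyS T) / 2.
have q0 : 0 < q by rewrite divr_gt0// oppr_gt0 pmulr_rlt0 ?expR_gt0.
pose w : R := q * expR (- (m * (bS + e))) * e.
have w0 : 0 < w by do 2 (apply: mulr_gt0 => //); exact: expR_gt0.
pose z := Num.min (c / 2) (Num.min (- dyS T / 2) (Num.min (w / 4) 1)).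
have z0 : 0 < z by rewrite !lt_min; apply/and4P; split => //; lra.
have zc : z <= c / 2 by rewrite ge_min lexx.
have zd : z <= - dyS T / 2 by rewrite !ge_min lexx orbT.
have zw : z <= w / 4 by rewrite !ge_min lexx !orbT.
have z1 : z <= 1 by rewrite !ge_min lexx !orbT.
pose Y := yS T + 1.
pose K := 1 + 2 * m + expR (2 * bS) * (expR Y * expexp Y).
have K0 : 0 <= K by rewrite /K !addr_ge0 ?mulr_ge0 ?expR_ge0.
pose g := z ^+ 2 * expR (- (K * (bS - T))).
have g0 : 0 < g by rewrite mulr_gt0 ?exprn_gt0 ?expR_gt0.
have [rho1 rho11 Hr] := H _ g0.
exists rho1 => // rho b y dy hrho reg.
have [Tb dT] := Hr rho b y dy hrho reg.
have sol : log_sol m b y dy by case: reg.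
have g_le : g <= z ^+ 2.
  rewrite ler_piMr ?sqr_ge0// -expR0 ler_expR oppr_le0 mulr_ge0// subr_ge0 ltW//.
have near (t : R) : T <= t -> t < b -> t < bS -> `|y t - yS t| <= z /\ `|dy t - dyS t| <= z.
  move=> Tt tb tbS.
  have [] := @dist2_growth _ m b bS y dy yS dyS T t Y (expR (2 * bS)) K m0 sol solS Tt tb tbS _ _ _ erefl.
  - have : `|y T - yS T| <= z.
      apply: norm_le_of_sqr (ltW z0) (le_trans _ g_le); apply: le_trans dT.
      by rewrite /dist2 lerDl sqr_ge0.
    by rewrite /Y ler_norml => /andP[_]; lra.
  - by rewrite /Y lerDl.
  - by rewrite ler_expR; lra.
  move=> _ h.
  have {}h : dist2 y dy yS dyS t <= z ^+ 2.
    apply: (le_trans h); apply: (le_trans (ler_wpM2r (expR_ge0 _) dT)).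
    rewrite /g -mulrA -expRD ler_piMr ?sqr_ge0// -expR0 ler_expR.
    have : K * (t - T) <= K * (bS - T) by rewrite ler_wpM2l//; lra.
    by rewrite mulrBr (mulrBr K bS); lra.
  split; apply: norm_le_of_sqr (ltW z0) (le_trans _ h); rewrite /dist2 ?lerDl ?lerDr ?sqr_ge0//.
rewrite ler_norml; apply/andP; split; rewrite leNgt; apply/negP => hb.
  have bt1 : b < t1 by rewrite lt_max; apply/orP; right; lra.
  have [|t /andP[Tt tb] yt] := lim_at_end (c := c / 2) sol Tb; first by rewrite divr_gt0.
  have tbS : t < bS := lt_trans (lt_trans tb bt1) t1b.
  have [] := near t (ltW Tt) tb tbS; rewrite ler_norml => /andP[h _] _.
  have : c <= yS t by apply: (log_sol_decr solS) => //; exact: ltW (lt_trans tb bt1).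
  by lra.
have [t /andP[Tt tbS] yt] := lim_at_end solS TbS z0.
have tb : t < b by apply: lt_trans tbS _; rewrite -subr_gt0; exact: lt_trans e0 hb.
have [] := near t (ltW Tt) tb tbS; rewrite ler_norml => /andP[_ h] _.
have eb : bS + e < b by rewrite -ltrBrDl.
have te : t <= bS + e by apply: ltW; apply: lt_trans tbS _; rewrite ltrDl.
have : y (bS + e) + w <= y t.
  have : y (bS + e) + q * expR (- (m * (bS + e))) * (bS + e) <= y t + q * expR (- (m * (bS + e))) * t.
    apply: (@le_of_deriv_le0 _ (fun t => y t + q * expR (- (m * (bS + e))) * t)
      (fun t => dy t + q * expR (- (m * (bS + e)))) _ _ te) => x /andP[tx xe].
      by case: sol => h1 _ _ _; have hx := h1 x (le_lt_trans xe eb); dtac; ring.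
    have Tx : T <= x := le_trans (ltW Tt) tx.
    have h1 := log_sol_slope sol Tx (le_lt_trans xe eb).
    have [_] := near T (lexx T) Tb TbS; rewrite ler_norml => /andP[_ h2].
    have h3 : expR (m * T) * dy T <= - q.
      have : expR (m * T) * dy T <= expR (m * T) * (dyS T / 2) by rewrite ler_wpM2l ?expR_ge0//; lra.
      by rewrite /q; lra.
    have h4 : dy x <= - q * expR (- (m * x)).
      rewrite -(ler_pM2l (expR_gt0 (m * x))) mulrCA -expRD subrr expR0 mulr1; exact: le_trans h1 h3.
    have h5 : q * expR (- (m * (bS + e))) <= q * expR (- (m * x)).
      by rewrite ler_pM2l// ler_expR lerN2 ler_wpM2l.
    by lra.
  have : w <= q * expR (- (m * (bS + e))) * (bS + e - t).
    have h' : e <= bS + e - t by rewrite addrAC lerDr subr_ge0 ltW.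
    by rewrite /w; apply: ler_wpM2l => //; apply: mulr_ge0; [exact: ltW|exact: expR_ge0].
  by rewrite mulrBr; lra.
have := log_sol_pos sol eb; lra.
Qed.
End convergence.

(** * Rigidity of sign alternations *)

Section alternation.
Context {R : realType}.
Implicit Types (t s z a b c h : R) (D : R -> R).

Lemma zero_or_end D s b : s < b -> (forall t : R, s <= t < b -> {for t, continuous D}) -> 0 < D s ->
  (exists2 q : R, s < q < b & D q <= 0) \/ (D t @[t --> b^'-] --> (0 : R)) ->
  exists z : R, [/\ s < z <= b, forall t : R, s <= t < z -> 0 < D t,
     D t @[t --> z^'-] --> (0 : R) & z < b -> D z = 0].
Proof.
move=> sb cD Ds H.
have [[q /andP[sq qb] Dq]|noq] := pselect (exists2 q : R, s < q < b & D q <= 0).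
  have [|||z [/andP[sz zq] Dz pos]] := @first_zero _ D s q sq => //.
    by move=> t /andP[st tq]; apply: cD; rewrite st (le_lt_trans tq).
  have zb := le_lt_trans zq qb.
  exists z; split => //; first by rewrite sz ltW.
  by rewrite -Dz; apply: cvg_at_left_filter; apply: cD; rewrite (ltW sz).
have lim0 : D t @[t --> b^'-] --> (0 : R) by case: H.
exists b; split; rewrite ?sb ?lexx ?ltxx// => t /andP[st tb].
have [<-//|ts] := eqVneq s t.
rewrite ltNge; apply/negP => Dt; apply: noq; exists t => //.
by rewrite lt_neqAle ts st.
Qed.

Lemma uniform_pos (f : nat -> R) (k : nat) : (forall i, (i <= k)%N -> 0 < f i) ->
  exists2 e : R, 0 < e & forall i, (i <= k)%N -> e <= f i.
Proof.
elim: k => [|k IH] H; first by exists (f 0%N) => [|i]; [exact: H|rewrite leqn0 => /eqP ->].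
have [i ik|e e0 he] := IH; first by apply: H; exact: leqW.
exists (Num.min e (f k.+1)); first by rewrite lt_min e0 H.
move=> i; rewrite leq_eqVlt => /orP[/eqP ->|]; first by rewrite ge_min lexx orbT.
by rewrite ltnS => ik; rewrite ge_min he.
Qed.

(** The first sign is negative, because a regular solution lies below the singular one near
    [t = -oo]. *)
Definition alternates (D : R -> R) (b : R) (k : nat) (s : nat -> R) :=
  (forall i, (i < k)%N -> s i < s i.+1) /\
  forall i, (i <= k)%N -> s i < b /\ 0 < (-1) ^+ i.+1 * D (s i).

(** After each point of an alternation comes a zero of [D], or the end [b] where [D] tends to 0. By
    [amplify], [|D|] is at least [c h / 2] at distance [h] before it. So any alternation can be
    replaced by one with values bounded away from 0 and points at least [h] apart in a bounded
    interval, which makes its existence a closed condition and bounds its length. *)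
Lemma alternation_rigid D (S : R -> R) a b c (K : R) h (k : nat) (s : nat -> R) : 0 < c -> c <= 1 -> 1 <= K -> h = c / (4 * K) ->
  (forall t : R, t < b -> is_derive t 1 D (S t)) ->
  (forall t : R, a < t < b -> {for t, continuous S}) ->
  (forall t : R, a < t < b -> `|S t| <= K /\ c <= `|D t| + `|S t|) ->
  a < b -> (forall t : R, t <= a -> D t <= - 1) ->
  alternates D b k s ->
  (exists2 q : R, s k < q < b & (-1) ^+ k.+1 * D q <= 0) \/ (D t @[t --> b^'-] --> (0 : R)) ->
  exists z : nat -> R, (forall i, (i < k)%N -> z i + h <= z i.+1) /\
    forall i, (i <= k)%N -> [/\ a + h <= z i, z i <= b & c * h / 2 <= (-1) ^+ i.+1 * D (z i - h)].
Proof.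
move=> c0 c1 K1 hE dD_ cS bd ab Da [sinc salt] Hend.
have h0 : 0 < h by rewrite hE divr_gt0// mulr_gt0// (lt_le_trans _ K1).
have K0 : 0 < K by lra.
have hK : h * K <= 1 / 4.
  have -> : h * K = c / 4 by rewrite hE; field; rewrite gt_eqF.
  by lra.
pose Di i t := (-1) ^+ i.+1 * D t.
have sg i : `|(-1) ^+ i.+1| = 1 :> R by rewrite normrX normrN normr1 expr1n.
have cDi i t : t < b -> {for t, continuous (Di i)}.
  by move=> tb; apply: (@d_cont _ _ _ ((-1) ^+ i.+1 * S t)); have hd := dD_ t tb; rewrite /Di; dtac; ring.
have ex i : exists z, (i <= k)%N -> [/\ s i < z <= b, forall t, s i <= t < z -> 0 < Di i t,
     Di i t @[t --> z^'-] --> (0 : R), z < b -> D z = 0 & ((i < k)%N -> z <= s i.+1)].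
  have [ik|] := boolP (i <= k)%N; last by exists 0.
  have [sib Dpos] := salt i ik.
  have := ik; rewrite leq_eqVlt => /orP[/eqP ik'|ik'].
    have [|||z [z1 z2 z3 z4]] := @zero_or_end (Di i) (s i) b sib => //.
    - by move=> t /andP[_ tb]; exact: cDi.
    - rewrite ik'; case: Hend => [?|lim0]; [by left|right].
      rewrite -[X in _ --> X](mulr0 ((-1) ^+ k.+1)).
      by apply: cvgMr.
    exists z => _; split => //; last by rewrite ik' ltnn.
    by move=> /z4/eqP; rewrite mulf_eq0 signr_eq0/= => /eqP.
  have [sib1 Dpos1] := salt i.+1 ik'.
  have Dn : Di i (s i.+1) < 0 by move: Dpos1; rewrite exprS mulN1r mulNr oppr_gt0.
  have [|||z [/andP[z1 z1'] z2 z3]] := @first_zero _ (Di i) (s i) (s i.+1) (sinc i ik') => //.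
  - by move=> t /andP[_ tb]; apply: cDi; exact: le_lt_trans sib1.
  - exact: ltW.
  have zb := le_lt_trans z1' sib1.
  exists z => _; split => //; first by rewrite z1 ltW.
    by rewrite -[X in _ --> X]z2; apply: cvg_at_left_filter; apply: cDi.
  by move=> _; move/eqP: z2; rewrite mulf_eq0 signr_eq0/= => /eqP.
have [z hz] := choice ex.
have lipD t t' : a <= t -> t <= t' -> t' < b -> `|D t' - D t| <= K * (t' - t).
  move=> at_ tt' tb'; have [<-|ne] := eqVneq t t'; first by rewrite !subrr normr0 mulr0.
  have ta : {for a, continuous D} by apply: d_cont (dD_ a ab).
  (* the bound on S holds in the open interval only *)
  move: at_; rewrite le_eqVlt => /predU1P[at_|at_].
    rewrite -at_ in ne tt' *.
    have ne' : a < t' by rewrite lt_neqAle ne.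
    apply/ler_addgt0Pr => e e0.
    have [/= d d0 hd] := (cvgrPdist_lt _ _).1 ta _ e0.
    pose x := Num.min t' (a + d / 2).
    have ax : a < x by rewrite lt_min ne'/=; lra.
    have xt : x <= t' by rewrite ge_min lexx.
    have xd : x <= a + d / 2 by rewrite ge_min lexx orbT.
    have h1 : `|D a - D x| < e by apply: hd; rewrite /ball_/= ltr0_norm; lra.
    have h2 : `|D t' - D x| <= K * (t' - x).
      apply: (@lip_of_deriv _ D S) => // w /andP[xw wt].
        by apply: dD_; lra.
      by have [] := bd w (_ : a < w < b); rewrite ?(lt_le_trans ax xw) ?(le_lt_trans wt).
    have : `|D t' - D a| <= `|D t' - D x| + `|D x - D a|.
      by rewrite (le_trans _ (ler_normD _ _))// addrA subrK.
    rewrite distrC in h1; have : K * (t' - x) <= K * (t' - a) by rewrite ler_wpM2l//; lra.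
    lra.
  apply: (@lip_of_deriv _ D S) => // w /andP[xw wt].
    by apply: dD_; lra.
  by have [] := bd w (_ : a < w < b); rewrite ?(lt_le_trans at_ xw) ?(le_lt_trans wt).
(* [D] is at most [-1] up to [a] and its slope is at most [K] with [h K <= 1/4], so it cannot come
   close to 0 before [a + h]. *)
have az i : (i <= k)%N -> a + h < z i.
  move=> ik; have [/andP[z1 z2] pos lim0 _ _] := hz i ik.
  rewrite ltNge; apply/negP => zi.
  have [/= d d0 hd] := (cvgrPdist_lt _ _).1 lim0 (1 / 2) (divr_gt0 ltr01 (ltr0Sn _ 1)).
  pose x := Num.max (s i) (z i - d / 2).
  have xz : x < z i by rewrite gt_max z1/=; lra.
  have xd : z i - d / 2 <= x by rewrite le_max lexx orbT.
  have : `|0 - Di i x| < 1 / 2 by apply: hd => //=; rewrite gtr0_norm; lra.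
  rewrite sub0r normrN normrM sg [X in X < _]mul1r => Dx.
  have [xa|xa] := leP x a.
    by have := Da x xa; move: Dx; rewrite ltr_norml => /andP[]; lra.
  have := lipD a x (lexx a) (ltW xa) (lt_le_trans xz z2).
  have := Da a (lexx a).
  have : K * (x - a) <= K * h by rewrite ler_wpM2l//; lra.
  move: Dx; rewrite ltr_norml ler_norml => /andP[? ?] ? ? /andP[? ?]; lra.
have big i : (i <= k)%N -> forall t, z i - h <= t < z i -> c / 2 * (z i - t) <= Di i t.
  move=> ik; have [/andP[z1 z2] pos lim0 _ _] := hz i ik.
  apply: (@amplify _ (Di i) (fun t => (-1) ^+ i.+1 * S t) a c K (z i) h c0 K0 hE) => //.
  - by have := az i ik; lra.
  - move=> t /andP[_ tz]; have hd := dD_ t (lt_le_trans tz z2).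
    by rewrite /Di; dtac; ring.
  - move=> t /andP[ta tz]; apply: cvgMr; apply: cS.
    by rewrite ta (lt_le_trans tz).
  - by move=> t /andP[ta tz]; rewrite /Di !normrM sg !mul1r; apply: bd; rewrite ta (lt_le_trans tz).
  - move=> e e0; pose x := Num.max (s i) (z i - e / 2).
    have xz : x < z i by rewrite gt_max z1/=; lra.
    exists x; last by apply: pos; rewrite xz le_max lexx.
    by rewrite xz andbT (lt_le_trans (y := z i - e / 2)) ?le_max ?lexx ?orbT//; lra.
exists z; split.
  move=> i ik.
  have [/andP[z1 z2] pos lim0 Dz zs] := hz i (ltnW ik).
  have [/andP[z1' z2'] pos' _ _ _] := hz i.+1 ik.
  have zb : z i < b by rewrite (le_lt_trans (zs ik))// (salt i.+1 ik).1.
  rewrite -lerBrDr leNgt; apply/negP => hzz.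
  have := big i.+1 ik (z i); rewrite (ltW hzz) (le_lt_trans (zs ik) z1') => /(_ isT).
  rewrite /Di Dz// mulr0 leNgt => /negP; apply; rewrite mulr_gt0 ?divr_gt0// subr_gt0.
  exact: le_lt_trans (zs ik) z1'.
move=> i ik; have [/andP[z1 z2] _ _ _ _] := hz i ik.
split => //; first exact/ltW/az.
have := big i ik (z i - h); rewrite lexx ltrBlDr ltrDl h0 => /(_ isT).
by rewrite subKr mulrAC.
Qed.
End alternation.

(** * Oscillation around the singular solution *)


Section perturbed_oscillation.
Context {R : realType}.
Implicit Types (m a b c t : R) (D S E : R -> R).

Lemma perturbed_sub m a b a' b' D S E : perturbed m a b D S E -> a <= a' -> b' <= b ->
  perturbed m a' b' D S E.
Proof. by move=> H aa bb t /andP[t1 t2]; apply: H; rewrite (le_trans aa)//= (le_trans t2). Qed.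

Lemma perturbed_sign m a b D S E (i : nat) : perturbed m a b D S E ->
  perturbed m a b (fun t => (-1) ^+ i * D t) (fun t => (-1) ^+ i * S t) (fun t => (-1) ^+ i * E t).
Proof.
move=> H t /H[h1 h2 h3]; split.
- by dtac; ring.
- by dtac; ring.
by rewrite !normrM normrX normrN normr1 expr1n !mul1r.
Qed.

Lemma energy_sign m D S (i : nat) t :
  energy m (fun t => (-1) ^+ i * D t) (fun t => (-1) ^+ i * S t) t = energy m D S t.
Proof.
rewrite /energy; have e : (-1) ^+ i * (-1) ^+ i = 1 :> R by rewrite -exprMn mulrNN mulr1 expr1n.
have -> : (-1) ^+ i * S t + m * ((-1) ^+ i * D t) / 2 = (-1) ^+ i * (S t + m * D t / 2) by ring.
by rewrite !exprMn !expr2 e !mul1r.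
Qed.

Lemma energy_large m c D S t : 1 <= m -> 0 < c <= 1 -> 2 * m ^+ 2 * c <= energy m D S t ->
  energy m D S t <= 1 -> [/\ 0 < energy m D S t, `|S t| <= 3 & c <= `|D t| + `|S t|].
Proof.
move=> m1 /andP[c0 c1] en up.
have m20 : 0 < m ^+ 2 by rewrite exprn_gt0// (lt_le_trans _ m1).
have [q1 _ _ q3] := energy_bounds (D t) (S t) m1; rewrite -/(energy m D S t) in q1 q3.
have en_gt0 : 0 < energy m D S t by apply: lt_le_trans en; rewrite mulr_gt0// mulr_gt0.
split => //.
  by apply: norm_le_of_sqr => //; apply: (le_trans q1); rewrite -natrX; move: up; clear; lra.
rewrite leNgt; apply/negP => hc.
have h1 : (`|D t| + `|S t|) ^+ 2 < c.
  have p0 : 0 <= `|D t| + `|S t| by rewrite addr_ge0.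
  have : (`|D t| + `|S t|) ^+ 2 <= (`|D t| + `|S t|) * 1.
    by rewrite expr2 ler_wpM2l// (le_trans (ltW hc)).
  by rewrite mulr1 => /le_lt_trans; exact.
have h2 : D t ^+ 2 + S t ^+ 2 <= (`|D t| + `|S t|) ^+ 2.
  rewrite -(real_normK (num_real (D t))) -(real_normK (num_real (S t))).
  by have := mulr_ge0 (normr_ge0 (D t)) (normr_ge0 (S t)); clear; lra.
have h3 : S t ^+ 2 <= m ^+ 2 * S t ^+ 2.
  by rewrite ler_peMl ?sqr_ge0// -[1](expr1n _ 2) lerXn2r ?nnegrE// ltW// (lt_le_trans _ m1).
have h4 : 2 * m ^+ 2 * (D t ^+ 2 + S t ^+ 2) < 2 * m ^+ 2 * c.
  have p : 0 < 2 * m ^+ 2 by rewrite mulr_gt0.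
  by rewrite ltr_pM2l//; exact: le_lt_trans h2 h1.
have := mulr_ge0 (ltW m20) (sqr_ge0 (D t)); have := sqr_ge0 (S t).
move: en q3 h3 h4; clear; lra.
Qed.

Definition period : R := 2 * pi + 2.

Lemma period_gt0 : 0 < period.
Proof. by have := pi_gt0 R; rewrite /period; lra. Qed.

(** In two successive periods [D] becomes positive and then negative. [amplify] with [K = 3], at the
    first zero in between, gives [D >= (c / 2) h] at distance [h = c / 12] before it. *)
Lemma amplitude m a D S E c : 1 <= m <= 7 -> 0 < c <= 1 ->
  perturbed m a (a + (2 * period + 1)) D S E ->
  (forall t : R, a <= t <= a + (2 * period + 1) ->
     [/\ 0 < energy m D S t, `|S t| <= 3 & c <= `|D t| + `|S t|]) ->
  exists2 t : R, a <= t <= a + (2 * period + 1) & c ^+ 2 / 24 <= D t.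
Proof.
move=> m17 /andP[c0 c1] H B; have l0 := period_gt0; set l := period in H B l0 *.
pose b := a + (2 * l + 1).
have lE : 2 * pi + 2 <= l by rewrite lexx.
have H1 : perturbed m (a + 1) (a + 1 + l) D S E by apply: (perturbed_sub H); lra.
have H2 : perturbed m (a + 1 + l) (a + 1 + 2 * l) D S E by apply: (perturbed_sub H); lra.
have [||p /andP[p1 p2] Dp] := takes_positive m17 _ H1; first by lra.
  by move=> t /andP[t1 t2]; have [] := B t; first (apply/andP; split; lra).
have [||q /andP[q1 q2]] := takes_positive m17 _ (perturbed_sign 1 H2); first by lra.
  by move=> t /andP[t1 t2]; rewrite energy_sign; have [] := B t; first (apply/andP; split; lra).
rewrite expr1 mulN1r oppr_gt0 => Dq.
have inab t : a + 1 <= t <= q -> a <= t <= a + (2 * l + 1) by move=> /andP[? ?]; apply/andP; split; lra.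
have hdD t : a + 1 <= t <= q -> is_derive t 1 D (S t) by move=> /inab/H[].
have pq : p < q by lra.
have [|z [/andP[pz zq] Dz pos]] := @first_zero _ D p q pq _ Dp (ltW Dq).
  by move=> t /andP[t1 t2]; apply: d_cont (hdD t _); apply/andP; split; lra.
pose h : R := c / (4 * 3).
have h0 : 0 < h by rewrite divr_gt0.
have h1 : h <= 1 by rewrite ler_pdivrMr//; lra.
have ok t : a < t < z -> a <= t <= a + (2 * l + 1) by move=> /andP[? ?]; apply/andP; split; lra.
have K : forall x : R, z - h <= x < z -> c / 2 * (z - x) <= D x.
  apply: (@amplify _ D S a c 3 z h c0) => //.
  - by lra.
  - by move=> t /ok/H[].
  - by move=> t /ok/H[_ h2 _]; exact: d_cont h2.
  - by move=> t /ok/B[].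
  - rewrite -[X in _ --> X]Dz; apply: cvg_at_left_filter; apply: d_cont (hdD z _).
    by apply/andP; split; lra.
  move=> e e0; pose x := Num.max p (z - e / 2).
  have xz : x < z by rewrite gt_max pz/=; lra.
  have px : p <= x by rewrite le_max lexx.
  have xe : z - e / 2 <= x by rewrite le_max lexx orbT.
  by exists x; [apply/andP; split; lra|apply: pos; rewrite px].
exists (z - h); first by apply/andP; split; lra.
have := K (z - h); rewrite lexx ltrBlDr ltrDl h0 => /(_ isT); apply: le_trans.
by rewrite subKr /h le_eqVlt; apply/orP; left; apply/eqP; field.
Qed.
End perturbed_oscillation.

Section oscillation.
Context {R : realType}.
Variables (n : nat) (bS : R) (yS dyS : R -> R).
Hypothesis n3 : (3 <= n)%N.
Hypothesis n9 : (n <= 9)%N.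
Let m : R := n%:R - 2.
Hypothesis singS : sing_sol m bS yS dyS.

Lemma m17 : 1 <= m <= 7.
Proof.
rewrite (m_ge1 n3)/=; have : n%:R <= 9 :> R by rewrite ler_nat.
by rewrite /m; lra.
Qed.

(** For large [rho] the interval from [inner rho + X] to [T] contains [k + 1] periods, and in each
    of them the difference takes the sign required. *)
Lemma alternation_exists (k : nat) : exists2 rho1, 1 <= rho1 &
  forall rho b y dy, rho1 <= rho -> reg_sol n rho b y dy ->
    exists s, alternates (fun t => y t - yS t) (Num.min b bS) k s.
Proof.
have [X [T [e0 [X0 TbS e00 HT]]]] := link n3 singS.
have [rho1 rho11 H] := HT T (lexx T).
have l0 := @period_gt0 R; set l := @period R in l0.
pose N := `|X - T + k.+1%:R * l|.
have N0 : 0 <= N by exact: normr_ge0.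
exists (rho1 + 2 * N); first by lra.
move=> rho b y dy hrho reg.
have [|Tb sX [E pert] _ en0] := H rho b y dy _ reg; first by lra.
pose a := inner rho + X.
have aT : a + k.+1%:R * l <= T.
  have := inner_le (_ : 0 <= rho); have := ler_norm (X - T + k.+1%:R * l); rewrite -/N /a.
  move=> h1 h2; have {}h2 := h2 (le_trans (ltW ltr01) (le_trans rho11 (_ : rho1 <= rho))).
  by have := h2 ltac:(lra); lra.
have /andP[m1 m7] := m17.
have ex i : exists t, (i <= k)%N -> a + i%:R * l < t < a + i.+1%:R * l /\
    0 < (-1) ^+ i.+1 * (y t - yS t).
  have [ik|] := boolP (i <= k)%N; last by exists 0.
  have i1 : i%:R * l <= i.+1%:R * l by rewrite ler_wpM2r ?ler_nat// ltW.
  have i2 : i.+1%:R * l <= k.+1%:R * l by rewrite ler_wpM2r ?ler_nat// ltW.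
  have i0 : 0 <= i%:R * l by rewrite mulr_ge0// ltW.
  have H1 : perturbed m (a + i%:R * l) (a + i.+1%:R * l)
     (fun t => emZ m y t - emZ m yS t) (fun t => emP y dy t - emP yS dyS t) E.
    by apply: (perturbed_sub pert); rewrite -/a; lra.
  have [||t tt Dt] := takes_positive m17 _ (perturbed_sign i.+1 H1).
  - by rewrite -natr1 mulrDl mul1r /l /period; lra.
  - move=> t /andP[t1 t2]; rewrite energy_sign.
    have at_ : a <= t by lra.
    have H2 : perturbed m a t (fun t => emZ m y t - emZ m yS t) (fun t => emP y dy t - emP yS dyS t) E.
      by apply: (perturbed_sub pert); rewrite -/a; lra.
    apply: lt_le_trans (energy_lower m1 at_ H2).
    by rewrite mulr_gt0 ?expR_gt0// (lt_le_trans e00).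
  exists t => _; split => //; move: Dt.
  have [d1 d2] := D_sgn n yS y t.
  rewrite -signr_odd; case: odd => /=; rewrite ?(expr1, expr0, mulN1r, mul1r, oppr_gt0) => h.
    by rewrite subr_lt0; exact: d2.
  by rewrite subr_gt0; exact: d1.
have [s hs] := choice ex.
exists s; split.
  move=> i ik; have [/andP[_ h1] _] := hs i (ltnW ik); have [/andP[h2 _] _] := hs i.+1 ik.
  exact: lt_trans h1 h2.
move=> i ik; have [/andP[_ h1] h2] := hs i ik; split => //.
have i2 : i.+1%:R * l <= k.+1%:R * l by rewrite ler_wpM2r ?ler_nat// ltW.
by rewrite lt_min; apply/andP; split; lra.
Qed.

(** Equal [|x|] means comparing [y] at [t] with [yS] at [t - (b - bS)]. The shift changes the
    difference by at most [3 |b - bS|], which tends to 0 by [converge_b]. The sign changes survive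
    if their amplitude does not depend on [rho], so they are sought right after [inner rho + X],
    where the energy is at least [e0]. *)
Lemma intersections_exist (k : nat) : exists2 rho1, 1 <= rho1 &
  forall rho b y dy, rho1 <= rho -> reg_sol n rho b y dy ->
    exists s : nat -> R, (forall i, (i < k)%N -> s i < s i.+1) /\
      forall i, (i <= k)%N -> s i < b /\ y (s i) = yS (s i - (b - bS)).
Proof.
have [X [T [e0 [X0 TbS e00 HT]]]] := link n3 singS.
have [solS /(_ 1 ltr01)[T2 T2b HS]] := singS.
pose T' := Num.min T (T2 - 1).
have T'T : T' <= T by rewrite ge_min lexx.
have T'T2 : T' + 1 <= T2 by rewrite -lerBrDr ge_min lexx orbT.
have [rho1 rho11 H] := HT T' T'T.
have l0 := @period_gt0 R; set l := @period R in l0.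
pose L := 2 * (2 * l + 1).
have L0 : 0 < L by rewrite /L; lra.
have /andP[m1 m7] := m17.
have m0 : 0 < m by lra.
(* The energy left after [k + 1] windows of length [L], in the form required by [energy_large]; it
   depends on [k] but not on [rho]. *)
pose c := Num.min 1 (e0 * expR (- (16 * m) * (k.+1%:R * L)) / (2 * m ^+ 2)).
have c0 : 0 < c by rewrite lt_min ltr01/= divr_gt0 ?mulr_gt0 ?expR_gt0 ?exprn_gt0.
have c1 : c <= 1 by rewrite ge_min lexx.
have cE : 2 * m ^+ 2 * c <= e0 * expR (- (16 * m) * (k.+1%:R * L)).
  by rewrite mulrC -ler_pdivlMr ?mulr_gt0 ?exprn_gt0// ge_min lexx orbT.
pose A := c ^+ 2 / 24.
have A0 : 0 < A by rewrite divr_gt0 ?exprn_gt0.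
have e1 : 0 < Num.min 1 (A / 4) by rewrite lt_min ltr01 divr_gt0.
have [rho2 rho21 Hb] := converge_b n3 singS e1.
pose N := `|X - T' + k.+1%:R * L|.
have N0 : 0 <= N by exact: normr_ge0.
exists (rho1 + rho2 + 2 * N); first by lra.
move=> rho b y dy hrho reg.
have [|Tb sX [E pert] en1 en0] := H rho b y dy _ reg; first by clear -hrho rho11 rho21 N0; clearbody N; lra.
have bb : `|b - bS| <= Num.min 1 (A / 4) by apply: Hb reg; clear -hrho rho11 rho21 N0; clearbody N; lra.
pose ka := b - bS.
have ka1 : `|ka| <= 1 by apply: (le_trans bb); rewrite ge_min lexx.
have kaA : `|ka| <= A / 4 by apply: (le_trans bb); rewrite ge_min lexx orbT.
have sol : log_sol m b y dy by case: reg.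
pose a := inner rho + X.
pose D t := emZ m y t - emZ m yS t; pose S t := emP y dy t - emP yS dyS t.
have aT : a + k.+1%:R * L <= T'.
  have r0 : 0 <= rho by clear -hrho rho11 rho21 N0; clearbody N; lra.
  have := inner_le r0; have := ler_norm (X - T' + k.+1%:R * L); rewrite -/N /a; clear -hrho rho11 rho21; clearbody N T' L; lra.
have fine (t : R) : a <= t <= a + k.+1%:R * L ->
   [/\ 0 < energy m D S t, `|S t| <= 3 & c <= `|D t| + `|S t|].
  move=> /andP[at_ tL].
  have H2 : perturbed m a t D S E.
    by apply: (perturbed_sub pert); rewrite -/a; clear -at_ tL aT; clearbody a L T'; lra.
  have low := energy_lower m1 at_ H2.
  have en : e0 * expR (- (16 * m) * (k.+1%:R * L)) <= energy m D S t.
    apply: le_trans low; rewrite ler_pM ?(ltW e00) ?expR_ge0// ler_expR !mulNr lerN2.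
    by rewrite ler_wpM2l ?mulr_ge0 ?(ltW m0)//; clear -tL; clearbody a L; lra.
  have up : energy m D S t <= 1 by apply: en1; rewrite -/a; clear -at_ tL aT; clearbody a L T'; apply/andP; split; lra.
  apply: energy_large => //; first by rewrite c0.
  exact: le_trans cE en.
have aL (t : R) : a <= t -> t <= a + k.+1%:R * L -> [/\ t < b, t < bS & t - ka < bS].
  move=> _ tL; have := ler_norm (- ka); rewrite normrN => h.
  by rewrite /ka in h ka1 *; clear -h ka1 tL aT T'T2 T2b; clearbody a L T'; split; lra.
pose Hh t := (expR (y t) + y t) - (expR (yS (t - ka)) + yS (t - ka)).
have HD (t : R) : a <= t -> t <= a + k.+1%:R * L -> `|Hh t - D t| <= 3 * `|ka|.
  move=> t1 t2.
  pose Q t := expR (yS t) + yS t.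
  have -> : Hh t - D t = Q t - Q (t - ka) by rewrite /Hh /D /Q /emZ; ring.
  have lipQ (u v : R) : u <= v -> v <= T2 -> `|Q v - Q u| <= 3 * (v - u).
    move=> uv vT; apply: (@lip_of_deriv _ Q (fun t => emP yS dyS t - 2)) => // x /andP[ux xv].
      have xb : x < bS by clear -xv vT T2b; lra.
      by case: solS => h _ _ _; have hx := h x xb; rewrite /Q /emP; dtac; ring.
    by have [_ h _] := HS x (le_trans xv vT); rewrite (le_trans (ler_normB _ _))// [ `|2|]ger0_norm// (_ : 3 = 1 + 2) ?lerD//; ring.
  have kk := ler_norm (- ka); rewrite normrN in kk.
  have tT2 : t <= T2 by clear -t2 aT T'T2; clearbody a L T'; lra.
  have [k0|k0] := leP 0 ka.
    by have := lipQ (t - ka) t; rewrite (ger0_norm k0) subKr; apply => //; rewrite gerBl.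
  have h := lipQ t (t - ka); rewrite distrC (ltr0_norm k0).
  by apply: (le_trans (h _ _)); clear -k0 kk ka1 t2 aT T'T2; clearbody a L T' ka; lra.
have contH (t : R) : a <= t -> t <= a + k.+1%:R * L -> {for t, continuous Hh}.
  move=> t1 t2; have [tb tbS tk] := aL t t1 t2.
  have hy : is_derive t 1 y (dy t) by case: sol => h _ _ _; exact: h.
  have hS : is_derive t 1 (fun t => yS (t - ka)) (dyS (t - ka)).
    have h2 : is_derive t 1 (fun t => t - ka) 1 by dtac; ring.
    case: solS => h _ _ _; have h1 := h _ tk.
    by apply: (d_eq (dcomp1 (g := fun t => t - ka) h1 h2)); rewrite mulr1.
  by apply: (@d_cont _ _ _ ((expR (y t) * dy t + dy t) - (expR (yS (t - ka)) * dyS (t - ka) + dyS (t - ka)))); rewrite /Hh; dtac; ring.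
have ex i : exists t, (i <= k)%N -> [/\ a + i%:R * L < t, t < a + i.+1%:R * L & Hh t = 0].
  have [ik|] := boolP (i <= k)%N; last by exists 0.
  have iL : i.+1%:R * L = i%:R * L + L by rewrite -natr1 mulrDl mul1r.
  have i2 : i.+1%:R * L <= k.+1%:R * L by rewrite ler_wpM2r ?ler_nat// ltW.
  have i0 : 0 <= i%:R * L by rewrite mulr_ge0// ltW.
  pose a1 := a + i%:R * L; pose a2 := a1 + (2 * l + 1).
  have aa2 : a2 + (2 * l + 1) = a + i.+1%:R * L by rewrite /a2 /a1 iL /L; ring.
  have c01 : 0 < c <= 1 by rewrite c0.
  have aa1 : a <= a1 by rewrite /a1 lerDl.
  have a12 : a2 = a1 + (2 * l + 1) by [].
  have a2L : a2 + (2 * l + 1) <= a + k.+1%:R * L by rewrite aa2 lerD2l.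
  have aiL : a + i.+1%:R * L <= a + k.+1%:R * L by rewrite lerD2l.
  have ll : 0 < 2 * l + 1 by rewrite addr_gt0 ?mulr_gt0.
  have P1 : perturbed m a1 (a1 + (2 * l + 1)) D S E.
    by apply: (perturbed_sub pert); rewrite -/a; clear -aa1 a12 a2L ll aT; clearbody a1 a2 a L; lra.
  have P2 : perturbed m a2 (a2 + (2 * l + 1)) D S E.
    by apply: (perturbed_sub pert); rewrite -/a; clear -aa1 a12 a2L ll aT; clearbody a1 a2 a L; lra.
  have [|p /andP[p1 p2] Dp] := amplitude m17 c01 P1.
    move=> t /andP[t1 t2]; apply: fine.
    by rewrite -/l in t2; clear -aa1 a12 a2L ll t1 t2; clearbody a1 a2 a L; apply/andP; split; lra.
  have [|q /andP[q1 q2]] := amplitude m17 c01 (perturbed_sign 1 P2).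
    move=> t /andP[t1 t2]; rewrite energy_sign !normrM normrX normrN normr1 expr1n !mul1r.
    by rewrite -/l in t2; apply: fine; clear -aa1 a12 a2L ll t1 t2; clearbody a1 a2 a L; apply/andP; split; lra.
  rewrite expr1 mulN1r -/A in Dp * => Dq.
  have pa : a <= p by exact: le_trans aa1 p1.
  have qL : q <= a + i.+1%:R * L by rewrite aa2 in q2.
  have pq : p <= q by rewrite a12 in q1; exact: le_trans p2 q1.
  have pL : p <= a + k.+1%:R * L by exact: le_trans pq (le_trans qL aiL).
  have Hp : 0 < Hh p.
    have := HD p pa pL; rewrite ler_norml => /andP[]; move: Dp kaA A0.
    by clear; clearbody Hh D A ka; lra.
  have Hq : Hh q < 0.
    have := HD q (le_trans pa pq) (le_trans qL aiL); rewrite ler_norml => /andP[]; move: Dq kaA A0.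
    by clear; clearbody Hh D A ka; lra.
  have pq' : p < q by rewrite lt_neqAle pq andbT; apply/negP => /eqP e; rewrite e ltNge (ltW Hq) in Hp.
  have [|z [/andP[pz zq] Hz _]] := @first_zero _ Hh p q pq' _ Hp (ltW Hq).
    by move=> t /andP[t1 t2]; apply: contH; [exact: le_trans pa t1|exact: le_trans t2 (le_trans qL aiL)].
  have zq' : z < q by rewrite lt_neqAle zq andbT; apply/negP => /eqP e; rewrite -e Hz ltxx in Hq.
  by exists z => _; split => //; [exact: le_lt_trans p1 pz|exact: lt_le_trans zq' qL].
have [s hs] := choice ex.
exists s; split.
  move=> i ik; have [_ h1 _] := hs i (ltnW ik); have [h2 _ _] := hs i.+1 ik; exact: lt_trans h1 h2.
move=> i ik; have [h1 h2 h3] := hs i ik.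
have i2 : i.+1%:R * L <= k.+1%:R * L by rewrite ler_wpM2r ?ler_nat// ltW.
have i0 : 0 <= i%:R * L by rewrite mulr_ge0// ltW.
split; first by clear -h2 i2 aT T'T Tb; clearbody a L T'; lra.
apply/eqP; rewrite -subr_eq0 -normr_le0 (le_trans (expDid_lip _ _))//.
by rewrite -/ka -/(Hh (s i)) h3 normr0.
Qed.
End oscillation.


(** * Deformation of alternations along a family of solutions *)

Lemma gap_sqr {R : realType} (x y r : R) : x <= r -> r + 2 <= y -> 1 <= (x - y) ^+ 2.
Proof. by move=> xr ry; have : 0 <= (y - x - 1) * (y - x + 1) by [apply: mulr_ge0; lra]; lra. Qed.

Lemma sum_sqr_le {R : realType} (p q : R) : 0 <= p -> 0 <= q -> p ^+ 2 + q ^+ 2 <= (p + q) ^+ 2.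
Proof. by move=> p0 q0; have := mulr_ge0 p0 q0; lra. Qed.

Section family.
Context {R : realType}.
Variables (n : nat) (bS : R) (yS dyS : R -> R).
Hypothesis n3 : (3 <= n)%N.
Hypothesis n9 : (n <= 9)%N.
Let m : R := n%:R - 2.
Hypothesis singS : sing_sol m bS yS dyS.
Variables (b : R -> R) (y dy : R -> R -> R).
Hypothesis reg : forall rho : R, 0 < rho -> reg_sol n rho (b rho) (y rho) (dy rho).
Hypothesis cont_b : forall rho0 e : R, 0 < rho0 -> 0 < e -> exists2 d, 0 < d &
  forall rho : R, 0 < rho -> `|rho - rho0| < d -> `|b rho - b rho0| < e.
Hypothesis cont_y : forall rho0 e : R, 0 < rho0 -> 0 < e -> exists2 d, 0 < d &
  forall rho : R, 0 < rho -> `|rho - rho0| < d ->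
  forall t : R, t < b rho -> t < b rho0 -> `|y rho t - y rho0 t| <= e.

Let mb rho := Num.min (b rho) bS.
Let D rho t := y rho t - yS t.

(* the sign of the difference at the right end, against that of the [k]-th
   point of an alternation *)
Definition end_sign (k : nat) (rho : R) := if odd k then b rho <= bS else bS <= b rho.

Lemma slope_bound rho1 rho a t : 0 < rho <= rho1 -> a <= t -> t < b rho -> t < bS ->
  `|dy rho t - dyS t| <= expR (2 * bS) * expexp rho1 + expR (- (m * a)) *
     (`|expR (m * a) * dyS a| + expR ((m + 2) * bS) * expexp (yS a) * (bS - a)).
Proof.
move=> /andP[r0 r1] at_ tb tbS.
have m0 : 0 <= m by have := m_ge1 n3 : 1 <= m; lra.
have [solS _] := singS; have [hS1 hS2 hS3 _] := solS.
have [sol hreg] := reg r0.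
rewrite (le_trans (ler_normB _ _))// lerD//.
  have [h _] := hreg t tb; have [_ dneg] : 0 < y rho t /\ dy rho t < 0 by case: sol => _ _ h3 _; exact: h3.
  rewrite ltr0_norm//.
  have h1 : expR (2 * t) * expexp rho / n%:R <= expR (2 * t) * expexp rho.
    by rewrite ler_piMr ?mulr_ge0 ?expR_ge0// invf_le1 ?ler1n ?ltr0n (leq_trans _ n3).
  have h2 : expR (2 * t) * expexp rho <= expR (2 * bS) * expexp rho1.
    apply: ler_pM; [exact: expR_ge0|exact/ltW/expexp_gt0| |exact: expexp_le].
    by rewrite ler_expR ler_pM2l// ltW.
  lra.
have : `|expR (m * t) * dyS t - expR (m * a) * dyS a| <= expR ((m + 2) * bS) * expexp (yS a) * (t - a).
  apply: (@lip_of_deriv _ (fun t => expR (m * t) * dyS t)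
    (fun t => - (expR (m * t) * (expR (2 * t) * expexp (yS t)))) _ _ _ at_) => x /andP[ax xt].
    by have hd := hS2 x (le_lt_trans xt tbS); dtac; ring.
  rewrite normrN ger0_norm ?mulr_ge0 ?expR_ge0// mulrA -expRD ler_pM ?expR_ge0 ?ler_expR//.
    rewrite -mulrDl; exact: (ler_wpM2l (addr_ge0 m0 (ler0n R 2)) (ltW (le_lt_trans xt tbS))).
  by apply: (log_sol_decr solS) => //; lra.
have h1 : expR ((m + 2) * bS) * expexp (yS a) * (t - a) <= expR ((m + 2) * bS) * expexp (yS a) * (bS - a).
  by rewrite ler_wpM2l ?mulr_ge0 ?expR_ge0//; lra.
have h2 : `|expR (m * t) * dyS t| <= `|expR (m * t) * dyS t - expR (m * a) * dyS a| + `|expR (m * a) * dyS a|.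
  by rewrite (le_trans _ (ler_normD _ _))// subrK.
rewrite normrM (ger0_norm (expR_ge0 (m * t))) in h2.
move=> h3.
have h4 : expR (m * a) * `|dyS t| <= expR (m * t) * `|dyS t|.
  by rewrite ler_wpM2r// ler_expR ler_wpM2l.
rewrite -(ler_pM2l (expR_gt0 (m * a))) mulrA -expRD subrr expR0 mul1r.
by lra.
Qed.

(** Constants uniform in [rho] near [rho0]. At [a] the singular solution exceeds all these maxima by
    2, so the squared distance is at least 1 there, and [dist2_growth] keeps it above [c] up to the
    end. Under [end_sign] the difference at the end does not have the sign of the last point, so a
    zero follows that point, or the limit at the end is 0. *)
Lemma rigid rho0 : 0 < rho0 -> exists d h A a : R, [/\ 0 < d, 0 < h, 0 < A &
  forall rho k s, 0 < rho -> `|rho - rho0| < d -> alternates (D rho) (mb rho) k s -> end_sign k rho ->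
    exists z : nat -> R, (forall i, (i < k)%N -> z i + h <= z i.+1) /\
      forall i, (i <= k)%N -> [/\ a + h <= z i, z i <= mb rho & A <= (-1) ^+ i.+1 * D rho (z i - h)]].
Proof.
move=> r0.
have m0 : 0 <= m by have := m_ge1 n3 : 1 <= m; lra.
have [solS HS] := singS; have [hS1 hS2 hS3 hS4] := solS.
pose rho2 := rho0 + 1.
have [T T_b HT] := HS _ (expR_gt0 (- (rho2 + 2))).
have yT t : t <= T -> rho2 + 2 <= yS t.
  by move=> /HT[_ _]; rewrite ler_expR lerN2.
pose a := Num.min T (Num.min (b rho0) bS - 1).
have aT : a <= T by rewrite ge_min lexx.
have a1 : a <= b rho0 - 1.
  have : a <= Num.min (b rho0) bS - 1 by rewrite ge_min lexx orbT.
  have : Num.min (b rho0) bS <= b rho0 by rewrite ge_min lexx.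
  lra.
have a2 : a <= bS - 1.
  have : a <= Num.min (b rho0) bS - 1 by rewrite ge_min lexx orbT.
  have : Num.min (b rho0) bS <= bS by rewrite ge_min lexx orbT.
  lra.
pose K := 1 + (expR (2 * bS) * expexp rho2 + expR (- (m * a)) *
     (`|expR (m * a) * dyS a| + expR ((m + 2) * bS) * expexp (yS a) * (bS - a))).
have K1 : 1 <= K.
  rewrite lerDl addr_ge0 ?mulr_ge0 ?expR_ge0 ?addr_ge0// mulr_ge0 ?mulr_ge0 ?expR_ge0//; lra.
pose G := 1 + 2 * m + expR (2 * bS) * (expR (yS a) * expexp (yS a)).
have G0 : 0 <= G by rewrite !addr_ge0 ?mulr_ge0 ?expR_ge0.
pose c := expR (- G * (bS - a)).
have c0 : 0 < c := expR_gt0 _.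
have c1 : c <= 1 by rewrite -expR0 ler_expR mulNr oppr_le0 mulr_ge0//; lra.
pose h := c / (4 * K).
have h0 : 0 < h by rewrite divr_gt0// mulr_gt0//; lra.
have [d1 d10 hd1] := cont_b r0 (divr_gt0 ltr01 (ltr0Sn _ 1)).
exists (Num.min d1 1), h, (c * h / 2), a.
have A0 : 0 < c * h / 2 by rewrite divr_gt0// mulr_gt0.
split; [by rewrite lt_min d10 ltr01|by []|by []|].
move=> rho k s rp; rewrite lt_min => /andP[rd r1] alt sgn.
have br : `|b rho - b rho0| < 1 / 2 by exact: hd1.
have ab : a < b rho by move: br; rewrite ltr_norml => /andP[]; lra.
have abS : a < bS by lra.
have rr2 : rho <= rho2 by move: r1; rewrite ltr_norml /rho2 => /andP[]; lra.
have [sol hreg] := reg rp; have [h1 h2 h3 h4] := sol.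
have tmb t : t < mb rho -> t < b rho /\ t < bS by rewrite lt_min => /andP[].
have y_le t : t < b rho -> y rho t <= rho2.
  by move=> /hreg[_ /andP[_ q]]; exact: le_trans q rr2.
apply: (@alternation_rigid _ (D rho) (fun t => dy rho t - dyS t) a (mb rho) c K h k s) => //.
- by move=> t /tmb[t1 t2]; have q1 := h1 t t1; have q2 := hS1 t t2; rewrite /D; dtac.
- move=> t /andP[_ /tmb[t1 t2]]; apply: cvgB; [exact: d_cont (h2 t t1)|exact: d_cont (hS2 t t2)].
- move=> t /andP[at_ /tmb[t1 t2]].
  have bd := slope_bound (_ : 0 < rho <= rho2) (ltW at_) t1 t2.
  split; first by apply: (le_trans (bd _)); rewrite ?rp// lerDr.
  have ya : y rho a <= yS a by apply: (le_trans (y_le a ab)); apply: le_trans (yT a aT); rewrite lerDl.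
  have le2 : expR (2 * t) <= expR (2 * bS) by rewrite ler_expR ler_pM2l// ltW.
  have [low _] := dist2_growth m0 sol solS (ltW at_) t1 t2 ya (lexx (yS a)) le2 (erefl G).
  have da : 1 <= dist2 (y rho) (dy rho) yS dyS a.
    by apply: (le_trans (gap_sqr (y_le a ab) (yT a aT))); rewrite /dist2 lerDl sqr_ge0.
  have {}low : c <= dist2 (y rho) (dy rho) yS dyS t.
    apply: le_trans low; rewrite -[c]mul1r ler_pM ?(ltW c0)// ler_expR !mulNr lerN2.
    by rewrite ler_wpM2l// lerD2r ltW.
  rewrite leNgt; apply/negP => hc.
  have : dist2 (y rho) (dy rho) yS dyS t <= (`|D rho t| + `|dy rho t - dyS t|) ^+ 2.
    rewrite /dist2 -/(D rho t) -(real_normK (num_real (D rho t))) -(real_normK (num_real (dy rho t - dyS t))).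
    exact: sum_sqr_le.
  have : (`|D rho t| + `|dy rho t - dyS t|) ^+ 2 < c.
    have p0 : 0 <= `|D rho t| + `|dy rho t - dyS t| by rewrite addr_ge0.
    have : (`|D rho t| + `|dy rho t - dyS t|) ^+ 2 <= (`|D rho t| + `|dy rho t - dyS t|) * 1.
      by rewrite expr2 ler_wpM2l// (le_trans (ltW hc)).
    by rewrite mulr1 => /le_lt_trans; exact.
  by move=> h5 h6; have := le_lt_trans (le_trans low h6) h5; rewrite ltxx.
- by rewrite lt_min ab abS.
- move=> t ta; have := y_le t (le_lt_trans ta ab); have := yT t (le_trans ta aT).
  by rewrite /D; lra.
have [sk _] := alt.2 k (leqnn k); have [sk1 sk2] := tmb _ sk.
(* Equal ends: both solutions tend to 0 there. Otherwise the solution that ends first is below the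
   other near its end. *)
have [be|bn] := eqVneq (b rho) bS.
  right; rewrite /mb -be minxx -(subrr (0 : R)); apply: cvgB; first exact: h4.
  by rewrite be; exact: hS4.
left; move: sgn; rewrite /end_sign -signr_odd.
rewrite /mb; case: (boolP (odd k)) => ok ble /=; rewrite ok /= ?expr0 ?expr1 ?mul1r ?mulN1r.
  have blt : b rho < bS by rewrite lt_neqAle bn.
  rewrite min_l//.
  have [q /andP[q1 q2] yq] := lim_at_end sol sk1 (log_sol_pos solS blt).
  exists q; first by rewrite q1 q2.
  have : yS (b rho) <= yS q by apply: (log_sol_decr solS) => //; exact: ltW.
  by rewrite /D; lra.
have blt : bS < b rho by rewrite lt_neqAle eq_sym bn.
rewrite min_r//.
have [q /andP[q1 q2] yq] := lim_at_end solS sk2 (log_sol_pos sol blt).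
exists q; first by rewrite q1 q2.
have : y rho bS <= y rho q by apply: (log_sol_decr sol) => //; exact: ltW.
by rewrite /D; lra.
Qed.

Lemma alternates_open rho0 k s : 0 < rho0 -> alternates (D rho0) (mb rho0) k s ->
  exists2 d : R, 0 < d & forall rho : R, 0 < rho -> `|rho - rho0| < d -> alternates (D rho) (mb rho) k s.
Proof.
move=> r0 [sinc salt].
have [i ik|e e0 he] := @uniform_pos R (fun i => Num.min (mb rho0 - s i) ((-1) ^+ i.+1 * D rho0 (s i))) k.
  by rewrite lt_min subr_gt0; apply/andP; exact: salt.
have [d1 d10 h1] := cont_b r0 e0.
have [d2 d20 h2] := cont_y r0 (divr_gt0 e0 (ltr0Sn _ 1)).
exists (Num.min d1 d2); first by rewrite lt_min d10.
move=> rho rp; rewrite lt_min => /andP[rd1 rd2]; split => // i ik.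
have := he i ik; rewrite le_min => /andP[f1 f2].
have b0 : mb rho0 <= b rho0 by rewrite ge_min lexx.
have b1 : mb rho0 <= bS by rewrite ge_min lexx orbT.
have s1 : s i < b rho by have := h1 rho rp rd1; rewrite ltr_norml => /andP[]; lra.
have s2 : s i < bS by lra.
have s0 : s i < b rho0 by lra.
split; first by rewrite lt_min s1 s2.
have : `|(-1) ^+ i.+1 * D rho (s i) - (-1) ^+ i.+1 * D rho0 (s i)| <= e / 2.
  rewrite -mulrBr normrM normrX normrN normr1 expr1n mul1r /D opprD addrACA subrr addr0.
  exact: h2.
by rewrite ler_norml => /andP[]; lra.
Qed.

(** If [b - bS] kept its sign beyond [rho0], then for every [k] of the matching parity the existence
    of an alternation would be open and closed in [rho]. It holds for large [rho], hence at
    [rho0 + 1] for all such [k], where [rigid] bounds the number of points. *)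
Lemma no_eventual_sign (o : bool) (rho0 : R) : 0 < rho0 ->
  ~ (forall rho : R, rho0 < rho -> if o then b rho <= bS else bS <= b rho).
Proof.
move=> r0 H.
have H' k rho : odd k = o -> rho0 < rho -> end_sign k rho by rewrite /end_sign => -> /H.
pose r1 := rho0 + 1; have r10 : 0 < r1 by rewrite /r1; lra.
have all k : odd k = o -> exists s, alternates (D r1) (mb r1) k s.
  move=> ok; have [rho2 rho21 ex] := alternation_exists n3 n9 singS k.
  pose r2 := rho2 + r1.
  have r12 : r1 <= r2 by rewrite /r2; lra.
  have {ex} : exists s, alternates (D r2) (mb r2) k s.
    by apply: ex (reg _); rewrite /r2; lra.
  (* Openness is [alternates_open]. For closedness, the points [z i - h] given by [rigid] at a
     nearby parameter carry values at least [A] and lie [h] before the end, so they still alternate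
     at [x]. *)
  apply: (@locally_constant_seg _ (fun r => exists s, alternates (D r) (mb r) k s) r1 r2 r12) => x /andP[x1 x2].
  have x0 : 0 < x by lra.
  have [d [h [A [a [d0 h0 A0 rig]]]]] := rigid x0.
  have [d1 d10 hd1] := cont_b x0 h0.
  have [d2 d20 hd2] := cont_y x0 (divr_gt0 A0 (ltr0Sn _ 1)).
  have [[s alt]|nalt] := pselect (exists s, alternates (D x) (mb x) k s).
    have [d3 d30 h3] := alternates_open x0 alt.
    exists d3 => // z /andP[z1 z2] zx; split => _; last by exists s.
    by exists s; apply: h3 => //; lra.
  exists (Num.min d (Num.min d1 d2)); first by rewrite !lt_min d0 d10.
  move=> r /andP[rr1 rr2]; rewrite !lt_min => /and3P[rd rd1 rd2]; split => // -[s alt].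
  exfalso; apply: nalt.
  have rp : 0 < r by lra.
  have rr0 : rho0 < r by rewrite /r1 in rr1; lra.
  have [z [zinc hz]] := rig r k s rp rd alt (H' k r ok rr0).
  exists (fun i => z i - h); split; first by move=> i ik; have := zinc i ik; lra.
  move=> i ik; have [_ zb zA] := hz i ik.
  have b1 : mb r <= b r by rewrite ge_min lexx.
  have b2 : mb r <= bS by rewrite ge_min lexx orbT.
  have t1 : z i - h < b r by lra.
  have t2 : z i - h < bS by lra.
  have t3 : z i - h < b x by have := hd1 r rp rd1; rewrite ltr_norml => /andP[]; lra.
  split; first by rewrite lt_min t3 t2.
  have : `|(-1) ^+ i.+1 * D r (z i - h) - (-1) ^+ i.+1 * D x (z i - h)| <= A / 2.
    rewrite -mulrBr normrM normrX normrN normr1 expr1n mul1r /D opprD addrACA subrr addr0.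
    exact: hd2.
  by rewrite ler_norml => /andP[]; lra.
(* The [k + 1] points are at least [h] apart between [a] and [bS]; [k] is chosen of parity [o] and
   larger than [(bS - a) / h]. *)
have [d [h [A [a [d0 h0 A0 rig]]]]] := rigid r10.
pose N := Num.bound `|(bS - a) / h|.
pose k := (N.*2 + o)%N.
have ok : odd k = o by rewrite oddD odd_double; case: (o).
have [s alt] := all k ok.
have rr : `|r1 - r1| < d by rewrite subrr normr0.
have r01 : rho0 < r1 by rewrite /r1; lra.
have [z [zinc hz]] := rig r1 k s r10 rr alt (H' k r1 ok r01).
have zk i : (i <= k)%N -> a + h + i%:R * h <= z i.
  elim: i => [|i IH] ik; first by rewrite mul0r addr0; have [] := hz 0%N ik.
  by have := zinc i ik; have := IH (ltnW ik); rewrite -natr1; lra.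
have := zk k (leqnn k); have [_ zb _] := hz k (leqnn k).
have b2 : mb r1 <= bS by rewrite ge_min lexx orbT.
move=> q.
have : k%:R * h <= bS - a by lra.
rewrite leNgt => /negP; apply; rewrite -ltr_pdivrMr//.
apply: (le_lt_trans (ler_norm _)).
have : `|(bS - a) / h| < N%:R by apply: archi_boundP.
move=> /lt_le_trans; apply; rewrite ler_nat /k -addnn -addnA leq_addr//.
Qed.
End family.

(** * Asymptotics of the singular solution *)


Ltac clra := repeat match goal with x := _ |- _ => clearbody x end; lra.

Section asymptotic_arithmetic.
Context {R : realType}.
Implicit Types (L M d m C : R).

Lemma ln_small d M : 0 < d -> 0 <= M -> exists2 L0, 1 <= L0 & forall L, L0 <= L -> 0 <= ln L /\ ln L + M <= d * L.
Proof.
move=> d0 M0; pose s0 := (2 + M) / d + 1.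
have s1 : 1 <= s0 by rewrite lerDr divr_ge0 ?(ltW d0)// addr_ge0.
exists (s0 ^+ 2); first by rewrite exprn_ege1.
move=> L sL.
have L1 : 1 <= L by apply: le_trans sL; rewrite exprn_ege1.
split; first exact: ln_ge0.
have L0 : 0 < L by exact: lt_le_trans L1.
pose s := Num.sqrt L.
have sE : L = s ^+ 2 by rewrite sqr_sqrtr// ltW.
have s_ge : s0 <= s by rewrite -(ler_pXn2r (n := 2)) -?sE// ?nnegrE ?sqrtr_ge0//; lra.
have sp : 0 < s by lra.
have lnL : ln L = 2 * ln s by rewrite sE expr2 lnM ?posrE//; ring.
have lns := ln_sublinear sp.
have : (2 + M) * s <= d * s * s.
  rewrite ler_wpM2r ?(ltW sp)// -ler_pdivrMl// mulrC; rewrite /s0 in s_ge; lra.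
have : M * 1 <= M * s by rewrite ler_wpM2l//; lra.
rewrite lnL sE; lra.
Qed.

Lemma ln_near1 (w d : R) : 0 <= d <= 1 / 2 -> `|w - 1| <= d -> `|ln w| <= 2 * d.
Proof.
move=> /andP[d0 d1]; rewrite !ler_norml => /andP[w1 w2].
have w0 : 0 < w by lra.
have e1 : ln w <= w - 1.
  by have := @le_ln1Dx R (w - 1); rewrite (addrC 1) subrK; apply; lra.
have e2 : ln w^-1 <= w^-1 - 1.
  have wi : 0 < w^-1 by rewrite invr_gt0.
  by have := @le_ln1Dx R (w^-1 - 1); rewrite (addrC 1) subrK; apply; lra.
rewrite lnV ?posrE// in e2.
have e3 : w^-1 <= 1 + 2 * d.
  rewrite -[leLHS]mul1r ler_pdivrMr//.
  have : 0 <= (w - 1 + d) * (1 + 2 * d) by rewrite mulr_ge0//; lra.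
  have : 0 <= d * (1 - 2 * d) by rewrite mulr_ge0//; lra.
  lra.
apply/andP; split; lra.
Qed.

Lemma exp_near0 (e d : R) : 0 <= d <= 1 / 2 -> `|e| <= d -> `|expR e - 1| <= 2 * d.
Proof.
move=> /andP[d0 d1]; rewrite !ler_norml => /andP[w1 w2].
have e1 := expR_ge1Dx e.
have e2 := expR_ge1Dx (- e).
have e0 := expR_gt0 e.
have e3 : expR e * (1 - e) <= 1.
  by rewrite -[leRHS](@expR0 R) -(subrr e) expRD ler_pM2l.
have q0 : 0 <= (expR e) * (d - e) by rewrite mulr_ge0 ?expR_ge0// subr_ge0.
have q2 : expR e * (1 - d) <= 1 by lra.
have q1 : 0 <= d * (1 - 2 * d) by rewrite mulr_ge0//; lra.
have : expR e <= 1 + 2 * d.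
  rewrite leNgt; apply/negP => q4.
  have : (1 + 2 * d) * (1 - d) < expR e * (1 - d) by rewrite ltr_pM2r//; lra.
  lra.
move=> q4; apply/andP; split; lra.
Qed.

Lemma near1_prod3 (a b c d : R) : 0 <= d <= 1 / 4 ->
  `|a - 1| <= d -> `|b - 1| <= d -> `|c - 1| <= d -> `|a * b * c - 1| <= 5 * d.
Proof.
move=> /andP[d0 d1] ha hb hc.
have ab : `|a * b - 1| <= 9 / 4 * d.
  have -> : a * b - 1 = (a - 1) * (b - 1) + (a - 1) + (b - 1) by ring.
  rewrite (le_trans (ler_normD _ _))// (le_trans (lerD (ler_normD _ _) (lexx _)))// normrM.
  have : `|a - 1| * `|b - 1| <= d * (1 / 4) by rewrite ler_pM//; lra.
  lra.
have -> : a * b * c - 1 = (a * b - 1) * (c - 1) + (a * b - 1) + (c - 1) by ring.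
rewrite (le_trans (ler_normD _ _))// (le_trans (lerD (ler_normD _ _) (lexx _)))// normrM.
have : `|a * b - 1| * `|c - 1| <= (9 / 4 * d) * (1 / 4) by rewrite ler_pM//; lra.
lra.
Qed.

Definition profA m L : R := 2 * L + ln (m / L) + ln (1 + ln L / (2 * L)).

(* [y] and [p = `|y'|] follow the prescribed expansions in [L = ln (1/|x|)] *)
Lemma asymptotic_small m C d : 1 <= m -> 0 <= C -> 0 < d -> exists2 L0, 1 <= L0 &
  forall L y p : R, L0 <= L -> `|y - ln (profA m L)| <= C / L ^+ 2 ->
    `|p - L^-1 - ln L / (2 * L ^+ 2)| <= C / L ^+ 2 ->
    [/\ `|expR y + y - 2 * L - ln (2 * m)| <= d, `|2 - (expR y + 1) * p| <= d & expR (- y) <= d].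
Proof.
move=> m1 C0 d0.
pose e := Num.min (d / 50) (1 / 16).
have e0 : 0 < e by rewrite lt_min !divr_gt0.
have ed : e <= d / 50 by rewrite ge_min lexx.
have e1 : e <= 1 / 16 by rewrite ge_min lexx orbT.
clearbody e.
have lm0 : 0 <= ln m by exact: ln_ge0.
have [|L0 L01 HL] := @ln_small e (ln m + C + 2) e0; first by rewrite !addr_ge0.
exists L0 => // L y p LL; have [lnL0 small] := HL L LL.
have Lp : 0 < L by apply: lt_le_trans LL; exact: lt_le_trans L01.
have L1 : 1 <= L by exact: le_trans LL.
pose q := ln L / L.
have q0 : 0 <= q by rewrite divr_ge0// ltW.
have qe : q <= e by rewrite /q ler_pdivrMr//; lra.
have Ce : C / L <= e by rewrite ler_pdivrMr//; lra.
have Li : L^-1 <= e by rewrite -[leLHS]mul1r ler_pdivrMr//; lra.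
have Li0 : 0 < L^-1 by rewrite invr_gt0.
have lnLE : ln L = q * L by rewrite /q divfK// gt_eqF.
pose k := ln (1 + ln L / (2 * L)).
have kq : ln L / (2 * L) = q / 2 by rewrite /q; field; rewrite gt_eqF.
have k0 : 0 <= k by rewrite ln_ge0// kq lerDl divr_ge0.
have ke : k <= e / 2.
  by rewrite /k kq; apply: (le_trans (le_ln1Dx _)); lra.
pose A := profA m L.
have AE : A = 2 * L + ln m - ln L + k.
  by rewrite /A /profA ln_div ?posrE ?(lt_le_trans ltr01 m1)// -/k; ring.
pose w := A / (2 * L).
have wA : A = w * (2 * L) by rewrite /w divfK// mulf_neq0// gt_eqF.
have w1 : `|w - 1| <= e.
  have -> : w - 1 = (ln m - ln L + k) / (2 * L) by rewrite /w AE; field; rewrite gt_eqF.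
  rewrite normrM normfV (gtr0_norm (_ : 0 < 2 * L)) ?mulr_gt0// ler_pdivrMr ?mulr_gt0//.
  rewrite ler_norml; apply/andP; split; lra.
have /andP[wl wu] : - e <= w - 1 <= e by rewrite -ler_norml.
have w0 : 0 < w by lra.
have A0 : 0 < A by rewrite wA mulr_gt0// mulr_gt0.
(* The cancellation behind the expansion: [A] contains [ln m - ln L] and [ln A] contains
   [ln 2 + ln L], so [A + ln A - 2 L - ln (2 m)] reduces to the small terms [k + ln w]. *)
have lnA : ln A = ln w + ln 2 + ln L by have p2 := mulr_gt0 (ltr0Sn R 1) Lp; rewrite {1}wA lnM ?posrE// (@lnM _ 2) ?posrE//; ring.
have lnw : `|ln w| <= 2 * e by apply: ln_near1 => //; clear -e0 e1; apply/andP; split; lra.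
move=> hy hp.
pose z := y - ln A.
have CL2 : C / L ^+ 2 <= e / L by rewrite expr2 invfM mulrA ler_wpM2r// ltW.
have zb : `|z| <= e / L by apply: le_trans hy CL2.
have eL : e / L <= e by rewrite ler_piMr ?(ltW e0)//; clear -Li e1; lra.
have ez : `|expR z - 1| <= 2 * (e / L).
  by apply: exp_near0 => //; rewrite divr_ge0 ?(ltW e0) ?(ltW Lp)//=; clear -eL e1; lra.
have ey : expR y = A * expR z.
  by rewrite /z -{1}(lnK A0) -expRD; congr expR; ring.
have pz : `|p * L - 1| <= 2 * e.
  have pE : p * L - 1 = (p - L^-1 - ln L / (2 * L ^+ 2)) * L + q / 2.
    by rewrite /q; field; rewrite gt_eqF.
  rewrite pE (le_trans (ler_normD _ _))// normrM (gtr0_norm Lp).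
  have h1 : `|p - L^-1 - ln L / (2 * L ^+ 2)| * L <= C / L ^+ 2 * L by rewrite ler_pM2r.
  have h2 : C / L ^+ 2 * L = C / L by field; rewrite gt_eqF.
  have h3 : `|q / 2| = q / 2 by rewrite ger0_norm// divr_ge0.
  by rewrite h3; clear -h1 h2 Ce qe e0; clra.
have ez2 : `|expR z - 1| <= 2 * e by clear -ez eL; clra.
split.
- have -> : expR y + y - 2 * L - ln (2 * m) = A * (expR z - 1) + k + ln w + z.
    have -> : y = z + ln A by rewrite /z subrK.
    by rewrite expRD lnK// lnM ?posrE// ?lnA ?AE//; [ring|clear -m1; lra].
  have h1 : `|A * (expR z - 1)| <= 3 * L * (2 * (e / L)).
    rewrite normrM (gtr0_norm A0) ler_pM ?(ltW A0)// wA.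
    have : w * L <= 17 / 16 * L by rewrite ler_pM2r//; clear -wu e1; clra.
    by move=> hw; clear -hw Lp; clra.
  have h2 : 3 * L * (2 * (e / L)) = 6 * e by field; rewrite gt_eqF.
  rewrite (le_trans (ler_normD _ _))// (le_trans (lerD (ler_normD _ _) (lexx _)))//.
  rewrite (le_trans (lerD (lerD (ler_normD _ _) (lexx _)) (lexx _)))// (ger0_norm k0).
  by rewrite h2 in h1; clear -h1 ke lnw zb eL ed e0; clra.
- have -> : 2 - (expR y + 1) * p = - 2 * (w * expR z * (p * L) - 1) - p.
    by rewrite ey wA; ring.
  rewrite (le_trans (ler_normB _ _))// normrM normrN [ `|2|]ger0_norm//.
  have h1 : `|w * expR z * (p * L) - 1| <= 5 * (2 * e).
    by apply: near1_prod3 => //; [clear -e0 e1; apply/andP; split; lra|clear -w1 e0; clra].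
  have h2 : `|p| <= 2 * e.
    have -> : p = (p * L) * L^-1 by rewrite mulfK// gt_eqF.
    rewrite normrM (gtr0_norm Li0).
    have h : `|p * L| <= 2 by have := ler_normD (p * L - 1) 1; rewrite subrK normr1; clear -pz e1; clra.
    have : `|p * L| * L^-1 <= 2 * L^-1 by rewrite ler_pM2r.
    by move=> hh; clear -hh Li; clra.
  by clear -h1 h2 ed e0; clra.
- rewrite expRN ey invfM.
  have h1 : A^-1 <= e.
    have : L <= A by rewrite wA; have : 1 / 2 * L <= w * L by [rewrite ler_pM2r//; clear -wl e1; clra]; clear; clra.
    by move=> h; apply: le_trans Li; rewrite lef_pV2 ?posrE.
  have h2 : (expR z)^-1 <= 2.
    rewrite -[leLHS]mul1r ler_pdivrMr ?expR_gt0//.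
    by move: ez2; rewrite ler_norml => /andP[]; clear -e1; clra.
  have : A^-1 * (expR z)^-1 <= e * 2 by rewrite ler_pM ?invr_ge0 ?expR_ge0// ltW.
  by clear -ed e0; clra.
Qed.
End asymptotic_arithmetic.

Section singular.
Context {R : realType} {n : nat}.
Implicit Types (r s t : R).
Variables (u : 'rV[R]_n -> R) (l : R) (i0 : 'I_n).
Local Notation e i := (delta_mx 0 i : 'rV[R]_n).
Hypothesis n3 : (3 <= n)%N.
Hypothesis singu : singular_solution l u.

Lemma sing_C2 : class_C 2 (uball `\ 0) u. Proof. by case: singu => -[]. Qed.
Lemma sing_l0 : 0 < l. Proof. by case: singu => -[]. Qed.
Lemma sing_rad : radial (uball `\ 0) u.
Proof.
case: singu => _ [_ _ _ h _] _ _ x y [Dx x0] [Dy y0]; apply: h; split => //; exact: ltW.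
Qed.
Lemma sing_eq x : (uball `\ 0) x -> - laplacian u x = l * expexp (u x).
Proof. by case: singu => _ [h _ _ _ _] _ _; exact: h. Qed.
Let b : R := ln l / 2.

(** Along the transverse line [u] is an even function of [s], so its derivative at 0 is its own
    opposite. *)
Lemma radial_tangential r i : 0 < r < 1 -> i != i0 -> pderiv i u (r *: e i0) = 0.
Proof.
move=> /[dup] r01 /andP[r0 r1] ii0.
have h1 := (is_derive_line _ _ _ _).1 (der1 sing_C2 i (uball0_line i0 r01)).
set d := pderiv _ _ _ in h1 *; set g := (fun s : R => _) in h1.
have h2 : is_derive (0 : R) 1 g (- d).
  have h1' : is_derive (- (0 : R)) 1 g d by rewrite oppr0.
  have h3 : is_derive (0 : R) 1 (fun s => g (- s)) (- d).
    apply: (d_eq (dcomp1 (g := fun s => - s) h1' (dN (dI 0)))); ring.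
  apply: d_ext h3.
  have c : {for (0 : R), continuous (fun s : R => r ^+ 2 + s ^+ 2)}.
    by apply: (@d_cont _ _ _ (2 * 0)); dtac; ring.
  have : \forall s \near (0 : R), r ^+ 2 + s ^+ 2 < 1.
    by apply: (cvgr_lt _ c); rewrite expr0n addr0 expr_lt1// ltW.
  apply: filterS => s rs.
  have Dw (a : R) : a ^+ 2 = s ^+ 2 -> (uball `\ 0) (a *: e i + r *: e i0).
    move=> as2; have rp : 0 < r ^+ 2 + s ^+ 2 by have := sqr_ge0 s; have := exprn_gt0 2 r0; lra.
    split; first by rewrite /uball/= enorm2// as2 -[ltRHS]sqrtr1 ltr_sqrt.
    move=> h; have := enorm2 r a ii0; rewrite h -(scale0r (e i)) enorm1 normr0 as2.
    by move=> /esym/eqP; rewrite sqrtr_eq0 leNgt rp.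
  by apply: sing_rad; rewrite ?enorm2 ?sqrrN//; apply: Dw; rewrite ?sqrrN.
have e1 : 'D_1 g 0 = d by case: h1.
have e2 : 'D_1 g 0 = - d by case: h2.
by lra.
Qed.

Lemma near0_line (P : 'rV[R]_n -> Prop) : (\forall x \near (0 : 'rV[R]_n)^', P x) ->
  exists T : R, forall t, t <= T -> P (expR t *: e i0).
Proof.
move=> H; have H' : nbhs (0 : 'rV[R]_n) (fun x => x != 0 -> P x) by exact: H.
have c : (fun s : R => s *: e i0) @ (0 : R) --> (0 : 'rV[R]_n).
  by rewrite -[X in _ --> X](scale0r (e i0)); apply: cvgZr_tmp; exact: cvg_id.
have /nbhs_ballP[d d0 hd] := c _ H'.
exists (ln (d / 2)) => t tT; apply: (hd (expR t)).
  rewrite /ball/= sub0r normrN gtr0_norm ?expR_gt0//.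
  have dp : 0 < d / 2 by rewrite divr_gt0.
  have : expR t <= d / 2 by rewrite -(lnK dp) ler_expR.
  by move: d0 => /=; lra.
by rewrite scaler_e_eq0 gt_eqF// expR_gt0.
Qed.

Lemma sqrt_l : Num.sqrt l = expR b.
Proof.
apply/eqP; rewrite -(@eqrXn2 _ 2)// ?sqrtr_ge0 ?expR_ge0// sqr_sqrtr ?ltW ?sing_l0//.
rewrite expr2 -expRD (_ : b + b = 2 * (ln l / 2)) ?exp_2b ?sing_l0//.
by rewrite /b; ring.
Qed.

Lemma singular_log : sing_sol (n%:R - 2) b (logprof u b i0) (dlogprof u b i0).
Proof.
have m1 : 1 <= n%:R - 2 :> R by exact: m_ge1.
set m := n%:R - 2 in m1 *.
have l0 := sing_l0.
have [[_ _ cu] [_ u0 upos _ _] asy1 asy2] := singu.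
pose y := logprof u b i0; pose dy := dlogprof u b i0.
have dy1 t : t < b -> is_derive t 1 y (dy t) by exact: (logprof_der1 i0 sing_C2).
have dy2 t : t < b -> is_derive t 1 dy (- m * dy t - expR (2 * t) * expexp (y t)).
  by exact: (logprof_der2 i0 sing_C2 sing_rad sing_eq l0).
have ypos t : t < b -> 0 < y t.
  by move=> tb; apply: upos; apply: uball0_line; exact: logprof_in.
have key d : 0 < d -> exists2 T, T < b & forall t, t <= T ->
    [/\ `|expR (y t) + y t + 2 * t - ln (2 * m)| <= d,
        `|2 - (expR (y t) + 1) * `|dy t| | <= d & expR (- y t) <= d].
  move=> d0.
  have [C1 [C10 H1]] : exists C, 0 <= C /\ \forall x \near (0 : 'rV[R]_n)^',
     `|u ((Num.sqrt l)^-1 *: x) - singular_profile x| <= C * `|(logi x ^+ 2)^-1|.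
    have /eqO_exP[C C0 h] := asy1; by exists C; split => //; exact: ltW.
  have [C2 [C20 H2]] : exists C, 0 <= C /\ \forall x \near (0 : 'rV[R]_n)^',
     `|(Num.sqrt l)^-1 * grad_norm u ((Num.sqrt l)^-1 *: x) - singular_slope x| <=
       C * `|(enorm x * logi x ^+ 2)^-1|.
    have /eqO_exP[C C0 h] := asy2; by exists C; split => //; exact: ltW.
  have [T1 h1] := near0_line H1; have [T2 h2] := near0_line H2.
  have [|L0 L01 HL] := @asymptotic_small R m (C1 + C2) d m1 _ d0; first by rewrite addr_ge0.
  exists (Num.min (- L0) (Num.min (b - 1) (Num.min T1 T2))).
    by rewrite !gt_min; apply/orP; right; apply/orP; left; lra.
  move=> t; rewrite !le_min => /and4P[tL tb1 tT1 tT2].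
  have tb : t < b by lra.
  have xE : (Num.sqrt l)^-1 *: (expR t *: e i0) = expR (t - b) *: e i0.
    by rewrite scalerA sqrt_l -expRN -expRD addrC.
  have en : enorm (expR t *: e i0) = expR t by rewrite enorm1 gtr0_norm ?expR_gt0.
  have lg : logi (expR t *: e i0) = - t by rewrite /logi en -expRN expRK.
  have Lp : 0 < - t by lra.
  have [|||g1 g2 g3] := HL (- t) (y t) `|dy t|; first by lra.
  - have := h1 t tT1; rewrite xE -/(y t) /singular_profile lg => hh.
    apply: (le_trans hh); rewrite ger0_norm ?invr_ge0 ?sqr_ge0//.
    by rewrite ler_wpM2r ?invr_ge0 ?sqr_ge0//; lra.
  - have := h2 t tT2; rewrite xE /singular_slope lg en => hh.
    have gE : grad_norm u (expR (t - b) *: e i0) = `|pderiv i0 u (expR (t - b) *: e i0)|.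
      rewrite /grad_norm (bigD1 i0)//= big1 ?addr0 ?sqrtr_sqr// => i ii0.
      by rewrite radial_tangential ?expr0n// logprof_in.
    have dyE : `|dy t| = expR t * ((Num.sqrt l)^-1 * grad_norm u (expR (t - b) *: e i0)).
      rewrite gE /dy /dlogprof normrM gtr0_norm ?expR_gt0// mulrA sqrt_l -expRN -expRD.
      by congr (expR _ * _).
    set g := _ * grad_norm _ _ in hh dyE.
    have -> : `|dy t| - (- t)^-1 - ln (- t) / (2 * (- t) ^+ 2) =
       expR t * (g - ((expR t * (- t))^-1 + ln (- t) / (2 * expR t * (- t) ^+ 2))).
      rewrite dyE; field; rewrite expR_eq0 lt_eqF//; lra.
    rewrite normrM gtr0_norm ?expR_gt0// -ler_pdivlMl ?expR_gt0//.
    have pp : 0 <= (expR t * (- t) ^+ 2)^-1.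
      by rewrite invr_ge0; apply: mulr_ge0; [exact: expR_ge0|exact: sqr_ge0].
    apply: (le_trans hh); rewrite (ger0_norm pp).
    rewrite invfM !mulrA [_^-1 * _]mulrC ler_wpM2r ?invr_ge0 ?sqr_ge0//.
    by rewrite ler_wpM2r ?invr_ge0 ?expR_ge0//; lra.
  split => //; by move: g1; rewrite mulrN opprK.
(* [e^(m t) y'] is nonincreasing, so [y' >= 0] at one time gives [y' >= 0] at all earlier ones; [y]
   would then be bounded as [t -> -oo], while it tends to infinity. *)
have dyneg t : t < b -> dy t < 0.
  move=> tb; rewrite ltNge; apply/negP => dt.
  have [T Tb HT] := key (expR (- (y t + 1)) ) (expR_gt0 _).
  pose s := Num.min T (t - 1).
  have st : s <= t - 1 by rewrite ge_min lexx orbT.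
  have sT : s <= T by rewrite ge_min lexx.
  have [_ _] := HT s sT; rewrite ler_expR lerN2 => ys.
  suff : y s <= y t by lra.
  apply: (@ge_of_deriv_ge0 _ y dy); first by lra.
    by move=> x /andP[_ xt]; apply: dy1; lra.
  move=> x /andP[sx xt].
  have : expR (m * t) * dy t <= expR (m * x) * dy x.
    apply: (@le_of_deriv_le0 _ (fun z => expR (m * z) * dy z) (fun z => - (expR (m * z) * (expR (2 * z) * expexp (y z)))) _ _ xt) => z /andP[xz zt].
      by have hz := dy2 z (le_lt_trans zt tb); dtac; ring.
    by rewrite oppr_le0 mulr_ge0 ?expR_ge0// mulr_ge0 ?expR_ge0// ltW// expexp_gt0.
  move=> h; have : 0 <= expR (m * x) * dy x by apply: le_trans h; rewrite mulr_ge0// expR_ge0.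
  by rewrite pmulr_rge0// expR_gt0.
split.
  split => //; first by move=> t tb; split; [exact: ypos|exact: dyneg].
  suff bl : u (r *: e i0) @[r --> (1 : R)^'-] --> (0 : R) by exact: (cvg_comp _ _ (shift_exp_lim _) bl).
  apply: (boundary_limit cu _ u0) => r /andP[r0 r1].
  split; first by rewrite /cball/= enorm1 gtr0_norm.
  by move/eqP; rewrite scaler_e_eq0 gt_eqF.
move=> d d0; have [T Tb HT] := key d d0; exists T => // t tT; have [a1 a2 a3] := HT t tT.
split => //; have := dyneg t (le_lt_trans tT Tb) => /ltr0_norm dn; move: a2.
by rewrite dn /emP -/y -/dy mulrN opprK addrC.
Qed.
End singular.

(** * Multiplicity and intersection points *)


Lemma counting_ge {R : realType} (T : choiceType) (X : set T) (k : nat) (f : nat -> T) :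
  (forall i j, (i <= k)%N -> (j <= k)%N -> f i = f j -> i = j) ->
  (forall i, (i <= k)%N -> X (f i)) -> (k.+1%:R%:E <= counting X :> \bar R)%E.
Proof.
move=> inj Xf; rewrite /counting; case: ifPn => [/asboolP finX|_]; last by rewrite leey.
rewrite lee_fin ler_nat; pose s := [seq f i | i <- iota 0 k.+1].
have us : uniq s.
  rewrite map_inj_in_uniq ?iota_uniq// => i j; rewrite !mem_iota !add0n !ltnS /= => ik jk.
  exact: inj.
have -> : k.+1 = size s by rewrite size_map size_iota.
apply: uniq_leq_size => // x /mapP[i]; rewrite mem_iota add0n ltnS /= => ik ->.
by rewrite in_fset_set// mem_set//; exact: Xf.
Qed.

Lemma continuous_delta {R : realType} (f : R -> R) (x e : R) : {for x, continuous f} -> 0 < e ->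
  exists2 d, 0 < d & forall z : R, `|z - x| < d -> `|f z - f x| < e.
Proof.
move=> /cvgrPdistC_lt h e0; have /nbhs_ballP[d /= d0 hd] := h e e0.
by exists d => // z zx; apply: hd; rewrite /ball/= distrC.
Qed.

Section curve.
Context {R : realType} {n : nat}.
Variables (lamS : R) (uS : 'rV[R]_n -> R) (lam : R -> R) (u : R -> 'rV[R]_n -> R) (i0 : 'I_n).
Local Notation ei i := (delta_mx 0 i : 'rV[R]_n).
Hypothesis n3 : (3 <= n)%N.
Hypothesis singu : singular_solution lamS uS.
Hypothesis curve : solution_curve lam u.

Let b rho := ln (lam rho) / 2.
Let bS := ln lamS / 2.
Let y rho := logprof (u rho) (b rho) i0.
Let dy rho := dlogprof (u rho) (b rho) i0.
Let yS := logprof uS bS i0.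
Let dyS := dlogprof uS bS i0.

Lemma curve_log (rho : R) : 0 < rho -> 0 < lam rho /\ reg_sol n rho (b rho) (y rho) (dy rho).
Proof.
move=> r0; have [_ _ h _] := curve; have [sol sup rad] := h rho r0.
by have [l0 ls bd] := regular_log i0 n3 sol rad sup; split => //; split.
Qed.

Lemma curve_sing : sing_sol (n%:R - 2) bS yS dyS.
Proof. exact: singular_log. Qed.

Lemma curve_lam_cont (rho0 : R) : 0 <= rho0 -> forall e : R, 0 < e ->
  exists2 d, 0 < d & forall rho : R, 0 <= rho -> `|rho - rho0| < d -> `|lam rho - lam rho0| < e.
Proof.
move=> r0 e e0; have [_ [cl _] _ _] := curve.
have /subspace_continuousP cl' := cl.
have := cl' rho0; rewrite /= in_itv/= r0 => /(_ isT).
move=> /cvgr_distC_lt /(_ e e0) /nbhs_ballP[d /= d0 hd]; exists d => // rho rho_ge hr.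
apply: hd; first by rewrite /ball/= distrC.
by rewrite /= in_itv/= rho_ge.
Qed.

Lemma curve_cont_b (rho0 e : R) : 0 < rho0 -> 0 < e -> exists2 d, 0 < d &
  forall rho : R, 0 < rho -> `|rho - rho0| < d -> `|b rho - b rho0| < e.
Proof.
move=> r0 e0; have [l0 _] := curve_log r0.
have c : {for lam rho0, continuous (fun l => ln l / 2)}.
  by apply: (@d_cont _ _ _ ((lam rho0)^-1 / 2)); have h := dln l0 (dI (lam rho0)); dtac; ring.
have [d1 d10 h1] := continuous_delta c e0.
have [d d0 hd] := curve_lam_cont (ltW r0) d10; exists d => // rho rp rd.
by apply: h1; apply: hd => //; exact: ltW.
Qed.

Lemma curve_cont_y (rho0 e : R) : 0 < rho0 -> 0 < e -> exists2 d, 0 < d &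
  forall rho : R, 0 < rho -> `|rho - rho0| < d ->
  forall t : R, t < b rho -> t < b rho0 -> `|y rho t - y rho0 t| <= e.
Proof.
move=> r0 e0; have [l0 [sol hreg]] := curve_log r0.
have [_ [_ cu] _ _] := curve.
have e2 : 0 < e / 2 by rewrite divr_gt0.
have /nbhs_ballP[d1 /= d10 h1] := cu rho0 (ltW r0) _ e2.
pose K := 1 + expR (2 * b rho0) * expexp rho0.
have K0 : 0 < K by rewrite addr_gt0// mulr_gt0 ?expR_gt0.
have eK : 0 < e / 2 / K by rewrite divr_gt0.
have [d2 d20 h2] := curve_cont_b r0 eK.
exists (Num.min d1 d2); first by rewrite lt_min d10.
move=> rho rp; rewrite lt_min => /andP[rd1 rd2] t tb tb0.
have lip (s1 s2 : R) : s1 <= s2 -> s2 < b rho0 -> `|y rho0 s2 - y rho0 s1| <= K * (s2 - s1).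
  move=> s12 s2b; case: sol => hd _ hneg _.
  apply: (@lip_of_deriv _ _ (dy rho0) _ _ _ s12) => x /andP[_ xs].
    by apply: hd; exact: le_lt_trans s2b.
  have xb : x < b rho0 by exact: le_lt_trans s2b.
  have [h _] := hreg x xb; have [_ /ltr0_norm ->] := hneg x xb.
  have q1 : expR (2 * x) * expexp rho0 / n%:R <= expR (2 * x) * expexp rho0.
    by rewrite ler_piMr ?mulr_ge0 ?expR_ge0// invf_le1 ?ler1n ?ltr0n (leq_trans _ n3).
  have q2 : expR (2 * x) * expexp rho0 <= expR (2 * b rho0) * expexp rho0.
    by rewrite ler_wpM2r ?expR_ge0// ler_expR ler_wpM2l// ltW.
  by move: h q1 q2; rewrite /K; lra.
(* The curve is continuous at fixed [x], not at fixed [t]: [t'] is the time at which the solution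
   [rho0] has the same [|x|], and the shift is paid for by the Lipschitz bound. *)
pose t' := t - b rho + b rho0.
have t'b : t' < b rho0 by rewrite /t' gtrDr subr_lt0.
have yt' : y rho0 t' = u rho0 (expR (t - b rho) *: ei i0) by rewrite /y /logprof /t' addrK.
have s1 : `|y rho t - y rho0 t'| <= e / 2.
  rewrite yt' /y /logprof; apply: h1; rewrite ?(ltW rp)//; first by rewrite /ball/= distrC.
  by rewrite /cball/= enorm1 gtr0_norm ?expR_gt0// -expR0 ler_expR subr_le0 ltW.
have s2 : `|y rho0 t' - y rho0 t| <= e / 2.
  have le1 : K * `|b rho - b rho0| <= e / 2.
    by rewrite mulrC -ler_pdivlMr//; apply: ltW; exact: h2.
  apply: le_trans le1.
  have [tt|tt] := leP t t'.
    apply: (le_trans (lip _ _ tt t'b)); rewrite ler_wpM2l ?(ltW K0)//.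
    by have := ler_norm (- (b rho - b rho0)); rewrite normrN /t'; lra.
  rewrite distrC; apply: (le_trans (lip _ _ (ltW tt) tb0)); rewrite ler_wpM2l ?(ltW K0)//.
  by rewrite (le_trans _ (ler_norm _))// /t'; lra.
have -> : y rho t - y rho0 t = (y rho t - y rho0 t') + (y rho0 t' - y rho0 t) by ring.
by rewrite (le_trans (ler_normD _ _))//; move: s1 s2; lra.
Qed.

Lemma lam_exp (rho : R) : 0 < rho -> lam rho = expR (2 * b rho).
Proof. by move=> /curve_log[l0 _]; rewrite exp_2b. Qed.

Hypothesis n9 : (n <= 9)%N.

Lemma curve_converges (e : R) : 0 < e ->
  exists2 rho1, 0 < rho1 & forall rho, rho1 <= rho -> `|lam rho - lamS| < e.
Proof.
move=> e0; have l0 : 0 < lamS := sing_l0 singu.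
have c : {for bS, continuous (fun t : R => expR (2 * t))}.
  by apply: (@d_cont _ _ _ (expR (2 * bS) * 2)); dtac; ring.
have [d d0 hd] := continuous_delta c e0.
have d2 : 0 < d / 2 by rewrite divr_gt0.
have [rho1 r1 H] := converge_b n3 curve_sing d2.
have r10 : 0 < rho1 by apply: lt_le_trans r1.
exists rho1 => // rho rr; have rp := lt_le_trans r10 rr.
have [_ reg] := curve_log rp; have := H rho _ _ _ rr reg => bb.
rewrite lam_exp// -(exp_2b l0); apply: hd; apply: (le_lt_trans bb).
by rewrite ltr_pdivrMr// ltr_pMr// ltr1n.
Qed.

Lemma curve_above (rho0 : R) : exists2 rho, rho0 < rho /\ 0 < rho & lamS < lam rho.
Proof.
pose r0 := Num.max rho0 1; have r00 : 0 < r0 by rewrite lt_max ltr01 orbT.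
have reg rho : 0 < rho -> reg_sol n rho (b rho) (y rho) (dy rho) by move=> /curve_log[].
have := @no_eventual_sign _ n bS yS dyS n3 n9 curve_sing b y dy reg curve_cont_b curve_cont_y true r0 r00.
move=> /existsNP[rho] /not_implyP[r0r /negP]; rewrite -ltNge => bb.
have rp := lt_trans r00 r0r; exists rho; first by split => //; apply: le_lt_trans r0r; rewrite le_max lexx.
by rewrite lam_exp// -(exp_2b (sing_l0 singu)) ltr_expR ltr_pM2l.
Qed.

Lemma curve_below (rho0 : R) : exists2 rho, rho0 < rho /\ 0 < rho & lam rho < lamS.
Proof.
pose r0 := Num.max rho0 1; have r00 : 0 < r0 by rewrite lt_max ltr01 orbT.
have reg rho : 0 < rho -> reg_sol n rho (b rho) (y rho) (dy rho) by move=> /curve_log[].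
have := @no_eventual_sign _ n bS yS dyS n3 n9 curve_sing b y dy reg curve_cont_b curve_cont_y false r0 r00.
move=> /existsNP[rho] /not_implyP[r0r /negP]; rewrite -ltNge => bb.
have rp := lt_trans r00 r0r; exists rho; first by split => //; apply: le_lt_trans r0r; rewrite le_max lexx.
by rewrite lam_exp// -(exp_2b (sing_l0 singu)) ltr_expR ltr_pM2l.
Qed.

(** Past any bound [lam] takes values above and below [lamS], hence the value [lamS], and the
    parameter [rho] is the sup norm of the solution. Functions are cut off outside [cball], so that
    distinct extensions of one solution are not counted. *)
Lemma infinitely_many_solutions :
  infinite_set [set v \_ cball | v in @classical_solution R n lamS].
Proof.
move=> fin; have := finite_image sup_norm fin.
move=> /finite_fsetP[F FE].
pose M := \big[Num.max/(0 : R)]_(x <- F) x.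
have [r1 [Mr1 r10] h1] := curve_above M; have [r2 [r12 r20] h2] := curve_below r1.
have cl : {within `[r1, r2], continuous lam}.
  have [_ [cl _] _ _] := curve; apply: continuous_subspaceW cl => x /=.
  by rewrite !in_itv/= => /andP[x1 _]; rewrite andbT; exact: le_trans (ltW r10) x1.
have [|c + lc] := IVT (ltW r12) cl (v := lamS).
  by rewrite ge_min (ltW h2) orbT le_max (ltW h1).
rewrite in_itv/= => /andP[c1 _].
have c0 : 0 < c by exact: lt_le_trans c1.
have [_ _ h _] := curve; have [solc supc _] := h c c0; rewrite lc in solc.
have supE : sup_norm (u c \_ cball) = c.
  rewrite -[RHS]supc /sup_norm; congr sup; apply/seteqP; split => _ [x Dx <-]; exists x => //;
    by rewrite patchE mem_set//; exact: ltW.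
have : c \in F.
  have : [set` F] c.
    by rewrite -FE; exists (u c \_ cball) => //; exists (u c).
  by [].
move=> cF; have : c <= M by rewrite /M; apply: le_bigmax_seq.
by move=> cM; have := lt_le_trans Mr1 (le_trans c1 cM); rewrite ltxx.
Qed.

Lemma intersections_to_infinity :
  counting (intersection_radii (u rho) uS) @[rho --> +oo%R] --> (+oo : \bar R)%E.
Proof.
apply/cvgeyPge => M.
have [k Mk] : exists k, (M%:E <= k.+1%:R%:E :> \bar R)%E.
  exists (Num.bound `|M|); rewrite lee_fin (le_trans (ler_norm _))//.
  by rewrite (le_trans (ltW (archi_boundP _)))// ler_nat leqnSn.
have [rho1 r1 H] := intersections_exist n3 n9 curve_sing k.
have r10 : 0 < rho1 by apply: lt_le_trans r1.
exists rho1; split; first exact: num_real.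
move=> rho /ltW rr; have rp := lt_le_trans r10 rr.
have [l0 reg] := curve_log rp; have [s [sinc hs]] := H rho _ _ _ rr reg.
apply: (le_trans Mk); apply: (@counting_ge _ _ _ _ (fun i => expR (s i - b rho))).
  have mono i j : (i < j)%N -> (j <= k)%N -> s i < s j.
    elim: j => // j IH; rewrite ltnS leq_eqVlt => /predU1P[-> /sinc//|ij jk].
    by apply: lt_trans (sinc j jk); apply: IH => //; exact: ltnW.
  move=> i j ik jk eE; case: (ltngtP i j) => // ij.
    by have := mono i j ij jk; rewrite -(ltrD2r (- b rho)) -ltr_expR eE ltxx.
  by have := mono j i ij ik; rewrite -(ltrD2r (- b rho)) -ltr_expR eE ltxx.
move=> i ik; have [sb se] := hs i ik; split; first exact: logprof_in.
move=> x xe; have r01 := logprof_in sb.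
have [_ _ h _] := curve; have [_ _ rad] := h rho rp.
have [_ [_ _ _ radS _] _ _] := singu.
have eE : enorm (expR (s i - b rho) *: ei i0) = expR (s i - b rho) by rewrite enorm1 gtr0_norm ?expR_gt0.
have cx : cball x by rewrite /cball/= xe; case/andP: r01 => _ /ltW.
have ce : cball (expR (s i - b rho) *: ei i0) by rewrite /cball/= eE; case/andP: r01 => _ /ltW.
rewrite (rad x (expR (s i - b rho) *: ei i0))// ?eE//.
rewrite (radS x (expR (s i - b rho) *: ei i0)) ?eE//.
- by move: se; rewrite /y /yS /logprof (_ : s i - (b rho - bS) - bS = s i - b rho)//; ring.
- by split => // x0; move: xe; rewrite x0 -(scale0r (ei i0)) enorm1 normr0; move: r01 => /andP[/lt_eqF h1 _] /eqP; rewrite h1.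
- by split => // /eqP; rewrite scaler_e_eq0 gt_eqF// expR_gt0.
Qed.
End curve.

(** * Comparison at finitely many nodes *)


Lemma cvg_finite_sum {R : realType} (T I : Type) (F : set_system T) {FF : Filter F} (r : seq I)
  (f : I -> T -> R) (l : I -> R) : (forall i, f i x @[x --> F] --> l i) ->
  \sum_(i <- r) f i x @[x --> F] --> \sum_(i <- r) l i.
Proof.
move=> h; elim: r => [|i r IH].
  rewrite big_nil (_ : (fun _ => _) = fun=> 0); [exact: cvg_cst|by apply/funext => t; rewrite big_nil].
rewrite big_cons (_ : (fun _ => _) = fun x => f i x + \sum_(j <- r) f j x); first exact: cvgD.
by apply/funext => t; rewrite big_cons.
Qed.

Section row_sums.
Context {R : realType} {p : nat}.
Implicit Types (M : 'M[R]_p) (c : R).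

Definition row_sum_le M c := forall i, \sum_j `|M i j| <= c.

Lemma row_sum_leM M1 M2 c1 c2 : row_sum_le M1 c1 -> row_sum_le M2 c2 ->
  row_sum_le (M1 *m M2) (c1 * c2).
Proof.
move=> h1 h2 i.
apply: (@le_trans _ _ (\sum_j \sum_k `|M1 i k| * `|M2 k j|)).
  apply: ler_sum => j _; rewrite mxE (le_trans (ler_norm_sum _ _ _))// ler_sum// => k _.
  by rewrite normrM.
rewrite exchange_big/= (@le_trans _ _ (\sum_k `|M1 i k| * c2))//.
  by apply: ler_sum => k _; rewrite -mulr_sumr ler_wpM2l.
rewrite -mulr_suml ler_wpM2r// (le_trans _ (h2 i))// sumr_ge0//.
Qed.

(** Writes the row-sum norm as a maximum of finitely many linear functionals, which can be
    differentiated along the solutions. *)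
Lemma sum_norm_signs (y : 'I_p -> R) c : \sum_j `|y j| <= c <->
  forall s : {ffun 'I_p -> bool}, \sum_j (-1) ^+ s j * y j <= c.
Proof.
split=> [h s|h].
  by apply: le_trans h; apply: ler_sum => j _; rewrite (le_trans (ler_norm _))// normrM normrX normrN normr1 expr1n mul1r.
apply: le_trans (h [ffun j => y j < 0]); apply: ler_sum => j _; rewrite ffunE.
case: ltrP => y0 /=; first by rewrite expr1 mulN1r ltr0_norm.
by rewrite expr0 mul1r ger0_norm.
Qed.
End row_sums.

(* Evaluation at the nodes, in the basis of rescaled Newton polynomials, identifies
   functions on the nodes with upper triangular matrices whose entries are the
   divided differences times powers of [d]; the row-sum norm of these matrices is
   submultiplicative with constants that do not depend on the number of nodes. *)
Section nodes.
Context {R : realType} {N : nat}.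
Variables (x : 'I_N.+1 -> R) (g r d : R).
Hypothesis injx : injective x.
Hypothesis near_g : forall i, `|x i - g| <= r.
Hypothesis d0 : 0 < d.
Implicit Types (f h : 'I_N.+1 -> R) (c : R).

Let B : 'M[R]_N.+1 := \matrix_(j, i) \prod_(k < N.+1 | (k < j)%N) ((x i - x k) / d).
Let Bi := invmx B.
Let Phi f : 'M[R]_N.+1 := B *m diag_mx (\row_i f i) *m Bi.

Let B_lt (j i : 'I_N.+1) : (i < j)%N -> B j i = 0.
Proof. by move=> ij; rewrite mxE (bigD1 i)//= subrr mul0r mul0r. Qed.

Let B_diag (j : 'I_N.+1) : B j j != 0.
Proof.
rewrite mxE; apply/prodf_neq0 => k kj; apply: mulf_neq0; last by rewrite invr_eq0 gt_eqF.
rewrite subr_eq0.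
by apply/negP => /eqP /injx jk; rewrite jk ltnn in kj.
Qed.

Let B_unit : B \in unitmx.
Proof.
rewrite unitmxE -det_tr det_trig.
  by rewrite unitfE; apply/prodf_neq0 => j _; rewrite mxE.
by apply/is_trig_mxP => i j ij; rewrite mxE B_lt.
Qed.

Let PhiM f h : Phi (fun k => f k * h k) = Phi f *m Phi h.
Proof.
have -> : Phi f *m Phi h = B *m diag_mx (\row_i f i) *m (Bi *m B) *m diag_mx (\row_i h i) *m Bi.
  by rewrite /Phi !mulmxA.
rewrite mulVmx// mulmx1 -[_ *m diag_mx _ *m diag_mx _]mulmxA mulmx_diag.
by congr (_ *m diag_mx _ *m _); apply/rowP => i; rewrite !mxE.
Qed.

Let Phi_entry f j i : Phi f j i = \sum_k B j k * Bi k i * f k.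
Proof.
rewrite /Phi mxE; apply: eq_bigr => k _; rewrite mul_mx_diag !mxE; ring.
Qed.

(** The functional that applies the signs [l.2] to row [l.1] of [Phi f]. [node_le f c] thus says
    that the row-sum norm of [Phi f] is at most [c], in a form that is linear in [f] for each
    [l]. *)
Definition node_functional (l : 'I_N.+1 * {ffun 'I_N.+1 -> bool}) (k : 'I_N.+1) : R :=
  \sum_i (-1) ^+ l.2 i * (B l.1 k * Bi k i).

Definition node_le f c := forall l, \sum_k node_functional l k * f k <= c.

Lemma node_leP f c : node_le f c <-> row_sum_le (Phi f) c.
Proof.
have E j s : \sum_k node_functional (j, s) k * f k = \sum_i (-1) ^+ s i * Phi f j i.
  rewrite /node_functional /=; under eq_bigr do rewrite mulr_suml.
  rewrite exchange_big/=; apply: eq_bigr => i _; rewrite Phi_entry mulr_sumr.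
  by apply: eq_bigr => k _; rewrite !mulrA.
split=> [h j|h [j s]]; first by apply/sum_norm_signs => s; rewrite -E; exact: h.
by rewrite E; apply: (sum_norm_signs _ _).1; exact: h.
Qed.

Lemma node_leN f c : node_le f c -> node_le (fun k => - f k) c.
Proof.
move=> /node_leP h; apply/node_leP => j; apply: le_trans (h j).
by apply: ler_sum => i _; rewrite !Phi_entry; under eq_bigr do rewrite mulrN; rewrite sumrN normrN.
Qed.

Lemma node_leD f h c1 c2 : node_le f c1 -> node_le h c2 -> node_le (fun k => f k + h k) (c1 + c2).
Proof.
move=> hf hh l; under eq_bigr do rewrite mulrDr.
by rewrite big_split/= lerD.
Qed.

Lemma node_leZ f c (a : R) : 0 <= a -> node_le f c -> node_le (fun k => a * f k) (a * c).
Proof. by move=> a0 h l; under eq_bigr do rewrite mulrCA; rewrite -mulr_sumr ler_wpM2l. Qed.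

Lemma node_leM f h c1 c2 : node_le f c1 -> node_le h c2 -> node_le (fun k => f k * h k) (c1 * c2).
Proof.
by move=> /node_leP h1 /node_leP h2; apply/node_leP; rewrite PhiM; exact: row_sum_leM.
Qed.

Lemma node_le_cst (a : R) : node_le (fun=> a) `|a|.
Proof.
apply/node_leP => j; have -> : Phi (fun=> a) = a%:M.
  rewrite /Phi (_ : \row_i _ = const_mx a); last by apply/rowP => i; rewrite !mxE.
  by rewrite diag_const_mx -scalemx1 -scalemxAr -scalemxAl mulmx1 mulmxV.
rewrite (bigD1 j)//= !mxE eqxx mulr1n big1 ?addr0// => i ij.
by rewrite !mxE eq_sym (negbTE ij) mulr0n normr0.
Qed.

(** Multiplication by [x - x j] sends the [j]-th rescaled Newton polynomial to [d] times the next
    one, so the matrix is bidiagonal with diagonal [x j - g] and superdiagonal [d]. In the last row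
    the superdiagonal is absent, the next polynomial vanishing at all nodes. *)
Lemma node_le_id : node_le (fun k => x k - g) (r + d).
Proof.
apply/node_leP; pose X : 'M[R]_N.+1 :=
  \matrix_(j, i) ((x j - g) *+ (i == j) + d *+ ((i : nat) == j.+1)).
have -> : Phi (fun k => x k - g) = X.
  rewrite /Phi (_ : _ *m diag_mx _ = X *m B) ?mulmxK//.
  apply/matrixP => j i; rewrite mul_mx_diag 2!mxE [RHS]mxE.
  have [jN|jN] := ltnP j N.
    pose j1 := Ordinal (jN : (j.+1 < N.+1)%N).
    have jj1 : j1 != j by apply/eqP => /(congr1 val)/= /eqP; rewrite eqn_leq ltnn.
    rewrite [RHS](bigD1 j)//= [X in _ = _ + X](bigD1 j1)//= [X in _ = _ + (_ + X)]big1 ?addr0; last first.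
      move=> k /andP[kj kj1]; rewrite mxE (negbTE kj) mulr0n add0r.
      by rewrite (_ : (k : nat) == j.+1 = false) ?mulr0n ?mul0r//; apply: contraNF kj1 => /eqP e; apply/eqP/val_inj.
    rewrite !mxE eqxx (negbTE jj1) eqxx mulr1n mulr0n add0r.
    rewrite (_ : ((j : nat) == j.+1) = false) ?mulr0n ?addr0; last by rewrite eqn_leq ltnn andbF.
    have -> : \prod_(k < N.+1 | (k < j1)%N) ((x i - x k) / d) =
              ((x i - x j) / d) * \prod_(k < N.+1 | (k < j)%N) ((x i - x k) / d).
      rewrite (bigD1 j)//=; congr (_ * _); apply: eq_bigl => k.
      by rewrite ltnS leq_eqVlt andb_orl/= -val_eqE/= andbN/= andb_idr// => /ltn_eqF ->.
    by rewrite mulrA mulr1n; field; rewrite gt_eqF.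
  have jE : (j : nat) = N by apply/eqP; rewrite eqn_leq jN -ltnS ltn_ord.
  rewrite [RHS](bigD1 j)//= [X in _ = _ + X]big1 ?addr0; last first.
    move=> k kj; rewrite mxE (negbTE kj) mulr0n add0r.
    by rewrite (_ : (k : nat) == j.+1 = false) ?mulr0n ?mul0r//; rewrite jE ltn_eqF.
  rewrite !mxE eqxx mulr1n (_ : ((j : nat) == j.+1) = false) ?mulr0n ?addr0; last by rewrite eqn_leq ltnn andbF.
  have [->|ij] := eqVneq i j; first by rewrite mulrC.
  rewrite (bigD1 i)/=; first by rewrite subrr !mul0r mulr0.
  by rewrite ltn_neqAle ij jE -ltnS ltn_ord.
move=> j; apply: (@le_trans _ _ (\sum_i (`|x j - g| *+ (i == j) + d *+ ((i : nat) == j.+1)))).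
  apply: ler_sum => i _; rewrite mxE (le_trans (ler_normD _ _))// !normrMn (gtr0_norm d0)//.
rewrite big_split/= lerD//.
  by rewrite (bigD1 j)//= eqxx mulr1n big1 ?addr0// => i /negbTE ->.
have [jN|jN] := ltnP j N.
  pose j1 := Ordinal (jN : (j.+1 < N.+1)%N).
  rewrite (bigD1 j1)//= eqxx mulr1n big1 ?addr0// => i ij.
  by rewrite (_ : (i : nat) == j.+1 = false)//; apply: contraNF ij => /eqP e; apply/eqP/val_inj.
rewrite big1 ?(ltW d0)// => i _; rewrite (_ : (i : nat) == j.+1 = false)//.
by rewrite ltn_eqF// ltnS (leq_trans _ jN)// -ltnS ltn_ord.
Qed.

(** A function supported at the last node is its top divided difference times the last Newton
    polynomial, a product of [N] factors of size at most [2 r / d]; this is where a gain geometric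
    in [N] appears. *)
Lemma node_le_last f c : node_le f c -> (forall i : 'I_N.+1, i != ord_max -> f i = 0) ->
  `|f ord_max| <= c * (2 * r / d) ^+ N.
Proof.
move=> /node_leP h f0.
have BN : B ord_max ord_max * Bi ord_max ord_max = 1.
  have := mulmxV B_unit; rewrite -/Bi => /matrixP /(_ ord_max ord_max).
  rewrite mxE [1%:M _ _]mxE eqxx (bigD1 ord_max)//= big1 ?addr0// => i im.
  by rewrite B_lt ?mul0r// ltn_neqAle -ltnS ltn_ord andbT.
have E : Phi f ord0 ord_max * B ord_max ord_max = f ord_max.
  rewrite Phi_entry (bigD1 ord_max)//= big1 ?addr0; last by move=> k kN; rewrite f0// mulr0.
  have -> : B ord0 ord_max = 1 by rewrite mxE big1.
  by rewrite mul1r mulrAC [_ * B _ _]mulrC BN mul1r.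
rewrite -E normrM ler_pM//.
  apply: le_trans (h ord0); rewrite (bigD1 ord_max)//= lerDl; exact: sumr_ge0.
have r0 : 0 <= r by exact: le_trans (near_g ord0).
rewrite mxE normr_prod (_ : (2 * r / d) ^+ N = \prod_(k < N.+1 | (k < N)%N) (2 * r / d)); last first.
  by rewrite (big_ord_narrow (leqnSn N)) prodr_const card_ord.
apply: ler_prod => k _; rewrite normr_ge0 normrM normfV (gtr0_norm d0)/= ler_pM2r ?invr_gt0//.
have -> : x ord_max - x k = (x ord_max - g) - (x k - g) by ring.
rewrite (le_trans (ler_normB _ _))//.
by have := near_g ord_max; have := near_g k; lra.
Qed.

Lemma node_le_lim (T : Type) (F : set_system T) {FF : ProperFilter F}
    (f : T -> 'I_N.+1 -> R) (c : T -> R) f0 c0 :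
  (\forall t \near F, node_le (f t) (c t)) -> (forall k, f t k @[t --> F] --> f0 k) ->
  c t @[t --> F] --> c0 -> node_le f0 c0.
Proof.
move=> fc ff cc l.
have h : \sum_k node_functional l k * f t k @[t --> F] --> \sum_k node_functional l k * f0 k.
  apply: (@cvg_finite_sum R T _ F _ _ (fun k t => node_functional l k * f t k)
    (fun k => node_functional l k * f0 k)) => k.
  by apply: cvgM; [exact: cvg_cst|exact: ff].
rewrite -subr_ge0; apply: (cvgr_to_ge (cvgB cc h)); apply: filterS fc => t ft.
by rewrite subr_ge0; exact: ft.
Qed.

(** [e^a - 1] has nonnegative Taylor coefficients, so the bound passes through its partial sums by
    submultiplicativity. *)
Lemma node_le_expm1 f c : node_le f c -> node_le (fun k => expR (f k) - 1) (expR c - 1).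
Proof.
move=> fc; pose S (a : R) n := \sum_(0 <= i < n) a ^+ i.+1 / i.+1`!%:R.
have cvgS a : S a n @[n --> \oo] --> expR a - 1.
  have h : series (exp_coeff a) n.+1 - 1 @[n --> \oo] --> expR a - 1.
    apply: cvgB; last exact: cvg_cst.
    by rewrite (cvg_shiftS (series (exp_coeff a))); exact: is_cvg_series_exp_coeff.
  apply: cvg_trans h; apply: near_eq_cvg; apply: nearW => n.
  by rewrite /series/= big_nat_recl// /exp_coeff/= expr0 fact0 divr1 addrC addKr.
apply: (@node_le_lim _ \oo _ (fun n k => S (f k) n) (fun n => S c n)) => //; apply: nearW => n.
rewrite /S; elim: n => [|n IH].
  rewrite big_geq// -[X in node_le _ X](normr0 R).
  by under eq_fun do rewrite big_geq//; exact: node_le_cst.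
rewrite big_nat_recr//=; under eq_fun do rewrite big_nat_recr//=.
apply: node_leD => //; under eq_fun do rewrite mulrC; rewrite mulrC.
apply: node_leZ; first by rewrite invr_ge0.
elim: n.+1 => [|j IHj].
  rewrite expr0 -[X in node_le _ X](normr1 R).
  by under eq_fun do rewrite expr0; exact: node_le_cst.
by rewrite exprS; under eq_fun do rewrite exprS; exact: node_leM.
Qed.

(** The increment is [expexp v] times a composition of two functions of the form [e^a - 1], each
    with a nonnegative factor. *)
Lemma node_le_expexp f c (v : R) : node_le f c ->
  node_le (fun k => expexp (v + f k) - expexp v) (expexp (v + c) - expexp v).
Proof.
move=> fc.
have E a : expexp (v + a) - expexp v = expexp v * (expR (expR v * (expR a - 1)) - 1).
  rewrite mulrBr mulr1; congr (_ - _); rewrite /expexp -expRD; congr expR.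
  by rewrite expRD; ring.
under eq_fun do rewrite E; rewrite E; apply: node_leZ; first exact: expR_ge0.
by apply: node_le_expm1; apply: node_leZ; [exact: expR_ge0|exact: node_le_expm1].
Qed.
End nodes.

(** * Comparison of solutions of the initial value problem at the nodes *)

Section ivp_comparison.
Context {R : realType}.
Implicit Types (s rho S : R).

(* the initial value problem for radial solutions, in the variable [s = sqrt lambda |x|] *)
Definition radial_ivp (n : nat) rho S (v p : R -> R) := [/\ v 0 = rho, p 0 = 0,
  forall s, 0 <= s < S -> is_derive s 1 v (p s) &
  forall s, 0 <= s < S -> is_derive s 1 (fun s => s ^+ n.+1 * p s) (- (s ^+ n.+1 * expexp (v s)))].

Lemma is_derive_ext (f h : R -> R) s a : f =1 h -> is_derive s 1 f a -> is_derive s 1 h a.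
Proof. by move=> /funext ->. Qed.

Lemma continuous_bigmax (T : Type) (r : seq T) (h : T -> R -> R) (a s : R) :
  (forall i, {for s, continuous (h i)}) ->
  {for s, continuous (fun s => \big[Num.max/a]_(i <- r) h i s)}.
Proof.
move=> ch; elim: r => [|i r IH].
  by rewrite (_ : (fun _ => _) = fun=> a); [exact: cvg_cst|apply/funext => t; rewrite big_nil].
rewrite (_ : (fun _ => _) = (h i) \max (fun s => \big[Num.max/a]_(j <- r) h j s)); last first.
  by apply/funext => t; rewrite big_cons.
exact: continuous_max.
Qed.

Lemma radial_ivp_slope_le n S (q dq : R -> R) s : 0 < s -> s < S ->
  (forall s, 0 <= s < S -> is_derive s 1 (fun s => s ^+ n.+1 * q s) (dq s)) ->
  (forall z, 0 <= z <= s -> 0 <= dq z) -> 0 <= q s.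
Proof.
move=> s0 sS hd hp.
have : 0 ^+ n.+1 * q 0 <= s ^+ n.+1 * q s.
  apply: (@ge_of_deriv_ge0 _ (fun s => s ^+ n.+1 * q s) dq _ _ (ltW s0)) => [z /andP[z0 zs]|].
    by apply: hd; rewrite z0 (le_lt_trans zs).
  exact: hp.
by rewrite exprS mul0r mul0r pmulr_rge0// exprn_gt0.
Qed.

Lemma radial_ivp_le n rho S v p s : radial_ivp n rho S v p -> 0 <= s < S -> v s <= rho.
Proof.
move=> [<- p0 hv hp] /andP[s0 sS].
apply: (@le_of_deriv_le0 _ v p) => // z /andP[z0 zs].
  by apply: hv; rewrite z0 (le_lt_trans zs).
move: z0; rewrite le_eqVlt => /predU1P[<-|z0]; first by rewrite p0.
rewrite -oppr_ge0; apply: (@radial_ivp_slope_le n S (fun s => - p s) (fun s => s ^+ n.+1 * expexp (v s))) => //.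
- exact: le_lt_trans sS.
- move=> w wS; have h := hp w wS; have := dN h.
  by rewrite opprK; apply: is_derive_ext => t; rewrite mulrN.
- by move=> w /andP[w0 _]; rewrite mulr_ge0 ?exprn_ge0 ?expR_ge0.
Qed.

(** The node norm of [vs - v] is compared with [Y = 2 (r + d) e^(C s^2)]. It starts at [r + d] or
    less; as long as it is below [Y <= 1], [node_le_expexp] bounds that of the nonlinear term by
    [C Y], and two integrations keep the solution below [Y]. No constant depends on [N]. *)
Lemma node_comparison (N n : nat) (x : 'I_N.+1 -> R) (g r d S : R) v p (vs ps : 'I_N.+1 -> R -> R) :
  injective x -> (forall i, `|x i - g| <= r) -> 0 < d ->
  2 * (r + d) * expR (expR (g + 1) * expexp (g + 1) * S ^+ 2) <= 1 ->
  radial_ivp n g S v p -> (forall i, radial_ivp n (x i) S (vs i) (ps i)) ->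
  forall s, 0 <= s < S -> node_le x d (fun k => vs k s - v s) 1.
Proof.
move=> injx nx d0 small iv ivs s1 /andP[s10 s1S].
set C := expR (g + 1) * expexp (g + 1) in small.
have C0 : 0 < C by rewrite mulr_gt0 ?expR_gt0.
have r0 : 0 <= r by exact: le_trans (nx ord0).
pose e := 2 * (r + d); have e0 : 0 < e by rewrite mulr_gt0// ltr_wpDl.
pose Y s := e * expR (C * s ^+ 2).
have Y0 s : 0 < Y s by rewrite mulr_gt0 ?expR_gt0.
have Y1 s : 0 <= s < S -> Y s <= 1.
  move=> /andP[s0 sS]; apply: le_trans small; rewrite ler_pM2l// ler_expR ler_pM2l//.
  by rewrite ler_pXn2r ?nnegrE// ?ltW// (le_lt_trans s0).
have dY s : is_derive s 1 Y (2 * C * s * Y s) by rewrite /Y; dtac; ring.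
pose c l k := node_functional x d l k.
pose a l s := \sum_k c l k * (vs k s - v s).
pose q l s := \sum_k c l k * (ps k s - p s).
have [v0 p0 hv hp] := iv.
have dsum (l : 'I_N.+1 * {ffun 'I_N.+1 -> bool}) (F dF : 'I_N.+1 -> R -> R) (s : R) :
    (forall k, is_derive s 1 (F k) (dF k s)) ->
    is_derive s 1 (fun s => \sum_k c l k * F k s) (\sum_k c l k * dF k s).
  move=> h; have := @is_derive_sum R R R N.+1 (fun k s => c l k * F k s) s 1 (fun k => c l k * dF k s).
  move=> hs; apply: (@is_derive_ext (\sum_k (fun s => c l k * F k s))).
    by move=> t; rewrite fct_sumE.
have da l s : 0 <= s < S -> is_derive s 1 (a l) (q l s).
  move=> sS; apply: (dsum l (fun k s => vs k s - v s) (fun k s => ps k s - p s)) => k.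
  have [_ _ hvk _] := ivs k.
  by apply: dD; [exact: hvk|apply: dN; exact: hv].
have dq l s : 0 <= s < S -> is_derive s 1 (fun s => s ^+ n.+1 * q l s)
    (- (s ^+ n.+1 * \sum_k c l k * (expexp (vs k s) - expexp (v s)))).
  move=> sS.
  have h : is_derive s 1 (fun s => \sum_k c l k * (s ^+ n.+1 * ps k s - s ^+ n.+1 * p s))
     (\sum_k c l k * (- (s ^+ n.+1 * expexp (vs k s)) - - (s ^+ n.+1 * expexp (v s)))).
    apply: (dsum l (fun k s => s ^+ n.+1 * ps k s - s ^+ n.+1 * p s)
      (fun k s => - (s ^+ n.+1 * expexp (vs k s)) - - (s ^+ n.+1 * expexp (v s)))) => k.
    by have [_ _ _ hpk] := ivs k; apply: dD; [exact: hpk|apply: dN; exact: hp].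
  apply: (d_eq (is_derive_ext _ h)).
    by move=> t; rewrite mulr_sumr; apply: eq_bigr => k _; ring.
  by rewrite mulr_sumr -sumrN; apply: eq_bigr => k _; ring.
have q0 l : q l 0 = 0.
  by rewrite /q big1// => k _; have [_ pk0 _ _] := ivs k; rewrite pk0 p0 subrr mulr0.
have a0 l : a l 0 < Y 0.
  have -> : a l 0 = \sum_k c l k * (x k - g).
    by apply: eq_bigr => k _; have [-> _ _ _] := ivs k; rewrite v0.
  apply: (le_lt_trans (node_le_id injx nx d0 l)).
  by rewrite /Y expr0n mulr0 expR0 mulr1 /e ltr_pMl// ?ltr1n// ltr_wpDl.
(* One function for the whole family, so that [first_exit] applies; the default value [-1] lies
   below the threshold 0. *)
pose F s := \big[Num.max/(- 1 : R)]_(l : 'I_N.+1 * {ffun 'I_N.+1 -> bool}) (a l s - Y s).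
have F_le s z : z > -1 -> (F s < z) <-> (forall l, a l s - Y s < z).
  by move=> z1; split=> [/bigmax_ltP[_ h] l|h]; [exact: h|apply/bigmax_ltP; split].
suff : F s1 < 0.
  move=> /F_le h l; have := h _ l; rewrite -/(a l s1) ltrN10 => /(_ isT).
  by rewrite subr_lt0 => /ltW /le_trans; apply; apply: Y1; rewrite s10.
apply: (@first_exit _ F 0 s1 0 s10); last by rewrite s10 lexx.
- move=> s /andP[s0 ss1]; apply: continuous_bigmax => l.
  have sS : 0 <= s < S by rewrite s0 (le_lt_trans ss1).
  by have h1 := da l s sS; have h2 := dY s; apply: (@d_cont _ _ _ (q l s - 2 * C * s * Y s)); dtac.
- by apply/F_le => // l; rewrite subr_lt0.
move=> s /andP[s0 ss1] H; apply/F_le => // l.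
have sS : s < S by exact: le_lt_trans s1S.
have bound z : 0 <= z <= s -> node_le x d (fun k => vs k z - v z) (Y z).
  move=> zs l'; rewrite -subr_le0 -/(c _ _).
  by apply: le_trans (H z zs); rewrite /F (bigD1 l')//= le_max lexx.
have force z : 0 <= z <= s -> `|\sum_k c l k * (expexp (vs k z) - expexp (v z))| <= C * Y z.
  move=> /[dup] zs /andP[z0 zs'].
  have zS : 0 <= z < S by rewrite z0 (le_lt_trans zs').
  have vg : v z <= g by exact: (radial_ivp_le iv zS).
  have slope : expexp (v z + Y z) - expexp (v z) <= C * Y z.
    rewrite (le_trans (ler_norm _))// (le_trans (@expexp_lip _ (g + 1) _ _ _ _))//.
    - by rewrite lerD// Y1.
    - by rewrite (le_trans vg)// lerDl.
    - by rewrite addrAC subrr add0r gtr0_norm.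
  have h := node_le_expexp injx d0 (v z) (bound z zs).
  have E : (fun k => expexp (v z + (vs k z - v z)) - expexp (v z)) =
           (fun k => expexp (vs k z) - expexp (v z)).
    by apply/funext => k; rewrite (addrC (v z)) subrK.
  rewrite E in h; have hN := node_leN h.
  rewrite ler_norml; apply/andP; split; last exact: le_trans (h l) slope.
  rewrite lerNl -sumrN; apply: le_trans slope; apply: le_trans (hN l).
  by apply: ler_sum => k _; rewrite mulrN.
(* [2 C z Y] is the derivative of [Y]. Its flux grows at least twice as fast as the bound [C Y] on
   the force lets that of [q] grow, since [n + 2 + 2 C z^2 >= 1]. *)
have qY z : 0 <= z <= s -> q l z <= 2 * C * z * Y z.
  move=> /andP[]; rewrite le_eqVlt => /predU1P[<-|z0 zs]; first by rewrite q0 mulr0 mul0r.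
  have zS : z < S by exact: le_lt_trans sS.
  rewrite -subr_ge0; apply: (@radial_ivp_slope_le n S (fun z => 2 * C * z * Y z - q l z)
    (fun z => 2 * C * z ^+ n.+1 * Y z * (n.+2%:R + 2 * C * z ^+ 2) +
       z ^+ n.+1 * \sum_k c l k * (expexp (vs k z) - expexp (v z)))) => //.
    move=> w wS; have h1 := dq l w wS; have h2 := dY w.
    have h3 : is_derive w 1 (fun z => z ^+ n.+2) (n.+2%:R * w ^+ n.+1) by dtac; ring.
    have h4 : is_derive w 1 (fun z => 2 * C * z ^+ n.+2 * Y z - z ^+ n.+1 * q l z)
      (2 * C * (n.+2%:R * w ^+ n.+1) * Y w + 2 * C * w ^+ n.+2 * (2 * C * w * Y w) +
        w ^+ n.+1 * \sum_k c l k * (expexp (vs k w) - expexp (v w))).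
      apply: (d_eq (dD (dM (dM (dC (2 * C) w) h3) h2) (dN h1))); ring.
    apply: (d_eq (is_derive_ext _ h4)); first by move=> t; rewrite !exprS; ring.
    by rewrite !exprS; ring.
  move=> w /andP[w0 wz]; have ws : 0 <= w <= s by rewrite w0 (le_trans wz).
  have := force w ws; rewrite ler_norml => /andP[f1 _].
  have -> : 2 * C * w ^+ n.+1 * Y w * (n.+2%:R + 2 * C * w ^+ 2) +
     w ^+ n.+1 * \sum_k c l k * (expexp (vs k w) - expexp (v w)) =
     w ^+ n.+1 * (2 * C * Y w * (n.+2%:R + 2 * C * w ^+ 2) +
       \sum_k c l k * (expexp (vs k w) - expexp (v w))) by ring.
  rewrite mulr_ge0 ?exprn_ge0//.
  have p1 : 1 <= n.+2%:R + 2 * C * w ^+ 2.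
    have t1 : 0 <= 2 * C * w ^+ 2.
      by apply: mulr_ge0; [apply: mulr_ge0 => //; exact: ltW|exact: sqr_ge0].
    have t2 : 1 <= n.+2%:R :> R by rewrite ler1n.
    by apply: (le_trans t2); rewrite lerDl.
  have p2 : 0 < C * Y w by rewrite mulr_gt0.
  have := ler_wpM2l (ltW p2) p1; rewrite mulr1; lra.
suff : a l s - Y s <= a l 0 - Y 0 by move=> /le_lt_trans; apply; rewrite subr_lt0.
apply: (@le_of_deriv_le0 _ (fun s => a l s - Y s) (fun s => q l s - 2 * C * s * Y s) _ _ s0).
  move=> z /andP[z0 zs]; have zS : 0 <= z < S by rewrite z0 (le_lt_trans zs).
  by have h1 := da l z zS; have h2 := dY z; dtac.
by move=> z zs; rewrite subr_le0 qY.
Qed.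
End ivp_comparison.

(** * Turning points *)


(** Each term is chosen strictly closer to [g] than the one before, which gives injectivity. *)
Lemma accumulating_sequence {R : realType} (Z : R -> Prop) (g r : R) : 0 < r ->
  (forall d : R, 0 < d -> exists2 x : R, 0 < `|x - g| < d & Z x) ->
  exists s : nat -> R, injective s /\ forall i, `|s i - g| < r /\ Z (s i).
Proof.
move=> r0 acc.
have [f hf] : {f : R -> R & forall d : R, 0 < d -> 0 < `|f d - g| < d /\ Z (f d)}.
  apply: (@choice R R (fun d x => 0 < d -> 0 < `|x - g| < d /\ Z x)) => d.
  have [/acc[x x1 x2]|d0] := ltP 0 d; first by exists x.
  by exists 0.
pose s n := iter n (fun z => f `|z - g|) (f r).
have sn n : [/\ 0 < `|s n - g|, `|s n - g| < r & Z (s n)].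
  elim: n => [|n [h1 h2 _]]; first by have [/andP[h1 h2] h3] := hf r r0.
  have [/andP[k1 k2] k3] := hf _ h1; split => //; exact: lt_trans h2.
have mono i j : (i < j)%N -> `|s j - g| < `|s i - g|.
  elim: j => // j IH; rewrite ltnS leq_eqVlt => /predU1P[<-|/IH]; last first.
    by apply: lt_trans; have [h1 _ _] := sn j; have [/andP[]] := hf _ h1.
  by have [h1 _ _] := sn i; have [/andP[]] := hf _ h1.
exists s; split; last by move=> i; have [_ h2 h3] := sn i.
move=> i j sij; case: (ltngtP i j) => // /mono; by rewrite sij ltxx.
Qed.

Section turning.
Context {R : realType} {n : nat}.
Variables (lam : R -> R) (u : R -> 'rV[R]_n -> R) (i0 : 'I_n).
Local Notation ei i := (delta_mx 0 i : 'rV[R]_n).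
Hypothesis n3 : (3 <= n)%N.
Hypothesis curve : solution_curve lam u.

Let v rho (s : R) := u rho ((s / Num.sqrt (lam rho)) *: ei i0).
Let p rho (s : R) := pderiv i0 (u rho) ((s / Num.sqrt (lam rho)) *: ei i0) / Num.sqrt (lam rho).

(** In [s = sqrt lambda |x|] all solutions solve one equation and differ by their initial value
    only; [S^2 <= lam rho] says that the solution is defined up to [S]. The weight [s^(n-1)]
    corresponds to the index [n.-2]. *)
Lemma curve_ivp (rho S : R) : 0 < rho -> S ^+ 2 <= lam rho -> 
  radial_ivp n.-2 rho S (v rho) (p rho).
Proof.
move=> r0 Sl; have [_ _ h _] := curve; have [sol sup rad] := h rho r0.
have l0 := regular_l0 i0 n3 sol rad.
have k0 : 0 < Num.sqrt (lam rho) by rewrite sqrtr_gt0.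
set k := Num.sqrt _ in k0.
have kk : k ^+ 2 = lam rho by rewrite sqr_sqrtr// ltW.
have nE : n.-1 = n.-2.+1 by move: n3; case: (n) => [|[|]].
have in01 (s : R) : 0 <= s < S -> 0 <= s / k < 1.
  move=> /andP[s0 sS]; rewrite divr_ge0 ?(ltW k0)//= ltr_pdivrMr// mul1r.
  apply: (lt_le_trans sS); rewrite leNgt; apply/negP => kS.
  have : k ^+ 2 < S ^+ 2 by rewrite ltr_pXn2r// nnegrE ?(ltW k0)// (le_trans (ltW k0) (ltW kS)).
  by rewrite kk ltNge Sl.
have dk (s : R) : is_derive s 1 (fun s : R => s / k) k^-1 by dtac; ring.
split.
- by rewrite /v mul0r; apply: (regular_sup i0 n3 sol rad sup).
- rewrite /p mul0r; set d := pderiv _ _ _.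
  pose U (r : R) := u rho (r *: ei i0).
  have h1 : is_derive (0 : R) 1 U d.
    by apply: (regular_der1 i0 sol); rewrite lexx ltr01.
  have h2 : is_derive (0 : R) 1 U (- d).
    have h1' : is_derive (- (0 : R)) 1 U d by rewrite oppr0.
    have h3 : is_derive (0 : R) 1 (fun r : R => U (- r)) (- d).
      by apply: (d_eq (dcomp1 (g := fun s => - s) h1' (dN (dI 0)))); rewrite mulrN1.
    apply: d_ext h3; apply/nbhs_ballP; exists 1 => //= r; rewrite /ball/= sub0r normrN => r1.
    by apply: rad; rewrite /cball/= ?enorm1 ?normrN//; exact: ltW.
  have e1 : 'D_1 U 0 = d by case: h1.
  have e2 : 'D_1 U 0 = - d by case: h2.
  by rewrite (_ : d = 0) ?mul0r//; lra.
- move=> s sS; apply: (d_eq (dcomp1 (g := fun s => s / k) (regular_der1 i0 sol (in01 s sS)) (dk s))).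
  by rewrite /p -/k.
- move=> s sS.
  have hW := dcomp1 (g := fun s => s / k) (regular_derW i0 n3 sol rad (in01 s sS)) (dk s).
  rewrite nE in hW.
  have h2 := dM (dC (k ^+ n.-2) s) hW.
  apply: (d_eq (is_derive_ext _ h2)).
    move=> t; rewrite /p -/k expr_div_n !exprS.
    have : k ^+ n.-2 != 0 by rewrite expf_neq0// gt_eqF.
    move: (k ^+ _) (t ^+ _) => a c a0; field.
    by rewrite a0 gt_eqF.
  rewrite -/(v rho s) -kk expr_div_n !exprS.
  have : k ^+ n.-2 != 0 by rewrite expf_neq0// gt_eqF.
  move: (k ^+ n.-2) (s ^+ n.-2) => a c a0; field.
  by rewrite a0 gt_eqF.
Qed.

Lemma curve_end_zero (rho S : R) : 0 < rho -> 0 < S -> lam rho = S ^+ 2 -> v rho s @[s --> S^'-] --> (0 : R).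
Proof.
move=> r0 S0 lS; have [_ _ h _] := curve; have [sol _ _] := h rho r0.
have kE : Num.sqrt (lam rho) = S by rewrite lS sqrtr_sqr gtr0_norm.
suff q : s / S @[s --> S^'-] --> (1 : R)^'-.
  by rewrite /v kE; exact: (cvg_comp _ _ q (regular_lim1 i0 sol)).
move=> A /nbhs_ballP[/= d d0 dA]; apply/nbhs_ballP; exists (d * S); first by rewrite /= mulr_gt0.
move=> s; rewrite /ball/= => sd sS; apply: dA; rewrite /ball/=; last by rewrite ltr_pdivrMr// mul1r.
have -> : 1 - s / S = (S - s) / S by field; rewrite gt_eqF.
by rewrite normrM normfV (gtr0_norm S0) ltr_pdivrMr.
Qed.

Lemma curve_end_pos (rho S : R) : 0 < rho -> 0 < S -> S ^+ 2 < lam rho ->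
  v rho s @[s --> S^'-] --> v rho S /\ 0 < v rho S.
Proof.
move=> r0 S0 lS; have [_ _ h _] := curve; have [sol _ rad] := h rho r0.
have l0 := regular_l0 i0 n3 sol rad.
have k0 : 0 < Num.sqrt (lam rho) by rewrite sqrtr_gt0.
pose S1 := Num.sqrt (lam rho).
have SS1 : S < S1 by rewrite -(ltr_pXn2r (n := 2)) ?nnegrE ?ltW// sqr_sqrtr// ltW.
have lS1 : S1 ^+ 2 <= lam rho by rewrite sqr_sqrtr// ltW.
have [_ _ hv _] := curve_ivp r0 lS1.
split; last first.
  have [_ _ _ upos _] := sol; apply: upos; apply: uball_line.
  by rewrite divr_ge0 ?(ltW S0) ?(ltW k0)//= ltr_pdivrMr// mul1r.
apply: cvg_at_left_filter; apply: (@d_cont _ _ _ (p rho S)); apply: hv.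
by rewrite (ltW S0).
Qed.

(** Let [S^2 = L] and suppose [lam z > L] for some [z] close to [g]. Take [N] nodes on the level and
    [z] as the last one. At [s = S] the solutions of the level vanish, and so does that of [g],
    while the one of [z] is positive there. Then [node_comparison] and [node_le_last] give
    [v z S <= 2^(-N)] for every [N]. The minimum at [g] ensures that all solutions involved exist up
    to [S]. *)
Lemma level_accumulation (g L : R) : 0 < g -> 0 < L -> lam g = L ->
  (\forall r \near g, L <= lam r) ->
  (forall d : R, 0 < d -> exists2 x : R, 0 < `|x - g| < d & lam x = L) ->
  \forall r \near g, lam r = L.
Proof.
move=> g0 L0 gL /nbhs_ballP[r1 /= r10 hr1] acc.
pose S := Num.sqrt L; have S0 : 0 < S by rewrite sqrtr_gt0.
have SL : S ^+ 2 = L by rewrite sqr_sqrtr// ltW.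
pose C := expR (expR (g + 1) * expexp (g + 1) * S ^+ 2).
have C0 : 0 < C := expR_gt0 _.
(* With [d = 4 r] the smallness condition of [node_comparison] becomes [10 C r <= 1], and the ratio
   [2 r / d] is [1/2]. *)
pose r := Num.min (Num.min (r1 / 2) (g / 2)) (10 * C)^-1.
have r0 : 0 < r by rewrite !lt_min !divr_gt0//= invr_gt0 mulr_gt0.
have rr1 : r < r1.
  by apply: (@le_lt_trans _ _ (r1 / 2)); [rewrite !ge_min lexx|rewrite ltr_pdivrMr// ltr_pMr// ltr1n].
have rg : r < g.
  by apply: (@le_lt_trans _ _ (g / 2)); [rewrite !ge_min lexx orbT|rewrite ltr_pdivrMr// ltr_pMr// ltr1n].
have rC : r * (10 * C) <= 1.
  by rewrite -ler_pdivlMr ?mulr_gt0// mul1r ge_min lexx orbT.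
have [s [sinj hs]] := @accumulating_sequence _ (fun x => lam x = L) g r r0 acc.
apply/nbhs_ballP; exists r => //= z; rewrite /ball/= distrC => zr.
have pos x : `|x - g| < r -> 0 < x by rewrite ltr_norml => /andP[]; lra.
have geL x : `|x - g| < r -> L <= lam x.
  by move=> xr; apply: hr1; rewrite /ball/= distrC; exact: lt_trans rr1.
apply/eqP; rewrite eq_le geL// andbT leNgt; apply/negP => zL.
have z0 := pos z zr; rewrite -SL in zL.
have [vlim vpos] := curve_end_pos z0 S0 zL.
have key N : v z S <= (1 / 2) ^+ N.
  pose x (i : 'I_N.+1) := if (i < N)%N then s i else z.
  have xr i : `|x i - g| < r by rewrite /x; case: ifP => // _; have [] := hs i.
  have injx : injective x.
    move=> i j; rewrite /x; case: ltnP => iN; case: ltnP => jN.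
    - by move=> /sinj /val_inj.
    - by move=> e; move: zL; rewrite -e (hs i).2 SL ltxx.
    - by move=> e; move: zL; rewrite e (hs j).2 SL ltxx.
    - by move=> _; apply: val_inj => /=; apply/eqP; rewrite eqn_leq (leq_trans (leq_ord i))// (leq_trans (leq_ord j)).
  have d0 : 0 < 4 * r by rewrite mulr_gt0.
  have small : 2 * (r + 4 * r) * expR (expR (g + 1) * expexp (g + 1) * S ^+ 2) <= 1.
    by rewrite -/C (_ : 2 * (r + 4 * r) * C = r * (10 * C)) //; ring.
  have iv : radial_ivp n.-2 g S (v g) (p g) by apply: curve_ivp => //; rewrite SL gL.
  have ivs i : radial_ivp n.-2 (x i) S (v (x i)) (p (x i)).
    by apply: curve_ivp; [exact: pos|rewrite SL; exact: geL].
  have H := node_comparison injx (fun i => ltW (xr i)) d0 small iv ivs.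
  pose f0 (i : 'I_N.+1) := if (i < N)%N then 0 else v z S.
  have H1 : node_le x (4 * r) f0 1.
    apply: (@node_le_lim _ _ _ _ _ (S^'-) _ (fun s k => v (x k) s - v g s) (fun=> 1)).
    - near=> t; apply: H; apply/andP; split; last by near: t; exact: nbhs_left_lt.
      by apply: ltW; near: t; exact: nbhs_left_gt.
    - move=> k; rewrite -[f0 k]subr0; apply: cvgB; last by apply: curve_end_zero => //; rewrite SL.
      rewrite /f0 /x; case: ifP => // kN; have [kr kL] := hs k.
      by apply: curve_end_zero => //; [exact: pos|rewrite kL SL].
    - exact: cvg_cst.
  have := node_le_last injx (fun i => ltW (xr i)) d0 H1.
  have -> : f0 ord_max = v z S by rewrite /f0 /= ltnn.
  rewrite (gtr0_norm vpos) mul1r (_ : 2 * r / (4 * r) = 1 / 2); last by field; rewrite gt_eqF.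
  apply => i im; rewrite /f0 (_ : (i < N)%N)// ltn_neqAle -ltnS ltn_ord andbT.
  by apply: contraNN im => /eqP e; apply/eqP/val_inj.
have : v z S <= 0.
  apply: (cvgr_to_ge (F := \oo) (f := fun N => (1 / 2 : R) ^+ N)).
    by apply: cvg_expr; rewrite ger0_norm ?ltr_pdivrMr ?mul1r ?ltr1n.
  by apply: nearW => N; exact: key.
by rewrite leNgt vpos.
Unshelve. all: by end_near. Qed.

Hypothesis cont_lam : forall rho0 : R, 0 <= rho0 -> forall e : R, 0 < e ->
  exists2 d, 0 < d & forall rho : R, 0 <= rho -> `|rho - rho0| < d -> `|lam rho - lam rho0| < e.

(** [g] is the rightmost minimum point on [[r1, r3]]. Were it not strict, the minimal level would
    accumulate at [g], so [lam] would be constant near [g], and minimum points would exist to its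
    right. *)
Lemma turning_between (r1 r2 r3 : R) : 0 < r1 -> r1 < r2 -> r2 < r3 ->
  lam r2 < lam r1 -> lam r2 < lam r3 ->
  exists2 g, r1 < g < r3 & turning_point lam g.
Proof.
move=> r10 r12 r23 l21 l23; have r13 : r1 < r3 := lt_trans r12 r23.
have cl : {within `[r1, r3], continuous lam}.
  have [_ [cl _] _ _] := curve; apply: continuous_subspaceW cl => x /=.
  by rewrite !in_itv/= => /andP[x1 _]; rewrite andbT; exact: le_trans (ltW r10) x1.
have [c cI cmin] := EVT_min (ltW r13) cl.
pose L := lam c.
have Lr2 : L <= lam r2 by apply: cmin; rewrite in_itv/= !ltW.
have minL x : r1 <= x <= r3 -> L <= lam x by move=> xI; apply: cmin; rewrite in_itv.
pose T := [set x | r1 <= x <= r3 /\ lam x = L].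
have Tc : T c by split => //; move: cI; rewrite in_itv.
have Tub : has_ubound T by exists r3 => x [/andP[]].
have Tsup : has_sup T by split => //; exists c.
pose g := sup T.
have cg : c <= g by exact: ub_le_sup.
have r1c : r1 <= c by move: cI; rewrite in_itv/= => /andP[].
have gr3 : g <= r3 by apply: sup_le_ub; [exists c|move=> x [/andP[]]].
have g0 : 0 < g by apply: lt_le_trans r10 _; exact: le_trans cg.
have gI : r1 <= g <= r3 by rewrite gr3 (le_trans r1c).
have gL : lam g = L.
  apply/eqP; rewrite eq_le minL// andbT leNgt; apply/negP => Lg.
  have e0 : 0 < lam g - L by rewrite subr_gt0.
  have [d d0 hd] := cont_lam (ltW g0) e0.
  have [x [/andP[x1 x3] xL] xg] := sup_adherent d0 Tsup.
  have xg' : x <= g by apply: ub_le_sup => //; split => //; rewrite x1.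
  have := hd x (le_trans (ltW r10) x1); rewrite xL distrC (ger0_norm (_ : 0 <= g - x)) ?subr_ge0//.
  rewrite -/g in xg; rewrite ltrBlDl -ltrBlDr xg => /(_ isT).
  by rewrite distrC gtr0_norm// ltxx.
have g1 : r1 < g by rewrite lt_neqAle (le_trans r1c)// andbT; apply/negP => /eqP e; move: l21; rewrite e gL ltNge Lr2.
have g3 : g < r3 by rewrite lt_neqAle gr3 andbT; apply/negP => /eqP e; move: l23; rewrite -e gL ltNge Lr2.
exists g; first by rewrite g1 g3.
split => //; right.
have nearI : \forall r \near g, r1 <= r <= r3.
  near=> r; apply/andP; split; apply: ltW; near: r; [exact: lt_nbhsr|exact: lt_nbhsl].
have L0 : 0 < L.
  have [_ _ h _] := curve; have [sol _ rad] := h g g0; rewrite -gL; exact: (regular_l0 i0 n3 sol rad).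
have nearL : \forall r \near g, L <= lam r by apply: filterS nearI => r; exact: minL.
have [iso|acc] := pselect (\forall r \near g^', lam r != L).
  rewrite gL; have nL : \forall r \near g^', L <= lam r by exact: cvg_within nearL.
  by apply: filterS2 iso nL => r rL Lr; rewrite lt_neqAle eq_sym rL.
exfalso.
have : \forall r \near g, lam r = L.
  apply: level_accumulation => // d d0; apply: contrapT => H; apply: acc.
  apply/nbhs_ballP; exists d => // x; rewrite /ball/= distrC => xd xg.
  apply/eqP => xL; apply: H; exists x => //; by rewrite xd normr_gt0 subr_eq0 xg.
move=> H.
have [x [xg xL xI]] : exists x, [/\ g < x, lam x = L & r1 <= x <= r3].
  have : \forall x \near g^'+, [/\ g < x, lam x = L & r1 <= x <= r3].
    near=> x; split; first by near: x; exact: nbhs_right_gt.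
      by near: x; exact: cvg_within H.
    by near: x; exact: cvg_within nearI.
  by move=> /filter_ex.
have : x <= g by apply: ub_le_sup => //; split.
by rewrite leNgt xg.
Unshelve. all: by end_near. Qed.
End turning.

Section infinitely_many.
Context {R : realType} {n : nat}.
Variables (lamS : R) (uS : 'rV[R]_n -> R) (lam : R -> R) (u : R -> 'rV[R]_n -> R) (i0 : 'I_n).
Hypothesis n3 : (3 <= n)%N.
Hypothesis n9 : (n <= 9)%N.
Hypothesis singu : singular_solution lamS uS.
Hypothesis curve : solution_curve lam u.

(** Beyond any bound [lam] is above, then below, then again above [lamS]; the minimum in between is
    a turning point, at a value close to [lamS]. *)
Lemma curve_infinitely_many_turning_points : infinitely_many_turning_points lam lamS.
Proof.
move=> U /nbhs_ballP[e /= e0 eU] fin.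
have [rho1 r10 H1] := curve_converges i0 n3 singu curve e0.
have /finite_fsetP[F FE] := fin.
pose M := \big[Num.max/rho1]_(x <- F) x.
have Mr1 : rho1 <= M by exact: bigmax_ge_id.
have [r1 [Mr r1p] h1] := curve_above i0 n3 singu curve n9 M.
have [r2 [r12 r2p] h2] := curve_below i0 n3 singu curve n9 r1.
have [r3 [r23 r3p] h3] := curve_above i0 n3 singu curve n9 r2.
have [g /andP[g1 g3] tp] := turning_between i0 n3 curve (curve_lam_cont curve) r1p r12 r23
  (lt_trans h2 h1) (lt_trans h2 h3).
have gM : M < g by exact: lt_trans g1.
have gF : g \in F.
  have : [set` F] g.
    rewrite -FE; split => //; apply: eU; rewrite /ball/= distrC; apply: H1.
    by apply: (le_trans Mr1); exact: ltW.
  by [].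
have : g <= M by apply: le_bigmax_seq.
by rewrite leNgt gM.
Qed.
End infinitely_many.

(** * Integration over boxes *)


Section bounded_measurable.
Context d (T : measurableType d) (R : realType).
Implicit Types f g : T -> R.

(** On a set of finite measure these functions are integrable, and they form an algebra, so
    integrability follows from the shape of the integrand. *)
Definition bmf f := measurable_fun setT f /\ exists M, forall x, `|f x| <= M.

Lemma bmf_cst (c : R) : bmf (fun=> c).
Proof. by split; [exact: measurable_cst|exists `|c|]. Qed.

Lemma bmfD f g : bmf f -> bmf g -> bmf (fun x => f x + g x).
Proof.
move=> [mf [M fM]] [mg [N gN]]; split; first exact: measurable_funD.
by exists (M + N) => x; rewrite (le_trans (ler_normD _ _))// lerD.
Qed.

Lemma bmfN f : bmf f -> bmf (fun x => - f x).
Proof.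
move=> [mf [M fM]]; split; first exact: measurableT_comp.
by exists M => x; rewrite normrN.
Qed.

Lemma bmfB f g : bmf f -> bmf g -> bmf (fun x => f x - g x).
Proof. by move=> hf hg; apply: bmfD => //; exact: bmfN. Qed.

Lemma bmfM f g : bmf f -> bmf g -> bmf (fun x => f x * g x).
Proof.
move=> [mf [M fM]] [mg [N gN]]; split; first exact: measurable_funM.
by exists (M * N) => x; rewrite normrM ler_pM.
Qed.

Lemma bmfX f k : bmf f -> bmf (fun x => f x ^+ k).
Proof.
move=> hf; elim: k => [|k IH]; first by under eq_fun do rewrite expr0; exact: bmf_cst.
by under eq_fun do rewrite exprS; exact: bmfM.
Qed.

Lemma bmf_norm f : bmf f -> bmf (fun x => `|f x|).
Proof.
move=> [mf [M fM]]; split; first exact: measurableT_comp.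
by exists M => x; rewrite normr_id.
Qed.

Lemma bmf_sum (I : Type) (r : seq I) (f : I -> T -> R) :
  (forall i, bmf (f i)) -> bmf (fun x => \sum_(i <- r) f i x).
Proof.
move=> h; elim: r => [|i r IH]; first by under eq_fun do rewrite big_nil; exact: bmf_cst.
by under eq_fun do rewrite big_cons; exact: bmfD.
Qed.

Variables (mu : {measure set T -> \bar R}) (D : set T).
Hypothesis mD : measurable D.
Hypothesis finD : (mu D < +oo)%E.

Lemma bmf_integrable f : bmf f -> mu.-integrable D (EFin \o f).
Proof.
move=> [mf [M fM]]; apply: measurable_bounded_integrable => //.
  exact: measurable_funTS.
by exists M; split; [exact: num_real|move=> y My x _ /=; rewrite (le_trans (fM x))// ltW].
Qed.

Local Notation J f := (Rintegral mu D f).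

Lemma bmf_intD f g : bmf f -> bmf g -> J (fun x => f x + g x) = J f + J g.
Proof. by move=> hf hg; rewrite RintegralD//; exact: bmf_integrable. Qed.

Lemma bmf_intB f g : bmf f -> bmf g -> J (fun x => f x - g x) = J f - J g.
Proof. by move=> hf hg; rewrite RintegralB//; exact: bmf_integrable. Qed.

Lemma bmf_intZ (c : R) f : bmf f -> J (fun x => c * f x) = c * J f.
Proof. by move=> hf; rewrite RintegralZl//; exact: bmf_integrable. Qed.

Lemma bmf_int_le f g : bmf f -> bmf g -> (forall x, D x -> f x <= g x) -> J f <= J g.
Proof. by move=> hf hg h; apply: le_Rintegral => //; exact: bmf_integrable. Qed.

Lemma bmf_int_norm f : bmf f -> `|J f| <= J (fun x => `|f x|).
Proof. by move=> hf; apply: le_normr_Rintegral => //; exact: bmf_integrable. Qed.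

Lemma bmf_int_sum (I : Type) (r : seq I) (f : I -> T -> R) :
  (forall i, bmf (f i)) -> J (fun x => \sum_(i <- r) f i x) = \sum_(i <- r) J (f i).
Proof.
move=> h; elim: r => [|i r IH].
  by under eq_Rintegral do rewrite big_nil; rewrite Rintegral_cst// mul0r big_nil.
under eq_Rintegral do rewrite big_cons.
by rewrite big_cons -IH bmf_intD//; exact: bmf_sum.
Qed.

Let l : R := fine (mu D).

Lemma bmf_int_cst (c : R) : J (fun=> c) = c * l.
Proof. exact: Rintegral_cst. Qed.

Lemma variance_identity f : 0 < l -> bmf f ->
  J (fun x => f x ^+ 2) = J (fun x => (f x - J f / l) ^+ 2) + (J f) ^+ 2 / l.
Proof.
move=> l0 hf; set a := J f / l.
have -> : J (fun x => (f x - a) ^+ 2) = J (fun x => f x ^+ 2) - 2 * a * J f + a ^+ 2 * l.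
  rewrite -bmf_intZ// -bmf_int_cst -bmf_intB//; [|exact: bmfX|by apply: bmfM => //; exact: bmf_cst].
  rewrite -bmf_intD//; [|by apply: bmfB; [exact: bmfX|by apply: bmfM => //; exact: bmf_cst]|exact: bmf_cst].
  by apply: eq_Rintegral => x _ /=; ring.
by rewrite /a; field; rewrite gt_eqF.
Qed.

Lemma sqr_int_le f : 0 < l -> bmf f -> (J f) ^+ 2 <= l * J (fun x => f x ^+ 2).
Proof.
move=> l0 hf; rewrite variance_identity// mulrDr [l * (_ / l)]mulrC divfK ?gt_eqF//.
by rewrite lerDr mulr_ge0 ?(ltW l0)// Rintegral_ge0// => x _; exact: sqr_ge0.
Qed.

Lemma oscillation_int f K : 0 < l -> bmf f ->
  (forall x y, D x -> D y -> `|f x - f y| <= K) -> 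
  J (fun x => f x ^+ 2) <= (J f) ^+ 2 / l + l * K ^+ 2.
Proof.
move=> l0 hf osc; rewrite variance_identity// addrC lerD2l.
have bc c : bmf (fun=> c) := bmf_cst c.
have near_avg x : D x -> `|f x - J f / l| <= K.
  move=> Dx; have -> : f x - J f / l = J (fun y => f x - f y) / l.
    by rewrite bmf_intB// bmf_int_cst; field; rewrite gt_eqF.
  rewrite normrM normfV (gtr0_norm l0) ler_pdivrMr//.
  have hb : bmf (fun y => f x - f y) by apply: bmfB.
  apply: (le_trans (bmf_int_norm hb)); rewrite -bmf_int_cst.
  by apply: bmf_int_le => //; [exact: bmf_norm|move=> y Dy; exact: osc].
rewrite [l * _]mulrC -bmf_int_cst; apply: bmf_int_le => //.
  by apply: bmfX; exact: bmfB.
move=> x Dx; rewrite -real_normK ?num_real// lerXn2r ?nnegrE//; last exact: near_avg.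
by rewrite (le_trans _ (near_avg x Dx)).
Qed.
End bounded_measurable.

(** * Fubini on boxes *)

Section boxes.
Context {R : realType}.
Local Notation T := (measurableTypeR R).
Implicit Types (n : nat) (c : nat -> R) (h : R).

Definition box n c h : set (n.-tuple T) := [set t | forall i : 'I_n, c i <= tnth t i < c i + h].

Definition tcoord n (s : R) (t : n.-tuple T) : n.+1.-tuple T := @tcons R n ((s : T), t).

Lemma measurable_tcoord n s : measurable_fun setT (@tcoord n s).
Proof. by apply: (@measurable_cons _ _ (n.-tuple T) T (fun=> s) n id) => //; exact: measurable_cst. Qed.

Lemma measurable_box n c h : measurable (@box n c h).
Proof.
have -> : @box n c h = \bigcap_(i in [set: 'I_n]) ((fun t => tnth t i) @^-1` `[c i, c i + h[).
  apply/seteqP; split=> [t ht i _|t ht i]; first by rewrite /preimage/= in_itv/=; exact: ht.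
  by have := ht i I; rewrite /preimage/= in_itv.
apply: fin_bigcap_measurable => [|i _]; first exact: finite_finset.
by rewrite -[X in measurable X]setTI; apply: measurable_tnth => //; exact: measurable_itv.
Qed.

Lemma tcons_box n c h : @tcons R n @^-1` (@box n.+1 c h) = `[c 0%N, c 0%N + h[ `*` box (fun i => c i.+1) h.
Proof.
apply/seteqP; split=> [[s t] H|[s t] [/= H1 H2] i].
  split=> /=; first by have := H ord0; rewrite in_itv.
  by move=> i; have := H (lift ord0 i); rewrite /tcons /= tnthS.
case: (unliftP ord0 i) => [j ->|->]; first by rewrite /tcons/= tnthS; exact: H2.
by rewrite /tcons/= in_itv/= in H1 *.
Qed.

Lemma box_measure n c h : 0 <= h -> lebesgue_tuple R n (box c h) = (h ^+ n)%:E.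
Proof.
move=> h0; elim: n c => [|n IH] c.
  rewrite /= expr0 /dirac indicE mem_set//; by move=> [].
rewrite /= /cons_measure tcons_box product_measure1E//; [|exact: measurable_box].
rewrite IH /lebesgue_sfm /= lebesgue_measure_itv /= lte_fin ltrDl.
case: ifPn => [_|]; first by rewrite -EFinD addrAC subrr add0r exprS.
by rewrite -leNgt => h0'; rewrite (@le_anti _ _ h 0) ?h0'// mul0e exprS mul0r.
Qed.

Lemma box_fin n c h : 0 <= h -> (lebesgue_tuple R n (box c h) < +oo)%E.
Proof. by move=> h0; rewrite box_measure// ltry. Qed.

Lemma itv_fin (a h : R) : (lebesgue_sfm R `[a, (a + h)%R[%classic < +oo)%E.
Proof. by rewrite /lebesgue_sfm /= lebesgue_measure_itv /=; case: ifP => _; rewrite ?ltry. Qed.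

Lemma iint_len (a h : R) : 0 <= h -> fine (lebesgue_sfm R `[a, (a + h)%R[%classic) = h.
Proof.
rewrite /lebesgue_sfm /= lebesgue_measure_itv /= lte_fin ltrDl => h0.
case: ifPn => [_|]; first by rewrite -EFinD/= addrAC subrr add0r.
by rewrite -leNgt => h0'; rewrite (@le_anti _ _ h 0) ?h0'.
Qed.

Definition bint n c h (f : n.-tuple T -> R) : R := Rintegral (lebesgue_tuple R n) (box c h) f.
Definition iint (a h : R) (f : T -> R) : R := Rintegral (lebesgue_sfm R) `[a, a + h[ f.

Lemma bmf_tcoord n s (f : n.+1.-tuple T -> R) : bmf f -> bmf (f \o tcoord s).
Proof.
move=> [mf [M fM]]; split; first by apply: measurableT_comp mf _; exact: measurable_tcoord.
by exists M => t; exact: fM.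
Qed.

Lemma bmf_tline n t (f : n.+1.-tuple T -> R) : bmf f -> bmf (fun s : T => f (tcoord s t)).
Proof.
move=> [mf [M fM]]; split; last by exists M => s; exact: fM.
apply: measurableT_comp mf _; apply: (@measurable_cons _ _ T T (fun s : T => s) n (fun=> t)) => //.
Qed.

Section fubini.
Variables (n : nat) (c : nat -> R) (h : R) (f : n.+1.-tuple T -> R).
Hypothesis h0 : 0 <= h.
Hypothesis hf : bmf f.
Let I : set T := `[c 0%N, c 0%N + h[.
Let Q : set (n.-tuple T) := box (fun i => c i.+1) h.
Let F (p : T * n.-tuple T) : \bar R := ((f \o @tcons R n) \_ (I `*` Q) p)%:E.

Let mIQ : measurable (I `*` Q).
Proof. by apply: measurableX; [exact: measurable_itv|exact: measurable_box]. Qed.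

Let mfc : measurable_fun setT (f \o @tcons R n).
Proof. by apply: measurableT_comp; [exact: hf.1|exact: measurable_tcons]. Qed.

Let IQfin : ((lebesgue_sfm R \x lebesgue_tuple R n) (I `*` Q) < +oo)%E.
Proof.
rewrite product_measure1E//; [|exact: measurable_itv|exact: measurable_box].
apply: lte_mul_pinfty; [exact: measure_ge0| |exact: box_fin].
by rewrite ge0_fin_numE ?measure_ge0//; exact: itv_fin.
Qed.

Let hfc : bmf (f \o @tcons R n).
Proof. by split => //; have [M fM] := hf.2; exists M => p; exact: fM. Qed.

Let intF : (lebesgue_sfm R \x lebesgue_tuple R n)%E.-integrable setT F.
Proof.
have := bmf_integrable mIQ IQfin hfc.
move=> H; have := (integrable_restrict (lebesgue_sfm R \x lebesgue_tuple R n)%E mIQ measurableT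
  (EFin \o (f \o @tcons R n))).1.
by rewrite setTI => /(_ H); rewrite restrict_EFin.
Qed.

Let F_in a t : I a -> Q t -> F (a, t) = (f (tcoord a t))%:E.
Proof. by move=> Ia Qt; rewrite /F patchE mem_set. Qed.

Let F_out a t : ~ (I a /\ Q t) -> F (a, t) = 0%E.
Proof. by move=> N; rewrite /F patchE memNset. Qed.

Let bint_prod : (\int[lebesgue_tuple R n.+1]_(t in box c h) (f t)%:E =
  \int[lebesgue_sfm R \x lebesgue_tuple R n]_p F p)%E.
Proof.
rewrite (@eq_measure_integral _ _ _ _ (pushforward (lebesgue_sfm R \x lebesgue_tuple R n)%E (@tcons R n))).
  exact: measurable_tcons.
move=> mt; rewrite (integral_pushforward mt).
- by rewrite tcons_box integral_mkcond /F restrict_EFin.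
- by apply/measurable_EFinP; exact: hf.1.
- by rewrite tcons_box; exact: (bmf_integrable mIQ IQfin hfc).
- exact: measurable_box.
- by [].
Qed.

Let inner1 a : (\int[lebesgue_tuple R n]_t F (a, t))%E =
  ((fun a => (bint (fun i => c i.+1) h (f \o tcoord a))%:E) \_ I) a.
Proof.
rewrite patchE; case: ifPn => Ia; last first.
  by rewrite (eq_integral (fun=> 0%E)) ?integral0// => t _; rewrite F_out// => -[]; rewrite -(@in_setE _ I) (negbTE Ia).
rewrite inE in Ia; rewrite /bint /Rintegral fineK.
  rewrite [RHS]integral_mkcond; apply: eq_integral => t _.
  rewrite patchE; case: ifPn => Qt; first by rewrite F_in//; rewrite inE in Qt.
  by rewrite F_out// => -[_]; rewrite -(@in_setE _ Q) (negbTE Qt).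
by apply: integrable_fin_num; [exact: measurable_box|apply: bmf_integrable; [exact: measurable_box|exact: box_fin|exact: bmf_tcoord]].
Qed.

(** The indicator is present because Fubini gives measurability for the integrand restricted to the
    product box. *)
Lemma bmf_bint : bmf (fun a : T => bint (fun i => c i.+1) h (f \o tcoord a) * \1_I a).
Proof.
have [M fM] := hf.2; split; last first.
  exists (M * h ^+ n) => a; rewrite normrM.
  have b1 : `|\1_I a : R| <= 1 by rewrite indicE; case: (_ \in _); rewrite ?normr1 ?normr0.
  apply: (@le_trans _ _ (`|bint (fun i => c i.+1) h (f \o tcoord a)| * 1)); first by rewrite ler_wpM2l.
  rewrite mulr1 (le_trans (bmf_int_norm (measurable_box _ _) (box_fin _ _ h0) (bmf_tcoord a hf)))//.
  have -> : M * h ^+ n = Rintegral (lebesgue_tuple R n) (box (fun i => c i.+1) h) (fun=> M).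
    rewrite Rintegral_cst; last exact: measurable_box.
    by congr (_ * _); rewrite [X in fine X]box_measure.
  apply: bmf_int_le; [exact: measurable_box|exact: box_fin| |exact: bmf_cst|by move=> t _; exact: fM].
  by apply: bmf_norm; exact: bmf_tcoord.
apply/measurable_EFinP.
have := measurable_fubini_F intF; apply: eq_measurable_fun => a _.
rewrite /fubini_F inner1 /= patchE indicE; case: ifPn => Ia; first by rewrite mulr1.
by rewrite mulr0.
Qed.

Lemma iint_bint : iint (c 0%N) h (fun a : T => bint (fun i => c i.+1) h (f \o tcoord a) * \1_I a) = bint c h f.
Proof.
rewrite /bint /iint [in RHS]/Rintegral bint_prod -integral12_prod_meas1// /fubini_F.
rewrite /Rintegral [in LHS]integral_mkcond; congr fine; apply: eq_integral => a _; rewrite inner1.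
have [Ia|Ia] := pselect (I a); last by rewrite !patchE !memNset.
by rewrite !patchE indicE !mem_set// mulr1.
Qed.

Lemma bint_fubini1 : bint c h f = iint (c 0%N) h (fun a => bint (fun i => c i.+1) h (f \o tcoord a)).
Proof.
rewrite -iint_bint; apply: eq_Rintegral => a Ia.
by rewrite indicE Ia mulr1.
Qed.

Let inner2 t : (\int[lebesgue_sfm R]_a F (a, t))%E =
  ((fun t => (iint (c 0%N) h (fun a => f (tcoord a t)))%:E) \_ Q) t.
Proof.
rewrite patchE; case: ifPn => Qt; last first.
  by rewrite (eq_integral (fun=> 0%E)) ?integral0// => a _; rewrite F_out// => -[_]; rewrite -(@in_setE _ Q) (negbTE Qt).
rewrite inE in Qt; rewrite /iint /Rintegral fineK.
  rewrite [RHS]integral_mkcond; apply: eq_integral => a _.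
  rewrite patchE; case: ifPn => Ia; first by rewrite F_in//; rewrite inE in Ia.
  by rewrite F_out// => -[]; rewrite -(@in_setE _ I) (negbTE Ia).
by apply: integrable_fin_num => //; apply: bmf_integrable; [exact: measurable_itv|exact: itv_fin|exact: bmf_tline].
Qed.

Lemma bmf_iint : bmf (fun t : n.-tuple T => iint (c 0%N) h (fun a => f (tcoord a t)) * \1_Q t).
Proof.
have [M fM] := hf.2; split; last first.
  exists (M * h) => t; rewrite normrM.
  have b1 : `|\1_Q t : R| <= 1 by rewrite indicE; case: (_ \in _); rewrite ?normr1 ?normr0.
  apply: (@le_trans _ _ (`|iint (c 0%N) h (fun a => f (tcoord a t))| * 1)); first by rewrite ler_wpM2l.
  have mI : measurable I := measurable_itv _.
  have If := itv_fin (c 0%N) h.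
  have bl := bmf_tline t hf.
  rewrite mulr1 (le_trans (bmf_int_norm mI If bl))//.
  have -> : M * h = Rintegral (lebesgue_sfm R) I (fun=> M).
    by rewrite Rintegral_cst//; congr (_ * _); rewrite [RHS]iint_len.
  apply: (bmf_int_le mI If); [exact: bmf_norm|exact: bmf_cst|by move=> a _; exact: fM].
apply/measurable_EFinP.
have := measurable_fubini_G intF; apply: eq_measurable_fun => t _.
rewrite /fubini_G inner2 /= patchE indicE; case: ifPn => Qt; first by rewrite mulr1.
by rewrite mulr0.
Qed.

Lemma bint_iint : bint (fun i => c i.+1) h (fun t => iint (c 0%N) h (fun a => f (tcoord a t)) * \1_Q t) = bint c h f.
Proof.
rewrite /bint [in RHS]/Rintegral bint_prod -integral21_prod_meas1// /fubini_G.
rewrite /Rintegral [in LHS]integral_mkcond; congr fine; apply: eq_integral => t _; rewrite inner2.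
have [Qt|Qt] := pselect (Q t); last by rewrite !patchE !memNset.
by rewrite !patchE indicE !mem_set// mulr1.
Qed.

Lemma bint_fubini2 : bint c h f = bint (fun i => c i.+1) h (fun t => iint (c 0%N) h (fun a => f (tcoord a t))).
Proof.
rewrite -bint_iint; apply: eq_Rintegral => t Qt.
by rewrite indicE Qt mulr1.
Qed.
End fubini.
End boxes.

Section box_calculus.
Context {R : realType}.
Local Notation T := (measurableTypeR R).
Implicit Types (n : nat) (c : nat -> R) (h : R).

Lemma iint_FTC (a h : R) (f F : R -> R) : 0 < h ->
  (forall s : R, is_derive s 1 F (f s)) -> continuous f -> bmf (f : T -> R) ->
  iint a h f = F (a + h) - F a.
Proof.
move=> h0 dF cf bf; rewrite /iint /lebesgue_sfm Rintegral_itv_bndo_bndc; last first.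
  by apply: (bmf_integrable _ _ bf); [exact: measurable_itv|exact: itv_fin].
rewrite /Rintegral (@continuous_FTC2 _ f F)//.
- by rewrite ltrDl.
- exact: continuous_subspaceT.
- split.
  + by move=> s _; have [] := dF s.
  + by apply: cvg_at_right_filter; exact: d_cont (dF a).
  + by apply: cvg_at_left_filter; exact: d_cont (dF (a + h)).
- by move=> s _; rewrite derive1E; have [_ ->] := dF s.
Qed.

(* [G i] is the partial derivative of [F] along the [i]-th coordinate *)
Fixpoint lined n : (n.-tuple T -> R) -> (nat -> n.-tuple T -> R) -> Prop :=
  match n return (n.-tuple T -> R) -> (nat -> n.-tuple T -> R) -> Prop with
  | 0 => fun _ _ => True
  | k.+1 => fun F G =>
    (forall t, (forall s : R, is_derive s 1 (fun s : R => F (tcoord s t)) (G 0%N (tcoord s t))) /\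
               continuous (fun s : R => G 0%N (tcoord s t))) /\
    (forall s : R, lined (F \o tcoord s) (fun i => G i.+1 \o tcoord s))
  end.

Definition faces0 n c h (F : n.-tuple T -> R) :=
  forall t, (exists i : 'I_n, ~~ (c i < tnth t i < c i + h)) -> F t = 0.

Lemma bint_partial n c h (F : n.-tuple T -> R) (G : nat -> n.-tuple T -> R) (i : nat) : 0 < h ->
  (i < n)%N -> lined F G -> (forall j, bmf (G j)) -> faces0 c h F -> bint c h (G i) = 0.
Proof.
move=> h0; elim: n i c F G => // n IH [|i] c F G ii [dF lF] bG face.
  rewrite bint_fubini2 ?(ltW h0)// (_ : (fun t => iint _ _ _) = fun=> 0).
    by rewrite /bint Rintegral_cst ?mul0r//; exact: measurable_box.
  apply/funext => t; have [d1 c1] := dF t.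
  rewrite (iint_FTC _ h0 d1 c1); last exact: bmf_tline.
  have f0 (s : R) : ~~ (c 0%N < s < c 0%N + h) -> F (tcoord s t) = 0.
    by move=> sc; apply: face; exists ord0.
  by rewrite !f0 ?subrr// ltxx ?andbF.
rewrite bint_fubini1 ?(ltW h0)// (_ : (fun a => bint _ _ _) = fun=> 0).
  by rewrite /iint Rintegral_cst ?mul0r//; exact: measurable_itv.
apply/funext => a; apply: (IH i _ _ (fun j => G j.+1 \o tcoord a) _ (lF a)) => //.
  by move=> j; exact: bmf_tcoord.
move=> t [j tj]; apply: face; exists (lift ord0 j).
by rewrite /tcoord /tcons/= tnthS.
Qed.

(** Induction on the dimension. For each value of the first coordinate the inequality holds on the
    slice; what remains is the square of the slice integral [B], a function of one variable whose
    oscillation is controlled by [G 0]. *)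
Lemma poincare n c h (F : n.-tuple T -> R) (G : nat -> n.-tuple T -> R) : 0 < h ->
  lined F G -> bmf F -> (forall j, bmf (G j)) ->
  bint c h (fun t => F t ^+ 2) <=
    h ^+ 2 * (\sum_(i < n) bint c h (fun t => G i t ^+ 2)) + (bint c h F) ^+ 2 / h ^+ n.
Proof.
move=> h0; have h0' := ltW h0; elim: n c F G => [|n IH] c F G lF bF bG.
  have E (f : 0.-tuple T -> R) : bint c h f = f [tuple].
    rewrite /bint (_ : Rintegral _ _ _ = Rintegral (lebesgue_tuple R 0) (box c h) (fun=> f [tuple])).
      rewrite Rintegral_cst; last exact: measurable_box.
      by rewrite [X in fine X]box_measure// expr0 mulr1.
    by apply: eq_Rintegral => t _; rewrite (tuple0 t).
  by rewrite big_ord0 mulr0 add0r !E expr0 divr1.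
have [dF lF'] := lF; pose c' i := c i.+1.
pose I : set T := `[c 0%N, (c 0%N + h)%R[%classic.
have mI : measurable I := measurable_itv _.
have Ifin : (lebesgue_sfm R I < +oo)%E := itv_fin _ _.
pose B a := bint c' h (F \o tcoord a) * \1_I a.
have bB : bmf B by exact: bmf_bint.
have BI (a : R) : I a -> bint c' h (F \o tcoord a) = B a.
  by move=> Ia; rewrite /B indicE mem_set// mulr1.
pose K := bint c h (fun t => `|G 0%N t|).
have mQ := @measurable_box R n c' h; have Qfin := @box_fin R n c' h h0'.
(* Two slices differ by the integral of [G 0] along the lines that join them, so the slice integrals
   differ by at most [K]. *)
have oscB (a a' : T) : I a -> I a' -> `|B a - B a'| <= K.
  have main (s s' : R) : I s -> I s' -> s <= s' -> `|B s - B s'| <= K.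
    move=> Is Is'; rewrite le_eqVlt => /predU1P[->|ss'].
      by rewrite subrr normr0; apply: Rintegral_ge0.
    rewrite distrC -!BI//.
    have b1 := bmf_tcoord s bF; have b2 := bmf_tcoord s' bF.
    rewrite /bint -(bmf_intB mQ Qfin b2 b1).
    apply: (le_trans (bmf_int_norm mQ Qfin (bmfB b2 b1))).
    have bG0 := bmf_norm (bG 0%N).
    rewrite /K -(bint_iint c h0' bG0).
    apply: (bmf_int_le mQ Qfin (bmf_norm (bmfB b2 b1)) (bmf_iint c h0' bG0)).
    move=> t Qt /=; have [d1 c1] := dF t; rewrite indicE mem_set// mulr1.
    have bl := bmf_tline t (bG 0%N).
    have ss0 : 0 < s' - s by rewrite subr_gt0.
    have := iint_FTC s ss0 d1 c1 bl; rewrite (addrC s) subrK => <-.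
    have bn := bmf_norm bl.
    have := bmf_int_norm (mu := lebesgue_sfm R) (measurable_itv `[s, s + (s' - s)[) (itv_fin s (s' - s)) bl.
    move=> /le_trans; apply.
    rewrite /iint (addrC s) subrK.
    have sub : `[s, s'[ `<=` I.
      move=> z /=; rewrite !in_itv/= => /andP[z1 z2].
      move: Is Is'; rewrite /I/= !in_itv/= => /andP[s1 s2] /andP[s3 s4].
      by rewrite (le_trans s1 z1) (lt_trans z2 s4).
    apply: fine_le.
    - apply: integrable_fin_num; [exact: measurable_itv|].
      by apply: (bmf_integrable _ _ bn); [exact: measurable_itv|rewrite -(subrK s s') addrC; exact: itv_fin].
    - apply: integrable_fin_num; [exact: measurable_itv|].
      by apply: (bmf_integrable _ _ bn); [exact: measurable_itv|exact: itv_fin].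
    apply: ge0_subset_integral => //.
    by apply/measurable_EFinP/measurable_funTS; exact: bn.1.
  move=> Ia Ia'; case: (leP (a : R) (a' : R)) => aa; first exact: main.
  by rewrite distrC; apply: main => //; exact: ltW.
have Il : fine (lebesgue_sfm R I) = h by exact: iint_len.
have Il0 : 0 < fine (lebesgue_sfm R I) by rewrite Il.
have H1 := oscillation_int mI Ifin Il0 bB oscB.
have KK : K ^+ 2 <= h ^+ n.+1 * bint c h (fun t => G 0%N t ^+ 2).
  have Qn : fine (lebesgue_tuple R n.+1 (box c h)) = h ^+ n.+1 by rewrite box_measure.
  have Qn0 : 0 < fine (lebesgue_tuple R n.+1 (box c h)) by rewrite Qn exprn_gt0.
  have := sqr_int_le (@measurable_box R n.+1 c h) (@box_fin R n.+1 c h h0') Qn0 (bmf_norm (bG 0%N)).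
  rewrite Qn => /le_trans; apply; rewrite ler_wpM2l ?exprn_ge0//.
  rewrite le_eqVlt; apply/orP; left; apply/eqP; apply: eq_Rintegral => t _.
  by rewrite real_normK ?num_real.
have bF2 := bmfX 2 bF; have bG2 i := bmfX 2 (bG i).
have bS (f : n.+1.-tuple T -> R) : bmf f -> bmf (fun a => bint c' h (f \o tcoord a) * \1_I a).
  exact: bmf_bint.
rewrite -(iint_bint c h0' bF2).
have bSG : bmf (fun a : T => \sum_(i < n) bint c' h ((fun t => G i.+1 t ^+ 2) \o tcoord a) * \1_I a).
  by apply: bmf_sum => i; exact: bS.
have step : iint (c 0%N) h (fun a => bint c' h ((fun t => F t ^+ 2) \o tcoord a) * \1_I a) <=
   iint (c 0%N) h (fun a => h ^+ 2 * (\sum_(i < n) bint c' h ((fun t => G i.+1 t ^+ 2) \o tcoord a) * \1_I a) + (h ^+ n)^-1 * B a ^+ 2).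
  apply: (bmf_int_le mI Ifin); first exact: bS.
    by apply: bmfD; apply: bmfM; [exact: bmf_cst|exact: bSG|exact: bmf_cst|exact: bmfX].
  move=> a Ia; rewrite indicE mem_set// mulr1.
  have := IH c' (F \o tcoord a) (fun i => G i.+1 \o tcoord a) (lF' a) (bmf_tcoord a bF) (fun j => bmf_tcoord a (bG j.+1)).
  move=> /le_trans; apply; rewrite BI// [_ / h ^+ n]mulrC lerD2r ler_wpM2l ?exprn_ge0//.
  by rewrite le_eqVlt; apply/orP; left; apply/eqP; apply: eq_bigr => i _; rewrite mulr1.
apply: (le_trans step).
have bB2 := bmfX 2 bB.
rewrite /iint (bmf_intD mI Ifin); last 2 first.
- by apply: bmfM; [exact: bmf_cst|exact: bSG].
- by apply: bmfM; [exact: bmf_cst|exact: bB2].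
rewrite (bmf_intZ mI Ifin _ bSG) (bmf_intZ mI Ifin _ bB2) (bmf_int_sum mI Ifin); last by move=> i; exact: bS.
have E1 : \sum_(i < n) Rintegral (lebesgue_sfm R) I (fun a => bint c' h ((fun t => G i.+1 t ^+ 2) \o tcoord a) * \1_I a) =
   \sum_(i < n) bint c h (fun t => G i.+1 t ^+ 2).
  by apply: eq_bigr => i _; rewrite -(iint_bint c h0' (bG2 i.+1)).
have E2 : Rintegral (lebesgue_sfm R) I B = bint c h F by rewrite -(iint_bint c h0' bF).
rewrite E1 big_ord_recl mulrDr; rewrite E2 Il in H1.
have H2 : (h ^+ n)^-1 * Rintegral (lebesgue_sfm R) I (fun a => B a ^+ 2) <=
   h ^+ 2 * bint c h (fun t => G 0%N t ^+ 2) + bint c h F ^+ 2 / h ^+ n.+1.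
  have hn : 0 < h ^+ n by rewrite exprn_gt0.
  rewrite ler_pdivrMl//; apply: (le_trans H1).
  have : h * K ^+ 2 <= h * (h ^+ n.+1 * bint c h (fun t => G 0%N t ^+ 2)) by rewrite ler_pM2l.
  have -> : h ^+ n * (h ^+ 2 * bint c h (fun t => G 0%N t ^+ 2) + bint c h F ^+ 2 / h ^+ n.+1) =
    bint c h F ^+ 2 / h + h * (h ^+ n.+1 * bint c h (fun t => G 0%N t ^+ 2)).
    by rewrite !exprS; field; rewrite !gt_eqF.
  by rewrite lerD2l.
apply: (le_trans (lerD (lexx _) H2)); rewrite addrCA addrA; exact: lexx.
Qed.
End box_calculus.


(** * Measurability of continuous functions for the product sigma-algebra *)

Section separately_continuous.
Context {R : realType}.
Local Notation T := (measurableTypeR R).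

Definition grid (k : nat) (a : R) : R := (Num.floor (k.+1%:R * a))%:~R / k.+1%:R.

Lemma grid_cvg (a : R) : grid k a @[k --> \oo] --> a.
Proof.
apply/cvgrPdist_le => e e0.
near=> k; rewrite /grid.
have k0 : 0 < k.+1%:R :> R by [].
have /andP[f1 f2] := floor_itv (k.+1%:R * a); rewrite intrD in f2.
have -> : a - (Num.floor (k.+1%:R * a))%:~R / k.+1%:R = (k.+1%:R * a - (Num.floor (k.+1%:R * a))%:~R) / k.+1%:R.
  by field; rewrite addrC natr1.
rewrite normrM normfV (gtr0_norm k0) ler_pdivrMr// ger0_norm ?subr_ge0//.
have : 1 <= e * k.+1%:R.
  rewrite mulrC -ler_pdivrMr// mul1r.
  near: k; exists (Num.bound e^-1) => // j /= hj.
  have := archi_boundP (ltW (_ : 0 < e^-1)); rewrite invr_gt0 => /(_ e0) h.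
  by apply: (le_trans (ltW h)); rewrite ler_nat (leq_trans hj).
by move: f2; rewrite mulr1z; lra.
Unshelve. all: by end_near. Qed.

(** Such a function is the pointwise limit of functions constant in the first variable on the cells
    of a grid, and these are measurable as countable unions of products. *)
Lemma measurable_slicewise d (T2 : measurableType d) (f : T * T2 -> R) :
  (forall a, measurable_fun setT (fun t => f (a, t))) ->
  (forall t, continuous (fun a : R => f ((a : T), t))) -> measurable_fun setT f.
Proof.
move=> mf cf.
apply: (measurable_fun_cvg (h := fun k p => f ((grid k p.1 : T), p.2))) => [k|[a t] _ /=]; last first.
  exact: (cvg_comp (fun k => grid k (a : R)) (fun s : R => f ((s : T), t)) (@grid_cvg a) (cf t (a : R))).
move=> _ Y mY; rewrite setTI.
have -> : (fun p => f ((grid k p.1 : T), p.2)) @^-1` Y =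
  \bigcup_(z : int) ([set a : T | Num.floor (k.+1%:R * (a : R)) = z] `*`
     (fun t => f ((z%:~R / k.+1%:R : T), t)) @^-1` Y).
  apply/seteqP; split=> [[a t] h|[a t] [z _ [/= <-]]]; last by [].
  by exists (Num.floor (k.+1%:R * (a : R))).
apply: countable_bigcupT_measurable => [|z]; first exact: countableP.
apply: measurableX; last by rewrite -[X in measurable X]setTI; apply: mf.
have -> : [set a : T | Num.floor (k.+1%:R * (a : R)) = z] = `[z%:~R / k.+1%:R, (z + 1)%:~R / k.+1%:R[%classic.
  apply/seteqP; split=> a /=; rewrite in_itv/= ler_pdivrMr// ltr_pdivlMr// ![(a : R) * _]mulrC.
    by move=> <-; exact: floor_itv.
  by move=> h; apply: floor_def.
exact: measurable_itv.
Qed.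

(** The sigma-algebra on tuples comes from the coordinates and not from a topology; continuity is
    therefore used one coordinate at a time. *)
Fixpoint sepcont n : (n.-tuple T -> R) -> Prop :=
  match n return (n.-tuple T -> R) -> Prop with
  | 0 => fun _ => True
  | k.+1 => fun F => (forall t, continuous (fun s : R => F (tcoord s t))) /\
               (forall s : R, sepcont (F \o tcoord s))
  end.

Lemma sepcont_measurable n (F : n.-tuple T -> R) : sepcont F -> measurable_fun setT F.
Proof.
elim: n F => [|n IH] F.
  move=> _; rewrite (_ : F = fun=> F [tuple]); first exact: measurable_cst.
  by apply/funext => t; rewrite (tuple0 t).
move=> [cF sF].
have -> : F = (F \o @tcons R n) \o (fun t => (thead t, [tuple of behead t])).
  by apply/funext => t /=; congr F; case/tupleP: t => a t; apply: val_inj.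
apply: measurableT_comp.
  apply: measurable_slicewise => [a|t]; first exact: (IH _ (sF a)).
  exact: cF.
by apply/measurable_fun_pair => /=; [exact: (measurable_tnth ord0)|exact: measurable_behead].
Qed.
End separately_continuous.

(** * Integration over the unit ball *)

Section euclidean.
Context {R : realType}.
Local Notation T := (measurableTypeR R).

Section embedding.
Context {N : nat}.
Implicit Types (e : nat -> 'rV[R]_N) (x : 'rV[R]_N).

(** The base point [x] is what makes inductions on coordinates possible: freezing the first
    coordinate moves [x] and leaves an embedding of the same kind. *)
Definition emb n e x (t : n.-tuple T) : 'rV[R]_N := x + \sum_(i < n) (tnth t i : R) *: e i.

Lemma emb_tcoord n e x (s : R) (t : n.-tuple T) :
  emb e x (tcoord s t) = emb (fun i => e i.+1) (x + s *: e 0%N) t.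
Proof.
rewrite /emb big_ord_recl addrA; congr (_ + _ *: _ + _).
by apply: eq_bigr => i _; rewrite /tcoord /tcons /= tnthS.
Qed.

Lemma emb_line n e x (s : R) (t : n.-tuple T) :
  emb e x (tcoord s t) = s *: e 0%N + (x + \sum_(i < n) (tnth t i : R) *: e i.+1).
Proof. by rewrite emb_tcoord /emb (addrC x) -addrA. Qed.

Lemma sepcont_emb (psi : 'rV[R]_N -> R) n e x : continuous psi -> sepcont (psi \o @emb n e x).
Proof.
move=> cp; elim: n e x => // n IH e x; split=> [t|s].
  move=> s; rewrite (_ : (fun _ => _) = psi \o (fun s : R => s *: e 0%N + (x + \sum_(i < n) (tnth t i : R) *: e i.+1))).
    by apply: continuous_comp; [exact: continuous_line|exact: cp].
  by apply/funext => z; rewrite /= emb_line.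
rewrite (_ : _ \o _ = psi \o @emb n (fun i => e i.+1) (x + s *: e 0%N)); first exact: IH.
by apply/funext => t /=; rewrite emb_tcoord.
Qed.

Lemma lined_emb (psi : 'rV[R]_N -> R) (G : nat -> 'rV[R]_N -> R) n e x :
  (forall i x, is_derive x (e i) psi (G i x)) -> (forall i, continuous (G i)) ->
  lined (psi \o @emb n e x) (fun i => G i \o emb e x).
Proof.
elim: n e x G => // n IH e x G dpsi cG; split=> [t|s].
  have E (f : 'rV[R]_N -> R) : (fun s : R => (f \o emb e x) (tcoord s t)) =
      f \o (fun s : R => s *: e 0%N + (x + \sum_(i < n) (tnth t i : R) *: e i.+1)).
    by apply/funext => z; rewrite /= emb_line.
  rewrite !E; split.
    by move=> s; rewrite /= emb_line; apply/is_derive_lineP; exact: dpsi.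
  by move=> s; apply: continuous_comp; [exact: continuous_line|exact: cG].
rewrite (_ : _ \o _ = psi \o @emb n (fun i => e i.+1) (x + s *: e 0%N)); last first.
  by apply/funext => t /=; rewrite emb_tcoord.
rewrite (_ : (fun i => _) = fun i => G i.+1 \o emb (fun i => e i.+1) (x + s *: e 0%N)); last first.
  by apply/funext => i; apply/funext => t /=; rewrite emb_tcoord.
exact: IH.
Qed.
End embedding.

Context {n : nat}.
Implicit Types (f psi : 'rV[R]_n -> R) (x : 'rV[R]_n).
Local Notation M := (@lebesgue_rV R n).
Local Notation row := (@row_of_tuple R n).

Definition unit_vec (i : nat) : 'rV[R]_n := \row_j ((j : nat) == i)%:R.

Lemma unit_vecE (i : 'I_n) : unit_vec i = delta_mx 0 i.
Proof. by apply/rowP => j; rewrite !mxE eqxx. Qed.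

Lemma row_emb t : row t = emb unit_vec 0 t.
Proof.
apply/rowP => j; rewrite /emb add0r summxE mxE (bigD1 j)//= big1 ?addr0.
  by rewrite !mxE eqxx mulr1.
by move=> i ij; rewrite !mxE (_ : (j : nat) == i = false) ?mulr0//; apply/negbTE; apply: contraNneq ij => e; apply/eqP/val_inj.
Qed.

Lemma measurable_row : measurable_fun setT row.
Proof. by move=> _ Y mY; rewrite setTI. Qed.

Lemma continuous_measurable f : continuous f -> measurable_fun setT f.
Proof.
move=> cf _ Y mY; rewrite setTI.
have : measurable_fun setT (f \o row).
  rewrite (_ : f \o row = f \o emb unit_vec 0); last by apply/funext => t /=; rewrite row_emb.
  by apply: sepcont_measurable; exact: sepcont_emb.
by move=> /(_ measurableT Y mY); rewrite setTI.
Qed.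

Lemma bmf_row f : bmf f -> bmf (f \o row).
Proof.
by move=> [mf [C fC]]; split; [apply: measurableT_comp => //; exact: measurable_row|exists C => t; exact: fC].
Qed.

Definition rbox (c : nat -> R) (h : R) : set 'rV[R]_n := [set x | forall i : 'I_n, c i <= x 0 i < c i + h].

Lemma row_rbox c h : row @^-1` (rbox c h) = box c h.
Proof. by apply/seteqP; split=> t H i; have := H i; rewrite !mxE. Qed.

Lemma measurable_rbox c h : measurable (rbox c h).
Proof. by rewrite /measurable/= /measurable_rV/= row_rbox; exact: measurable_box. Qed.

Lemma rbox_measure c h : 0 <= h -> M (rbox c h) = (h ^+ n)%:E.
Proof. by move=> h0; rewrite /= /lebesgue_rV row_rbox box_measure. Qed.

Lemma rint_row c h f : 0 <= h -> bmf f -> Rintegral M (rbox c h) f = bint c h (f \o row).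
Proof.
move=> h0 bf; rewrite /bint /Rintegral; congr fine.
rewrite (@eq_measure_integral _ _ _ _ (pushforward (lebesgue_tuple R n) row)).
  exact: measurable_row.
move=> mt; rewrite (integral_pushforward mt).
- by rewrite row_rbox.
- by apply/measurable_EFinP; exact: bf.1.
- rewrite row_rbox; apply: (bmf_integrable (@measurable_box R n c h) (box_fin _ _ h0) (bmf_row bf)).
- exact: measurable_rbox.
- by [].
Qed.

Lemma continuous_enorm : continuous (@enorm R n).
Proof.
move=> x; apply: continuous_comp; last exact: sqrt_continuous.
apply: (@cvg_finite_sum R _ _ (nbhs x) _ _ (fun i x => x 0 i ^+ 2)) => i.
rewrite expr2; under eq_fun do rewrite expr2.
by apply: cvgM; exact: coord_continuous.
Qed.

Lemma coord_le_enorm x i : `|x 0 i| <= enorm x.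
Proof.
rewrite -sqrtr_sqr; apply: ler_wsqrtr; rewrite (bigD1 i)//= lerDl.
by apply: sumr_ge0 => j _; exact: sqr_ge0.
Qed.

Lemma open_uball : open (@uball R n).
Proof.
have -> : @uball R n = (@enorm R n) @^-1` [set r | r < 1] by [].
by apply: open_comp; [move=> x _; exact: continuous_enorm|exact: open_lt].
Qed.

Lemma measurable_uball : measurable (@uball R n).
Proof.
have -> : @uball R n = (@enorm R n) @^-1` `]-oo, 1[.
  by apply/seteqP; split=> x; rewrite /preimage/= in_itv.
rewrite -[X in measurable X]setTI; exact: (continuous_measurable continuous_enorm).
Qed.

Lemma uball_rbox : @uball R n `<=` rbox (fun=> -1) 2.
Proof.
move=> x xB i; have := le_lt_trans (coord_le_enorm x i) xB.
by rewrite ltr_norml => /andP[]; lra.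
Qed.

Lemma uball_fin : (M (@uball R n) < +oo)%E.
Proof.
apply: (@le_lt_trans _ _ (M (rbox (fun=> -1) 2))); last by rewrite rbox_measure// ltry.
by apply: le_measure; rewrite ?inE; [exact: measurable_uball|exact: measurable_rbox|exact: uball_rbox].
Qed.

Lemma Rintegral_support (D E : set 'rV[R]_n) f : measurable D -> measurable E -> D `<=` E ->
  (forall x, ~ D x -> f x = 0) -> Rintegral M D f = Rintegral M E f.
Proof.
move=> mD mE DE f0; rewrite [LHS]Rintegral_mkcond [RHS]Rintegral_mkcond.
apply: eq_Rintegral => x _; rewrite !patchE.
have [Dx|Dx] := pselect (D x); first by rewrite !mem_set//; exact: DE.
by rewrite (memNset Dx); case: ifP => // _; rewrite f0.
Qed.

Local Notation J f := (Rintegral M (@uball R n) f).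

Lemma uball_int f : bmf f -> (forall x, ~ uball x -> f x = 0) -> J f = bint (fun=> -1) 2 (f \o row).
Proof.
move=> bf f0; rewrite (Rintegral_support measurable_uball (measurable_rbox (fun=> -1) 2) uball_rbox f0).
by rewrite rint_row.
Qed.

Definition ball_C1 f (G : 'I_n -> 'rV[R]_n -> R) :=
  [/\ continuous f, forall i x, is_derive x (delta_mx 0 i) f (G i x), forall i, continuous (G i) &
   exists K, [/\ compact K, K `<=` uball & forall x, ~ K x -> f x = 0 /\ forall i, G i x = 0]].

Lemma compact_support_bmf f K : continuous f -> compact K -> (forall x, ~ K x -> f x = 0) -> bmf f.
Proof.
move=> cf cK f0; split; first exact: continuous_measurable.
have /compact_bounded[C [_ hC]] : compact (f @` K).
  by apply: continuous_compact => //; exact: continuous_subspaceT.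
exists (`|C| + 1) => x; have [Kx|Kx] := pselect (K x); last by rewrite f0// normr0 addr_ge0.
by apply: hC; [rewrite ltr_pwDr// ler_norm|exists x].
Qed.

Lemma ball_C1_bmf f G : ball_C1 f G -> bmf f /\ forall i, bmf (G i).
Proof.
move=> [cf _ cG [K [cK _ K0]]]; split.
  by apply: (compact_support_bmf cf cK) => x /K0[].
by move=> i; apply: (compact_support_bmf (cG i) cK) => x /K0[_]; apply.
Qed.

Lemma ball_C1_out f G x : ball_C1 f G -> ~ uball x -> f x = 0 /\ forall i, G i x = 0.
Proof. by move=> [_ _ _ [K [_ KB K0]]] xB; apply: K0; apply: contra_not xB; exact: KB. Qed.

Definition ext_grad (G : 'I_n -> 'rV[R]_n -> R) (i : nat) : 'rV[R]_n -> R :=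
  if insub i is Some j then G j else fun=> 0.

Lemma ext_gradE G (i : 'I_n) : ext_grad G i = G i.
Proof. by rewrite /ext_grad valK. Qed.

Lemma is_derive_0vec f x : is_derive x 0 f 0.
Proof.
apply/is_derive_line; apply: (@is_derive_ext _ (fun=> f x)); by move=> t; rewrite scaler0 add0r.
Qed.

Lemma ball_C1_lined f G : ball_C1 f G -> lined (f \o row) (fun i => ext_grad G i \o row).
Proof.
move=> [cf df cG _].
have E (g : 'rV[R]_n -> R) : g \o row = g \o emb unit_vec 0 by apply/funext => t /=; rewrite row_emb.
rewrite E (_ : (fun i => _) = fun i => ext_grad G i \o emb unit_vec 0); last by apply/funext => i; rewrite E.
apply: lined_emb => [i x|i].
  rewrite /ext_grad; case: insubP => [j _ <-|ni]; first by rewrite unit_vecE; exact: df.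
  rewrite (_ : unit_vec i = 0); first exact: is_derive_0vec.
  by apply/rowP => j; rewrite !mxE (_ : (j : nat) == i = false)//; apply/negbTE; apply: contraNneq ni => <-.
rewrite /ext_grad; case: insubP => [j _ _|_]; first exact: cG.
by move=> x; exact: cst_continuous.
Qed.

Lemma ext_grad_bmf f G i : ball_C1 f G -> bmf (ext_grad G i).
Proof.
move=> /ball_C1_bmf[_ h]; rewrite /ext_grad; case: insubP => // _; exact: bmf_cst.
Qed.

Lemma uball_int_partial f G i : ball_C1 f G -> J (G i) = 0.
Proof.
move=> H; have [_ bG] := ball_C1_bmf H.
rewrite uball_int//; last by move=> x xB; have [_] := ball_C1_out H xB; exact.
have := @bint_partial R n (fun=> -1) 2 (f \o row) (fun i => ext_grad G i \o row) i.
rewrite ext_gradE; apply => //.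
- exact: ball_C1_lined.
- by move=> j; apply: bmf_row; exact: ext_grad_bmf H.
move=> t [j /negP nj]; suff xB : ~ uball (row t) by have [] := ball_C1_out H xB.
move=> xB; apply: nj; have := le_lt_trans (coord_le_enorm (row t) j) xB.
by rewrite mxE ltr_norml => /andP[h1 h2]; apply/andP; split; [exact: h1|lra].
Qed.
End euclidean.


Section square_norm.
Context {R : realType} {n : nat}.
Implicit Types (x v : 'rV[R]_n).

Definition sqn x : R := \sum_(i < n) x 0 i ^+ 2.

Lemma sqn_ge0 x : 0 <= sqn x.
Proof. by apply: sumr_ge0 => i _; exact: sqr_ge0. Qed.

Lemma enorm_sqn x : enorm x ^+ 2 = sqn x.
Proof. by rewrite sqr_sqrtr ?sqn_ge0. Qed.

Lemma sqn_gt0 x : (0 < sqn x) = (x != 0).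
Proof.
rewrite lt_neqAle sqn_ge0 andbT eq_sym; congr (~~ _); apply/eqP/eqP => [s0|->]; last first.
  by rewrite /sqn big1// => i _; rewrite mxE expr0n.
apply/rowP => i; rewrite mxE; apply/eqP; rewrite -sqrf_eq0; apply/eqP.
by move: s0 => /eqP; rewrite psumr_eq0 => [/allP/(_ i (mem_index_enum i))/eqP|j _]; last exact: sqr_ge0.
Qed.

Lemma sqn_lt1 x : (sqn x < 1) = (enorm x < 1).
Proof.
have e0 : 0 <= enorm x by exact: sqrtr_ge0.
by rewrite -enorm_sqn expr_lt1.
Qed.

Lemma enorm_gt0 x : (0 < enorm x) = (x != 0).
Proof. by rewrite sqrtr_gt0 sqn_gt0. Qed.
End square_norm.

(** * The potential of the linearized problem *)

Section potential.
Context {R : realType} {n : nat}.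
Variables (u : 'rV[R]_n -> R) (l : R).
Hypothesis n3 : (3 <= n)%N.
Hypothesis singu : singular_solution l u.
Let i0 : 'I_n := Ordinal (leq_trans (isT : (1 <= 3)%N) n3).
Let b : R := ln l / 2.
Let m : R := n%:R - 2.
Let y := logprof u b i0.
Let dy := dlogprof u b i0.
Let l0 : 0 < l := sing_l0 singu.

Definition potential (x : 'rV[R]_n) : R := l * expR (u x) * expexp (u x).

Let uE x : uball x -> x != 0 -> u x = y (ln (enorm x) + b).
Proof.
move=> xB x0; have e0 : 0 < enorm x by rewrite enorm_gt0.
rewrite /y /logprof addrK lnK ?posrE//; apply: (sing_rad singu).
- by split=> //; apply/eqP.
- by apply: uball0_line; rewrite e0.
- by rewrite enorm1 gtr0_norm.
Qed.

Lemma potential_scaled x : uball x -> x != 0 ->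
  potential x * sqn x = 2 * m * expR (emZ m y (ln (enorm x) + b)).
Proof.
move=> xB x0; have e0 : 0 < enorm x by rewrite enorm_gt0.
have m1 : 1 <= m := m_ge1 n3.
rewrite /potential uE// /emZ; set z := y _.
have -> : sqn x = expR (2 * (ln (enorm x) + b)) / l.
  rewrite mulrDr expRD (exp_2b l0) mulfK ?gt_eqF//.
  by rewrite [2 * _]mulr_natl mulr2n expRD lnK ?posrE// -expr2 enorm_sqn.
rewrite expRB expRD lnK ?posrE; last by lra.
rewrite expRD /expexp; field.
by rewrite (gt_eqF l0) gt_eqF//; lra.
Qed.

Lemma potential_near0 (d : R) : 0 < d -> exists2 r0 : R, 0 < r0 & forall x,
  uball x -> x != 0 -> enorm x <= r0 -> `|potential x * sqn x - 2 * m| <= d.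
Proof.
move=> d0; have [_ H] := singular_log i0 n3 singu; have m1 : 1 <= m := m_ge1 n3.
pose d' := Num.min (1 / 2) (d / (4 * m)).
have d'0 : 0 < d'.
  rewrite lt_min; apply/andP; split; first by lra.
  by apply: divr_gt0 => //; lra.
have [T Tb HT] := H d' d'0.
exists (expR (T - b)); first exact: expR_gt0.
move=> x xB x0 xr; have e0 : 0 < enorm x by rewrite enorm_gt0.
have tT : ln (enorm x) + b <= T.
  by rewrite -lerBrDr -ler_expR lnK ?posrE.
have [Zd _ _] := HT _ tT; rewrite potential_scaled//.
have d2 : 0 <= d' <= 1 / 2 by rewrite ltW//= ge_min lexx.
have := exp_near0 d2 Zd; rewrite -/y.
set Z := expR _ => h.
have -> : 2 * m * Z - 2 * m = 2 * m * (Z - 1) by ring.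
have d4 : d' <= d / (4 * m) by rewrite ge_min lexx orbT.
rewrite normrM gtr0_norm; last by lra.
apply: (@le_trans _ _ (2 * m * (2 * (d / (4 * m))))).
  by rewrite ler_pM2l; lra.
by rewrite le_eqVlt; apply/orP; left; apply/eqP; field; lra.
Qed.

Lemma potential_away (r0 : R) : 0 < r0 -> exists C : R, forall x,
  uball x -> r0 <= enorm x -> potential x <= C.
Proof.
move=> r00; have [[H1 H2 H3 H4] _] := singular_log i0 n3 singu.
pose z := y (ln r0 + b); exists (l * expR z * expexp z) => x xB rx.
have x0 : x != 0 by rewrite -enorm_gt0 (lt_le_trans r00).
have e0 : 0 < enorm x by rewrite enorm_gt0.
have uz : u x <= z.
  rewrite uE//; apply: (log_sol_decr (singular_log i0 n3 singu).1); first by rewrite lerD2r ler_ln ?posrE.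
  by rewrite gtrDr ln_lt0// e0.
rewrite /potential; apply: ler_pM; [|exact/ltW/expexp_gt0| |exact: expexp_le].
  by rewrite mulr_ge0 ?expR_ge0// ltW.
by rewrite ler_pM2l// ler_expR.
Qed.

Lemma potential_gt0 x : 0 < potential x.
Proof. by rewrite /potential !mulr_gt0// ?expR_gt0// expexp_gt0. Qed.

Lemma potential_continuous x : uball x -> x != 0 -> {for x, continuous potential}.
Proof.
move=> xB x0; have cu : {for x, continuous u}.
  by have [] := sing_C2 singu (s := [::]) (isT : (0 <= 2)%N) (conj xB (elimN eqP x0)).
apply: (@continuous_comp _ _ _ u (fun t : R => l * expR t * expexp t)); first exact: cu.
apply: continuousM; first by apply: continuousM; [exact: cst_continuous|exact: continuous_expR].
by apply: continuous_comp; exact: continuous_expR.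
Qed.
End potential.

(** * Hardy and Poincare inequalities *)


Section vector_derivatives.
Context {R : realType} {n : nat}.
Implicit Types (f g p : 'rV[R]_n -> R) (x v : 'rV[R]_n) (i j : 'I_n).
Local Notation e i := (delta_mx 0 i : 'rV[R]_n).

Lemma is_derive_mulv f g x v (a b : R) : is_derive x v f a -> is_derive x v g b ->
  is_derive x v (fun x => f x * g x) (a * g x + f x * b).
Proof.
move=> /is_derive_line hf /is_derive_line hg; apply/is_derive_line.
by apply: (d_eq (dM hf hg)); rewrite scale0r add0r; ring.
Qed.

Lemma coord_line x i j (s : R) : (s *: e j + x) 0 i = s * (i == j)%:R + x 0 i.
Proof. by rewrite !mxE eqxx. Qed.

Lemma sqn_line x j (s : R) : sqn (s *: e j + x) = sqn x + 2 * s * x 0 j + s ^+ 2.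
Proof.
rewrite /sqn (bigD1 j)//= [X in _ = X + _ + _](bigD1 j)//= coord_line eqxx.
rewrite (eq_bigr (fun i => x 0 i ^+ 2)) => [|i /negbTE ij]; last by rewrite coord_line ij mulr0 add0r.
by rewrite /=; set z := \sum_(_ < _ | _) _; ring.
Qed.

Lemma is_derive_coord x i j : is_derive x (e j) (fun x => x 0 i) (i == j)%:R.
Proof.
apply/is_derive_line; apply: (@is_derive_ext _ (fun s : R => s * (i == j)%:R + x 0 i)).
  by move=> s; rewrite coord_line.
by have h1 := dI (0 : R); have h2 := dC (i == j)%:R (0 : R); have h3 := dC (x 0 i) (0 : R);
  apply: (d_eq (dD (dM h1 h2) h3)); ring.
Qed.

Lemma is_derive_sqn x j : is_derive x (e j) sqn (2 * x 0 j).
Proof.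
apply/is_derive_line; apply: (@is_derive_ext _ (fun s : R => sqn x + 2 * s * x 0 j + s ^+ 2)).
  by move=> s; rewrite sqn_line.
by dtac; ring.
Qed.

Lemma continuous_mulv f g : continuous f -> continuous g -> continuous (fun x => f x * g x).
Proof. by move=> cf cg x; apply: continuousM; [exact: cf|exact: cg]. Qed.

Lemma continuous_addv f g : continuous f -> continuous g -> continuous (fun x => f x + g x).
Proof. by move=> cf cg x; apply: continuousD; [exact: cf|exact: cg]. Qed.

Lemma continuous_oppv f : continuous f -> continuous (fun x => - f x).
Proof. by move=> cf x; apply: continuousN; exact: cf. Qed.

Lemma continuous_cstv (a : R) : continuous ((fun=> a) : 'rV[R]_n -> R).
Proof. by move=> x; exact: cst_continuous. Qed.

Lemma continuous_coordv i : continuous (fun x => x 0 i : R).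
Proof. exact: coord_continuous. Qed.

Lemma continuous_sqn : continuous (@sqn R n).
Proof.
rewrite (_ : @sqn R n = fun x => enorm x * enorm x); last by apply/funext => x; rewrite -expr2 enorm_sqn.
by apply: continuous_mulv; exact: continuous_enorm.
Qed.

Section hardy_field.
Variable (d : R).
Hypothesis d0 : 0 < d.
Let q x : R := sqn x + d.

Let q0 x : q x != 0.
Proof. by rewrite gt_eqF// ltr_wpDl// sqn_ge0. Qed.

(** The shift [d > 0] keeps the field smooth at the origin, where test functions need not vanish;
    [d] tends to 0 only after the passage from test functions to the Sobolev space. *)
Definition hardy_field i x : R := x 0 i / (sqn x + d).
Definition hardy_dfield i j x : R := (i == j)%:R / (sqn x + d) - 2 * x 0 i * x 0 j / (sqn x + d) ^+ 2.

Lemma continuous_inv_sqn : continuous (fun x => (sqn x + d)^-1).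
Proof.
move=> x; apply: (@continuous_comp _ _ _ (fun x => sqn x + d) GRing.inv); last exact: (inv_continuous (q0 x)).
by apply: continuous_addv; [exact: continuous_sqn|exact: continuous_cstv].
Qed.

Lemma continuous_hardy_field i : continuous (hardy_field i).
Proof. by apply: continuous_mulv; [exact: continuous_coordv|exact: continuous_inv_sqn]. Qed.

Lemma continuous_hardy_dfield i j : continuous (hardy_dfield i j).
Proof.
apply: continuous_addv.
  by apply: continuous_mulv; [exact: continuous_cstv|exact: continuous_inv_sqn].
apply: continuous_oppv.
rewrite (_ : (fun _ => _) = fun x => 2 * x 0 i * x 0 j * ((sqn x + d)^-1 * (sqn x + d)^-1)); last first.
  by apply/funext => z; rewrite expr2 invfM.
apply: continuous_mulv; last by apply: continuous_mulv; exact: continuous_inv_sqn.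
apply: continuous_mulv; last exact: continuous_coordv.
by apply: continuous_mulv; [exact: continuous_cstv|exact: continuous_coordv].
Qed.

Lemma is_derive_inv_sqn x j : is_derive x (e j) (fun x => (sqn x + d)^-1) (- (2 * x 0 j) / (sqn x + d) ^+ 2).
Proof.
have /is_derive_line h := is_derive_sqn x j; apply/is_derive_line.
have h2 := dD h (dC d (0 : R)).
have ne : sqn (0 *: e j + x) + d != 0 by exact: q0.
have h3 := @dV _ (fun s : R => sqn (s *: e j + x) + d) _ _ ne h2; apply: (d_eq h3); rewrite scale0r add0r; have := q0 x; rewrite /q => ?; field.
by [].
Qed.

Lemma is_derive_hardy_field i j x : is_derive x (e j) (hardy_field i) (hardy_dfield i j x).
Proof.
have h := is_derive_mulv (is_derive_coord x i j) (is_derive_inv_sqn x j).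
have <- : (i == j)%:R * (sqn x + d)^-1 + x 0 i * (- (2 * x 0 j) / (sqn x + d) ^+ 2) = hardy_dfield i j x.
  by rewrite /hardy_dfield; have := q0 x; rewrite /q => ?; field.
exact: h.
Qed.
End hardy_field.
End vector_derivatives.

Section ball_functions.
Context {R : realType} {n : nat}.
Implicit Types (f g p psi : 'rV[R]_n -> R) (x v : 'rV[R]_n) (i j : 'I_n).
Local Notation e i := (delta_mx 0 i : 'rV[R]_n).
Local Notation B := (@uball R n).
Local Notation M := (@lebesgue_rV R n).
Local Notation J f := (Rintegral M B f).
Let mB := @measurable_uball R n.
Let finB := @uball_fin R n.

Lemma ball_C1_mul f G p (P : 'I_n -> 'rV[R]_n -> R) : ball_C1 f G -> continuous p ->
  (forall i x, is_derive x (e i) p (P i x)) -> (forall i, continuous (P i)) ->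
  ball_C1 (fun x => f x * p x) (fun i x => G i x * p x + f x * P i x).
Proof.
move=> [cf df cG [K [cK KB K0]]] cp dp cP; split.
- exact: continuous_mulv.
- by move=> i x; exact: is_derive_mulv.
- by move=> i; apply: continuous_addv; exact: continuous_mulv.
- exists K; split => // x /K0[-> G0]; split; first by rewrite mul0r.
  by move=> i; rewrite G0 !mul0r addr0.
Qed.

Lemma ball_C1_bmfM f G p : ball_C1 f G -> continuous p -> bmf (fun x => f x * p x).
Proof.
move=> [cf _ _ [K [cK _ K0]]] cp; apply: (compact_support_bmf _ cK) => [|x /K0[-> _]]; last by rewrite mul0r.
exact: continuous_mulv.
Qed.

(* Integrate [|grad f + (m/2) f F|^2 >= 0] and the divergence of [f^2 F], where
   [F = x / (|x|^2 + d)] satisfies [div F >= m / (|x|^2 + d)]. *)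
Lemma hardy (d : R) f G : 0 < d -> (2 <= n)%N -> ball_C1 f G ->
  ((n%:R - 2) ^+ 2 / 4) * J (fun x => f x ^+ 2 / (sqn x + d)) <= \sum_(i < n) J (fun x => G i x ^+ 2).
Proof.
move=> d0 n2 H; set m : R := n%:R - 2.
have m0 : 0 <= m by rewrite subr_ge0 ler_nat.
have [bf bG] := ball_C1_bmf H; have [cf df cG _] := H.
have HF i := ball_C1_mul (ball_C1_mul H cf df cG) (@continuous_hardy_field R n d d0 i)
   (fun j x => is_derive_hardy_field d0 i j x) (@continuous_hardy_dfield R n d d0 i).
pose D i x := (G i x * f x + f x * G i x) * hardy_field d i x + f x * f x * hardy_dfield d i i x.
have D0 i : J (D i) = 0 by exact: (uball_int_partial i (HF i)).
have bD i : bmf (D i) by have [_ /(_ i)] := ball_C1_bmf (HF i).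
have bW : bmf (fun x => f x ^+ 2 / (sqn x + d)).
  have := ball_C1_bmfM (ball_C1_mul H cf df cG) (continuous_inv_sqn d0).
  by congr bmf; apply/funext => x; rewrite -expr2.
have bG2 i := bmfX 2 (bG i).
have bS : bmf (fun x => \sum_(i < n) G i x ^+ 2) by apply: bmf_sum.
have bSD : bmf (fun x => \sum_(i < n) D i x) by apply: bmf_sum.
have b1 : bmf (fun x => m ^+ 2 / 4 * (f x ^+ 2 / (sqn x + d))) by apply: bmfM => //; exact: bmf_cst.
have b2 : bmf (fun x => m / 2 * \sum_(i < n) D i x) by apply: bmfM => //; exact: bmf_cst.
rewrite -(bmf_int_sum mB finB)// -(bmf_intZ mB finB)//.
have -> : J (fun x => \sum_(i < n) G i x ^+ 2) = J (fun x => \sum_(i < n) G i x ^+ 2 + m / 2 * \sum_(i < n) D i x).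
  by rewrite (bmf_intD mB finB)// (bmf_intZ mB finB)// (bmf_int_sum mB finB _ bD) big1 ?mulr0 ?addr0.
apply: (bmf_int_le mB finB) => //; first exact: bmfD.
move=> x _ /=.
have q0 : 0 < sqn x + d by rewrite ltr_wpDl// sqn_ge0.
pose W := (sqn x + d)^-1; pose A := \sum_(i < n) G i x * x 0 i.
have W0 : 0 < W by rewrite invr_gt0.
have qW : sqn x * W <= 1 by rewrite ler_pdivrMr// mul1r lerDl ltW.
have ED : \sum_(i < n) D i x = 2 * f x * W * A + n%:R * (f x ^+ 2 * W) - 2 * f x ^+ 2 * W ^+ 2 * sqn x.
  have <- : \sum_(i < n) (f x ^+ 2 * W) = n%:R * (f x ^+ 2 * W) by rewrite sumr_const card_ord mulr_natl.
  rewrite /A /sqn !mulr_sumr -big_split/= -sumrB; apply: eq_bigr => i _.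
  rewrite /D /hardy_field /hardy_dfield eqxx mulr1n -/W exprVn -/W; ring.
have ES : \sum_(i < n) (G i x + m / 2 * f x * W * x 0 i) ^+ 2 =
    \sum_(i < n) G i x ^+ 2 + m * f x * W * A + (m / 2 * f x * W) ^+ 2 * sqn x.
  rewrite /A /sqn !mulr_sumr -!big_split/=; apply: eq_bigr => i _; by field.
have S0 : 0 <= \sum_(i < n) (G i x + m / 2 * f x * W * x 0 i) ^+ 2.
  by apply: sumr_ge0 => i _; exact: sqr_ge0.
rewrite ED -/W; rewrite ES in S0.
have nm : n%:R = m + 2 :> R by rewrite subrK.
rewrite nm; move: S0; set S := \sum_(i < n) G i x ^+ 2; set F := f x; set Q := sqn x => S0.
have T : 0 <= F ^+ 2 * W * ((m + m ^+ 2 / 4) * (1 - Q * W)).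
  have F2 := sqr_ge0 F; have m2 := sqr_ge0 m.
  apply: mulr_ge0; first by apply: mulr_ge0 => //; exact: ltW.
  by apply: mulr_ge0; [apply: addr_ge0 => //; apply: divr_ge0|rewrite subr_ge0].
rewrite -subr_ge0.
have -> : S + m / 2 * (2 * F * W * A + (m + 2) * (F ^+ 2 * W) - 2 * F ^+ 2 * W ^+ 2 * Q) - m ^+ 2 / 4 * (F ^+ 2 * W) =
  (S + m * F * W * A + (m / 2 * F * W) ^+ 2 * Q) + F ^+ 2 * W * ((m + m ^+ 2 / 4) * (1 - Q * W)) by field.
exact: addr_ge0.
Qed.

Section cells.
Variable N : nat.
Let h : R := 2 / N.+1%:R.
Let h0 : 0 < h. Proof. by rewrite divr_gt0. Qed.
Local Notation cells := {ffun 'I_n -> 'I_N.+1}.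

Definition cell_corner (k : cells) (i : nat) : R :=
  -1 + 2 / N.+1%:R * (if insub i is Some j then (k j : nat)%:R else 0).
Definition cell (k : cells) : set 'rV[R]_n := rbox (cell_corner k) (2 / N.+1%:R).

Lemma measurable_cell k : measurable (cell k).
Proof. exact: measurable_rbox. Qed.

Lemma cellP k x : cell k x <-> forall i, (k i : nat)%:R <= (x 0 i + 1) / h < (k i : nat).+1%:R.
Proof.
have E i : (cell_corner k i <= x 0 i < cell_corner k i + 2 / N.+1%:R) = ((k i : nat)%:R <= (x 0 i + 1) / h < (k i : nat).+1%:R).
  rewrite /cell_corner valK ler_pdivlMr// ltr_pdivrMr// -[(k i).+1%:R]natr1 -/h mulrDl mul1r [_ * h]mulrC.
  by set z := h * _; apply/idP/idP => /andP[z1 z2]; apply/andP; split; lra.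
by split=> H i; have := H i; rewrite ?E// /cell -E.
Qed.

Lemma cell_partition x : uball x -> \sum_(k : cells) \1_(cell k) x = 1 :> R.
Proof.
move=> xB; pose k0 : cells := [ffun i => inord (Num.trunc ((x 0 i + 1) / h))].
have X i : 0 <= (x 0 i + 1) / h < N.+1%:R.
  have := le_lt_trans (coord_le_enorm x i) xB; rewrite ltr_norml => /andP[x1 x2].
  rewrite divr_ge0 ?(ltW h0)//=; last by lra.
  rewrite ltr_pdivrMr// /h [_ * (_ / _)]mulrC divfK//; lra.
have k0E i : (k0 i : nat) = Num.trunc ((x 0 i + 1) / h).
  rewrite ffunE inordK//; have /andP[X1 X2] := X i.
  by rewrite -(ltr_nat R); apply: le_lt_trans X2; have /andP[] := truncn_itv X1.
rewrite (bigD1 k0)//= big1 ?addr0.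
  rewrite indicE mem_set//; apply/cellP => i; rewrite k0E.
  by have /andP[X1 _] := X i; exact: truncn_itv.
move=> k /eqP kk; rewrite indicE memNset// => /cellP H; apply: kk; apply/ffunP => i; apply: val_inj => /=.
by rewrite k0E; apply/esym; apply: truncn_def; exact: H.
Qed.

Lemma bmf_cell k : bmf (\1_(cell k) : 'rV[R]_n -> R).
Proof.
split; first by apply: measurable_indic; exact: measurable_cell.
by exists 1 => x; rewrite indicE; case: (_ \in _); rewrite ?normr1 ?normr0.
Qed.

Lemma cell_int p k : (forall x, ~ B x -> p x = 0) -> Rintegral M (cell k) p = J (fun x => p x * \1_(cell k) x).
Proof.
move=> p0; rewrite [LHS]Rintegral_mkcond [RHS]Rintegral_mkcond.
apply: eq_Rintegral => x _; rewrite !patchE indicE.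
have [xB|xB] := pselect (B x); last by rewrite (memNset xB); case: ifP => // _; rewrite p0.
by rewrite (mem_set xB); case: (x \in cell k); rewrite ?mulr1 ?mulr0.
Qed.

Lemma cell_decomposition p : bmf p -> (forall x, ~ B x -> p x = 0) ->
  J p = \sum_(k : cells) Rintegral M (cell k) p.
Proof.
move=> bp p0; transitivity (J (fun x => \sum_(k : cells) p x * \1_(cell k) x)).
  by apply: eq_Rintegral => x; rewrite inE => xB; rewrite -mulr_sumr cell_partition// mulr1.
rewrite (bmf_int_sum mB finB); last by move=> k; apply: bmfM => //; exact: bmf_cell.
by apply: eq_bigr => k _; rewrite cell_int.
Qed.

(** The inequality of [poincare] summed over the cells; the gain is the squared side of a cell, and
    the integrals over the cells are the finitely many quantities left over. *)
Lemma ball_poincare f G : ball_C1 f G ->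
  J (fun x => f x ^+ 2) <= (2 / N.+1%:R) ^+ 2 * (\sum_(i < n) J (fun x => G i x ^+ 2)) +
    \sum_(k : cells) (J (fun x => f x * \1_(cell k) x)) ^+ 2 / (2 / N.+1%:R) ^+ n.
Proof.
move=> H; have [bf bG] := ball_C1_bmf H; have f0 x (xB : ~ B x) := ball_C1_out H xB.
have bG2 i := bmfX 2 (bG i); have bf2 := bmfX 2 bf.
rewrite cell_decomposition//; last by move=> x /f0[-> _]; rewrite expr0n.
have -> : \sum_(i < n) J (fun x => G i x ^+ 2) =
   \sum_(k : cells) \sum_(i < n) Rintegral M (cell k) (fun x => G i x ^+ 2).
  rewrite exchange_big; apply: eq_bigr => i _; apply: cell_decomposition => //.
  by move=> x /f0[_ ->]; rewrite expr0n.
rewrite mulr_sumr -big_split/=; apply: ler_sum => k _.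
rewrite -cell_int; last by move=> x /f0[].
rewrite /cell !rint_row ?(ltW h0)//.
under eq_bigr do rewrite rint_row ?(ltW h0)//.
have := poincare (cell_corner k) h0 (ball_C1_lined H) (bmf_row bf) (fun j : nat => bmf_row (ext_grad_bmf j H)).
have E i : bint (cell_corner k) h (fun t => (ext_grad G i \o @row_of_tuple R n) t ^+ 2) =
    bint (cell_corner k) h ((fun x => G i x ^+ 2) \o @row_of_tuple R n) by rewrite ext_gradE.
by rewrite (eq_bigr _ (fun i _ => E i)).
Qed.
End cells.

Lemma test_function_C1 psi : test_function B psi -> ball_C1 psi (fun i => pderiv i psi).
Proof.
move=> [C [K [cK KB K0]]]; split.
- by move=> x; have [] := C 0%N [::] x isT I.
- by move=> i x; apply: derivableP; have [_] := C 1%N [::] x isT I; exact.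
- by move=> i x; have [] := C 1%N [:: i] x isT I.
exists K; split => // x Kx; split; first exact: K0.
move=> i; rewrite /pderiv.
have clK : closed K by apply: compact_closed => //; exact: norm_hausdorff.
have nK : \forall z \near x, psi z = (fun=> 0 : R) z.
  have : nbhs x (~` K) by apply: open_nbhs_nbhs; split=> //; exact: closed_openC.
  by apply: filterS => z; exact: K0.
by rewrite (near_eq_derive _ nK) derive_cst.
Qed.

Lemma test_function_pderiv psi i : test_function B psi -> test_function B (pderiv i psi).
Proof.
move=> H; have [_ _ _ _] := test_function_C1 H; have [C _] := H.
have [_ _ _ [K [cK KB K0]]] := test_function_C1 H; split; last first.
  by exists K; split => // x /K0[_]; exact.
move=> k s x sk _.
have E s' : iter_pderiv s' (pderiv i psi) = iter_pderiv (rcons s' i) psi by rewrite /iter_pderiv foldr_rcons.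
have sz : (size (rcons s i) <= k.+1)%N by rewrite size_rcons.
have [c d] := C k.+1 (rcons s i) x sz I.
by rewrite E; split => // sk'; apply: d; rewrite size_rcons.
Qed.
End ball_functions.


(** * Square-integrable functions and limits of quadratic forms *)

Section square_integrable.
Context d (T : measurableType d) (R : realType) (mu : {measure set T -> \bar R}) (D : set T).
Hypothesis mD : measurable D.
Implicit Types f g w : T -> R.

Definition sqint f := measurable_fun D f /\ mu.-integrable D (EFin \o (fun x => f x ^+ 2)).
Definition ip f g : R := Rintegral mu D (fun x => f x * g x).

Lemma sqint_mul f g : sqint f -> sqint g -> mu.-integrable D (EFin \o (fun x => f x * g x)).
Proof.
move=> [mf f2] [mg g2]; apply: (le_integrable mD _ _ (integrableD mD f2 g2)).
  by apply/measurable_EFinP; exact: measurable_funM.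
move=> x _ /=; rewrite lee_fin [X in _ <= X]ger0_norm ?addr_ge0 ?sqr_ge0// ler_norml.
have h1 := sqr_ge0 (f x + g x); have h2 := sqr_ge0 (f x - g x).
have h3 := sqr_ge0 (f x); have h4 := sqr_ge0 (g x).
rewrite sqrrD in h1; rewrite sqrrB in h2.
by apply/andP; split; lra.
Qed.

Lemma sqintD f g : sqint f -> sqint g -> sqint (fun x => f x + g x).
Proof.
move=> hf hg; split; first by apply: measurable_funD; [exact: hf.1|exact: hg.1].
have h := integrableD mD (integrableD mD hf.2 (integrableZl mD 2 (sqint_mul hf hg))) hg.2.
apply: eq_integrable h => // x _ /=; rewrite -EFinM -!EFinD; congr EFin; ring.
Qed.

Lemma sqintZ (a : R) f : sqint f -> sqint (fun x => a * f x).
Proof.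
move=> [mf f2]; split; first exact: measurable_funM.
by apply: eq_integrable (integrableZl mD (a ^+ 2) f2) => // x _ /=; rewrite -EFinM exprMn.
Qed.

Lemma sqint0 : sqint (fun=> 0).
Proof.
split; first exact: measurable_cst.
apply: (@eq_integrable _ _ _ _ _ mD (fun=> 0%E)); last exact: integrable0.
by move=> x _ /=; rewrite expr0n.
Qed.

Lemma sqintB f g : sqint f -> sqint g -> sqint (fun x => f x - g x).
Proof.
move=> hf hg; have := sqintD hf (sqintZ (-1) hg); congr sqint.
by apply/funext => x; rewrite mulN1r.
Qed.

Lemma sqint_sum (I : Type) (r : seq I) (f : I -> T -> R) : (forall i, sqint (f i)) ->
  sqint (fun x => \sum_(i <- r) f i x).
Proof.
move=> h; elim: r => [|i r IH]; first by under eq_fun do rewrite big_nil; exact: sqint0.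
by under eq_fun do rewrite big_cons; exact: sqintD.
Qed.

Lemma sqint_bmfM w f : bmf w -> sqint f -> sqint (fun x => w x * f x).
Proof.
move=> [mw [S wS]] hf; have [mf f2] := sqintZ S hf.
have mwf : measurable_fun D (fun x => w x * f x).
  by apply: measurable_funM; [exact: measurable_funTS|exact: hf.1].
split => //; apply: (le_integrable mD _ _ f2); first by apply/measurable_EFinP; exact: measurable_funX.
move=> x _ /=; rewrite lee_fin !normrX !normrM lerXn2r ?nnegrE ?mulr_ge0//.
by rewrite ler_wpM2r// (le_trans (wS x))// ler_norm.
Qed.

Lemma bmf_sqint f : (mu D < +oo)%E -> bmf f -> sqint f.
Proof.
move=> fin bf; split; first by apply: measurable_funTS; exact: bf.1.
by apply: bmf_integrable => //; exact: bmfX.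
Qed.

Lemma ipC f g : ip f g = ip g f.
Proof. by apply: eq_Rintegral => x _; rewrite mulrC. Qed.

Lemma ipDl f g h : sqint f -> sqint g -> sqint h -> ip (fun x => f x + g x) h = ip f h + ip g h.
Proof.
move=> hf hg hh; rewrite /ip -RintegralD//; last 2 first.
- exact: sqint_mul.
- exact: sqint_mul.
by apply: eq_Rintegral => x _; rewrite mulrDl.
Qed.

Lemma ipZl (a : R) f h : sqint f -> sqint h -> ip (fun x => a * f x) h = a * ip f h.
Proof.
move=> hf hh; rewrite /ip -RintegralZl//; last exact: sqint_mul.
by apply: eq_Rintegral => x _; rewrite mulrA.
Qed.

Lemma ipBl f g h : sqint f -> sqint g -> sqint h -> ip (fun x => f x - g x) h = ip f h - ip g h.
Proof.
move=> hf hg hh; rewrite -mulN1r -ipZl// -ipDl//; last exact: sqintZ.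
by congr ip; apply/funext => x; rewrite mulN1r.
Qed.

Lemma ip_suml (I : Type) (r : seq I) (f : I -> T -> R) h : (forall i, sqint (f i)) -> sqint h ->
  ip (fun x => \sum_(i <- r) f i x) h = \sum_(i <- r) ip (f i) h.
Proof.
move=> hf hh; elim: r => [|i r IH].
  rewrite big_nil /ip (_ : (fun x => _) = fun=> 0); first by rewrite Rintegral_cst// mul0r.
  by apply/funext => x; rewrite big_nil mul0r.
rewrite big_cons -IH -ipDl//; last exact: sqint_sum.
by congr ip; apply/funext => x; rewrite big_cons.
Qed.

Lemma ip_ge0 f : 0 <= ip f f.
Proof. by apply: Rintegral_ge0 => x _; rewrite -expr2 sqr_ge0. Qed.

Lemma cauchy_schwarz f g : sqint f -> sqint g -> ip f g ^+ 2 <= ip f f * ip g g.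
Proof.
move=> hf hg; set a := ip f f; set b := ip f g; set c := ip g g.
have H (t : R) : 0 <= a + 2 * t * b + t ^+ 2 * c.
  have h1 : sqint (fun x => t * g x) := sqintZ t hg.
  have h2 := sqintD hf h1.
  have -> : a + 2 * t * b + t ^+ 2 * c = ip (fun x => f x + t * g x) (fun x => f x + t * g x).
    rewrite ipDl// ipZl// [ip f _]ipC [ip g _]ipC !ipDl// !ipZl// [ip g f]ipC -/a -/b -/c; ring.
  exact: ip_ge0.
have [c0|c0] := eqVneq c 0.
  rewrite c0 mulr0; have [->|b0] := eqVneq b 0; first by rewrite expr0n.
  have := H (- (a + 1) / (2 * b)); rewrite c0 mulr0 addr0.
  have -> : a + 2 * (- (a + 1) / (2 * b)) * b = -1 by field.
  by rewrite lerNr oppr0 ler10.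
have cp : 0 < c by rewrite lt_neqAle eq_sym c0 ip_ge0.
have := H (- b / c).
have -> : a + 2 * (- b / c) * b + (- b / c) ^+ 2 * c = (a * c - b ^+ 2) / c by field.
by rewrite pmulr_lge0 ?invr_gt0// subr_ge0.
Qed.

Section limits.
Variables (f : T -> R) (fk : nat -> T -> R).
Hypothesis hf : sqint f.
Hypothesis hfk : forall k, sqint (fk k).
Let dk k x := fk k x - f x.
Hypothesis lim0 : ip (dk k) (dk k) @[k --> \oo] --> (0 : R).
Let hdk k : sqint (dk k) := sqintB (hfk k) hf.

Let ip_dk0 g : sqint g -> ip (dk k) g @[k --> \oo] --> (0 : R).
Proof.
move=> hg; apply: norm_cvg0.
have S : Num.sqrt (ip (dk k) (dk k) * ip g g) @[k --> \oo] --> (0 : R).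
  rewrite -sqrtr0; apply: continuous_cvg; first exact: sqrt_continuous.
  by rewrite -[X in _ --> X](mul0r (ip g g)); apply: cvgM => //; exact: cvg_cst.
apply: (squeeze_cvgr _ (cvg_cst (0 : R)) S).
by apply: nearW => k; rewrite normr_ge0/= -sqrtr_sqr; apply: ler_wsqrtr; exact: cauchy_schwarz.
Qed.

Lemma ip_cvg g : sqint g -> ip (fk k) g @[k --> \oo] --> ip f g.
Proof.
move=> hg; have -> : (fun k => ip (fk k) g) = (fun k => ip (dk k) g + ip f g).
  by apply/funext => k; rewrite ipBl// subrK.
by rewrite -[X in _ --> X]add0r; apply: cvgD; [exact: ip_dk0|exact: cvg_cst].
Qed.

Lemma ip_weight_cvg w : bmf w ->
  ip (fun x => w x * fk k x) (fk k) @[k --> \oo] --> ip (fun x => w x * f x) f.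
Proof.
move=> bw; have hwf := sqint_bmfM bw hf; have hwd k := sqint_bmfM bw (hdk k).
have E k : ip (fun x => w x * fk k x) (fk k) =
    ip (fun x => w x * f x) f + 2 * ip (dk k) (fun x => w x * f x) + ip (fun x => w x * dk k x) (dk k).
  have -> : ip (fun x => w x * fk k x) (fk k) = ip (fun x => w x * f x + w x * dk k x) (fun x => f x + dk k x).
    by apply: eq_Rintegral => x _; rewrite /dk; ring.
  have hsum : sqint (fun x => f x + dk k x) by exact: sqintD.
  rewrite (ipDl hwf (hwd k) hsum) ![ip _ (fun x => f x + dk k x)]ipC.
  rewrite (ipDl hf (hdk k) hwf) (ipDl hf (hdk k) (hwd k)).
  have -> : ip f (fun x => w x * dk k x) = ip (dk k) (fun x => w x * f x).
    by apply: eq_Rintegral => x _; ring.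
  by rewrite [ip f (fun x => w x * f x)]ipC [ip (dk k) (fun x => w x * dk k x)]ipC; ring.
rewrite (_ : (fun k => _) = (fun k => ip (fun x => w x * f x) f + 2 * ip (dk k) (fun x => w x * f x) + ip (fun x => w x * dk k x) (dk k))); last by apply/funext => k; exact: E.
have -> : ip (fun x => w x * f x) f = ip (fun x => w x * f x) f + 2 * 0 + 0 by rewrite mulr0 !addr0.
apply: cvgD.
  by apply: cvgD; [rewrite mulr0 !addr0; exact: cvg_cst|apply: cvgM; [exact: cvg_cst|exact: ip_dk0]].
apply: norm_cvg0; have [mw [S wS]] := bw.
have L : `|S| * ip (dk k) (dk k) @[k --> \oo] --> (0 : R).
  by rewrite -[X in _ --> X](mulr0 `|S|); apply: cvgM => //; exact: cvg_cst.
apply: (squeeze_cvgr _ (cvg_cst (0 : R)) L).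
apply: nearW => k; rewrite normr_ge0/=.
apply: (le_trans (le_normr_Rintegral mD (sqint_mul (hwd k) (hdk k)))).
rewrite -ipZl//; apply: le_Rintegral => //.
- have := integrable_norm (sqint_mul (hwd k) (hdk k)); apply: eq_integrable => // x _.
- by apply: sqint_mul => //; exact: sqintZ.
move=> x _; rewrite -!mulrA -expr2 normrM [X in _ * X <= _]ger0_norm ?sqr_ge0// ler_wpM2r ?sqr_ge0//.
by rewrite (le_trans (wS x))// ler_norm.
Qed.
End limits.
End square_integrable.

(** * Finite Morse index *)


Section sobolev_ball.
Context {R : realType} {n : nat}.
Implicit Types (f psi V : 'rV[R]_n -> R) (x : 'rV[R]_n) (i j : 'I_n) (g : 'I_n -> 'rV[R]_n -> R).
Local Notation B := (@uball R n).
Local Notation M := (@lebesgue_rV R n).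
Local Notation J f := (Rintegral M B f).
Local Notation IP f g := (@ip _ _ R M B f g).
Local Notation sq f := (@sqint _ _ R M B f).
Let mB := @measurable_uball R n.
Let finB := @uball_fin R n.

Lemma L2_sqint f : L2 B f -> sq f.
Proof.
move=> [mf f2]; split => //; apply/integrableP; split.
  by apply/measurable_EFinP; exact: measurable_funX.
rewrite (eq_integral (fun x => (f x ^+ 2)%:E)) => // x _ /=.
by rewrite ger0_norm ?sqr_ge0.
Qed.

Lemma sqint_L2 f : sq f -> L2 B f.
Proof.
move=> [mf /integrableP[_ f2]]; split => //; move: f2.
by rewrite (eq_integral (fun x => (f x ^+ 2)%:E)) => // x _ /=; rewrite ger0_norm ?sqr_ge0.
Qed.

Lemma EFin_Rintegral f : M.-integrable B (EFin \o f) -> (\int[M]_(x in B) (f x)%:E = (J f)%:E)%E.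
Proof. by move=> h; rewrite /Rintegral fineK//; exact: integrable_fin_num. Qed.

Lemma EFin_ip (f g : 'rV[R]_n -> R) : sq f -> sq g -> (\int[M]_(x in B) (f x * g x)%:E = (IP f g)%:E)%E.
Proof. by move=> hf hg; rewrite (EFin_Rintegral (sqint_mul mB hf hg)). Qed.

Lemma EFin_sqr (f : 'rV[R]_n -> R) : sq f -> (\int[M]_(x in B) (f x ^+ 2)%:E = (IP f f)%:E)%E.
Proof. by move=> hf; rewrite -EFin_ip//; apply: eq_integral => x _; rewrite expr2. Qed.

Lemma test_sqint psi : test_function B psi -> sq psi /\ forall i, sq (pderiv i psi).
Proof.
move=> /test_function_C1/ball_C1_bmf[b1 b2]; split; first exact: bmf_sqint.
by move=> i; exact: bmf_sqint.
Qed.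

Lemma weak_gradient_ip f g i psi : L2 B f -> weak_gradient B f g -> test_function B psi ->
  IP f (pderiv i psi) = - IP (g i) psi.
Proof.
move=> /L2_sqint hf wg tp; have [/L2_sqint hg H] := wg i; have [s1 s2] := test_sqint tp.
by have := H psi tp; rewrite !EFin_ip// => -[].
Qed.

Lemma H10_approx f : H10 B f -> exists g (psi : nat -> 'rV[R]_n -> R),
  [/\ weak_gradient B f g, forall k, test_function B (psi k),
      IP (fun x => psi k x - f x) (fun x => psi k x - f x) @[k --> \oo] --> (0 : R) &
      forall i, IP (fun x => pderiv i (psi k) x - g i x) (fun x => pderiv i (psi k) x - g i x) @[k --> \oo] --> (0 : R)].
Proof.
move=> [/L2_sqint hf [g wg [psi tp lim]]]; exists g, psi.
have hg i : sq (g i) by have [/L2_sqint] := wg i.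
have h0 k : sq (fun x => psi k x - f x) by apply: sqintB => //; have [] := test_sqint (tp k).
have h1 k i : sq (fun x => pderiv i (psi k) x - g i x) by apply: sqintB => //; have [] := test_sqint (tp k).
pose E k := IP (fun x => psi k x - f x) (fun x => psi k x - f x) +
   \sum_(i < n) IP (fun x => pderiv i (psi k) x - g i x) (fun x => pderiv i (psi k) x - g i x).
have EE k : (\int[M]_(x in B) ((psi k x - f x) ^+ 2 +
        \sum_(i < n) (pderiv i (psi k) x - g i x) ^+ 2)%:E = (E k)%:E)%E.
  under eq_integral do rewrite EFinD -sumEFin.
  rewrite integralD//=; [|exact: (h0 k).2|by apply: integrable_sum => // i _; exact: (h1 k i).2].
  rewrite integral_sum//; last by move=> i; exact: (h1 k i).2.
  by rewrite /E EFinD -sumEFin EFin_sqr//; congr (_ + _)%E; apply: eq_bigr => i _; exact: EFin_sqr.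
have E0 : E k @[k --> \oo] --> (0 : R).
  have := fine_cvg lim; rewrite (_ : fine \o _ = E); first exact.
  by apply/funext => k /=; rewrite EE.
split => // [|i].
  apply: (squeeze_cvgr _ (cvg_cst (0 : R)) E0); apply: nearW => k; rewrite ip_ge0/= lerDl.
  by apply: sumr_ge0 => i _; exact: ip_ge0.
apply: (squeeze_cvgr _ (cvg_cst (0 : R)) E0); apply: nearW => k; rewrite ip_ge0/=.
rewrite /E (bigD1 i)//= addrCA lerDl addr_ge0 ?ip_ge0//.
by apply: sumr_ge0 => j _; exact: ip_ge0.
Qed.

(* Testing both weak gradients against [pderiv i (psi k)] shows that [g0 i] is the
   orthogonal projection of [g i] on the limit of the [pderiv i (psi k)]. *)
Lemma gradient_minimal f g g0 (psi : nat -> 'rV[R]_n -> R) i : L2 B f -> weak_gradient B f g ->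
  weak_gradient B f g0 -> (forall k, test_function B (psi k)) ->
  IP (fun x => pderiv i (psi k) x - g0 i x) (fun x => pderiv i (psi k) x - g0 i x) @[k --> \oo] --> (0 : R) ->
  IP (g0 i) (g0 i) <= IP (g i) (g i).
Proof.
move=> hf wg wg0 tp lim.
have [/L2_sqint hg _] := wg i; have [/L2_sqint hg0 _] := wg0 i.
have hp k : sq (pderiv i (psi k)) by have [] := test_sqint (tp k).
have c1 := ip_cvg mB hg0 hp lim hg; have c2 := ip_cvg mB hg0 hp lim hg0.
have E k : IP (pderiv i (psi k)) (g i) = IP (pderiv i (psi k)) (g0 i).
  rewrite ![IP (pderiv _ _) _]ipC; apply: oppr_inj.
  by rewrite -!(weak_gradient_ip _ hf _ (test_function_pderiv i (tp k))).
have e : IP (g0 i) (g i) = IP (g0 i) (g0 i).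
  by apply: (cvg_unique _ _ c2) => //; move: c1; under eq_fun do rewrite E.
have := cauchy_schwarz mB hg0 hg; rewrite e expr2.
have := ip_ge0 M B (g0 i); rewrite le_eqVlt => /predU1P[<- _|p0]; first exact: ip_ge0.
by rewrite ler_pM2l.
Qed.
End sobolev_ball.

Section potential_measurability.
Context {R : realType} {n : nat}.
Variables (u : 'rV[R]_n -> R) (l : R).
Hypothesis n3 : (3 <= n)%N.
Hypothesis singu : singular_solution l u.
Implicit Types (x : 'rV[R]_n).
Local Notation B := (@uball R n).
Local Notation M := (@lebesgue_rV R n).
Local Notation V := (potential u l).

Lemma uball0_measurable : measurable (B `\ 0).
Proof.
have -> : B `\ (0 : 'rV[R]_n) = (@enorm R n) @^-1` `]0, 1[.
  apply/seteqP; split=> x; rewrite /preimage/= in_itv/= enorm_gt0.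
    by move=> [xB /eqP ->].
  by move=> /andP[/eqP x0 xB]; split.
by rewrite -[X in measurable X]setTI; exact: (continuous_measurable continuous_enorm).
Qed.

Lemma potential_measurable : measurable_fun (B `\ 0) V.
Proof.
pose i0 : 'I_n := Ordinal (leq_trans (isT : (1 <= 3)%N) n3).
pose phi (r : R) := V (r *: delta_mx 0 i0).
have mphi : measurable_fun (`]0, 1[%classic : set (measurableTypeR R)) phi.
  apply: open_continuous_measurable_fun; first exact: interval_open.
  move=> r; rewrite inE/= in_itv/= => r01.
  have [rB r0] := uball0_line i0 r01.
  apply: (@continuous_comp _ _ _ (fun r : R => r *: delta_mx 0 i0) V).
    have := @continuous_line R n 0 (delta_mx 0 i0) r.
    by under eq_fun do rewrite addr0.
  by apply: (potential_continuous singu) => //; apply/eqP.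
apply: (@eq_measurable_fun _ _ _ _ _ (phi \o @enorm R n)).
  move=> x; rewrite inE => -[xB x0]; rewrite /phi/= /potential.
  suff -> : u (enorm x *: delta_mx 0 i0) = u x by [].
  have e0 : 0 < enorm x by rewrite enorm_gt0; apply/eqP.
  apply: (sing_rad singu) => //; first by apply: uball0_line; rewrite e0.
  by rewrite enorm1 gtr0_norm.
apply: measurable_comp mphi _; first exact: measurable_itv.
  move=> _ [x [xB x0] <-]; rewrite /= in_itv/= enorm_gt0; apply/andP; split => //; exact/eqP.
by apply: measurable_funTS; apply: continuous_measurable; exact: continuous_enorm.
Qed.

Lemma singleton0_null : measurable [set (0 : 'rV[R]_n)] /\ M [set 0] = 0%E.
Proof.
have m0 : measurable [set (0 : 'rV[R]_n)].
  have -> : [set (0 : 'rV[R]_n)] = B `\` (B `\ 0).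
    apply/seteqP; split=> [x ->|x [xB h]].
      split; last by move=> [_]; apply.
      by rewrite /uball/= -sqn_lt1 /sqn big1// => i _; rewrite mxE expr0n.
    by apply: contrapT => x0; apply: h; split.
  exact: (measurableD measurable_uball uball0_measurable).
split => //; apply/eqP; rewrite -measure_le0.
apply/lee_addgt0Pr => e e0; rewrite add0e.
pose h := Num.min 1 e; have h0 : 0 < h by rewrite lt_min e0 ltr01.
apply: (@le_trans _ _ (M (rbox (fun=> 0) h))).
  apply: le_measure; rewrite ?inE; [exact: m0|exact: measurable_rbox|].
  by move=> x -> i; rewrite mxE lexx add0r.
rewrite rbox_measure ?(ltW h0)// lee_fin; apply: (@le_trans _ _ h); last by rewrite ge_min lexx orbT.
have h1 : h <= 1 by rewrite ge_min lexx.
by case: n n3 => // k _; rewrite exprS ler_piMr ?(ltW h0)// exprn_ile1// ltW.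
Qed.

Lemma potential_measurable_ball : measurable_fun B V.
Proof.
have [m00 _] := singleton0_null.
have -> : B = (B `\ 0) `|` [set (0 : 'rV[R]_n)].
  apply/seteqP; split=> [x xB|x [[]//|->]].
    by have [->|/eqP x0] := eqVneq x 0; [right|left].
  by rewrite /uball/= -sqn_lt1 /sqn big1// => i _; rewrite mxE expr0n.
apply/measurable_funU => //; first exact: uball0_measurable.
by split; [exact: potential_measurable|exact: measurable_fun_set1].
Qed.
End potential_measurability.

Section finite_index.
Context {R : realType} {n : nat}.
Variables (u : 'rV[R]_n -> R) (l : R).
Hypothesis n11 : (11 <= n)%N.
Hypothesis singu : singular_solution l u.
Implicit Types (f psi : 'rV[R]_n -> R) (x : 'rV[R]_n) (i : 'I_n).
Local Notation B := (@uball R n).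
Local Notation M := (@lebesgue_rV R n).
Local Notation J f := (Rintegral M B f).
Local Notation IP f g := (@ip _ _ R M B f g).
Local Notation sq f := (@sqint _ _ R M B f).
Local Notation V := (potential u l).
Let mB := @measurable_uball R n.
Let finB := @uball_fin R n.
Let n3 : (3 <= n)%N := leq_trans (isT : (3 <= 11)%N) n11.
Let m : R := n%:R - 2.
Let m9 : 9 <= m.
Proof. by have : 11%:R <= n%:R :> R by [rewrite ler_nat]; rewrite /m; lra. Qed.

(** The excess 1 over [2 m] still leaves [2 m + 1 < m^2 / 4] for [m >= 9], a strict margin in
    Hardy's inequality. *)
Lemma potential_bound : exists C : R, 0 <= C /\ forall x, B x -> x != 0 ->
  V x <= (2 * m + 1) / sqn x + C.
Proof.
have [r0 r00 H1] := potential_near0 n3 singu (ltr01 : 0 < 1 :> R).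
have [C H2] := potential_away n3 singu r00.
exists `|C|; split => // x xB x0; have q0 : 0 < sqn x by rewrite sqn_gt0.
have A0 : 0 <= (2 * m + 1) / sqn x by rewrite divr_ge0 ?(ltW q0)//; have := m9; lra.
case: (leP (enorm x) r0) => xr; last first.
  by apply: (le_trans (H2 x xB (ltW xr))); rewrite (le_trans (ler_norm C))// lerDr.
have := H1 x xB x0 xr; rewrite ler_norml => /andP[_]; rewrite -/m => h.
have : V x <= (2 * m + 1) / sqn x by rewrite ler_pdivlMr//; move: h; lra.
by move=> /le_trans; apply; rewrite lerDl.
Qed.

(** A bounded truncation that increases to [V] off the origin as [d] decreases to 0 and matches the
    regularized weight of [hardy]. The indicator removes the origin, where the value of [u] is
    arbitrary. *)
Let Vd (d : R) x := V x * sqn x / (sqn x + d) * \1_(B `\ 0) x.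

Let Vd_bmf d : 0 < d -> bmf (Vd d).
Proof.
move=> d0; have [C [C0 HC]] := potential_bound; split.
  have -> : Vd d = (fun x => V x * (sqn x / (sqn x + d))) \_ (B `\ 0).
    apply/funext => x; rewrite /Vd patchE indicE.
    have [xB|xB] := pselect ((B `\ 0) x); first by rewrite !mem_set// mulr1 mulrA.
    by rewrite !memNset// mulr0.
  apply/(measurable_restrictT _ uball0_measurable).
  apply: measurable_funM; first exact: (potential_measurable n3 singu).
  apply: measurable_funTS; apply: continuous_measurable; apply: continuous_mulv; first exact: continuous_sqn.
  exact: continuous_inv_sqn.
exists ((2 * m + 1) / d + C) => x; rewrite /Vd indicE.
have A0 : 0 <= 2 * m + 1 by have := m9; lra.
have [[xB /eqP x0]|xB] := pselect ((B `\ 0) x); last first.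
  by rewrite memNset// mulr0 normr0 addr_ge0// divr_ge0// ltW.
have q0 : 0 < sqn x by rewrite sqn_gt0.
have qd : 0 < sqn x + d by rewrite addr_gt0.
rewrite mem_set; last by split => //; apply/eqP.
have V0 : 0 <= V x by exact: ltW (potential_gt0 singu x).
rewrite mulr1 ger0_norm; last by apply: divr_ge0; [apply: mulr_ge0 => //; exact: ltW|exact: ltW].
have h1 := HC x xB x0.
apply: (@le_trans _ _ (((2 * m + 1) / sqn x + C) * sqn x / (sqn x + d))).
  by rewrite ler_wpM2r ?invr_ge0 ?(ltW qd)// ler_wpM2r// ltW.
have -> : ((2 * m + 1) / sqn x + C) * sqn x / (sqn x + d) = (2 * m + 1) / (sqn x + d) + C * (sqn x / (sqn x + d)).
  by field; rewrite !gt_eqF.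
apply: lerD; first by rewrite ler_wpM2l// lef_pV2 ?posrE// lerDr ltW.
by rewrite ler_piMr// ler_pdivrMr// mul1r lerDl ltW.
Qed.

(** Hardy's inequality spends the fraction [A / H = 1 - eta] of the gradient on the singular part;
    the remaining [eta] pays, through [ball_poincare], for the bounded part [C]. Neither [N] nor the
    constant depends on [d]. *)
Lemma test_quadratic_bound : exists (N : nat) (C : R), forall d : R, 0 < d -> forall psi, test_function B psi ->
  J (fun x => Vd d x * psi x * psi x) <= \sum_(i < n) IP (pderiv i psi) (pderiv i psi) +
    C * \sum_(k : {ffun 'I_n -> 'I_N.+1}) (IP psi \1_(cell k)) ^+ 2.
Proof.
have [C [C0 HC]] := potential_bound.
pose A := 2 * m + 1; pose H := m ^+ 2 / 4.
have A0 : 0 < A by have := m9; rewrite /A; lra.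
have AH : A < H.
  have h : 0 <= (m - 9) * m by apply: mulr_ge0; have := m9; lra.
  have -> : H = ((m - 9) * m + 9 * m) / 4 by rewrite /H; field.
  by have := m9; rewrite /A; lra.
have H0 : 0 < H := lt_trans A0 AH.
pose eta := 1 - A / H; have eta0 : 0 < eta by rewrite subr_gt0 ltr_pdivrMr// mul1r.
(* Makes the cells so small that [C (2 / (N + 1))^2 <= eta]. *)
pose N := Num.bound (4 * C / eta); exists N, (C / (2 / N.+1%:R) ^+ n).
have N0 : 0 < N.+1%:R :> R by [].
have hN : C * (2 / N.+1%:R) ^+ 2 <= eta.
  have hb : 4 * C / eta < N%:R.
    by apply: archi_boundP; rewrite divr_ge0 ?mulr_ge0 ?(ltW eta0).
  have hb2 : 4 * C < eta * N%:R by rewrite [eta * _]mulrC -ltr_pdivrMr.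
  have -> : C * (2 / N.+1%:R) ^+ 2 = 4 * C / N.+1%:R ^+ 2 by field; rewrite gt_eqF.
  rewrite ler_pdivrMr ?exprn_gt0//; apply: (le_trans (ltW hb2)); rewrite ler_pM2l//.
  by rewrite -natrX ler_nat; apply: (leq_trans (leqnSn N)); rewrite -[X in (X <= _)%N]expn1 leq_exp2l.
move=> d d0 psi tp; have HC1 := test_function_C1 tp.
have [bp bG] := ball_C1_bmf HC1; have bp2 := bmfX 2 bp; have bG2 i := bmfX 2 (bG i).
have n2 : (2 <= n)%N by exact: leq_trans n3.
have hardyd := hardy d0 n2 HC1; have poinc := ball_poincare N HC1.
have bW : bmf (fun x => psi x ^+ 2 / (sqn x + d)).
  have [cf df cG _] := HC1; have := ball_C1_bmfM (ball_C1_mul HC1 cf df cG) (continuous_inv_sqn d0).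
  by congr bmf; apply/funext => x; rewrite -expr2.
pose S := \sum_(i < n) J (fun x => pderiv i psi x ^+ 2).
have SE : \sum_(i < n) IP (pderiv i psi) (pderiv i psi) = S.
  by apply: eq_bigr => i _; apply: eq_Rintegral => x _; rewrite expr2.
pose P := \sum_(k : {ffun 'I_n -> 'I_N.+1}) (IP psi \1_(cell k)) ^+ 2.
have poinc' : J (fun x => psi x ^+ 2) <= (2 / N.+1%:R) ^+ 2 * S + P / (2 / N.+1%:R) ^+ n.
  by apply: (le_trans poinc); rewrite /P mulr_suml.
have S0 : 0 <= S by apply: sumr_ge0 => i _; apply: Rintegral_ge0 => x _; exact: sqr_ge0.
have P0 : 0 <= P by apply: sumr_ge0 => k _; exact: sqr_ge0.
have step : J (fun x => Vd d x * psi x * psi x) <= J (fun x => A * (psi x ^+ 2 / (sqn x + d)) + C * psi x ^+ 2).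
  apply: (bmf_int_le mB finB).
  - by do 2! apply: bmfM => //; exact: Vd_bmf.
  - by apply: bmfD; apply: bmfM => //; exact: bmf_cst.
  move=> x xB; have p2 := sqr_ge0 (psi x).
  have -> : Vd d x * psi x * psi x = Vd d x * psi x ^+ 2 by rewrite expr2 mulrA.
  have -> : A * (psi x ^+ 2 / (sqn x + d)) + C * psi x ^+ 2 = (A / (sqn x + d) + C) * psi x ^+ 2 by ring.
  rewrite ler_wpM2r// /Vd indicE.
  have qd : 0 < sqn x + d by rewrite ltr_wpDl// sqn_ge0.
  have [x0|x0] := eqVneq x 0.
    by rewrite memNset ?mulr0 ?addr_ge0 ?divr_ge0 ?(ltW A0) ?(ltW qd)// => -[_]; rewrite x0; apply.
  have q0 : 0 < sqn x by rewrite sqn_gt0.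
  rewrite mem_set ?mulr1; last by split => //; apply/eqP.
  apply: (@le_trans _ _ ((A / sqn x + C) * sqn x / (sqn x + d))).
    by rewrite ler_wpM2r ?invr_ge0 ?(ltW qd)// ler_wpM2r ?HC// ltW.
  have -> : (A / sqn x + C) * sqn x / (sqn x + d) = A / (sqn x + d) + C * (sqn x / (sqn x + d)).
    by field; rewrite !gt_eqF.
  by rewrite lerD2l ler_piMr// ler_pdivrMr// mul1r lerDl ltW.
apply: (le_trans step); rewrite (bmf_intD mB finB); last 2 first.
- by apply: bmfM => //; exact: bmf_cst.
- by apply: bmfM => //; exact: bmf_cst.
rewrite !(bmf_intZ mB finB)// SE -/P.
have e1 : A * J (fun x => psi x ^+ 2 / (sqn x + d)) <= (1 - eta) * S.
  have -> : 1 - eta = A / H by rewrite /eta; ring.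
  by rewrite -mulrA ler_pM2l// ler_pdivlMl.
have e2 : C * J (fun x => psi x ^+ 2) <= eta * S + C / (2 / N.+1%:R) ^+ n * P.
  apply: (le_trans (ler_wpM2l C0 poinc')); rewrite mulrDr mulrA; apply: lerD; first by rewrite ler_wpM2r.
  by rewrite mulrA mulrAC.
by apply: (le_trans (lerD e1 e2)); rewrite mulrBl mul1r addrA subrK.
Qed.
(* By Hardy's inequality with constant [m^2/4 > 2 m] the form controls the [L^2] norm
   up to a bounded potential, which the averages over small cells absorb. *)
Lemma cell_average_nonneg : exists N : nat, forall f, H10 B f ->
  (forall k : {ffun 'I_n -> 'I_N.+1}, IP f (\1_(cell k)) = 0) ->
  forall g, weak_gradient B f g -> (0 <= quad_form B V f g)%E.
Proof.
have [N [C HQ]] := test_quadratic_bound; exists N => f Hf avg g wg.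
have hf : sq f by apply: L2_sqint; case: Hf.
have [g0 [psi [wg0 tp lim0 limg]]] := H10_approx Hf.
have hg0 i : sq (g0 i) by have [/L2_sqint] := wg0 i.
have hg i : sq (g i) by have [/L2_sqint] := wg i.
have hp k : sq (psi k) by have [] := test_sqint (tp k).
have hdp k i : sq (pderiv i (psi k)) by have [] := test_sqint (tp k).
have h1 k : sq (\1_(@cell R n N k)) by apply: bmf_sqint => //; exact: bmf_cell.
pose S := \sum_(i < n) IP (g i) (g i).
(* The bound passes from test functions to [f] because the weight [Vd d] is bounded. The limit
   yields the gradient [g0] of the approximation, whose norm is at most that of the given weak
   gradient [g]. *)
have main d : 0 < d -> IP (fun x => Vd d x * f x) f <= S.
  move=> d0; apply: (@le_trans _ _ (\sum_(i < n) IP (g0 i) (g0 i))); last first.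
    by apply: ler_sum => i _; apply: (gradient_minimal (sqint_L2 hf) wg wg0 tp); exact: limg.
  have c1 := ip_weight_cvg mB hf hp lim0 (Vd_bmf d0).
  have cg i : IP (pderiv i (psi k)) (pderiv i (psi k)) @[k --> \oo] --> IP (g0 i) (g0 i).
    have := ip_weight_cvg mB (hg0 i) (fun k => hdp k i) (limg i) (bmf_cst _ 1).
    have e (h : 'rV[R]_n -> R) : (fun x => 1 * h x) = h by apply/funext => x; rewrite mul1r.
    by rewrite e; under eq_fun do rewrite e.
  have c2 : (\sum_(i < n) IP (pderiv i (psi k)) (pderiv i (psi k)) +
    C * \sum_(c : {ffun 'I_n -> 'I_N.+1}) (IP (psi k) \1_(cell c)) ^+ 2) @[k --> \oo] -->
    \sum_(i < n) IP (g0 i) (g0 i) + C * \sum_(c : {ffun 'I_n -> 'I_N.+1}) (IP f \1_(cell c)) ^+ 2.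
    apply: cvgD; first by apply: cvg_finite_sum => i; exact: cg.
    apply: cvgM; first exact: cvg_cst.
    apply: cvg_finite_sum => c; rewrite expr2; under eq_fun do rewrite expr2.
    by apply: cvgM; apply: (ip_cvg mB hf hp lim0).
  rewrite (_ : \sum_(i < n) IP (g0 i) (g0 i) = \sum_(i < n) IP (g0 i) (g0 i) + C * \sum_(c : {ffun 'I_n -> 'I_N.+1}) (IP f \1_(cell c)) ^+ 2).
    by apply: (ler_cvg_to c1 c2); apply: nearW => k; exact: HQ.
  by rewrite [X in C * X]big1 ?mulr0 ?addr0// => c _; rewrite avg expr0n.
have [m00 M00] := singleton0_null (R := R) n3.
have mV := potential_measurable_ball n3 singu.
have mVf : measurable_fun B (fun x => V x * f x ^+ 2).
  by apply: measurable_funM => //; apply: measurable_funX; exact: hf.1.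
have V0 x : 0 <= V x by exact: ltW (potential_gt0 singu x).
have Vf0 x : 0 <= V x * f x ^+ 2 by rewrite mulr_ge0 ?sqr_ge0.
(* Monotone convergence along [d = 1 / (k + 1)], off the origin, which is a null set. *)
have Vint : (\int[M]_(x in B) (V x * f x ^+ 2)%:E <= S%:E)%E.
  rewrite (@ge0_negligible_integral _ _ _ M B [set (0 : 'rV[R]_n)] (fun x => (V x * f x ^+ 2)%:E) m00 mB _ _ M00); last 2 first.
  - exact/measurable_EFinP.
  - by move=> x _; rewrite lee_fin.
  pose w (k : nat) x := sqn x / (sqn x + k.+1%:R^-1).
  pose h k x := (V x * w k x * f x ^+ 2)%:E.
  have mB0 : measurable (B `\ 0) := uball0_measurable.
  have k0 k : 0 < k.+1%:R^-1 :> R by rewrite invr_gt0.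
  have w0 k x : 0 <= w k x by rewrite divr_ge0 ?sqn_ge0// addr_ge0 ?sqn_ge0// ltW.
  have wle (a b : nat) x : (a <= b)%N -> w a x <= w b x.
    move=> ab; rewrite ler_wpM2l ?sqn_ge0// lef_pV2 ?posrE ?ltr_wpDl ?sqn_ge0//.
    by rewrite lerD2l lef_pV2 ?posrE// ler_nat.
  have wlim x : (B `\ 0) x -> w k x @[k --> \oo] --> (1 : R).
    move=> [_ /eqP x0]; have q0 : 0 < sqn x by rewrite sqn_gt0.
    have -> : 1 = sqn x / (sqn x + 0) by rewrite addr0 divff ?gt_eqF.
    apply: cvgM; first exact: cvg_cst.
    apply: cvgV; first by rewrite addr0 gt_eqF.
    apply: cvgD; first exact: cvg_cst.
    exact: cvg_harmonic.
  have mc := @cvg_monotone_convergence _ _ _ M _ mB0 h.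
  have E : (\int[M]_(x in B `\ (0 : 'rV[R]_n)%R) (V x * f x ^+ 2)%:E = \int[M]_(x in B `\ (0 : 'rV[R]_n)%R) limn (fun k : nat => h k x))%E.
    apply: eq_integral => x; rewrite inE => xB; apply/esym/cvg_lim => //.
    apply: cvg_EFin; first exact: nearW.
    rewrite [X in X @ _ --> _](_ : _ = fun k => V x * f x ^+ 2 * w k x); last first.
      by apply/funext => k; rewrite /h/=; ring.
    rewrite -[X in _ --> X]mulr1; apply: cvgM; [exact: cvg_cst|exact: wlim].
  rewrite E; apply: (cvge_to_le (mc _ _ _)).
  - move=> k; apply/measurable_EFinP; apply: measurable_funM; last first.
      by apply: measurable_funX; apply: measurable_funS hf.1 => //; exact: subDsetl.
    apply: measurable_funM; first exact: (potential_measurable n3 singu).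
    apply: measurable_funTS; apply: continuous_measurable; apply: continuous_mulv; first exact: continuous_sqn.
    exact: continuous_inv_sqn.
  - by move=> k x _; rewrite lee_fin mulr_ge0 ?sqr_ge0// mulr_ge0.
  - by move=> x _ a b ab; rewrite lee_fin ler_wpM2r ?sqr_ge0// ler_wpM2l//; exact: wle.
  apply: nearW => k; have kk := k0 k.
  have -> : (\int[M]_(x in B `\ (0 : 'rV[R]_n)%R) h k x = \int[M]_(x in B) (Vd k.+1%:R^-1 x * f x * f x)%:E)%E.
    rewrite integral_mkcond [RHS]integral_mkcond; apply: eq_integral => x _.
    rewrite !patchE /Vd indicE; have [xB|xB] := pselect ((B `\ 0) x).
      by rewrite (mem_set xB) (mem_set xB.1) /h /w; congr EFin; rewrite mulr1 expr2 !mulrA.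
    by rewrite (memNset xB) mulr0 !mul0r; case: ifP.
  by rewrite (EFin_ip (sqint_bmfM mB (Vd_bmf kk) hf) hf) lee_fin; exact: main.
have iV : M.-integrable B (EFin \o (fun x => V x * f x ^+ 2)).
  apply/integrableP; split; first by apply/measurable_EFinP.
  apply: le_lt_trans (ltry S); apply: le_trans Vint.
  by rewrite le_eqVlt; apply/orP; left; apply/eqP; apply: eq_integral => x _ /=; rewrite ger0_norm.
have iG : M.-integrable B (EFin \o (fun x => \sum_(i < n) g i x ^+ 2)).
  have h : M.-integrable B (fun x => \sum_(i < n) (g i x ^+ 2)%:E)%E.
    by apply: integrable_sum => // i _; exact: (hg i).2.
  by apply: eq_integrable h => // x _ /=; rewrite sumEFin.
rewrite /quad_form; under eq_integral do rewrite EFinB.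
rewrite integralB//= sube_ge0//; last by apply/orP; right; exact: (integrable_fin_num mB iG).
apply: (le_trans Vint); rewrite /S -sumEFin.
rewrite le_eqVlt; apply/orP; left; apply/eqP.
under [RHS]eq_integral do rewrite -sumEFin.
rewrite integral_sum//; last by move=> i; exact: (hg i).2.
by apply: eq_bigr => i _; rewrite EFin_sqr.
Qed.

Lemma linear_space_sum (X : set ('rV[R]_n -> R)) (k : nat) (c : 'I_k -> R) (b : 'I_k -> 'rV[R]_n -> R) :
  linear_space X -> (forall j : 'I_k, X (b j)) -> X (fun x => \sum_(j < k) c j * b j x).
Proof.
move=> [X0 XD]; elim: k c b => [|k IH] c b Xb.
  by rewrite (_ : (fun _ => _) = fun=> 0)//; apply/funext => x; rewrite big_ord0.
have := XD (c ord0) _ _ (Xb ord0) (IH (fun j => c (lift ord0 j)) (fun j => b (lift ord0 j)) (fun j => Xb (lift ord0 j))).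
by congr X; apply/funext => x; rewrite big_ord_recl.
Qed.

(** In a space with more independent elements than cells, some nontrivial combination has zero
    integral over every cell, and the form is nonnegative on it. *)
Lemma morse_index_finite : (solution_morse_index l u < +oo)%E.
Proof.
have [N HN] := cell_average_nonneg.
pose K := #|{ffun 'I_n -> 'I_N.+1}|.
apply: (@le_lt_trans _ _ K%:R%:E); last exact: ltry.
apply: ge_ereal_sup => _ [X [XH XL Xneg] <-]; apply: ge_ereal_sup => _ [k [b Xb bfree] <-].
rewrite lee_fin ler_nat leqNgt; apply/negP => Kk.
pose A : 'M[R]_(k, K) := \matrix_(j, c) IP (b j) (\1_(cell (enum_val c))).
have hb (j : 'I_k) : sq (b j) by apply: L2_sqint; case: (XH _ (Xb j)).
have h1 c : sq (\1_(@cell R n N c)) by apply: bmf_sqint => //; exact: bmf_cell.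
have : kermx A != 0.
  by rewrite kermx_eq0 -row_leq_rank -ltnNge (leq_ltn_trans (rank_leq_col A)).
move=> /eqP/matrixP; have [//|] := pselect (exists (i j : 'I_k), kermx A i j != 0); last first.
  move=> nex hz; apply: hz => i' j'; rewrite [RHS]mxE; apply: contrapT => /eqP nz; apply: nex; by exists i', j'.
move=> [i [j0 nz]] _.
pose c (j : 'I_k) := kermx A i j; pose f x := \sum_(j < k) c j * b j x.
have Xf : X f by exact: linear_space_sum.
have [fz|fnz] := pselect (ae_zero B f).
  by move: nz; rewrite -/(c j0) (bfree c fz j0) eqxx.
have [g wg] := Xneg f Xf fnz; rewrite ltNge => /negP; apply.
apply: (HN f (XH _ Xf)) => // cc.
have hcb (j : 'I_k) : sq (fun x => c j * b j x) by exact: sqintZ.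
rewrite (ip_suml mB (index_enum 'I_k) hcb (h1 cc)).
have := mulmx_ker A => /matrixP/(_ i (enum_rank cc)); rewrite !mxE => kz.
by rewrite -[RHS]kz; apply: eq_bigr => j _; rewrite ipZl// [A _ _]mxE enum_rankK.
Qed.
End finite_index.

(** * Flat functions and test functions *)


Section flat.
Context {R : realType}.
Implicit Types (t s w : R).

(** The powers [t^(-k)] are included so that the family is closed under differentiation up to linear
    combinations. *)
Definition flat (k : nat) t : R := if 0 < t then t^-1 ^+ k * expR (- t^-1) else 0.

Lemma flat_bound k : exists2 C : R, 0 <= C & forall t, `|flat k t| <= C * t ^+ 2.
Proof.
pose N : nat := k.+2; exists (N%:R ^+ N); first exact: exprn_ge0.
move=> t; rewrite /flat; case: ifPn => [t0|_]; last by rewrite normr0 mulr_ge0 ?sqr_ge0// exprn_ge0.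
set s := t^-1; have s0 : 0 < s by rewrite invr_gt0.
have N0 : 0 < N%:R :> R by [].
have sN : 0 < s / N%:R by rewrite divr_gt0.
(* From [s / N <= e^(s / N)]. The exponent [N = k + 2] leaves a factor [t^2], which gives derivative
   0 at the origin. *)
have es : (s / N%:R) ^+ N <= expR s.
  have -> : expR s = expR (s / N%:R) ^+ N by rewrite -expRM_natl mulrC divfK// gt_eqF.
  rewrite lerXn2r ?nnegrE ?(ltW sN) ?expR_ge0//.
  by apply: le_trans (expR_ge1Dx _); lra.
rewrite ger0_norm ?mulr_ge0 ?exprn_ge0 ?expR_ge0 ?(ltW s0)// expRN.
have ek : (expR s)^-1 <= ((s / N%:R) ^+ N)^-1 by rewrite lef_pV2 ?posrE ?expR_gt0 ?exprn_gt0.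
apply: (le_trans (ler_wpM2l (exprn_ge0 k (ltW s0)) ek)).
rewrite le_eqVlt; apply/orP; left; apply/eqP.
have sE : s ^+ N = s ^+ k * s ^+ 2 by rewrite -exprD addn2.
rewrite expr_div_n sE.
have -> : t = s^-1 by rewrite invrK.
set a := s ^+ k; set b := N%:R ^+ N; have a0 : a != 0 by rewrite expf_neq0// gt_eqF.
by field; rewrite a0 !gt_eqF// exprn_gt0.
Qed.

Lemma is_derive_quadratic (f : R -> R) (C : R) : 0 <= C -> (forall t, `|f t| <= C * t ^+ 2) ->
  is_derive (0 : R) 1 f 0.
Proof.
move=> C0 H; have f0 : f 0 = 0.
  by apply/eqP; rewrite -normr_le0; have := H 0; rewrite expr0n mulr0.
have lim : h^-1 *: ((f \o shift 0) (h *: (1 : R)) - f 0) @[h --> (0 : R)^'] --> (0 : R).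
  apply/cvgrPdist_le => e e0.
  have C1 : 0 < C + 1 by rewrite ltr_wpDl.
  have nz : \forall h \near (0 : R)^', h != 0 by exact: nbhs_dnbhs_neq.
  have sm : \forall h \near (0 : R)^', `|h| < e / (C + 1) by apply: dnbhs0_lt; exact: divr_gt0.
  near=> h; have h0 : h != 0 by near: h.
  have hs : `|h| < e / (C + 1) by near: h.
  rewrite sub0r normrN f0 subr0 /= addr0 /GRing.scale/= mulr1 normrM normfV.
  have hp : 0 < `|h| by rewrite normr_gt0.
  rewrite mulrC ler_pdivrMr//; apply: (le_trans (H h)).
  rewrite -real_normK ?num_real// expr2 mulrA ler_pM2r//.
  apply: (@le_trans _ _ ((C + 1) * `|h|)); first by rewrite ler_wpM2r// lerDl.
  by rewrite mulrC -ler_pdivlMr// ltW.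
apply: DeriveDef; first by apply/cvg_ex; exists 0.
exact: (cvg_lim _ lim).
Unshelve. all: by end_near. Qed.

Lemma near0_der (f : R -> R) t : (\near t, f t = 0) -> is_derive t 1 f 0.
Proof.
move=> h; apply: (@d_ext _ (fun=> 0 : R)).
by apply: filterS h => s ->.
Qed.

Lemma flat_der k t : is_derive t 1 (flat k) (flat k.+2 t - k%:R * flat k.+1 t).
Proof.
case: (ltgtP t 0) => [t0|t0|->].
- have -> : flat k.+2 t - k%:R * flat k.+1 t = 0 by rewrite /flat ltNge (ltW t0)/= mulr0 subr0.
  have : \forall s \near t, s < 0 by apply: lt_nbhsl.
  by move=> h; apply: near0_der; move: h; apply: filterS => s s0; rewrite /flat ltNge (ltW s0).
- rewrite /flat t0.
  apply: (@d_ext _ (fun t => t^-1 ^+ k * expR (- t^-1))).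
    have : \forall s \near t, 0 < s by apply: lt_nbhsr.
    by apply: filterS => s s0; rewrite s0.
  have tn : t != 0 by rewrite gt_eqF.
  have h1 := dV tn (dI t); have h2 := dexp (dN h1).
  case: k => [|k].
    apply: (@is_derive_ext _ (fun t => expR (- t^-1))); first by move=> s; rewrite expr0 mul1r.
    by apply: (d_eq h2); rewrite mul0r subr0 mulr1 opprK exprVn mulrC.
  apply: (d_eq (dM (dX k h1) h2)); rewrite -exprVn !exprS expr0.
  by set a := t^-1 ^+ k; set E := expR _; set v := t^-1; ring.
- have [C C0 H] := flat_bound k.
  have -> : flat k.+2 0 - k%:R * flat k.+1 0 = 0 :> R by rewrite /flat ltxx mulr0 subr0.
  exact: is_derive_quadratic C0 H.
Qed.

(** A syntactic class of functions closed under differentiation: smoothness of all orders follows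
    without computing any higher derivative. *)
Inductive sm1 : (R -> R) -> Prop :=
| sm1_cst (c : R) : sm1 (fun=> c)
| sm1_exp (c : R) : sm1 (fun w => expR (c * w))
| sm1_flat (k : nat) (a b : R) : sm1 (fun w => flat k (a * w + b))
| sm1_add f g : sm1 f -> sm1 g -> sm1 (fun w => f w + g w)
| sm1_mul f g : sm1 f -> sm1 g -> sm1 (fun w => f w * g w).

Lemma sm1_der f : sm1 f -> exists2 df : R -> R, sm1 df & forall w, is_derive w 1 f (df w).
Proof.
elim=> [c|c|k a b|{}f g _ [df sdf Hf] _ [dg sdg Hg]|{}f g sf [df sdf Hf] sg [dg sdg Hg]].
- by exists (fun=> 0); [exact: sm1_cst|move=> w; exact: dC].
- exists (fun w => c * expR (c * w)); first by apply: sm1_mul; [exact: sm1_cst|exact: sm1_exp].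
  by move=> w; apply: (d_eq (dexp (dM (dC c w) (dI w)))); ring.
- exists (fun w => a * (flat k.+2 (a * w + b) + - k%:R * flat k.+1 (a * w + b))).
    apply: sm1_mul; first exact: sm1_cst.
    by apply: sm1_add; [exact: sm1_flat|apply: sm1_mul; [exact: sm1_cst|exact: sm1_flat]].
  move=> w; have h := dD (dM (dC a w) (dI w)) (dC b w).
  by apply: (d_eq (dcomp1 (g := fun w => a * w + b) (flat_der k (a * w + b)) h)); ring.
- by exists (fun w => df w + dg w); [exact: sm1_add|move=> w; exact: dD].
- exists (fun w => f w * dg w + g w * df w); last by move=> w; exact: dM.
  by apply: sm1_add; exact: sm1_mul.
Qed.

(** Applied to [q = |x|^2]; since [f] is required to vanish for very negative arguments, the value 0
    for [q <= 0] continues it smoothly. *)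
Definition onlog (f : R -> R) (q : R) : R := if 0 < q then f (ln q) else 0.

Lemma onlog_der (f df : R -> R) w0 : (forall w, is_derive w 1 f (df w)) -> (forall w, w < w0 -> f w = 0) ->
  (forall w, w < w0 -> df w = 0) /\
  forall q : R, is_derive q 1 (onlog f) (onlog (fun w => expR (- 1 * w) * df w) q).
Proof.
move=> Hf f0; have df0 w : w < w0 -> df w = 0.
  move=> ww; have h : is_derive w 1 f 0.
    have : \forall s \near w, s < w0 by apply: lt_nbhsl.
    by move=> h; apply: near0_der; move: h; apply: filterS => s /f0 ->.
  by have [_ <-] := h; have [_ ->] := Hf w.
split=> // q; case: (ltP q (expR w0)) => qw.
  have -> : onlog (fun w => expR (- 1 * w) * df w) q = 0.
    by rewrite /onlog; case: ifPn => // q0; rewrite df0 ?mulr0// -ltr_expR lnK ?posrE.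
  have : \forall s \near q, s < expR w0 by apply: lt_nbhsl.
  move=> h; apply: near0_der; move: h; apply: filterS => s sw; rewrite /onlog; case: ifPn => // s0.
  by rewrite f0// -ltr_expR lnK ?posrE.
have q0 : 0 < q := lt_le_trans (expR_gt0 _) qw.
rewrite {2}/onlog q0; apply: (@d_ext _ (fun q => f (ln q))).
  have : \forall s \near q, 0 < s by apply: lt_nbhsr.
  by apply: filterS => s s0; rewrite /onlog s0.
have h := dcomp1 (Hf (ln q)) (dln q0 (dI q)).
by apply: (d_eq h); rewrite mulr1 mulN1r expRN lnK ?posrE// mulrC.
Qed.
End flat.

Section smooth_vector.
Context {R : realType} {n : nat}.
Implicit Types (f g : 'rV[R]_n -> R) (x : 'rV[R]_n) (i : 'I_n).

(** The counterpart of [sm1] on row vectors: each partial derivative stays in the class, so its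
    members are of class [C^k] for every [k]. *)
Inductive smv : ('rV[R]_n -> R) -> Prop :=
| smv_cst (c : R) : smv (fun=> c)
| smv_coord i : smv (fun x => x 0 i)
| smv_log (f : R -> R) (w0 : R) : sm1 f -> (forall w, w < w0 -> f w = 0) -> smv (fun x => onlog f (sqn x))
| smv_add f g : smv f -> smv g -> smv (fun x => f x + g x)
| smv_mul f g : smv f -> smv g -> smv (fun x => f x * g x).

Lemma is_derive_onlog (f df : R -> R) (w0 : R) i x : (forall w : R, is_derive w 1 f (df w)) -> (forall w, w < w0 -> f w = 0) ->
  is_derive x (delta_mx 0 i) (fun x => onlog f (sqn x)) (2 * x 0 i * onlog (fun w => expR (- 1 * w) * df w) (sqn x)).
Proof.
move=> Hf f0; have [_ H] := onlog_der Hf f0; have /is_derive_line hq := is_derive_sqn x i.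
apply/is_derive_line.
have h1 := H (sqn (0 *: delta_mx 0 i + x)).
have h2 := dcomp1 (g := fun s : R => sqn (s *: delta_mx 0 i + x)) h1 hq.
by apply: (d_eq h2); rewrite scale0r add0r mulrC.
Qed.

Lemma continuous_onlog (f df : R -> R) (w0 : R) : (forall w : R, is_derive w 1 f (df w)) -> (forall w, w < w0 -> f w = 0) ->
  continuous (fun x => onlog f (sqn x)).
Proof.
move=> Hf f0 x; apply: continuous_comp; first exact: continuous_sqn.
by have [_ /(_ (sqn x))] := onlog_der Hf f0; exact: d_cont.
Qed.

Lemma smv_continuous f : smv f -> continuous f.
Proof.
elim=> [c|i|h w0 sh h0|{}f g _ cf _ cg|{}f g _ cf _ cg].
- exact: continuous_cstv.
- exact: continuous_coordv.
- by have [dh _ Hh] := sm1_der sh; exact: continuous_onlog Hh h0.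
- exact: continuous_addv.
- exact: continuous_mulv.
Qed.

Lemma smv_der f i : smv f -> exists2 df : 'rV[R]_n -> R, smv df & forall x, is_derive x (delta_mx 0 i) f (df x).
Proof.
elim=> [c|j|h w0 sh h0|{}f g _ [df sdf Hf] _ [dg sdg Hg]|{}f g sf [df sdf Hf] sg [dg sdg Hg]].
- by exists (fun=> 0); [exact: smv_cst|move=> x; exact: is_derive_cst].
- by exists (fun=> (j == i)%:R); [exact: smv_cst|move=> x; exact: is_derive_coord].
- have [dh sdh Hh] := sm1_der sh; have [dh0 _] := onlog_der Hh h0.
  exists (fun x => 2 * x 0 i * onlog (fun w => expR (- 1 * w) * dh w) (sqn x)).
    apply: smv_mul; first by apply: smv_mul; [exact: smv_cst|exact: smv_coord].
    apply: (@smv_log _ w0); last by move=> w /dh0 ->; rewrite mulr0.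
    by apply: sm1_mul => //; exact: sm1_exp.
  by move=> x; exact: is_derive_onlog Hh h0.
- by exists (fun x => df x + dg x); [exact: smv_add|move=> x; exact: is_deriveD].
- exists (fun x => df x * g x + f x * dg x); last by move=> x; exact: is_derive_mulv.
  by apply: smv_add; exact: smv_mul.
Qed.

Lemma smv_pderiv f i : smv f -> smv (pderiv i f) /\ forall x, derivable f x (delta_mx 0 i).
Proof.
move=> /(smv_der i)[df sdf H]; split; last by move=> x; have [] := H x.
by rewrite (_ : pderiv i f = df)//; apply/funext => x; have [_] := H x.
Qed.

Lemma smv_class_C f k : smv f -> class_C k setT f.
Proof.
move=> sf s x _ _; have ss : smv (iter_pderiv s f).
  by elim: s => //= i s IH; have [] := smv_pderiv i IH.
split; first exact: smv_continuous.
by move=> _ i; have [_] := smv_pderiv i ss.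
Qed.
End smooth_vector.


(** * Bumps in the logarithm of the radius *)

Section log_bump.
Context {R : realType}.
Variables (m a : R).
Implicit Types (w t : R).

Definition bump_time w : R := 1 / 20 * w + - a / 10.
(* With [w = ln |x|^2] and [f = e^(- m w / 4) h(w)], [|x|^2] times the Laplacian of [f] is
   [e^(- m w / 4) (4 h'' - m^2/4 h)]; the bump occupies [2 a < w < 2 a + 20], long enough
   for [4 h''] to stay above [- 8/25 h]. *)
Definition log_bump w : R :=
  expR (- (m / 4) * w) * (flat 0 (bump_time w) * flat 0 (- (1 / 20) * w + (1 + a / 10))).

Let tE w : - (1 / 20) * w + (1 + a / 10) = 1 - bump_time w.
Proof. by rewrite /bump_time; field. Qed.

Lemma sm1_bump : sm1 log_bump.
Proof.
by apply: sm1_mul; [exact: sm1_exp|apply: sm1_mul; exact: sm1_flat].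
Qed.

Lemma bump_out w : ~~ (0 < bump_time w < 1) -> log_bump w = 0.
Proof.
rewrite /log_bump tE /flat negb_and subr_gt0 => /orP[/negbTE ->|/negbTE ->]; first by rewrite mul0r mulr0.
by rewrite !mulr0.
Qed.

Lemma bumpE w : 0 < bump_time w < 1 ->
  log_bump w = expR (- (m / 4) * w) * (expR (- (bump_time w)^-1) * expR (- (1 - bump_time w)^-1)).
Proof. by rewrite /log_bump tE /flat => /andP[-> ?]; rewrite subr_gt0 ifT// !expr0 !mul1r. Qed.

Lemma bump_gt0 w : 0 < bump_time w < 1 -> 0 < log_bump w.
Proof. by move=> /bumpE ->; rewrite !mulr_gt0// expR_gt0. Qed.

Lemma bump_low w : w < 2 * a -> log_bump w = 0.
Proof. by move=> h; apply: bump_out; rewrite negb_and -leNgt /bump_time; apply/orP; left; lra. Qed.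

Variables (K1 K2 : R -> R).
Hypothesis d1 : forall w, is_derive w 1 log_bump (K1 w).
Hypothesis d2 : forall w, is_derive w 1 K1 (K2 w).

Let der_unique (f : R -> R) w (b c : R) : is_derive w 1 f b -> is_derive w 1 f c -> b = c.
Proof. by move=> [_ <-] [_ <-]. Qed.

Let bump_time_cont w : {for w, continuous bump_time}.
Proof. by apply: (@d_cont _ _ _ (1 / 20)); rewrite /bump_time; dtac; ring. Qed.

Let inside_open w : 0 < bump_time w < 1 -> \forall s \near w, 0 < bump_time s < 1.
Proof.
move=> /andP[t0 t1]; have c := @bump_time_cont w.
have h1 : \forall s \near w, 0 < bump_time s by exact: (cvgr_gt _ c).
have h2 : \forall s \near w, bump_time s < 1 by exact: (cvgr_lt _ c).
by apply: filterS2 h1 h2 => s -> ->.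
Qed.

Let A w : R := - (m / 4) + 1 / 20 * ((bump_time w)^-1 ^+ 2 - (1 - bump_time w)^-1 ^+ 2).

Let K1E w : 0 < bump_time w < 1 -> K1 w = log_bump w * A w.
Proof.
move=> tw; have /andP[t0 t1] := tw; apply: der_unique (d1 w) _.
apply: (@d_ext _ (fun w => expR (- (m / 4) * w) * (expR (- (bump_time w)^-1) * expR (- (1 - bump_time w)^-1)))).
  by apply: filterS (inside_open tw) => s /bumpE ->.
have ht : is_derive w 1 bump_time (1 / 20) by rewrite /bump_time; dtac; ring.
have n0 : bump_time w != 0 by rewrite gt_eqF.
have n1 : 1 - bump_time w != 0 by rewrite gt_eqF// subr_gt0.
have h1 := dexp (dN (dV n0 ht)).
have h2 := dexp (dN (@dV _ (fun y => 1 - bump_time y) w _ n1 (dD (dC (1 : R) w) (dN ht)))).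
have h3 := dexp (dM (dC (- (m / 4)) w) (dI w)).
apply: (d_eq (dM h3 (dM h1 h2))); rewrite (bumpE tw) /A !exprVn.
move: (expR _) (expR _) (expR _) => E1 E2 E3; ring.
Qed.

Lemma bump_ode w : 0 < bump_time w < 1 ->
  4 * K2 w + 2 * m * K1 w = log_bump w * ((((bump_time w)^-1 ^+ 2 - (1 - bump_time w)^-1 ^+ 2) ^+ 2 -
     2 * (bump_time w)^-1 ^+ 3 - 2 * (1 - bump_time w)^-1 ^+ 3) / 100 - m ^+ 2 / 4).
Proof.
move=> tw; have /andP[t0 t1] := tw.
have n0 : bump_time w != 0 by rewrite gt_eqF.
have n1 : 1 - bump_time w != 0 by rewrite gt_eqF// subr_gt0.
have ht : is_derive w 1 bump_time (1 / 20) by rewrite /bump_time; dtac; ring.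
have hA : is_derive w 1 A (1 / 20 * (- (1 / 10) * (bump_time w)^-1 ^+ 3 - 1 / 10 * (1 - bump_time w)^-1 ^+ 3)).
  have h1 := dV n0 ht; have h2 := @dV _ (fun y => 1 - bump_time y) w _ n1 (dD (dC (1 : R) w) (dN ht)).
  apply: (d_eq (dD (dC _ w) (dM (dC (1 / 20) w) (dD (dX 1 h1) (dN (dX 1 h2)))))).
  by rewrite -!exprVn; set p := (bump_time w)^-1; set s := (1 - _)^-1; rewrite expr1; field.
have -> : K2 w = log_bump w * (A w ^+ 2 + 1 / 20 * (- (1 / 10) * (bump_time w)^-1 ^+ 3 - 1 / 10 * (1 - bump_time w)^-1 ^+ 3)).
  apply: der_unique (d2 w) _; apply: (@d_ext _ (fun w => log_bump w * A w)).
    by apply: filterS (inside_open tw) => s /K1E ->.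
  by apply: (d_eq (dM (d1 w) hA)); rewrite (K1E tw); ring.
rewrite (K1E tw) /A; set p := (bump_time w)^-1; set s := (1 - _)^-1; by field.
Qed.

(** With [p = 1 / (t (1 - t)) >= 4] the bracket is [p^4 - 6 p^3 + 6 p^2], which is at least its
    value [-32] at [p = 4]; divided by 100 this is [- 8 / 25]. *)
Lemma bump_ode_ge w : 0 < bump_time w < 1 ->
  log_bump w * (- (8 / 25) - m ^+ 2 / 4) <= 4 * K2 w + 2 * m * K1 w.
Proof.
move=> tw; rewrite bump_ode// ler_pM2l ?bump_gt0// lerD2r.
move: tw; set t := bump_time w => /andP[t0 t1]; have t1' : 0 < 1 - t by rewrite subr_gt0.
pose p := (t * (1 - t))^-1.
have p4 : 4 <= p.
  rewrite -[4]invrK lef_pV2 ?posrE ?mulr_gt0// ?invr_gt0//.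
  have := sqr_ge0 (t - 1 / 2); rewrite expr2.
  have -> : (t - 1 / 2) * (t - 1 / 2) = 1 / 4 - t * (1 - t) by field.
  by lra.
have -> : (t^-1 ^+ 2 - (1 - t)^-1 ^+ 2) ^+ 2 - 2 * t^-1 ^+ 3 - 2 * (1 - t)^-1 ^+ 3 =
   p ^+ 4 - 6 * p ^+ 3 + 6 * p ^+ 2.
  by rewrite /p; field; rewrite !gt_eqF.
have f : 0 <= (p - 4) * (p * ((p - 4) * (p - 4) + 6 * (p - 4) + 6) - 8).
  apply: mulr_ge0; first by rewrite subr_ge0.
  have q0 : 0 <= p - 4 by rewrite subr_ge0.
  have q1 := mulr_ge0 q0 q0.
  have : 4 * 6 <= p * ((p - 4) * (p - 4) + 6 * (p - 4) + 6) by apply: ler_pM => //; lra.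
  by lra.
have -> : p ^+ 4 - 6 * p ^+ 3 + 6 * p ^+ 2 = (p - 4) * (p * ((p - 4) * (p - 4) + 6 * (p - 4) + 6) - 8) - 32 by ring.
by lra.
Qed.

Lemma bump_flat w : (bump_time w < 0) || (1 < bump_time w) -> K1 w = 0 /\ K2 w = 0.
Proof.
move=> tw; have c := @bump_time_cont w.
have op s : (bump_time s < 0) || (1 < bump_time s) -> K1 s = 0.
  move=> ts; have cs := @bump_time_cont s.
  suff h : \near s, log_bump s = 0 by apply: der_unique (d1 s) _; exact: near0_der.
  case/orP: ts => ts.
    have h : \forall z \near s, bump_time z < 0 by exact: (cvgr_lt _ cs).
    by apply: filterS h => z z0; apply: bump_out; rewrite negb_and -leNgt (ltW z0).
  have h : \forall z \near s, 1 < bump_time z by exact: (cvgr_gt _ cs).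
  by apply: filterS h => z z0; apply: bump_out; rewrite negb_and -!leNgt (ltW z0) orbT.
split; first exact: op.
apply: der_unique (d2 w) _; apply: near0_der.
case/orP: tw => tw.
  have h : \forall z \near w, bump_time z < 0 by exact: (cvgr_lt _ c).
  by apply: filterS h => z z0; apply: op; rewrite z0.
have h : \forall z \near w, 1 < bump_time z by exact: (cvgr_gt _ c).
by apply: filterS h => z z0; apply: op; rewrite z0 orbT.
Qed.
End log_bump.

Section radial_bump.
Context {R : realType} {n : nat}.
Implicit Types (x : 'rV[R]_n) (i : 'I_n) (a : R).
Let m : R := n%:R - 2.

Definition radial_bump a x : R := onlog (log_bump m a) (sqn x).

Lemma smv_radial_bump a : smv (radial_bump a).
Proof. by apply: (@smv_log _ _ _ (2 * a)); [exact: sm1_bump|exact: bump_low]. Qed.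

Lemma radial_bump_support a x : radial_bump a x != 0 -> x != 0 /\ a < ln (enorm x) < a + 10.
Proof.
rewrite /radial_bump /onlog; case: ifPn => [q0|_]; last by rewrite eqxx.
have x0 : x != 0 by rewrite -sqn_gt0.
have e0 : 0 < enorm x by rewrite enorm_gt0.
have [ht _|ht] := boolP (0 < bump_time a (ln (sqn x)) < 1); last by rewrite bump_out ?eqxx.
split => //; move: ht; rewrite /bump_time -enorm_sqn lnXn// -mulr_natl; lra.
Qed.

Lemma radial_bump_gt0 a x : x != 0 -> a < ln (enorm x) < a + 10 -> 0 < radial_bump a x.
Proof.
move=> x0 ax; have e0 : 0 < enorm x by rewrite enorm_gt0.
rewrite /radial_bump /onlog sqn_gt0 x0; apply: bump_gt0.
by move: ax; rewrite /bump_time -enorm_sqn lnXn// -mulr_natl; lra.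
Qed.

Lemma laplacian_onlog (K K1 K2 : R -> R) (w0 : R) x : x != 0 -> (forall w : R, is_derive w 1 K (K1 w)) ->
  (forall w : R, is_derive w 1 K1 (K2 w)) -> (forall w, w < w0 -> K w = 0) ->
  sqn x * laplacian (fun x => onlog K (sqn x)) x = 4 * K2 (ln (sqn x)) + 2 * m * K1 (ln (sqn x)).
Proof.
move=> x0 h1 h2 K0; have q0 : 0 < sqn x by rewrite sqn_gt0.
have [K10 _] := onlog_der h1 K0.
pose L1 (w : R) : R := expR (- 1 * w) * K1 w.
pose L2 (w : R) : R := expR (- 1 * w) * K2 w + K1 w * (expR (- 1 * w) * - 1).
have dL1 (w : R) : is_derive w 1 L1 (L2 w).
  by apply: (d_eq (dM (dexp (dM (dC (- 1) w) (dI w))) (h2 w))); rewrite /L2; ring.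
have L10 (w : R) : w < w0 -> L1 w = 0 by move=> /K10 h; rewrite /L1 h mulr0.
have p1 i : pderiv i (fun x => onlog K (sqn x)) = (fun x => 2 * x 0 i * onlog L1 (sqn x)).
  by apply/funext => z; have [_] := is_derive_onlog i z h1 K0.
have p2 i : pderiv i (fun x => 2 * x 0 i * onlog L1 (sqn x)) x =
    2 * onlog L1 (sqn x) + 4 * x 0 i ^+ 2 * onlog (fun w => expR (- 1 * w) * L2 w) (sqn x).
  have hc : is_derive x (delta_mx 0 i) (fun x => 2 * x 0 i) 2.
    have := is_derive_mulv (is_derive_cst (2 : R) x (delta_mx 0 i)) (is_derive_coord x i i).
    by rewrite eqxx mul0r add0r mulr1.
  by rewrite /pderiv; have [_ ->] := is_derive_mulv hc (is_derive_onlog i x dL1 L10); ring.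
rewrite /laplacian (eq_bigr (fun i => 2 * onlog L1 (sqn x) + 4 * x 0 i ^+ 2 * onlog (fun w => expR (- 1 * w) * L2 w) (sqn x))).
  rewrite big_split/= sumr_const card_ord -mulr_suml -mulr_sumr -/(sqn x) /onlog q0.
  have eq : expR (- 1 * ln (sqn x)) = (sqn x)^-1 by rewrite mulN1r expRN lnK ?posrE.
  rewrite /L1 /L2 eq -mulr_natl /m; field; rewrite gt_eqF//.
by move=> i _; rewrite p1 p2.
Qed.
End radial_bump.

(** * Infinite Morse index *)


Section test_functions.
Context {R : realType} {n : nat}.
Implicit Types (f : 'rV[R]_n -> R) (x : 'rV[R]_n) (i : 'I_n).
Local Notation e i := (delta_mx 0 i : 'rV[R]_n).
Local Notation B := (@uball R n).
Local Notation M := (@lebesgue_rV R n).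
Local Notation J f := (Rintegral M B f).
Let mB := @measurable_uball R n.
Let finB := @uball_fin R n.

Lemma smv_test_function (r : R) f : 0 < r < 1 -> smv f -> (forall x, r < enorm x -> f x = 0) -> test_function B f.
Proof.
move=> /andP[r0 r1] sf f0; split; first by move=> k; exact: smv_class_C.
exists [set x | enorm x <= r]; split.
- apply: bounded_closed_compact.
    exists r; split; first exact: num_real.
    move=> y ry x /= xr; apply: (le_trans _ (ltW ry)); apply: (le_trans _ xr).
    rewrite /Num.norm/= mx_normrE; apply/bigmax_leP; split; first exact: sqrtr_ge0.
    by move=> [i j] _ /=; rewrite (ord1 i); exact: coord_le_enorm.
  have -> : [set x : 'rV[R]_n | enorm x <= r] = (@enorm R n) @^-1` [set y | y <= r] by [].
  by apply: closed_comp; [move=> x _; exact: continuous_enorm|exact: closed_le].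
- by move=> x /= xr; apply: le_lt_trans r1.
- by move=> x /negP; rewrite -ltNge; exact: f0.
Qed.

Lemma test_weak_gradient f : test_function B f -> weak_gradient B f (fun i => pderiv i f).
Proof.
move=> tf i; have [sf sdf] := test_sqint tf; split; first exact: sqint_L2.
move=> psi tp; have [sp sdp] := test_sqint tp.
rewrite !EFin_ip// -EFinN; congr EFin.
have [cp dp cdp _] := test_function_C1 tp.
have H := ball_C1_mul (test_function_C1 tf) cp dp cdp.
have := uball_int_partial i H => /eqP.
have [_ bH] := ball_C1_bmf H.
have [b1 b2] := ball_C1_bmf (test_function_C1 tf); have [b3 b4] := ball_C1_bmf (test_function_C1 tp).
rewrite (bmf_intD mB finB); [|exact: bmfM|exact: bmfM].
by rewrite addrC addr_eq0 => /eqP.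
Qed.

Lemma test_H10 f : test_function B f -> H10 B f.
Proof.
move=> tf; have [sf _] := test_sqint tf; split; first exact: sqint_L2.
exists (fun i => pderiv i f); first exact: test_weak_gradient.
exists (fun=> f) => //.
rewrite (_ : (fun k : nat => _) = fun=> 0%E); first exact: cvg_cst.
apply/funext => k; rewrite -[RHS](integral0 M B); apply: eq_integral => x _.
rewrite subrr expr0n add0r big1// => i _; by rewrite subrr expr0n.
Qed.

Lemma ae_zero_continuous f : continuous f -> ae_zero B f -> forall x, B x -> f x = 0.
Proof.
move=> cf [N [mN N0 sub]] x xB; apply: contrapT => /eqP fx.
have open_nz : nbhs x [set y | B y /\ f y != 0].
  have h1 : \forall y \near x, B y by apply: open_nbhs_nbhs; split => //; exact: open_uball.
  have h2 : \forall y \near x, f y != 0.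
    have : nbhs (f x) [set z | z != 0].
      by apply: open_nbhs_nbhs; split => //; exact: open_neq.
    by move=> /(cf x).
  by apply: filterS2 h1 h2.
have [e /= e0 he] := (nbhs_ballP _ _).1 open_nz.
have box_sub : rbox (fun i : nat => if insub i is Some j then x 0 j else 0) (e / 2) `<=` N.
  move=> y yb; apply: sub => /= h; have : B y /\ f y != 0.
    apply: he; split => // i j; rewrite (ord1 i); have := yb j; rewrite valK => /andP[y1 y2].
    by rewrite /ball/= distrC ger0_norm ?subr_ge0//; move: y2; rewrite -ltrBlDl => /lt_trans; apply; lra.
  by move=> [yB]; rewrite h// eqxx.
have e20 : 0 < e / 2 by rewrite divr_gt0.
have : (M (rbox (fun i : nat => if insub i is Some j then x 0%R j else 0%R) (e / 2)%R) <= M N)%E.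
  by apply: le_measure; rewrite ?inE//; exact: measurable_rbox.
by rewrite rbox_measure ?(ltW e20)// N0 lee_fin leNgt exprn_gt0.
Qed.

Lemma is_derive_lincomb (I : Type) (r : seq I) (c : I -> R) (f df : I -> 'rV[R]_n -> R) x v :
  (forall j, is_derive x v (f j) (df j x)) ->
  is_derive x v (fun x => \sum_(j <- r) c j * f j x) (\sum_(j <- r) c j * df j x).
Proof.
move=> H; elim: r => [|j r IH].
  rewrite big_nil (_ : (fun _ => _) = fun=> 0); first exact: is_derive_cst.
  by apply/funext => y; rewrite big_nil.
rewrite big_cons (_ : (fun _ => _) = fun x => c j * f j x + \sum_(j <- r) c j * f j x); last first.
  by apply/funext => y; rewrite big_cons.
apply: is_deriveD.
Qed.

Lemma smv_lincomb (I : Type) (r : seq I) (c : I -> R) (f : I -> 'rV[R]_n -> R) :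
  (forall j, smv (f j)) -> smv (fun x => \sum_(j <- r) c j * f j x).
Proof.
move=> H; elim: r => [|j r IH].
  by rewrite (_ : (fun _ => _) = fun=> 0); [exact: smv_cst|apply/funext => y; rewrite big_nil].
rewrite (_ : (fun _ => _) = fun x => c j * f j x + \sum_(j <- r) c j * f j x); last first.
  by apply/funext => y; rewrite big_cons.
by apply: smv_add => //; apply: smv_mul => //; exact: smv_cst.
Qed.

Lemma laplacian_lincomb (I : Type) (r : seq I) (c : I -> R) (f : I -> 'rV[R]_n -> R) x :
  (forall j, smv (f j)) ->
  laplacian (fun x => \sum_(j <- r) c j * f j x) x = \sum_(j <- r) c j * laplacian (f j) x.
Proof.
move=> H; have E (g : I -> 'rV[R]_n -> R) i : (forall j, smv (g j)) ->
    pderiv i (fun x => \sum_(j <- r) c j * g j x) = (fun x => \sum_(j <- r) c j * pderiv i (g j) x).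
  move=> Hg; apply/funext => y.
  have [_] := @is_derive_lincomb I r c g (fun j => pderiv i (g j)) y (e i)
    (fun j => derivableP ((smv_pderiv i (Hg j)).2 y)).
  exact.
have E2 i : pderiv i (pderiv i (fun x => \sum_(j <- r) c j * f j x)) x =
    \sum_(j <- r) c j * pderiv i (pderiv i (f j)) x.
  by rewrite (E f i H) (E (fun j => pderiv i (f j)) i)// => j; have [] := smv_pderiv i (H j).
transitivity (\sum_(i < n) \sum_(j <- r) c j * pderiv i (pderiv i (f j)) x).
  by apply: eq_bigr => i _; exact: E2.
rewrite exchange_big /=.
by apply: eq_bigr => j _; rewrite mulr_sumr.
Qed.

Lemma green f : test_function B f ->
  bmf (fun x => \sum_(i < n) pderiv i f x ^+ 2 + f x * laplacian f x) /\
  J (fun x => \sum_(i < n) pderiv i f x ^+ 2 + f x * laplacian f x) = 0.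
Proof.
move=> tf; pose G i x := pderiv i f x * pderiv i f x + f x * pderiv i (pderiv i f) x.
have HG i : bmf (G i) /\ J (G i) = 0.
  have ti := test_function_pderiv i tf; have [cp dp cdp _] := test_function_C1 ti.
  have H := ball_C1_mul (test_function_C1 tf) cp dp cdp.
  by have [_ /(_ i) bH] := ball_C1_bmf H; split => //; exact: (uball_int_partial i H).
have -> : (fun x => \sum_(i < n) pderiv i f x ^+ 2 + f x * laplacian f x) = (fun x => \sum_(i < n) G i x).
  apply/funext => x; rewrite /laplacian mulr_sumr -big_split/=; apply: eq_bigr => i _.
  by rewrite /G expr2.
split; first by apply: bmf_sum => i; exact: (HG i).1.
by rewrite (bmf_int_sum mB finB (index_enum 'I_n) (fun i => (HG i).1)) big1// => i _; exact: (HG i).2.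
Qed.
End test_functions.

Section infinite_index.
Context {R : realType} {n : nat}.
Variables (u : 'rV[R]_n -> R) (l : R).
Hypothesis n3 : (3 <= n)%N.
Hypothesis n9 : (n <= 9)%N.
Hypothesis singu : singular_solution l u.
Implicit Types (f : 'rV[R]_n -> R) (x : 'rV[R]_n) (i : 'I_n).
Local Notation B := (@uball R n).
Local Notation M := (@lebesgue_rV R n).
Local Notation J f := (Rintegral M B f).
Local Notation V := (potential u l).
Let mB := @measurable_uball R n.
Let finB := @uball_fin R n.
Let m : R := n%:R - 2.

Let m17 : 7 / 4 <= 2 * m - m ^+ 2 / 4.
Proof.
have m1 : 1 <= m := m_ge1 n3.
have m7 : m <= 7 by have : n%:R <= 9%:R :> R by [rewrite ler_nat]; rewrite /m; lra.
have : 0 <= (m - 1) * (7 - m) by apply: mulr_ge0; lra.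
have -> : (m - 1) * (7 - m) = 8 * m - m ^+ 2 - 7 by ring.
by lra.
Qed.

(** Of the gap [2 m - m^2 / 4 >= 7/4], the bump uses [8/25] and the deviation of [|x|^2 V] from
    [2 m] uses [2/5]. More than 1 is left, and [|x|^2 < 1] on the support. The bound [A <= -11]
    keeps the support inside the ball. *)
Lemma bump_inequality : exists A : R, A <= - 11 /\ forall (a : R) x, a <= A -> radial_bump a x != 0 ->
  radial_bump a x ^+ 2 <= radial_bump a x * (laplacian (radial_bump a) x + V x * radial_bump a x).
Proof.
have d0 : 0 < 2 / 5 :> R by lra.
have [r0 r00 Hr] := potential_near0 n3 singu d0.
exists (Num.min (- 11) (ln r0 - 10)); split; first by rewrite ge_min lexx.
move=> a x; rewrite le_min => /andP[a11 ar] nz.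
have [x0 /andP[ax1 ax2]] := radial_bump_support nz.
have e0 : 0 < enorm x by rewrite enorm_gt0.
have xB : B x by rewrite /uball/= -ltr_ln ?posrE// ln1; lra.
have xr : enorm x <= r0 by rewrite -ler_ln ?posrE//; lra.
have := Hr x xB x0 xr; rewrite -/m ler_norml => /andP[hV _].
have [K1 _ h1] := sm1_der (sm1_bump m a).
have [] := sm1_der (sm1_bump m a) => K1' sK1 h1'; have [K2 _ h2] := sm1_der sK1.
have L := laplacian_onlog x0 h1' h2 (@bump_low R m a).
have q0 : 0 < sqn x by rewrite sqn_gt0.
have ht : 0 < bump_time a (ln (sqn x)) < 1.
  by move: ax1 ax2; rewrite /bump_time -enorm_sqn lnXn// -mulr_natl; lra.
have G := bump_ode_ge h1' h2 ht.
have K0 := bump_gt0 m ht.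
have KE : radial_bump a x = log_bump m a (ln (sqn x)) by rewrite /radial_bump /onlog q0.
rewrite KE expr2 ler_pM2l//.
rewrite -[fun x => onlog _ (sqn x)]/(radial_bump a) -/m in L.
set K := log_bump _ _ _ in G K0 KE *; rewrite -L in G.
have q1 : sqn x < 1 by rewrite sqn_lt1.
rewrite -(ler_pM2l q0) mulrDr; apply: (@le_trans _ _ (1 * K)); first by rewrite ler_pM2r// ltW.
have h3 : (2 * m - 2 / 5) * K <= sqn x * (V x * K).
  by rewrite mulrA ler_pM2r// mulrC; lra.
have h4 : 0 <= K * (2 * m - m ^+ 2 / 4 - 7 / 4) by rewrite mulr_ge0 ?(ltW K0)//; have := m17; lra.
apply: le_trans (lerD G h3); rewrite -subr_ge0.
have -> : K * (- (8 / 25) - m ^+ 2 / 4) + (2 * m - 2 / 5) * K - 1 * K =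
   K * (2 * m - m ^+ 2 / 4 - 7 / 4) + 3 / 100 * K by field.
by apply: addr_ge0 => //; rewrite mulr_ge0 ?(ltW K0)//; lra.
Qed.

Lemma bump_elsewhere (a b : R) x : radial_bump a x != 0 -> b + 10 < a \/ a + 10 < b ->
  radial_bump b x = 0 /\ laplacian (radial_bump b) x = 0.
Proof.
move=> nz ab; have [x0 /andP[ax1 ax2]] := radial_bump_support nz.
have e0 : 0 < enorm x by rewrite enorm_gt0.
have q0 : 0 < sqn x by rewrite sqn_gt0.
have [K1 sK1 h1] := sm1_der (sm1_bump m b); have [K2 _ h2] := sm1_der sK1.
have ht : (bump_time b (ln (sqn x)) < 0) || (1 < bump_time b (ln (sqn x))).
  rewrite /bump_time -enorm_sqn lnXn// -mulr_natl; apply/orP.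
  by case: ab => ab; [right|left]; lra.
have [k1 k2] := bump_flat h1 h2 ht.
have L := laplacian_onlog x0 h1 h2 (@bump_low R m b).
rewrite k1 k2 !mulr0 addr0 -[fun x => onlog _ (sqn x)]/(radial_bump b) in L.
split; last by move/eqP: L; rewrite mulf_eq0 gt_eqF//= => /eqP.
rewrite /radial_bump /onlog q0 bump_out// negb_and -!leNgt.
by case/orP: ht => /ltW ->; rewrite ?orbT.
Qed.

Lemma bump_span k : exists b : 'I_k -> 'rV[R]_n -> R,
  [/\ forall j, smv (b j),
      exists r1 r2 : R, [/\ 0 < r1, 0 < r2 < 1 & forall j x, ~~ (r1 <= enorm x <= r2) -> b j x = 0],
      forall c : 'I_k -> R, (forall x, B x -> \sum_(j < k) c j * b j x = 0) -> forall j, c j = 0 &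
      forall (c : 'I_k -> R) x, B x -> (\sum_(j < k) c j * b j x) ^+ 2 <=
        (\sum_(j < k) c j * b j x) * (laplacian (fun x => \sum_(j < k) c j * b j x) x + V x * (\sum_(j < k) c j * b j x))].
Proof.
have [A [A11 HA]] := bump_inequality.
pose a (j : 'I_k) : R := A - 20 * (j : nat)%:R.
have aA j : a j <= A by rewrite gerBl mulr_ge0.
have sep (i j : 'I_k) : j != i -> a j + 10 < a i \/ a i + 10 < a j.
  move=> ji; have ij : (i < j)%N \/ (j < i)%N.
    by case: (ltngtP i j) => // [_|_|h]; [left|right|move: ji; rewrite (val_inj h) eqxx].
  rewrite /a; case: ij => h; [left|right].
    have : (i : nat).+1%:R <= (j : nat)%:R :> R by rewrite ler_nat.
    by rewrite -natr1; lra.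
  have : (j : nat).+1%:R <= (i : nat)%:R :> R by rewrite ler_nat.
  by rewrite -natr1; lra.
pose b (j : 'I_k) : 'rV[R]_n -> R := radial_bump (a j).
have sb j : smv (b j) by exact: smv_radial_bump.
have at_i (c : 'I_k -> R) (i : 'I_k) x : b i x != 0 -> \sum_(j < k) c j * b j x = c i * b i x /\
    laplacian (fun x => \sum_(j < k) c j * b j x) x = c i * laplacian (b i) x.
  move=> nz; split.
    rewrite (bigD1 i)//= big1 ?addr0// => j ji.
    by have [h _] := bump_elsewhere nz (sep i j ji); rewrite /b h mulr0.
  rewrite (laplacian_lincomb _ _ _ sb) (bigD1 i)//= big1 ?addr0// => j ji.
  by have [_ h] := bump_elsewhere nz (sep i j ji); rewrite /b h mulr0.
exists b; split => //.
- exists (expR (A - 20 * k%:R)), (expR (A + 10)); split; first exact: expR_gt0.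
    by rewrite expR_gt0/= expR_lt1; lra.
  move=> j x; apply: contraNeq => nz; have [x0 /andP[ax1 ax2]] := radial_bump_support nz.
  have e0 : 0 < enorm x by rewrite enorm_gt0.
  have aj := aA j; have ak : A - 20 * k%:R <= a j.
    by rewrite /a lerD2l lerN2 ler_pM2l// ler_nat ltnW.
  by rewrite -[enorm x]lnK ?posrE// !ler_expR; apply/andP; split; lra.
- move=> c c0 j.
  pose x : 'rV[R]_n := expR (a j + 5) *: delta_mx 0 (Ordinal (leq_trans (isT : (1 <= 3)%N) n3)).
  have ex : enorm x = expR (a j + 5) by rewrite enorm1 gtr0_norm ?expR_gt0.
  have x0 : x != 0 by rewrite -enorm_gt0 ex expR_gt0.
  have xB : B x by rewrite /uball/= ex expR_lt1; have := aA j; lra.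
  have nz : b j x != 0 by rewrite gt_eqF// radial_bump_gt0// ex expRK; apply/andP; split; lra.
  by have [E _] := at_i c j x nz; have := c0 x xB; rewrite E => /eqP; rewrite mulf_eq0 (negbTE nz) orbF => /eqP.
- move=> c x xB; have [[i nz]|none] := pselect (exists i : 'I_k, b i x != 0); last first.
    rewrite [\sum_(j < k) _]big1 ?mul0r ?expr0n// => j _.
    by have -> : b j x = 0 by [apply: contrapT => /eqP nz; apply: none; exists j]; rewrite mulr0.
  have [-> ->] := at_i c i x nz; have := HA (a i) x (aA i) nz; rewrite -/(b i).
  have -> : c i * b i x * (c i * laplacian (b i) x + V x * (c i * b i x)) =
    c i ^+ 2 * (b i x * (laplacian (b i) x + V x * b i x)) by ring.
  by rewrite exprMn => h; rewrite ler_wpM2l ?sqr_ge0.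
Qed.

(** By Green's formula the form equals minus the integral of [f (Delta f + V f)], hence is at most
    minus that of [f^2]. As [f] vanishes for [|x| < r1], [V] may be replaced by its bounded
    restriction [W]. *)
Lemma quad_form_neg (r1 r2 : R) f : 0 < r1 -> 0 < r2 < 1 -> smv f -> (forall x, ~~ (r1 <= enorm x <= r2) -> f x = 0) ->
  (forall x, B x -> f x ^+ 2 <= f x * (laplacian f x + V x * f x)) -> ~ ae_zero B f ->
  (quad_form B V f (fun i => pderiv i f) < 0)%E.
Proof.
move=> r10 r21 sf f0 hf fnz.
have tf : test_function B f.
  by apply: (smv_test_function r21 sf) => x xr; apply: f0; rewrite negb_and -!ltNge xr orbT.
have [bf bG] := ball_C1_bmf (test_function_C1 tf).
have [C HC] := potential_away n3 singu r10.
pose D : set 'rV[R]_n := B `&` [set x | r1 <= enorm x].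
have mD : measurable D.
  apply: measurableI => //.
  have -> : [set x : 'rV[R]_n | r1 <= enorm x] = (@enorm R n) @^-1` `[r1, +oo[.
    by apply/seteqP; split=> x; rewrite /preimage/= in_itv/= andbT.
  by rewrite -[X in measurable X]setTI; exact: (continuous_measurable continuous_enorm).
pose W := V \_ D.
have V0 x : 0 < V x by exact: potential_gt0 singu x.
have bW : bmf W.
  split.
    apply/(measurable_restrictT _ mD); apply: measurable_funS (potential_measurable_ball n3 singu) => //.
    exact: subIsetl.
  exists `|C| => x; rewrite /W patchE; case: ifPn => [|_]; last by rewrite normr0.
  by rewrite inE => -[xB xr]; rewrite gtr0_norm// (le_trans (HC x xB xr))// ler_norm.
have WV x : B x -> V x * f x ^+ 2 = W x * f x ^+ 2.
  move=> xB; have [xr|xr] := leP r1 (enorm x); last by rewrite f0 ?expr0n ?mulr0// negb_and -ltNge xr.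
  by rewrite /W patchE mem_set.
have bf2 := bmfX 2 bf; have bWf := bmfM bW bf2.
have bS : bmf (fun x => \sum_(i < n) pderiv i f x ^+ 2) by apply: bmf_sum => i; exact: bmfX.
have bI : bmf (fun x => \sum_(i < n) pderiv i f x ^+ 2 - W x * f x ^+ 2) by exact: bmfB.
have -> : quad_form B V f (fun i => pderiv i f) = (J (fun x => \sum_(i < n) pderiv i f x ^+ 2 - W x * f x ^+ 2))%:E.
  rewrite -EFin_Rintegral; last by apply: bmf_integrable.
  by apply: eq_integral => x; rewrite inE => xB; rewrite WV.
have [bGr Gr] := green tf.
have f2pos : 0 < J (fun x => f x ^+ 2).
  rewrite lt_neqAle Rintegral_ge0 ?andbT; last by move=> x _; exact: sqr_ge0.
  apply/eqP => J0; apply: fnz.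
  have mf2 : measurable_fun B (EFin \o (fun x => f x ^+ 2)).
    by apply/measurable_EFinP/measurable_funTS; exact: bf2.1.
  have : (\int[M]_(x in B) `|(f x ^+ 2)%:E| = 0)%E.
    rewrite (eq_integral (EFin \o (fun x => f x ^+ 2))).
      by rewrite [LHS]EFin_Rintegral -?J0//; exact: bmf_integrable.
    by move=> x _ /=; rewrite ger0_norm ?sqr_ge0.
  move=> /(ae_eq_integral_abs M mB mf2); apply: filterS => x h xB.
  by have := h xB => /= -[] /eqP; rewrite sqrf_eq0 => /eqP.
rewrite lte_fin; apply: (@le_lt_trans _ _ (J (fun x => (\sum_(i < n) pderiv i f x ^+ 2 + f x * laplacian f x) - f x ^+ 2))).
  apply: (bmf_int_le mB finB) => //; first exact: bmfB.
  move=> x xB; have := hf x xB; rewrite mulrDr => h; rewrite -WV//.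
  have -> : V x * f x ^+ 2 = f x * (V x * f x) by ring.
  by rewrite -addrA lerD2l; lra.
by rewrite (bmf_intB mB finB)// Gr sub0r oppr_lt0.
Qed.

Lemma morse_index_infinite : solution_morse_index l u = +oo%E.
Proof.
apply/eqyP => C C0; have [k hk] : exists k : nat, C <= k%:R.
  by exists (Num.bound C); rewrite ltW// archi_boundP// ltW.
apply: (@le_trans _ _ k%:R%:E); first by rewrite lee_fin.
have [b [sb [r1 [r2 [r10 r21 bout]]] bind bneg]] := bump_span k.
pose S (c : 'I_k -> R) (x : 'rV[R]_n) := \sum_(j < k) c j * b j x.
have sS c : smv (S c) by exact: smv_lincomb.
have S0 c x : ~~ (r1 <= enorm x <= r2) -> S c x = 0.
  by move=> h; rewrite /S big1// => j _; rewrite bout// mulr0.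
have tS c : test_function B (S c).
  by apply: (smv_test_function r21 (sS c)) => x xr; apply: S0; rewrite negb_and -!ltNge xr orbT.
pose X : set ('rV[R]_n -> R) := [set f | exists c, f = S c].
have XN : negative_space B V X.
  split.
  - by move=> _ [c ->]; exact: test_H10.
  - split; first by exists (fun=> 0); apply/funext => x; rewrite /S big1// => j _; rewrite mul0r.
    move=> z _ _ [c ->] [d ->]; exists (fun j => z * c j + d j); apply/funext => x.
    by rewrite /S mulr_sumr -big_split/=; apply: eq_bigr => j _; rewrite mulrDl mulrA.
  - move=> _ [c ->] nz; exists (fun i => pderiv i (S c)); first exact: test_weak_gradient.
    by apply: (quad_form_neg r10 r21 (sS c)) => //; [exact: S0|exact: bneg].
apply: (@le_trans _ _ (ae_dim B X)); last by apply: ereal_sup_ubound; exists X.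
apply: ereal_sup_ubound; exists k => //; exists b.
  move=> j; exists (fun i : 'I_k => (i == j)%:R); apply/funext => x.
  by rewrite /S (bigD1 j)//= eqxx mul1r big1 ?addr0// => i /negbTE ->; rewrite mul0r.
move=> c cz; apply: bind => x xB; apply: (ae_zero_continuous _ cz) => //.
exact: (smv_continuous (sS c)).
Qed.
End infinite_index.

Theorem theorem1p2 (R : realType) (n : nat)
    (lamS : R) (uS : 'rV[R]_n -> R) (lam : R -> R) (u : R -> 'rV[R]_n -> R) :
  (3 <= n)%N -> singular_pair lamS uS -> solution_curve lam u ->
  ((11 <= n)%N -> (solution_morse_index lamS uS < +oo)%E) /\
  ((n <= 9)%N ->
   [/\ solution_morse_index lamS uS = +oo%E,
       infinitely_many_turning_points lam lamS,
       infinite_set [set v \_ cball | v in @classical_solution R n lamS] &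
       counting (intersection_radii (u rho) uS) @[rho --> +oo%R]
         --> (+oo : \bar R)%E]).
Proof.
move=> n3 [singu _] curve; pose i0 : 'I_n := Ordinal (leq_trans (isT : (1 <= 3)%N) n3).
split=> [n11|n9]; first exact: morse_index_finite n11 singu.
split; first exact: morse_index_infinite n3 n9 singu.
- exact: (curve_infinitely_many_turning_points i0 n3 n9 singu curve).
- exact: (infinitely_many_solutions i0 n3 singu curve n9).
- exact: (intersections_to_infinity i0 n3 singu curve n9).
Qed.
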